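(* Let $\pi_1,\pi_2,\pi_3:\mathbb R^2\to\mathbb R$ be pairwise linearly independent linear maps, let $v_j$ be a unit vector with $\pi_j(v_j)=0$, and put $D_{\boldsymbol\pi^\perp}=\prod_{j=1}^3(v_j\cdot\nabla)$. Let $S$ be a real-valued real analytic function near $0\in\mathbb R^2$ with $D_{\boldsymbol\pi^\perp}S\not\equiv 0$. For $a\in C_c^\infty(\mathbb R^2)$, $\lambda\in\mathbb R$ and $f_1,f_2,f_3\in L^2(\mathbb R)$ set $$\Lambda_{S,\boldsymbol\pi}(f_1,f_2,f_3)=\iint e^{i\lambda S(x,y)}a(x,y)\prod_{j=1}^3 f_j(\pi_j(x,y))\,dx\,dy.$$ Then there is a neighborhood $W$ of $0$ such that for every smooth $a$ supported in $W$ there is a constant $C$ with $$|\Lambda_{S,\boldsymbol\pi}(f_1,f_2,f_3)|\le C|\lambda|^{-\frac{1}{2\,\mathrm{mult}_{\boldsymbol\pi}(S)}}\prod_{j=1}^3\|f_j\|_2\quad\text{for all }|\lambda|\ge 1,\ f_j\in L^2(\mathbb R).$$ Moreover this is sharp: if in addition $a(0,0)\neq 0$, then there is $C'>0$ such that for all sufficiently large $|\lambda|$ there exist nonzero $f_1,f_2,f_3\in L^2(\mathbb R)$ with $$|\Lambda_{S,\boldsymbol\pi}(f_1,f_2,f_3)|\ge C'|\lambda|^{-\frac{1}{2\,\mathrm{mult}_{\boldsymbol\pi}(S)}}\prod_{j=1}^3\|f_j\|_2.$$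
   Context: Write the Taylor expansion of $S$ at $0$ as $S=\sum_{i\ge0}S_i$ with $S_i(x,y)=\sum_{p+q=i}c_{p,q}x^py^q$ homogeneous of degree $i$. For a real analytic $F$ with homogeneous expansion $F=\sum_i F_i$, $\mathrm{mult}(F)=\min\{i:F_i\not\equiv0\}$. The multiplicity of $S$ relative to $\boldsymbol\pi=(\pi_1,\pi_2,\pi_3)$ is $\mathrm{mult}_{\boldsymbol\pi}(S)=\min\{i: D_{\boldsymbol\pi^\perp}S_i\not\equiv 0\}=\mathrm{mult}(D_{\boldsymbol\pi^\perp}S)+3$. *)

(* Defs.v *)
From mathcomp Require Import all_boot all_order all_algebra.
From mathcomp Require Import all_classical all_reals all_analysis.
From mathcomp Require Import complex.
Import numFieldNormedType.Exports.
Import Order.TTheory GRing.Theory Num.Theory.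

Set Implicit Arguments.
Unset Strict Implicit.
Unset Printing Implicit Defensive.

Local Open Scope ring_scope.
Local Open Scope classical_set_scope.

Section Defs.
Context {R : realType}.

Definition linear2 (p : R * R -> R) : Prop :=
  forall (k : R) (z w : R * R), p (k *: z + w) = k * p z + p w.

Definition lin_indep2 (p q : R * R -> R) : Prop :=
  forall s t : R, (forall z, s * p z + t * q z = 0) -> s = 0 /\ t = 0.

Definition unit_vec2 (v : R * R) : Prop := v.1 ^+ 2 + v.2 ^+ 2 = 1.

Definition Dperp (v1 v2 v3 : R * R) (f : R * R -> R) : R * R -> R :=
  'D_v1 ('D_v2 ('D_v3 f)).

Definition hom_part (c : nat -> nat -> R) (i : nat) (z : R * R) : R :=
  \sum_(p < i.+1) c p (i - p)%N * z.1 ^+ p * z.2 ^+ (i - p).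

Definition abs_hom_part (c : nat -> nat -> R) (i : nat) (z : R * R) : R :=
  \sum_(p < i.+1) `|c p (i - p)%N| * `|z.1| ^+ p * `|z.2| ^+ (i - p).

(** S is given on the box |x|,|y| < r (r > 0) by the absolutely convergent
    power series sum_{p,q} c_{p,q} x^p y^q = sum_i S_i(x,y); this is real
    analyticity of S near 0, with Taylor coefficients c. *)
Definition power_series_rep (S : R * R -> R) (c : nat -> nat -> R) (r : R)
  : Prop :=
  0 < r /\
  forall z : R * R, `|z.1| < r -> `|z.2| < r ->
    (exists l : R, series (fun i => abs_hom_part c i z) @ \oo --> l) /\
    series (fun i => hom_part c i z) @ \oo --> S z.

Definition is_mult_pi (v1 v2 v3 : R * R) (c : nat -> nat -> R) (m : nat)
  : Prop :=
  (exists z, Dperp v1 v2 v3 (hom_part c m) z <> 0) /\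
  (forall i, (i < m)%N -> forall z, Dperp v1 v2 v3 (hom_part c i) z = 0).

Fixpoint iterD (vs : seq (R * R)) (f : R * R -> R) : R * R -> R :=
  if vs is v :: vs' then 'D_v (iterD vs' f) else f.

Definition smooth2 (f : R * R -> R) : Prop :=
  forall (vs : seq (R * R)) (z : R * R), differentiable (iterD vs f) z.

Definition smooth2C (a : R * R -> R[i]) : Prop :=
  smooth2 (fun z => complex.Re (a z)) /\ smooth2 (fun z => complex.Im (a z)).

Definition supported_in (a : R * R -> R[i]) (W : set (R * R)) : Prop :=
  exists K : set (R * R), compact K /\ K `<=` W /\
    (forall z, a z != 0 -> K z).

Definition cmod (z : R[i]) : R :=
  Num.sqrt (complex.Re z ^+ 2 + complex.Im z ^+ 2).

Definition L2 (f : R -> R[i]) : Prop :=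
  measurable_fun setT (fun x => complex.Re (f x)) /\
  measurable_fun setT (fun x => complex.Im (f x)) /\
  (\int[@lebesgue_measure R]_x ((cmod (f x)) ^+ 2)%:E < +oo)%E.

Definition L2norm (f : R -> R[i]) : R :=
  Num.sqrt (Rintegral (@lebesgue_measure R) setT (fun x => cmod (f x) ^+ 2)).

Definition leb2 := (@lebesgue_measure R \x @lebesgue_measure R)%E.

Definition expi (t : R) : R[i] := Complex (cos t) (sin t).

Definition Lambda (lam : R) (S : R * R -> R) (a : R * R -> R[i])
  (pi1 pi2 pi3 : R * R -> R) (f1 f2 f3 : R -> R[i]) : R[i] :=
  let F := fun z : R * R =>
    expi (lam * S z) * a z * (f1 (pi1 z) * f2 (pi2 z) * f3 (pi3 z)) in
  Complex (Rintegral leb2 setT (fun z => complex.Re (F z)))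
          (Rintegral leb2 setT (fun z => complex.Im (F z))).

End Defs.

(* Main.v *)
(* In linear coordinates in which the three maps are multiples of X, Y and X + Y,
   the operator D is a multiple of dX dY (dX - dY), and the multiplicity is m = a + 3
   where a is the least order of a derivative of D S that does not vanish at 0.

   Upper bound, by induction on a.  For a = 0, Cauchy-Schwarz in X + Y and then in the
   two remaining variables leaves an oscillatory kernel whose phase has derivative
   (y' - y) tau D S at an intermediate point; two integrations by parts and Schur's
   test bound it.  For a > 0, cut the plane into dyadic squares.  Where some derivative
   of D S of order less than a is large at the scale of the square, the case a - 1
   applies.  In every other square all these derivatives are small; since a derivative
   of order a is bounded below, two of the three families of lines X = cst, Y = cst,
   X + Y = cst meet boundedly many such squares of a given size each, so that these
   pieces can be added by Cauchy-Schwarz, and the sum over the sizes is geometric.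

   Sharpness.  As D S vanishes to order m - 3, S agrees to order m with a sum
   q1(X) + q2(Y) + q3(X + Y); multiplying indicators of intervals of length comparable
   to |lambda|^(-1/m) by exp(- i lambda q_j) removes the oscillation. *)

Require Import Defs.
From HB Require Import structures.
From mathcomp Require Import all_boot all_order all_algebra.
From mathcomp Require Import all_classical all_reals all_analysis.
From mathcomp Require Import measurable_realfun complex.
From mathcomp Require Import ring lra.
Import numFieldNormedType.Exports.
Import Order.TTheory GRing.Theory Num.Theory.
Local Open Scope ring_scope.
Local Open Scope classical_set_scope.

Set Implicit Arguments.
Unset Strict Implicit.
Unset Printing Implicit Defensive.

(** * Bounded measurable functions of bounded support *)

(** Two reductions keep the analysis elementary. A complex factor only turns the phase by a quarter,
    so one real form with kernel [cos] and a free additive constant in the phase covers all real and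
    imaginary parts. Its inputs are bounded with bounded support, which justifies every exchange of
    integrals; general square integrable inputs follow by truncation. The obstacle that shapes the
    induction is uniformity. The lower case is applied to squares of every size and position, so its
    constant may depend only on the normalised bounds [B], [c], [BA], and no compactness argument
    can supply it. Therefore [decay] carries a side, a size and a number [kappa], and [upper]
    controls two orders more than [lower]: these are the two derivatives that the integrations by
    parts spend. The sum over sizes is geometric because the lower case has the better exponent: its
    bounds grow by a fixed ratio from one size to the next smaller one, and the subdivision stops at
    the size where the trivial bound, the square root of the side, already equals the target. *)

Section IntegralOfBoundedFunctions.
Context {R : realType}.
Local Notation mu := (@lebesgue_measure R).

(* Boundedness and bounded support; [N] measures how far out a point lies. *)
Definition bmeas d (T : measurableType d) (N : T -> R) (f : T -> R) :=
  measurable_fun setT f /\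
  exists M : R, forall t, `|f t| <= M /\ (M < N t -> f t = 0).

(** The multipliers of the class [bmeas]: cosines of the phase and amplitudes are bounded but need
    not have bounded support. *)
Definition bmeasurable d (T : measurableType d) (f : T -> R) :=
  measurable_fun setT f /\ exists M : R, forall t, `|f t| <= M.

Definition size1 (x : R) : R := `|x|.
Definition size_prod (T : Type) (N : T -> R) (z : T * R) : R := N z.1 + `|z.2|.
Definition size2 : R * R -> R := size_prod size1.
Definition size3 : R * R * R -> R := size_prod size2.

Definition Int (f : R -> R) : R := Rintegral mu setT f.

Section Generic.
Context d (T : measurableType d) (N : T -> R).
Implicit Types f g : T -> R.

Lemma bmeas_bmeasurable f : bmeas N f -> bmeasurable f.
Proof. by move=> [mf [M Mf]]; split=> //; exists M => t; have [] := Mf t. Qed.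

Lemma bmeasurable_cst (k : R) : bmeasurable (fun _ : T => k).
Proof. by split; [exact: measurable_cst|exists `|k|]. Qed.

Lemma bmeasurableM f g : bmeasurable f -> bmeasurable g ->
  bmeasurable (fun t => f t * g t).
Proof.
move=> [mf [M Mf]] [mg [K Kg]]; split; first exact: measurable_funM.
by exists (M * K) => t; rewrite normrM ler_pM.
Qed.

Lemma bmeasurableD f g : bmeasurable f -> bmeasurable g ->
  bmeasurable (fun t => f t + g t).
Proof.
move=> [mf [M Mf]] [mg [K Kg]]; split; first exact: measurable_funD.
by exists (M + K) => t; rewrite (le_trans (ler_normD _ _))// lerD.
Qed.

Lemma bmeasurableX f n : bmeasurable f -> bmeasurable (fun t => f t ^+ n).
Proof.
move=> bf; elim: n => [|n ih]; first exact: bmeasurable_cst.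
by under eq_fun do rewrite exprS; exact: bmeasurableM.
Qed.

Lemma bmeasurable_norm f : bmeasurable f -> bmeasurable (fun t => `|f t|).
Proof.
move=> [mf [M Mf]]; split; first exact: measurableT_comp.
by exists M => t; rewrite normr_id.
Qed.

Lemma bmeasMl f g : bmeas N f -> bmeasurable g -> bmeas N (fun t => f t * g t).
Proof.
move=> [mf [M Mf]] [mg [K Kg]]; split; first exact: measurable_funM.
exists (M * K + M) => t; have [M1 M2] := Mf t.
have M0 : 0 <= M := le_trans (normr_ge0 _) M1.
have K0 : 0 <= K := le_trans (normr_ge0 _) (Kg t).
split; first by rewrite normrM (le_trans (ler_pM _ _ M1 (Kg t)))// lerDl.
by move=> h; rewrite M2 ?mul0r//; apply: le_lt_trans h; rewrite lerDr mulr_ge0.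
Qed.

Lemma bmeasMr f g : bmeasurable f -> bmeas N g -> bmeas N (fun t => f t * g t).
Proof. by move=> bf bg; under eq_fun do rewrite mulrC; exact: bmeasMl. Qed.

Lemma bmeasM f g : bmeas N f -> bmeas N g -> bmeas N (fun t => f t * g t).
Proof. by move=> bf bg; apply: bmeasMl => //; exact: bmeas_bmeasurable. Qed.

Lemma bmeasD f g : bmeas N f -> bmeas N g -> bmeas N (fun t => f t + g t).
Proof.
move=> [mf [M Mf]] [mg [K Kg]]; split; first exact: measurable_funD.
exists (M + K) => t; have [M1 M2] := Mf t; have [K1 K2] := Kg t.
have M0 : 0 <= M := le_trans (normr_ge0 _) M1.
have K0 : 0 <= K := le_trans (normr_ge0 _) K1.
split; first by rewrite (le_trans (ler_normD _ _))// lerD.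
by move=> h; rewrite M2 ?K2 ?addr0//; apply: le_lt_trans h;
  rewrite ?lerDl ?lerDr.
Qed.

Lemma bmeasZ (k : R) f : bmeas N f -> bmeas N (fun t => k * f t).
Proof. by apply: bmeasMr; exact: bmeasurable_cst. Qed.

Lemma bmeasN f : bmeas N f -> bmeas N (fun t => - f t).
Proof. by move=> bf; under eq_fun do rewrite -mulN1r; exact: bmeasZ. Qed.

Lemma bmeasB f g : bmeas N f -> bmeas N g -> bmeas N (fun t => f t - g t).
Proof. by move=> bf bg; apply: bmeasD => //; exact: bmeasN. Qed.

Lemma bmeas_norm f : bmeas N f -> bmeas N (fun t => `|f t|).
Proof.
move=> [mf [M Mf]]; split; first exact: measurableT_comp.
by exists M => t; have [M1 M2] := Mf t; rewrite normr_id; split => // /M2 ->; rewrite normr0.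
Qed.

Lemma bmeasX f n : bmeas N f -> bmeas N (fun t => f t ^+ n.+1).
Proof.
move=> bf; under eq_fun do rewrite exprS.
by apply: bmeasMl => //; apply: bmeasurableX; exact: bmeas_bmeasurable.
Qed.

Lemma bmeasurable_comp d' (T' : measurableType d') f (p : T' -> T) :
  bmeasurable f -> measurable_fun setT p -> bmeasurable (fun t => f (p t)).
Proof.
by move=> [mf [M Mf]] mp; split; [exact: measurableT_comp|exists M].
Qed.

(** The growth condition makes [p] proper: a far point has a far image, so bounded support pulls
    back. *)
Lemma bmeas_comp d' (T' : measurableType d') (N' : T' -> R) f (p : T' -> T) C :
  0 <= C -> bmeas N f -> measurable_fun setT p ->
  (forall t, N' t <= C * (1 + N (p t))) -> bmeas N' (fun t => f (p t)).
Proof.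
move=> C0 [mf [M Mf]] mp Np; split; first exact: measurableT_comp.
exists (`|M| + C * (1 + `|M|)) => t; have [M1 M2] := Mf (p t); split.
  by rewrite (le_trans M1)// (le_trans (ler_norm M))// lerDl mulr_ge0// addr_ge0.
move=> h; apply: M2; rewrite ltNge; apply: contraPN h => h.
apply/negP; rewrite -leNgt (le_trans (Np t))//.
apply: (@le_trans _ _ (C * (1 + `|M|))); last by rewrite lerDr.
by rewrite ler_wpM2l// lerD2l (le_trans h)// ler_norm.
Qed.

Lemma bmeas_dom f g (M : R) : bmeasurable f -> bmeas N g ->
  (forall t, g t = 0 -> f t = 0) -> bmeas N f.
Proof.
move=> [mf [K Kf]] [mg [L Lg]] gf; split=> //; exists (`|K| + `|L|) => t; split.
  by rewrite (le_trans (Kf t))// (le_trans (ler_norm K))// lerDl.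
move=> h; apply: gf; apply: (Lg t).2; apply: le_lt_trans h.
by rewrite (le_trans (ler_norm L))// lerDr.
Qed.

End Generic.

Lemma bmeas_integrable f : bmeas size1 f -> mu.-integrable setT (EFin \o f).
Proof.
move=> [mf [M Mf]].
have mitv (i : interval R) : mu [set` i] = _ := lebesgue_measure_itv i.
have muM : (mu `[(- M)%R, M] < +oo)%E.
  have -> : mu `[(- M)%R, M] = _ := mitv (Interval (BLeft (- M)) (BRight M)).
  by case: ifPn => //=; rewrite ltry.
have h : mu.-integrable `[- M, M] (EFin \o f).
  apply: measurable_bounded_integrable => //.
  - exact: measurable_funTS.
  - by exists M; split; [exact: num_real|move=> K MK x _; apply: (le_trans (Mf x).1); exact: ltW].
move: h; rewrite integrable_mkcond// => h.
rewrite (_ : EFin \o f = (EFin \o f) \_ `[- M, M])//.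
apply/funext => x; rewrite patchE; case: ifPn => // xM /=.
rewrite (Mf x).2// /size1 ltNge; apply/negP => xM'; move/negP: xM; apply.
by rewrite inE /= in_itv /= -ler_norml.
Qed.

Lemma eq_Int f g : f =1 g -> Int f = Int g.
Proof. by move=> /funext ->. Qed.

Lemma IntD f g : bmeas size1 f -> bmeas size1 g ->
  Int (fun x => f x + g x) = Int f + Int g.
Proof. by move=> /bmeas_integrable bf /bmeas_integrable bg; exact: RintegralD. Qed.

Lemma IntB f g : bmeas size1 f -> bmeas size1 g ->
  Int (fun x => f x - g x) = Int f - Int g.
Proof. by move=> /bmeas_integrable bf /bmeas_integrable bg; exact: RintegralB. Qed.

Lemma IntZ k f : bmeas size1 f -> Int (fun x => k * f x) = k * Int f.
Proof. by move=> /bmeas_integrable bf; exact: RintegralZl. Qed.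

Lemma IntZr k f : bmeas size1 f -> Int (fun x => f x * k) = Int f * k.
Proof. by move=> /bmeas_integrable bf; exact: RintegralZr. Qed.

Lemma Int0 : Int (fun=> 0) = 0.
Proof.
by rewrite /Int /Rintegral (_ : (fun x : R => _) = cst 0%E)// integral0.
Qed.

Lemma Int_ge0 f : (forall x, 0 <= f x) -> 0 <= Int f.
Proof. by move=> f0; apply: Rintegral_ge0. Qed.

Lemma le_Int f g : bmeas size1 f -> bmeas size1 g -> (forall x, f x <= g x) ->
  Int f <= Int g.
Proof.
by move=> /bmeas_integrable bf /bmeas_integrable bg fg; apply: le_Rintegral => // x _.
Qed.

Lemma norm_Int f : bmeas size1 f -> `|Int f| <= Int (fun x => `|f x|).
Proof. by move=> /bmeas_integrable bf; exact: le_normr_Rintegral. Qed.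

Section Affine.
Variables (k b : R).
Hypothesis k0 : k != 0.
Let phi : measurableTypeR R -> measurableTypeR R := fun x => k * x + b.

Let mphi : measurable_fun setT phi.
Proof.
by apply: measurable_funD => //; apply: measurable_funM.
Qed.

Let absk : {nonneg R} := NngNum (normr_ge0 k).

Let pushm : {measure set (measurableTypeR R) -> \bar R} :=
  @measure_function_pushforward__canonical__measure_function_Measure
    _ _ _ _ _ mu phi mphi.

(** Lebesgue measure is determined by the lengths of half-open intervals, so only preimages of []x,
    y]] are computed. For [k < 0] the preimage is closed on the other side, which has the same
    length. *)
Lemma lebesgue_affine (A : set (measurableTypeR R)) : measurable A ->
  mu A = mscale absk pushm A.
Proof.
move=> mA; apply: lebesgue_measure_unique => // _ [[x y]] _ <-.
have mitv (i : interval R) : mu [set` i] = _ := lebesgue_measure_itv i.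
transitivity ((if (x < y)%R then y - x else 0)%:E).
  by rewrite mitv /= lte_fin; case: ifPn.
rewrite -[RHS]/(`|k|%:E * mu (phi @^-1` `]x, y]))%E.
have [k_gt0|k_lt0|k_eq0] := ltrgtP 0 k; last by move: k0; rewrite -k_eq0 eqxx.
- rewrite (_ : phi @^-1` _ = `](x - b) / k, (y - b) / k]%classic); last first.
    apply/seteqP; split => z /=; rewrite !in_itv /= /phi ltr_pdivrMr// ler_pdivlMr//;
      by rewrite ltrBlDr lerBrDr mulrC.
  rewrite mitv /= lte_fin ltr_pM2r ?invr_gt0// ltrD2r.
  case: ifPn => _; last by rewrite mule0.
  by rewrite -EFinB -EFinM gtr0_norm//; congr EFin; field; rewrite gt_eqF.
- rewrite (_ : phi @^-1` _ = `[(y - b) / k, (x - b) / k[%classic); last first.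
    apply/seteqP; split => z /=; rewrite !in_itv /= /phi ler_ndivrMr// ltr_ndivlMr//;
      by rewrite ltrBlDr lerBrDr mulrC andbC.
  rewrite mitv /= lte_fin ltr_nM2r ?invr_lt0// ltrD2r.
  case: ifPn => _; last by rewrite mule0.
  by rewrite -EFinB -EFinM ltr0_norm//; congr EFin; field; rewrite lt_eqF.
Qed.

Lemma ge0_integral_affine (f : R -> \bar R) : measurable_fun setT f ->
  (forall x, 0 <= f x)%E ->
  (\int[mu]_x f x = `|k|%:E * \int[mu]_x f (k * x + b)%R)%E.
Proof.
move=> mf f0.
transitivity (\int[mscale absk pushm]_x f x)%E.
  by apply: eq_measure_integral => A mA _; exact: lebesgue_affine.
rewrite ge0_integral_mscale//=; congr (_ * _)%E.
by rewrite ge0_integral_pushforward.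
Qed.

(** A signed integrand is handled through its positive and negative parts, whose integrals are
    finite and can be subtracted. *)
Lemma Int_affine (f : R -> R) : bmeas size1 f ->
  Int (fun x => f (k * x + b)) = `|k|^-1 * Int f.
Proof.
move=> bf; have nk : `|k| != 0 by rewrite normr_eq0.
have mf := bf.1; have := bmeas_integrable bf.
have bf' : bmeas size1 (fun x => f (k * x + b)).
  apply: (@bmeas_comp _ _ _ _ _ _ f (fun x => k * x + b) (`|k|^-1 * (1 + `|b|))) => //.
  - exact: bf.
  - move=> x; rewrite /size1 -mulrA ler_pdivlMl ?normr_gt0// -normrM.
    have := ler_normB (k * x + b) b; rewrite addrK => h.
    rewrite (le_trans h)// mulrDl mul1r mulrDr mulr1.
    have : 0 <= `|b| * `|k * x + b| by rewrite mulr_ge0.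
    by move: (`|k * x + b|) => u; lra.
move=> iE.
have pos (g : R -> \bar R) : measurable_fun setT g -> (forall x, 0 <= g x)%E ->
   (\int[mu]_x g (k * x + b)%R = `|k|^-1%:E * \int[mu]_x g x)%E.
  move=> mg g0; rewrite (ge0_integral_affine mg g0) muleA -EFinM mulVf//.
  by rewrite mul1e.
pose E : R -> \bar R := EFin \o f.
have mE : measurable_fun setT E by exact/measurable_EFinP.
have E1 : (\int[mu]_x (f (k * x + b)%R)%:E =
   \int[mu]_x E^\+ (k * x + b)%R - \int[mu]_x E^\- (k * x + b)%R)%E.
  by rewrite [LHS]integralE; congr (_ - _)%E; apply: eq_integral => x _; rewrite ?funeposE ?funenegE.
rewrite /Int /Rintegral E1 (pos _ (measurable_funepos mE))// (pos _ (measurable_funeneg mE))//.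
have fp : (\int[mu]_x E^\+ x)%E \is a fin_num.
  exact: integrable_fin_num (integrable_funepos measurableT iE).
have fn : (\int[mu]_x E^\- x)%E \is a fin_num.
  exact: integrable_fin_num (integrable_funeneg measurableT iE).
rewrite [X in _ = _ * fine X]integralE -/E -[in LHS](fineK fp) -[in LHS](fineK fn).
by rewrite -[in RHS](fineK fp) -[in RHS](fineK fn) -!EFinM -!EFinB /= mulrBr.
Qed.

End Affine.

Lemma Int_shift f b : bmeas size1 f -> Int (fun x => f (x + b)) = Int f.
Proof.
move=> bf; have := Int_affine b (oner_neq0 R) bf.
by rewrite normr1 invr1 mul1r => <-; apply: eq_Int => x; rewrite mul1r.
Qed.

Lemma Int_reflect f b : bmeas size1 f -> Int (fun x => f (b - x)) = Int f.
Proof.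
move=> bf; have n1 : (-1 : R) != 0 by rewrite oppr_eq0 oner_neq0.
have := Int_affine b n1 bf; rewrite normrN1 invr1 mul1r => <-.
by apply: eq_Int => x; rewrite mulN1r addrC.
Qed.

End IntegralOfBoundedFunctions.

(** * Iterated integrals in the plane, exchange of order, and Cauchy-Schwarz *)

Section IteratedIntegrals.
Context {R : realType}.
Local Notation mu := (@lebesgue_measure R).

Definition itvind (a b x : R) : R := ((a <= x) && (x <= b))%:R.

Lemma itvind_ge0 a b x : 0 <= itvind a b x.
Proof. by rewrite /itvind; case: (_ && _). Qed.

Lemma measurable_bool_natr d (T : measurableType d) (b : T -> bool) :
  measurable_fun setT b -> measurable_fun setT (fun x => (b x)%:R : R).
Proof.
move=> mb; have -> : (fun x => (b x)%:R : R) = (fun x => if b x then 1 else 0).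
  by apply/funext => x; case: (b x).
by apply: measurable_fun_ifT => //; exact: measurable_cst.
Qed.

Lemma measurable_itvind (a b : R) : measurable_fun setT (itvind a b).
Proof.
apply: measurable_bool_natr; apply: measurable_and; apply: measurable_fun_ler => //.
Qed.

Lemma bmeas_itvind a b : bmeas size1 (itvind a b).
Proof.
split; first exact: measurable_itvind.
exists (1 + `|a| + `|b|) => x; split.
  rewrite ger0_norm ?itvind_ge0// /itvind -addrA.
  by apply: (@le_trans _ _ 1); [case: (_ && _)|rewrite lerDl addr_ge0].
rewrite /size1 => h; rewrite /itvind; case: (boolP (_ && _)) => // /andP[ax xb].
exfalso; move: h; rewrite ltNge => /negP; apply.
rewrite ler_norml; have := ler_norm (- a); have := ler_norm b; rewrite normrN.
have := normr_ge0 a; have := normr_ge0 b.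
by move: (`|a|) (`|b|) => u v *; apply/andP; split; lra.
Qed.

Lemma Int_itvind a b : a <= b -> Int (itvind a b) = b - a.
Proof.
move=> ab; rewrite /Int /Rintegral.
transitivity (fine (mu `[a, b])).
  rewrite -[X in mu X]setIT -integral_indic//.
  congr fine; apply: eq_integral => x _; rewrite /itvind indicE; congr ((_%:R)%:E).
  have -> : (x \in `[a, b]%classic) = (x \in Interval (BLeft a) (BRight b)).
    by apply/idP/idP => [/set_mem//|h]; apply/mem_set.
  by rewrite in_itv.
have -> : mu `[a, b] = _ := lebesgue_measure_itv (Interval (BLeft a) (BRight b)).
rewrite /= lte_fin; case: ifPn => //; rewrite -leNgt => ba.
by move=> /=; lra.
Qed.

Lemma Int_bound (f : R -> R) a b K : a <= b -> bmeas size1 f -> (forall x, `|f x| <= K) ->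
  (forall x, ~~ ((a <= x) && (x <= b)) -> f x = 0) -> `|Int f| <= K * (b - a).
Proof.
move=> ab bf fK f0; rewrite (le_trans (norm_Int bf))// -(Int_itvind ab).
rewrite -IntZ; last exact: bmeas_itvind.
apply: le_Int; [exact: bmeas_norm|exact/bmeasZ/bmeas_itvind|move=> x].
have := fK x; have := f0 x; rewrite /itvind; case: (_ && _) => /=.
  by rewrite mulr1.
by move=> -> //; rewrite normr0 mulr0.
Qed.

Section Generic.
Context d (T : measurableType d) (N : T -> R).
Hypothesis N0 : forall t, 0 <= N t.
Implicit Types f g : T * R -> R.

Lemma bmeas_section f t : bmeas (size_prod N) f -> bmeas size1 (fun x => f (t, x)).
Proof.
move=> [mf [M Mf]]; split; first exact: measurable_fun_pair2.
exists M => x; have [M1 M2] := Mf (t, x); split=> // h; apply: M2.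
by apply: lt_le_trans h _; rewrite /size_prod /= lerDr.
Qed.

(** Measurability in the parameter comes from Tonelli, which wants a nonnegative integrand: hence
    the splitting of [f] as [(|f| + f) - |f|]. *)
Lemma bmeas_Int f : bmeas (size_prod N) f -> bmeas N (fun t => Int (fun x => f (t, x))).
Proof.
move=> bf; have bnf := bmeas_norm bf.
have mpos g : bmeas (size_prod N) g -> (forall z, 0 <= g z) ->
    measurable_fun setT (fun t => Int (fun x => g (t, x))).
  move=> [mg _] g0; apply: (measurableT_comp (fine_measurable measurableT)).
  by apply: (@measurable_fun_fubini_tonelli_F _ _ _ _ _ mu (EFin \o g));
   [exact/measurable_EFinP|move=> z; rewrite lee_fin].
split.
  rewrite (_ : (fun t => _) = (fun t => Int (fun x => `|f (t, x)| + f (t, x)))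
      \- (fun t => Int (fun x => `|f (t, x)|))).
    apply: measurable_funB.
      apply: (mpos (fun z => `|f z| + f z)); first exact: bmeasD.
      by move=> z; have := ler_norm (- f z); rewrite normrN; lra.
    by apply: (mpos (fun z => `|f z|)).
  apply/funext => t /=; rewrite IntD; [by rewrite addrAC subrr add0r|exact: (bmeas_section t bnf)|exact: bmeas_section].
(* Each section lives in [[-|M|, |M|]], which gives the product term; the summand [|M|] makes the
   new radius at least the old one, so that the support stays bounded. *)
have [mf [M Mf]] := bf; exists (`|M| + `|M| * (`|M| + `|M|)) => t; split.
  rewrite (@le_trans _ _ (`|M| * (`|M| - - `|M|)))//; last by rewrite opprK lerDr.
  apply: Int_bound; [by have := normr_ge0 M; lra|exact: bmeas_section| |].
    by move=> x; rewrite (le_trans (Mf (t, x)).1)// ler_norm.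
  move=> x; rewrite -ler_norml -ltNge => h; apply: (Mf (t, x)).2.
  rewrite (le_lt_trans (ler_norm M))// (lt_le_trans h)// /size_prod /=.
  by rewrite lerDr.
move=> h; rewrite (_ : (fun x => _) = fun=> 0) ?Int0//; apply/funext => x.
apply: (Mf (t, x)).2; rewrite /size_prod /=.
rewrite (le_lt_trans (ler_norm M))// (@lt_le_trans _ _ (N t)) ?lerDl//.
by rewrite (le_lt_trans _ h)// lerDl mulr_ge0// addr_ge0.
Qed.

End Generic.

Lemma size1_ge0 x : 0 <= size1 x :> R. Proof. exact: normr_ge0. Qed.
Lemma size2_ge0 z : 0 <= size2 z :> R. Proof. by apply: addr_ge0; exact: normr_ge0. Qed.
#[local] Hint Resolve size1_ge0 size2_ge0 : core.

Lemma size2_swap (z : R * R) : size2 (z.2, z.1) = size2 z.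
Proof. by rewrite /size2 /size_prod /size1 addrC. Qed.

Lemma bmeas_swap (f : R * R -> R) : bmeas size2 f -> bmeas size2 (fun z => f (z.2, z.1)).
Proof.
move=> bf; apply: (@bmeas_comp _ _ _ _ _ _ _ f (fun z => (z.2, z.1)) 1) => //.
- exact: bf.
- by apply: measurable_fun_pair; [exact: measurable_snd|exact: measurable_fst].
- by move=> z; rewrite size2_swap mul1r lerDr.
Qed.

Lemma bmeas_section_l (f : R * R -> R) y : bmeas size2 f -> bmeas size1 (fun x => f (x, y)).
Proof. by move=> /bmeas_swap bf; exact: (bmeas_section size1_ge0 y bf). Qed.

Lemma bmeas_section_r (f : R * R -> R) x : bmeas size2 f -> bmeas size1 (fun y => f (x, y)).
Proof. by move=> bf; exact: (bmeas_section size1_ge0 x bf). Qed.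

Lemma bmeas_Int_r (f : R * R -> R) : bmeas size2 f -> bmeas size1 (fun x => Int (fun y => f (x, y))).
Proof. by move=> bf; exact: (bmeas_Int size1_ge0 bf). Qed.

Lemma bmeas_Int_l (f : R * R -> R) : bmeas size2 f -> bmeas size1 (fun y => Int (fun x => f (x, y))).
Proof. by move=> /bmeas_swap bf; exact: (bmeas_Int size1_ge0 bf). Qed.

Lemma bmeas2_integrable (f : R * R -> R) : bmeas size2 f ->
  (@leb2 R).-integrable setT (EFin \o f).
Proof.
move=> bf; have [mf _] := bf; apply/integrableP; split; first exact/measurable_EFinP.
have mnf : measurable_fun setT (fun z => `|(f z)%:E|%E).
  by apply: measurableT_comp => //; exact/measurable_EFinP.
rewrite /leb2 fubini_tonelli1//= /fubini_F.
rewrite (_ : (\int[_]_x _)%E = (\int[mu]_x ((Int (fun y => `|f (x, y)|))%:E))%E).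
  by have /integrableP[_] := bmeas_integrable (bmeas_Int_r (bmeas_norm bf));
     under eq_integral do rewrite /= ger0_norm ?Int_ge0//.
apply: eq_integral => x _; rewrite /Int /Rintegral fineK//.
exact: (integrable_fin_num measurableT (bmeas_integrable (bmeas_section_r x (bmeas_norm bf)))).
Qed.

Lemma EFin_Int (f : R -> R) : bmeas size1 f -> ((Int f)%:E = \int[mu]_x (f x)%:E)%E.
Proof.
move=> bf; rewrite /Int /Rintegral fineK//.
exact: (integrable_fin_num measurableT (bmeas_integrable bf)).
Qed.

Definition Int2 (f : R * R -> R) : R := Rintegral (@leb2 R) setT f.

Lemma Int2E (f : R * R -> R) : bmeas size2 f -> Int2 f = Int (fun x => Int (fun y => f (x, y))).
Proof.
move=> bf; rewrite /Int2 /Rintegral -(integral12_prod_meas1 (bmeas2_integrable bf)).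
rewrite /Int /Rintegral; congr fine; apply: eq_integral => x _.
by rewrite /fubini_F -[RHS]/((Int (fun y => f (x, y)))%:E) EFin_Int//; exact: bmeas_section_r.
Qed.

Lemma Int2E_swap (f : R * R -> R) : bmeas size2 f -> Int2 f = Int (fun y => Int (fun x => f (x, y))).
Proof.
move=> bf; rewrite /Int2 /Rintegral -(integral21_prod_meas1 (bmeas2_integrable bf)).
rewrite /Int /Rintegral; congr fine; apply: eq_integral => x _.
by rewrite /fubini_G -[RHS]/((Int (fun y => f (y, x)))%:E) EFin_Int//; exact: bmeas_section_l.
Qed.

Lemma Int_swap (f : R * R -> R) : bmeas size2 f ->
  Int (fun x => Int (fun y => f (x, y))) = Int (fun y => Int (fun x => f (x, y))).
Proof. by move=> bf; rewrite -Int2E// Int2E_swap. Qed.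

(** The quadratic polynomial [A - 2 s B + s^2 C] is the integral of [(f - s g)^2], hence
    nonnegative, and is evaluated at its minimiser [B / C]. *)
Lemma Int_CS (f g : R -> R) : bmeas size1 f -> bmeas size1 g ->
  Int (fun x => f x * g x) ^+ 2 <= Int (fun x => f x ^+ 2) * Int (fun x => g x ^+ 2).
Proof.
move=> bf bg; set B := Int _; set A := Int _; set C := Int _.
have bf2 := bmeasX 1 bf; have bg2 := bmeasX 1 bg; have bfg := bmeasM bf bg.
have A0 : 0 <= A by apply: Int_ge0 => x; rewrite sqr_ge0.
have C0 : 0 <= C by apply: Int_ge0 => x; rewrite sqr_ge0.
have H s : 0 <= A - 2 * s * B + s ^+ 2 * C.
  have <- : Int (fun x => (f x - s * g x) ^+ 2) = A - 2 * s * B + s ^+ 2 * C.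
    rewrite -!IntZ// -IntB//; last exact: bmeasZ.
    rewrite -IntD//; [|by apply: bmeasB => //; exact: bmeasZ|exact: bmeasZ].
    by apply: eq_Int => x; ring.
  by apply: Int_ge0 => x; rewrite sqr_ge0.
have [C_eq0|Cn0] := eqVneq C 0.
  have [->|Bn0] := eqVneq B 0; first by rewrite expr0n /= mulr_ge0.
  (* For [C = 0] the polynomial is affine in [s], and this [s] would give it the value [-1]. *)
  have := H ((A + 1) / (2 * B)); rewrite C_eq0 mulr0 addr0.
  rewrite (_ : 2 * ((A + 1) / (2 * B)) * B = A + 1); last by field; rewrite Bn0.
  by lra.
have Cp : 0 < C by rewrite lt_def Cn0.
have := H (B / C); rewrite (_ : _ + _ = A - B ^+ 2 / C); last by field.
by rewrite subr_ge0 ler_pdivrMr.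
Qed.

End IteratedIntegrals.
#[export] Hint Resolve size1_ge0 size2_ge0 : core.

(** * Opening squares: correlation along antidiagonals and Schur's test *)

Section Correlations.
Context {R : realType}.

(** Neither factor alone needs bounded support as a function of [t]; only the two arguments together
    control [N t]. *)
Lemma bmeas_comp2 d1 (T1 : measurableType d1) (N1 : T1 -> R)
    d2 (T2 : measurableType d2) (N2 : T2 -> R) d (T : measurableType d) (N : T -> R)
    f g (p : T -> T1) (q : T -> T2) (C : R) :
  0 <= C -> bmeas N1 f -> bmeas N2 g -> measurable_fun setT p -> measurable_fun setT q ->
  (forall t, N t <= C * (1 + N1 (p t) + N2 (q t))) ->
  bmeas N (fun t => f (p t) * g (q t)).
Proof.
move=> C0 [mf [M Mf]] [mg [K Kg]] mp mq Npq; split.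
  by apply: measurable_funM; apply: measurableT_comp.
exists (`|M| * `|K| + C * (1 + `|M| + `|K|)) => t.
have [M1 M2] := Mf (p t); have [K1 K2] := Kg (q t); split.
  rewrite normrM (@le_trans _ _ (`|M| * `|K|))//.
    by apply: ler_pM => //; [apply: (le_trans M1)|apply: (le_trans K1)]; exact: ler_norm.
  by rewrite lerDl mulr_ge0// !addr_ge0.
move=> h; have [pM|Mp] := leP (N1 (p t)) M; last by rewrite M2 ?mul0r.
have [qK|Kq] := leP (N2 (q t)) K; last by rewrite K2 ?mulr0.
exfalso; move: h; rewrite ltNge => /negP; apply; rewrite (le_trans (Npq t))//.
rewrite (@le_trans _ _ (C * (1 + `|M| + `|K|)))//; last by rewrite lerDr mulr_ge0.
rewrite ler_wpM2l// -!addrA lerD2l lerD//.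
  by rewrite (le_trans pM)// ler_norm.
by rewrite (le_trans qK)// ler_norm.
Qed.

Lemma measurable_pair3 d (T : measurableType d) (a b c : T -> R) :
  measurable_fun setT a -> measurable_fun setT b -> measurable_fun setT c ->
  measurable_fun setT (fun t => (a t, b t, c t)).
Proof. by move=> ma mb mc; apply: measurable_fun_pair => //; exact: measurable_fun_pair. Qed.

Definition c31 (t : R * R * R) := t.1.1.
Definition c32 (t : R * R * R) := t.1.2.
Definition c33 (t : R * R * R) := t.2.

Lemma measurable_c31 : measurable_fun setT c31.
Proof. exact: (measurableT_comp measurable_fst measurable_fst). Qed.
Lemma measurable_c32 : measurable_fun setT c32.
Proof. exact: (measurableT_comp measurable_snd measurable_fst). Qed.
Lemma measurable_c33 : measurable_fun setT c33.
Proof. exact: measurable_snd. Qed.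
#[local] Hint Resolve measurable_c31 measurable_c32 measurable_c33 : core.

Section Rotation.
Variable g : R * R * R -> R.
Hypothesis bg : bmeas size3 g.

Let perm (p : R * R * R -> R * R * R) : measurable_fun setT p ->
  (forall t, size3 t = size3 (p t)) -> bmeas size3 (fun t => g (p t)).
Proof.
move=> mp pN; apply: (@bmeas_comp _ _ _ _ _ _ _ g p 1) => //; first exact: bg.
by move=> t; rewrite pN mul1r lerDr.
Qed.

Lemma bmeas3_section1 a : bmeas size2 (fun z => g (a, z.1, z.2)).
Proof.
apply: (@bmeas_comp _ _ _ _ _ _ _ g (fun z => (a, z.1, z.2)) 1) => //.
- exact: bg.
- by apply: measurable_pair3.
- move=> z; rewrite /size3 /size2 /size_prod /size1 /= mul1r.
  by have := normr_ge0 a; move: (`|z.1|) (`|z.2|) => u v; lra.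
Qed.

Lemma bmeas3_Int_c : bmeas size2 (fun z => Int (fun c => g (z.1, z.2, c))).
Proof.
have := bmeas_Int size2_ge0 bg.
by under eq_fun do (under eq_Int do rewrite [X in g (X, _)]surjective_pairing).
Qed.

Lemma bmeas3_Int_b : bmeas size2 (fun z => Int (fun b => g (z.1, b, z.2))).
Proof.
have b' : bmeas size3 (fun t => g (c31 t, c33 t, c32 t)).
  apply: perm; first exact: measurable_pair3.
  by move=> t; rewrite /size3 /size2 /size_prod /size1 /c31 /c32 /c33 /= addrAC.
by have := bmeas_Int size2_ge0 b'.
Qed.

Lemma bmeas3_Int_a : bmeas size2 (fun z => Int (fun a => g (a, z.1, z.2))).
Proof.
have b' : bmeas size3 (fun t => g (c33 t, c31 t, c32 t)).
  apply: perm; first exact: measurable_pair3.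
  by move=> t; rewrite /size3 /size2 /size_prod /size1 /c31 /c32 /c33 /=; ring.
by have := bmeas_Int size2_ge0 b'.
Qed.

Lemma bmeas3_section3 c : bmeas size2 (fun z => g (z.1, z.2, c)).
Proof.
apply: (@bmeas_comp _ _ _ _ _ _ _ g (fun z => (z.1, z.2, c)) 1) => //.
- exact: bg.
- by apply: measurable_pair3.
- move=> z; rewrite /size3 /size2 /size_prod /size1 /= mul1r.
  by have := normr_ge0 c; move: (`|z.1|) (`|z.2|) => u v; lra.
Qed.

(** Three adjacent exchanges: one with [a] fixed, one after integration over [b], one with [c]
    fixed. *)
Lemma Int_rot : Int (fun a => Int (fun b => Int (fun c => g (a, b, c)))) =
  Int (fun c => Int (fun b => Int (fun a => g (a, b, c)))).
Proof.
transitivity (Int (fun a => Int (fun c => Int (fun b => g (a, b, c))))).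
  by apply: eq_Int => a; exact: (Int_swap (bmeas3_section1 a)).
rewrite (Int_swap bmeas3_Int_b); apply: eq_Int => c.
exact: (Int_swap (bmeas3_section3 c)).
Qed.

End Rotation.

(** The second variable is parametrised by its distance [tau] to the first, since the later
    estimates depend on that shift. *)
Lemma Int_sqr (h : R -> R) : bmeas size1 h ->
  Int h ^+ 2 = Int (fun u => Int (fun tau => h u * h (u - tau))).
Proof.
move=> bh; rewrite expr2 -IntZr//; apply: eq_Int => u.
rewrite -(Int_reflect u bh) -IntZ//.
apply: (@bmeas_comp _ _ _ _ _ _ _ h (fun x : R => u - x) (1 + `|u|)) => //; first exact: bh.
  by apply: measurable_funB => //.
move=> x; rewrite /size1; have := ler_normB u (u - x); rewrite opprB addrC subrK.
have := mulr_ge0 (normr_ge0 u) (normr_ge0 (u - x)).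
by move: (`|u|) (`|u - x|) (`|x|) => a b c; nra.
Qed.

Section Pairing.
Variables (K : R * R -> R) (f : R -> R).
Hypotheses (bK : bmeas size2 K) (bf : bmeas size1 f).

Lemma bmeas_skew : bmeas size2 (fun z => K (z.2, z.1 - z.2)).
Proof.
apply: (@bmeas_comp _ _ _ _ _ _ _ K (fun z : R * R => (z.2, z.1 - z.2)) 2) => //; first exact: bK.
  apply: measurable_fun_pair; first exact: measurable_snd.
  by apply: measurable_funB; [exact: measurable_fst|exact: measurable_snd].
move=> z; rewrite /size2 /size_prod /size1 /=.
have := ler_normD (z.1 - z.2) z.2; rewrite subrK.
by have := normr_ge0 z.2; have := normr_ge0 (z.1 - z.2); lra.
Qed.

(** With [t = x + y] as a variable, [f t] comes out of the inner integral, and Cauchy-Schwarz in [t]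
    removes it from the problem. *)
Lemma pairing_sqr_le :
  Int (fun x => Int (fun y => K (x, y) * f (x + y))) ^+ 2 <=
  Int (fun t => f t ^+ 2) * Int (fun t => Int (fun u => K (u, t - u)) ^+ 2).
Proof.
have bKf : bmeas size2 (fun z => K (z.2, z.1 - z.2) * f z.1).
  apply: bmeasMl; first exact: bmeas_skew.
  by apply: bmeasurable_comp (bmeas_bmeasurable bf) _; exact: measurable_fst.
have -> : Int (fun x => Int (fun y => K (x, y) * f (x + y))) =
    Int (fun t => f t * Int (fun u => K (u, t - u))).
  transitivity (Int (fun x => Int (fun t => K (x, t - x) * f t))).
    apply: eq_Int => x.
    have b : bmeas size1 (fun t => K (x, t - x) * f t).
      exact: (bmeas_section_l x bKf).
    rewrite -(Int_shift x b); apply: eq_Int => y.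
    by rewrite addrK addrC.
  rewrite -(Int_swap bKf); apply: eq_Int => t /=; rewrite -IntZ; last first.
    exact: (bmeas_section_r t bmeas_skew).
  by apply: eq_Int => u; rewrite mulrC.
by apply: Int_CS => //; exact: (bmeas_Int_r bmeas_skew).
Qed.

Lemma bmeas_correlation :
  bmeas size3 (fun t => K (c32 t, c31 t - c32 t) * K (c32 t - c33 t, c31 t - c32 t + c33 t)).
Proof.
apply: (@bmeas_comp2 _ _ _ _ _ _ _ _ _ K K (fun t => (c32 t, c31 t - c32 t))
   (fun t => (c32 t - c33 t, c31 t - c32 t + c33 t)) 4) => //; [exact: bK|exact: bK|..].
- by apply: measurable_fun_pair => //; apply: measurable_funB.
- apply: measurable_fun_pair; first exact: measurable_funB.
  by apply: measurable_funD => //; apply: measurable_funB.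
- move=> [[a b] c]; rewrite /size3 /size2 /size_prod /size1 /c31 /c32 /c33 /=.
  have := ler_normD (a - b) b; rewrite subrK.
  have := ler_normB b (b - c); rewrite opprB addrC subrK.
  have := normr_ge0 b; have := normr_ge0 (a - b); have := normr_ge0 (b - c).
  by have := normr_ge0 (a - b + c); lra.
Qed.

Lemma bmeas_correlation_sheared :
  bmeas size3 (fun t => K (c32 t, c33 t) * K (c32 t - c31 t, c33 t + c31 t)).
Proof.
apply: (@bmeas_comp2 _ _ _ _ _ _ _ _ _ K K (fun t => (c32 t, c33 t))
   (fun t => (c32 t - c31 t, c33 t + c31 t)) 4) => //; [exact: bK|exact: bK|..].
- exact: measurable_fun_pair.
- by apply: measurable_fun_pair; [apply: measurable_funB|apply: measurable_funD].
- move=> [[a b] e]; rewrite /size3 /size2 /size_prod /size1 /c31 /c32 /c33 /=.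
  have := ler_normB b (b - a); rewrite opprB addrC subrK.
  have := normr_ge0 b; have := normr_ge0 e; have := normr_ge0 (b - a).
  by have := normr_ge0 (e + a); lra.
Qed.

(** The two points in the opened square lie on one line [x + y = t], so they differ by a multiple of
    [(-1, 1)]; this is how the factor [dx - dy] enters. *)
Lemma correlation :
  Int (fun t => Int (fun u => K (u, t - u)) ^+ 2) =
  Int (fun tau => Int (fun u => Int (fun y => K (u, y) * K (u - tau, y + tau)))).
Proof.
transitivity (Int (fun t => Int (fun u => Int (fun tau =>
    K (u, t - u) * K (u - tau, t - u + tau))))).
  apply: eq_Int => t; rewrite Int_sqr; last exact: (bmeas_section_r t bmeas_skew).
  by apply: eq_Int => u; apply: eq_Int => tau; congr (_ * K (_, _)); ring.
have := Int_rot bmeas_correlation; rewrite /c31 /c32 /c33 /= => ->.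
apply: eq_Int => tau; apply: eq_Int => u.
have b := bmeas_section_l u (bmeas3_section3 bmeas_correlation tau).
move: b; rewrite /c31 /c32 /c33 /= => b.
by rewrite -(Int_shift u b); apply: eq_Int => y; rewrite !addrK.
Qed.

End Pairing.

Section Bilinear.
Variables (F G w : R -> R) (B1 B2 : R * R -> R) (kap : R -> R).
Hypotheses (bF : bmeas size1 F) (bG : bmeas size1 G) (bw : bmeas size1 w).
Hypotheses (bB1 : bmeasurable B1) (bB2 : bmeasurable B2) (bkap : bmeas size1 kap).
Hypotheses (w0 : forall u, 0 <= w u) (w1 : forall u, F u != 0 -> 1 <= w u).
Hypothesis kap0 : forall x, 0 <= kap x.
Hypothesis kernel : forall y y', G y != 0 -> G y' != 0 ->
  `|Int (fun u => w u * (B1 (u, y) * B1 (u, y') + B2 (u, y) * B2 (u, y')))| <= kap (y' - y).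

Let bGB (B : R * R -> R) : bmeasurable B ->
  bmeas size3 (fun t => w (c31 t) * (G (c32 t) * G (c33 t) * (B (c31 t, c32 t) * B (c31 t, c33 t)))).
Proof.
move=> bB.
have b2 : bmeas size2 (fun z => w z.1 * G z.2).
  apply: (@bmeas_comp2 _ _ _ _ _ _ _ _ _ w G fst snd 1) => //; [exact: bw|exact: bG|].
  by move=> t; rewrite /size2 /size_prod /size1; lra.
have b3 : bmeas size3 (fun t => w (c31 t) * G (c32 t) * G (c33 t)).
  apply: (@bmeas_comp2 _ _ _ _ _ _ _ _ _ (fun z => w z.1 * G z.2) G fst c33 1) => //; [exact: b2|exact: bG|].
  by move=> t; rewrite /size3 /size_prod /size1 /c33; lra.
rewrite (_ : (fun t => _) = (fun t => w (c31 t) * G (c32 t) * G (c33 t) *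
    (B (c31 t, c32 t) * B (c31 t, c33 t)))); last by apply/funext => t; ring.
by apply: bmeasMl => //; apply: bmeasurableM; apply: bmeasurable_comp => //;
  apply: measurable_fun_pair.
Qed.

Let L (B : R * R -> R) u := Int (fun y => G y * B (u, y)).

Let bL B : bmeasurable B -> bmeasurable (L B).
Proof.
move=> bB; have b : bmeas (size_prod (fun=> 0)) (fun z => G z.2 * B z).
  apply: bmeasMl => //.
  apply: (@bmeas_comp _ _ _ _ _ _ _ G snd 1) => //; [exact: bG|].
  by move=> t; rewrite /size_prod /size1; lra.
have := bmeas_Int (fun=> lexx 0) b; exact: bmeas_bmeasurable.
Qed.

Let bGy (B : R * R -> R) u : bmeasurable B -> bmeas size1 (fun y => G y * B (u, y)).
Proof.
by move=> bB; apply: bmeasMl => //; apply: bmeasurable_comp.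
Qed.

(** Opening the square leaves the [u] integral innermost, because that is where the oscillation will
    be exploited. *)
Let LE B : bmeasurable B -> Int (fun u => w u * L B u ^+ 2) =
  Int (fun y' => Int (fun y => G y * G y' * Int (fun u => w u * (B (u, y) * B (u, y'))))).
Proof.
move=> bB; have b3 := bGB bB.
transitivity (Int (fun u => Int (fun y => Int (fun y' =>
   w u * (G y * G y' * (B (u, y) * B (u, y'))))))).
  apply: eq_Int => u; rewrite expr2 -IntZr; last exact: bGy.
  rewrite -IntZ; last first.
    by apply: bmeasMl; [exact: bGy|exact: bmeasurable_cst].
  apply: eq_Int => y; rewrite -IntZ; last exact: bGy.
  rewrite -IntZ; last by apply: bmeasMr; [exact: bmeasurable_cst|exact: bGy].
  by apply: eq_Int => y'; ring.
have := Int_rot b3; rewrite /c31 /c32 /c33 /= => ->.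
apply: eq_Int => y'; apply: eq_Int => y; rewrite -IntZ.
  by apply: eq_Int => u; ring.
apply: bmeasMl => //; apply: bmeasurableM; apply: bmeasurable_comp => //;
  by apply: measurable_fun_pair => //; exact: measurable_cst.
Qed.

(** Schur's test for a convolution kernel: [2 |G y| |G y'|] is at most the sum of the squares, and
    [Int kap] is invariant under translation and reflection. *)
Lemma schur_le : Int (fun y' => Int (fun y => `|G y| * `|G y'| * kap (y' - y))) <=
  Int kap * Int (fun y => G y ^+ 2).
Proof.
have bG2 := bmeasX 1 bG.
have bk2 (H : R -> R) : bmeas size1 H -> bmeas size2 (fun z : R * R => H z.2 * kap (z.1 - z.2)).
  move=> bH; apply: (@bmeas_comp2 _ _ _ _ _ _ _ _ _ H kap snd (fun z : R * R => z.1 - z.2) 2) => //; [exact: bH|exact: bkap| |].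
    by apply: measurable_funB; [exact: measurable_fst|exact: measurable_snd].
  move=> z; rewrite /size2 /size_prod /size1 /=.
  have := ler_normD (z.1 - z.2) z.2; rewrite subrK.
  by have := normr_ge0 z.2; have := normr_ge0 (z.1 - z.2); lra.
have bk1 (H : R -> R) : bmeas size1 H -> bmeas size2 (fun z : R * R => H z.1 * kap (z.1 - z.2)).
  move=> bH; apply: (@bmeas_comp2 _ _ _ _ _ _ _ _ _ H kap fst (fun z : R * R => z.1 - z.2) 2) => //; [exact: bH|exact: bkap| |].
    by apply: measurable_funB; [exact: measurable_fst|exact: measurable_snd].
  move=> z; rewrite /size2 /size_prod /size1 /=.
  have := ler_normB (z.1) (z.1 - z.2); rewrite opprB addrC subrK.
  by have := normr_ge0 z.2; have := normr_ge0 (z.1 - z.2); lra.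
have bl : bmeas size2 (fun z => `|G z.2| * `|G z.1| * kap (z.1 - z.2)).
  under eq_fun do rewrite mulrAC; apply: bmeasMl; first exact: (bk2 _ (bmeas_norm bG)).
  exact: (bmeasurable_comp (bmeasurable_norm (bmeas_bmeasurable bG)) measurable_fst).
pose br := bmeasD (bk2 _ bG2) (bk1 _ bG2).
have bkl y : bmeas size1 (fun x => kap (x - y)).
  apply: (@bmeas_comp _ _ _ _ _ _ _ kap (fun x : R => x - y) (1 + `|y|)) => //; first exact: bkap.
    by apply: measurable_funB.
  move=> x; rewrite /size1; have := ler_normD (x - y) y; rewrite subrK.
  have := mulr_ge0 (normr_ge0 y) (normr_ge0 (x - y)).
  by move: (`|y|) (`|x - y|) (`|x|) => a b c; nra.
have bkr y : bmeas size1 (fun x => kap (y - x)).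
  apply: (@bmeas_comp _ _ _ _ _ _ _ kap (fun x : R => y - x) (1 + `|y|)) => //; first exact: bkap.
    by apply: measurable_funB.
  move=> x; rewrite /size1; have := ler_normB y (y - x); rewrite opprB addrC subrK.
  have := mulr_ge0 (normr_ge0 y) (normr_ge0 (y - x)).
  by move: (`|y|) (`|y - x|) (`|x|) => a b c; nra.
apply: (@le_trans _ _ (Int (fun y' => Int (fun y => 2^-1 * (G y ^+ 2 * kap (y' - y) + G y' ^+ 2 * kap (y' - y)))))).
  apply: le_Int; [exact: (bmeas_Int_r bl)|exact: (bmeas_Int_r (bmeasZ (2^-1) br))|move=> y'].
  apply: le_Int; [exact: (bmeas_section_r y' bl)|exact: (bmeas_section_r y' (bmeasZ (2^-1) br))|move=> y].
  rewrite -mulrDl mulrA ler_wpM2r// -[G y ^+ 2]real_normK ?num_real// -[G y' ^+ 2]real_normK ?num_real//.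
  by have := sqr_ge0 (`|G y| - `|G y'|); move: (`|G y|) (`|G y'|) => a b; nra.
have e1 : Int (fun y' => Int (fun y => G y ^+ 2 * kap (y' - y))) = Int kap * Int (fun y => G y ^+ 2).
  rewrite (Int_swap (bk2 _ bG2)) -IntZ//; apply: eq_Int => y /=.
  by rewrite IntZ// mulrC (Int_shift (- y) bkap).
have e2 : Int (fun y' => Int (fun y => G y' ^+ 2 * kap (y' - y))) = Int kap * Int (fun y => G y ^+ 2).
  rewrite -IntZ//; apply: eq_Int => y /=.
  by rewrite IntZ// mulrC (Int_reflect y bkap).
under eq_Int => y'.
  rewrite IntZ; last exact: (bmeas_section_r y' br).
  rewrite IntD; [|exact: (bmeas_section_r y' (bk2 _ bG2))|exact: (bmeas_section_r y' (bk1 _ bG2))].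
  over.
rewrite IntZ; last by apply: bmeasD; [exact: (bmeas_Int_r (bk2 _ bG2))|exact: (bmeas_Int_r (bk1 _ bG2))].
rewrite IntD; [|exact: (bmeas_Int_r (bk2 _ bG2))|exact: (bmeas_Int_r (bk1 _ bG2))].
by rewrite e1 e2; lra.
Qed.

(** Cauchy-Schwarz in [u], then Schur's test. Before the square is opened two nonnegative
    enlargements are made: the weight [w], which can be smooth where an indicator cannot, and the
    square of the companion form with [B2]. With cosine and sine for [B1] and [B2], the sum of
    products in [kernel] is the cosine of a phase difference. *)
Lemma bilinear_sqr_le :
  Int (fun u => F u * Int (fun y => G y * B1 (u, y))) ^+ 2 <=
  Int (fun u => F u ^+ 2) * (Int kap * Int (fun y => G y ^+ 2)).
Proof.
have bwL B : bmeasurable B -> bmeas size1 (fun u => w u * L B u ^+ 2).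
  by move=> bB; apply: bmeasMl => //; apply: bmeasurableX; exact: bL.
(* The weight exceeds 1 only where [F] is nonzero, so the indicator of that set is inserted before
   Cauchy-Schwarz separates [F] from the rest. *)
pose chi u : R := (F u != 0)%:R.
have mchi : measurable_fun setT chi.
  apply: measurable_bool_natr; apply: measurable_neg.
  by apply: measurable_fun_eqr => //; exact: bF.1.
have bchi : bmeas size1 chi.
  apply: (bmeas_dom 0 _ bF).
    by split=> //; exists 1 => u; rewrite /chi; case: (_ != _); rewrite ?normr0 ?normr1.
  by move=> u Fu; rewrite /chi Fu eqxx.
have bchiL : bmeas size1 (fun u => chi u * L B1 u) by apply: bmeasMl => //; exact: bL.
have -> : Int (fun u => F u * Int (fun y => G y * B1 (u, y))) = Int (fun u => F u * (chi u * L B1 u)).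
  apply: eq_Int => u; rewrite /chi; have [->|_] := eqVneq (F u) 0; first by rewrite !mul0r.
  by rewrite mul1r.
apply: (le_trans (Int_CS bF bchiL)); apply: ler_wpM2l.
  by apply: Int_ge0 => u; rewrite sqr_ge0.
apply: (@le_trans _ _ (Int (fun u => w u * L B1 u ^+ 2 + w u * L B2 u ^+ 2))).
  apply: le_Int; [exact: bmeasX|by apply: bmeasD; apply: bwL|move=> u].
  rewrite exprMn; have := w0 u; have := w1 (u := u); rewrite /chi.
  have := sqr_ge0 (L B1 u); have := sqr_ge0 (L B2 u); move: (_ ^+ 2) (_ ^+ 2) => p q.
  by case: (_ != _) => /= q0 p0 h0 h1; [have := h0 isT; nra|rewrite expr0n /= mul0r; nra].
rewrite IntD ?LE//; [|exact: bwL..].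
have bb B : bmeasurable B -> bmeas size2 (fun z => G z.2 * G z.1 * Int (fun u => w u * (B (u, z.2) * B (u, z.1)))).
  move=> bB; have := bmeas3_Int_a (bGB bB); rewrite /c31 /c32 /c33 /= => /bmeas_swap /=.
  congr (bmeas _ _); apply/funext => z; rewrite -IntZ.
    by apply: eq_Int => u; ring.
  apply: bmeasMl => //; apply: bmeasurableM; apply: bmeasurable_comp => //;
    by apply: measurable_fun_pair => //; exact: measurable_cst.
rewrite -IntD; [|exact: (bmeas_Int_r (bb _ bB1))|exact: (bmeas_Int_r (bb _ bB2))].
apply: le_trans schur_le.
have bl : bmeas size2 (fun z => `|G z.2| * `|G z.1| * kap (z.1 - z.2)).
  apply: bmeasMl; last first.
    apply: bmeasurable_comp; first exact: bmeas_bmeasurable bkap.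
    by apply: measurable_funB; [exact: measurable_fst|exact: measurable_snd].
  have bnG := bmeas_norm bG.
  apply: (@bmeas_comp2 _ _ _ _ _ _ _ _ _ (fun y => `|G y|) (fun y => `|G y|) snd fst 1) => //; [exact: bnG|exact: bnG|].
  by move=> t; rewrite /size2 /size_prod /size1; lra.
apply: le_Int.
- by apply: bmeasD; [exact: (bmeas_Int_r (bb _ bB1))|exact: (bmeas_Int_r (bb _ bB2))].
- exact: (bmeas_Int_r bl).
move=> y' /=.
rewrite -IntD; [|exact: (bmeas_section_r y' (bb _ bB1))|exact: (bmeas_section_r y' (bb _ bB2))].
apply: le_Int.
- by apply: bmeasD; [exact: (bmeas_section_r y' (bb _ bB1))|exact: (bmeas_section_r y' (bb _ bB2))].
- exact: (bmeas_section_r y' bl).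
move=> y /=.
have [->|Gy] := eqVneq (G y) 0; first by rewrite normr0 !mul0r addr0.
have [->|Gy'] := eqVneq (G y') 0; first by rewrite normr0 !mulr0 !mul0r addr0.
rewrite -mulrDr -IntD.
- rewrite (le_trans (ler_norm _))// normrM normrM ler_wpM2l ?mulr_ge0//.
  apply: le_trans (kernel Gy Gy'); rewrite le_eqVlt; apply/orP; left; apply/eqP.
  by congr `|_|; apply: eq_Int => u; rewrite mulrDr.
- apply: bmeasMl => //; apply: bmeasurableM; apply: bmeasurable_comp => //;
    by apply: measurable_fun_pair => //; exact: measurable_cst.
- apply: bmeasMl => //; apply: bmeasurableM; apply: bmeasurable_comp => //;
    by apply: measurable_fun_pair => //; exact: measurable_cst.
Qed.

End Bilinear.

End Correlations.
#[export] Hint Resolve measurable_c31 measurable_c32 measurable_c33 : core.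

(** * Calculus in one variable *)

Section OneVariableCalculus.
Context {R : realType}.
Implicit Types (f g : R -> R) (x a b : R).

Lemma der_eq f x a b : is_derive x 1 f a -> a = b -> is_derive x 1 f b.
Proof. by move=> h <-. Qed.

Lemma der_cst x k : is_derive x 1 (fun=> k) (0 : R).
Proof. exact: is_derive_cst. Qed.

Lemma der_id x : is_derive x 1 (fun y => y) (1 : R).
Proof. exact: is_derive_id. Qed.

Lemma der_add f g x a b : is_derive x 1 f a -> is_derive x 1 g b ->
  is_derive x 1 (fun y => f y + g y) (a + b).
Proof. by move=> fa gb; exact: is_deriveD. Qed.

Lemma der_sub f g x a b : is_derive x 1 f a -> is_derive x 1 g b ->
  is_derive x 1 (fun y => f y - g y) (a - b).
Proof. by move=> fa gb; exact: is_deriveB. Qed.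

Lemma der_mul f g x a b : is_derive x 1 f a -> is_derive x 1 g b ->
  is_derive x 1 (fun y => f y * g y) (a * g x + f x * b).
Proof.
move=> fa gb; apply: (der_eq (is_deriveM fa gb)).
by rewrite /GRing.scale /= addrC mulrC.
Qed.

Lemma der_comp f g x a b : is_derive x 1 f a -> is_derive (f x) 1 g b ->
  is_derive x 1 (fun y => g (f y)) (a * b).
Proof. by move=> fa gb; rewrite mulrC; exact: is_derive1_comp. Qed.

Lemma der_inv f x a : f x != 0 -> is_derive x 1 f a ->
  is_derive x 1 (fun y => (f y)^-1) (- a * (f x)^-1 ^+ 2).
Proof.
move=> fx0 fa; have dfx : derivable f x 1 by exact: ex_derive.
apply: DeriveDef; first by apply: derivableV.
rewrite deriveV//.
by rewrite derive_val /GRing.scale /= exprVn mulrC mulrN mulNr.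
Qed.

Lemma der_sin f x a : is_derive x 1 f a ->
  is_derive x 1 (fun y => sin (f y)) (a * cos (f x)).
Proof. by move=> fa; apply: der_comp fa _. Qed.

Lemma der_cos f x a : is_derive x 1 f a ->
  is_derive x 1 (fun y => cos (f y)) (- a * sin (f x)).
Proof.
by move=> fa; apply: (der_eq (der_comp fa _)); rewrite mulrN mulNr.
Qed.

Lemma der_affine k b x : is_derive x 1 (fun y => k * y + b) k.
Proof.
apply: (der_eq (der_add (der_mul (der_cst x k) (der_id x)) (der_cst x b))).
by ring.
Qed.

Lemma der_continuous f x a : is_derive x 1 f a -> {for x, continuous f}.
Proof. by move=> fa; apply: differentiable_continuous; apply/derivable1_diffP; exact: ex_derive. Qed.

Lemma MVT_ex f (df : R -> R) a b : (forall x, a <= x <= b -> is_derive x 1 f (df x)) ->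
  a <= b -> exists2 c, a <= c <= b & f b - f a = df c * (b - a).
Proof.
move=> fd; rewrite le_eqVlt => /predU1P[->|ab].
  by exists b; rewrite ?lexx// !subrr mulr0.
have ooc x : x \in Interval (BRight a) (BLeft b) -> a <= x <= b.
  by rewrite in_itv /= => /andP[/ltW -> /ltW ->].
have [||c cab ->] := @MVT R f df a b ab.
- by move=> x /ooc; exact: fd.
- apply: continuous_in_subspaceT => x /set_mem /=; rewrite in_itv /= => xab.
  exact: der_continuous (fd x xab).
- by exists c => //; exact: ooc.
Qed.

Lemma bmeas_itvind_continuous (e : R -> R) a b :
  (forall x, a <= x <= b -> {for x, continuous e}) ->
  bmeas size1 (fun x => itvind a b x * e x).
Proof.
move=> ce.
have cw : {within `[a, b], continuous e}.
  by apply: continuous_in_subspaceT => x /set_mem /=; rewrite in_itv /=; exact: ce.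
have [M0 eM] : exists M, forall x, a <= x <= b -> `|e x| <= M.
  have /compact_bounded[M [_ bM]] := continuous_compact cw (@segment_compact _ a b).
  exists (`|M| + 1) => x xab; apply: (bM (`|M| + 1)).
    by rewrite (le_lt_trans (ler_norm M))// ltrDl.
  by exists x => //=; rewrite in_itv.
have E : (fun x => itvind a b x * e x) = e \_ `[a, b].
  apply/funext => x; rewrite patchE /itvind mem_setE in_itv /=.
  by case: (_ && _); rewrite ?mul1r ?mul0r.
apply: (bmeas_dom 0 _ (bmeas_itvind a b)); last by move=> x ->; rewrite mul0r.
split.
  rewrite E; apply/(measurable_restrictT _ _).1 => //.
  by apply: subspace_continuous_measurable_fun.
exists `|M0| => x; rewrite /itvind; case: (boolP (_ && _)) => [xab|_]; last by rewrite mul0r normr0.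
by rewrite mul1r (le_trans (eM x xab))// ler_norm.
Qed.

Lemma FTC_segment (E e : R -> R) a b : a <= b ->
  (forall x, a <= x <= b -> is_derive x 1 E (e x)) ->
  (forall x, a <= x <= b -> {for x, continuous e}) ->
  Int (fun x => itvind a b x * e x) = E b - E a.
Proof.
move=> ab dE ce; have be := bmeas_itvind_continuous ce.
have cw : {within `[a, b], continuous e}.
  by apply: continuous_in_subspaceT => x /set_mem /=; rewrite in_itv /=; exact: ce.
have cE : {within `[a, b], continuous E}.
  apply: continuous_in_subspaceT => x /set_mem /=; rewrite in_itv /= => xab.
  exact: der_continuous (dE x xab).
move: ab; rewrite le_eqVlt => /predU1P[ab|ab].
  (* A degenerate segment: the integrand lives at the single point [a], and the bound by value times
     length is zero. *)
  subst b; rewrite subrr; apply/eqP; rewrite -normr_le0.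
  rewrite -[leRHS](mulr0 `|e a|) -[X in _ * X](subrr a); apply: Int_bound => //.
    move=> x; rewrite /itvind; case: (boolP (_ && _)) => [/andP[ax xa]|_]; last by rewrite mul0r normr0.
    by rewrite mul1r (_ : x = a)//; apply/eqP; rewrite eq_le ax xa.
  by move=> x; rewrite /itvind => /negbTE ->; rewrite mul0r.
have ooc x : x \in Interval (BRight a) (BLeft b) -> a <= x <= b.
  by rewrite in_itv /= => /andP[/ltW -> /ltW ->].
have EFTC := @continuous_FTC2 R e E a b ab cw.
rewrite /Int /Rintegral.
have -> : (\int[@lebesgue_measure R]_x (itvind a b x * e x)%:E =
   \int[@lebesgue_measure R]_(x in `[a, b]) (e x)%:E)%E.
  rewrite [RHS]integral_mkcond; apply: eq_integral => x _.
  rewrite patchE /itvind mem_setE in_itv /=.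
  by case: (_ && _); rewrite ?mul1r ?mul0r.
rewrite EFTC//.
- have [Ea Eb] : a <= a <= b /\ a <= b <= b by rewrite !lexx (ltW ab).
  split.
  + by move=> x /ooc /dE h; exact: ex_derive.
  + by apply: cvg_at_right_filter; exact: der_continuous (dE a Ea).
  + by apply: cvg_at_left_filter; exact: der_continuous (dE b Eb).
- by move=> x /ooc /dE h; rewrite derive1E; exact: derive_val.
Qed.

Section IntegrationByParts.
Variables (Phi g g1 g2 h h1 h2 : R -> R) (a b : R).
Hypothesis ab : a <= b.
Hypothesis dPhi : forall x, a <= x <= b -> is_derive x 1 Phi (g x).
Hypothesis dg : forall x, a <= x <= b -> is_derive x 1 g (g1 x).
Hypothesis dg1 : forall x, a <= x <= b -> is_derive x 1 g1 (g2 x).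
Hypothesis dh : forall x, a <= x <= b -> is_derive x 1 h (h1 x).
Hypothesis dh1 : forall x, a <= x <= b -> is_derive x 1 h1 (h2 x).
Hypothesis cg2 : forall x, a <= x <= b -> {for x, continuous g2}.
Hypothesis ch2 : forall x, a <= x <= b -> {for x, continuous h2}.
Hypotheses (ha : h a = 0) (hb : h b = 0) (h1a : h1 a = 0) (h1b : h1 b = 0).
Variables (gam d B H : R).
Hypotheses (gam0 : 0 < gam) (d0 : 0 < d) (B0 : 0 <= B) (H0 : 0 <= H).
Hypothesis gl : forall x, a <= x <= b -> gam <= `|g x|.
Hypothesis g1u : forall x, a <= x <= b -> `|g1 x| <= B * (`|g x| / d).
Hypothesis g2u : forall x, a <= x <= b -> `|g2 x| <= B * (`|g x| / d ^+ 2).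
Hypothesis hu : forall x, a <= x <= b -> `|h x| <= H.
Hypothesis h1u : forall x, a <= x <= b -> `|h1 x| <= H / d.
Hypothesis h2u : forall x, a <= x <= b -> `|h2 x| <= H / d ^+ 2.

Let k x := (g x)^-1.
Let E x := h x * k x * sin (Phi x) + (h1 x * (k x * k x) - h x * (g1 x * (k x * (k x * k x)))) * cos (Phi x).
Let r x := h2 x * (k x * k x) - 3 * (h1 x * g1 x * (k x * (k x * k x)))
  - h x * g2 x * (k x * (k x * k x)) + 3 * (h x * (g1 x * g1 x) * (k x * (k x * (k x * k x)))).
Let e x := h x * cos (Phi x) + r x * cos (Phi x).

(* With q = (h/g)'/g one has (h/g sin Phi + q cos Phi)' = (h + q') cos Phi:
   two integrations by parts in a single application of the fundamental theorem. *)
Lemma oscillatory_by_parts :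
  `|Int (fun x => itvind a b x * (h x * cos (Phi x)))| <=
  (1 + 4 * B + 3 * B ^+ 2) * H / (gam * d) ^+ 2 * (b - a).
Proof.
have g0 x : a <= x <= b -> g x != 0.
  by move=> xab; rewrite -normr_gt0 (lt_le_trans gam0)// gl.
have dk x : a <= x <= b -> is_derive x 1 k (- g1 x * (k x * k x)).
  by move=> xab; apply: (der_eq (der_inv (g0 x xab) (dg xab))); rewrite expr2.
have dE x : a <= x <= b -> is_derive x 1 E (e x).
  move=> xab.
  have D := der_mul (dk x xab) (dk x xab).
  have D2 := der_mul (dk x xab) D.
  have D2' := der_mul (dk x xab) (der_mul (dk x xab) (dk x xab)).
  have ds := der_sin (dPhi xab); have dc := der_cos (dPhi xab).
  have P1 := der_mul (der_mul (dh xab) (dk x xab)) ds.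
  have Pa := der_mul (dh1 xab) D.
  have Pb := der_mul (dh xab) (der_mul (dg1 xab) D2').
  apply: (der_eq (der_add P1 (der_mul (der_sub Pa Pb) dc))).
  rewrite /e /r.
  have gk : g x * k x = 1 by rewrite /k divff// g0.
  (* The product rule gives [e x] up to multiples of [1 - g x * k x]; with these isolated, what
     remains is a ring identity. *)
  transitivity (h x * cos (Phi x) * (g x * k x) + r x * cos (Phi x)
    + (h1 x * k x - h x * g1 x * (k x * k x)) * sin (Phi x) * (1 - g x * k x)).
    by rewrite /r; ring.
  by rewrite gk subrr mulr0 addr0 mulr1.
have cts x : a <= x <= b -> {for x, continuous e}.
  move=> xab.
  have ck : {for x, continuous k} := der_continuous (dk x xab).
  have cg1 : {for x, continuous g1} := der_continuous (dg1 xab).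
  have cg2' := cg2 xab; have ch2' := ch2 xab.
  have chh : {for x, continuous h} := der_continuous (dh xab).
  have ch1 : {for x, continuous h1} := der_continuous (dh1 xab).
  have cc : {for x, continuous (fun x => cos (Phi x))} := der_continuous (der_cos (dPhi xab)).
  rewrite /e /r; apply: continuousD; apply: continuousM => //.
  have c3 : {for x, continuous (fun x => k x * (k x * k x))} by do 2 apply: continuousM => //.
  have cst3 : {for x, continuous (fun _ : R => 3 : R)} by exact: cst_continuous.
  apply: continuousD; [apply: continuousB; [apply: continuousB|]|].
  - by apply: continuousM => //; apply: continuousM.
  - by apply: continuousM => //; apply: continuousM => //; apply: continuousM.
  - by apply: continuousM => //; apply: continuousM.
  - by apply: continuousM => //; apply: continuousM; apply: continuousM => //; apply: continuousM.
have FT := FTC_segment ab dE cts.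
(* [h] and [h1] vanish at both ends, so the integral of [e] is zero and the oscillatory integral
   equals minus that of the remainder [r * cos]. *)
have E0 : E b - E a = 0 by rewrite /E ha hb h1a h1b; ring.
have cr x : a <= x <= b -> {for x, continuous (fun x => e x - h x * cos (Phi x))}.
  move=> xab; apply: continuousB; first exact: cts.
  apply: continuousM; first exact: der_continuous (dh xab).
  exact: der_continuous (der_cos (dPhi xab)).
have be := bmeas_itvind_continuous cts; have br := bmeas_itvind_continuous cr.
have -> : Int (fun x => itvind a b x * (h x * cos (Phi x))) =
    - Int (fun x => itvind a b x * (e x - h x * cos (Phi x))).
  rewrite -[LHS]opprK; congr (- _); rewrite -[LHS](addr0 (- _)) -{1}E0 -FT addrC -IntB//.
    by apply: eq_Int => x; ring.
  rewrite (_ : (fun x => _) = (fun x => itvind a b x * e x - itvind a b x * (e x - h x * cos (Phi x)))).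
    exact: bmeasB.
  by apply/funext => x; ring.
rewrite normrN; apply: Int_bound => //; last first.
  by move=> x; rewrite /itvind => /negbTE ->; rewrite mul0r.
move=> x; have C0 : 0 <= (1 + 4 * B + 3 * B ^+ 2) * H / (gam * d) ^+ 2.
  rewrite divr_ge0 ?sqr_ge0// mulr_ge0//.
  by rewrite !addr_ge0 ?mulr_ge0 ?sqr_ge0.
rewrite /itvind; case: (boolP (_ && _)) => [xab|_]; last by rewrite mul0r normr0.
rewrite mul1r (_ : e x - _ = r x * cos (Phi x)); last by rewrite /e; ring.
have Cc : `|cos (Phi x)| <= 1 by rewrite ler_norml cos_geN1 cos_le1.
rewrite normrM (le_trans (ler_wpM2l (normr_ge0 _) Cc))// mulr1.
have gp : 0 < `|g x| by rewrite normr_gt0 g0.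
set G := `|g x| in gp; pose K := `|k x|.
have KG : K * G = 1 by rewrite /K /G -normrM mulVf ?normr1// g0.
have Kp : 0 <= K by exact: normr_ge0.
pose D := d^-1; have Dp : 0 < D by rewrite invr_gt0.
have nh := hu xab; have nh1 := h1u xab; have nh2 := h2u xab.
have ng1 := g1u xab; have ng2 := g2u xab; rewrite -/G in ng1 ng2.
have Kgam : K <= gam^-1.
  by rewrite /K /k normfV lef_pV2 ?posrE//; apply: gl.
(* The bounds on [g1] and [g2] are proportional to [G], and [K * G = 1]: each such factor uses up
   one [K], so that all four terms end with exactly [K ^+ 2]. *)
have rb : `|r x| <= (1 + 4 * B + 3 * B ^+ 2) * H * (D * K) ^+ 2.
  rewrite /r.
  have t1 : `|h2 x * (k x * k x)| <= H * (D * K) ^+ 2.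
    rewrite !normrM -/K (_ : H * _ = H / d ^+ 2 * (K * K)); last by rewrite -exprVn -/D; ring.
    by rewrite ler_wpM2r// mulr_ge0.
  have t2 : `|h1 x * g1 x * (k x * (k x * k x))| <= B * H * (D * K) ^+ 2.
    rewrite !normrM -/K (_ : B * H * _ = (H / d * (B * (G / d))) * (K * (K * K))).
      by apply: ler_wpM2r; [rewrite !mulr_ge0|exact: ler_pM].
    transitivity (B * H * (D * K) ^+ 2 * (K * G)); first by rewrite KG mulr1.
    by rewrite -/D; ring.
  have t3 : `|h x * g2 x * (k x * (k x * k x))| <= B * H * (D * K) ^+ 2.
    rewrite !normrM -/K (_ : B * H * _ = (H * (B * (G / d ^+ 2))) * (K * (K * K))).
      by apply: ler_wpM2r; [rewrite !mulr_ge0|exact: ler_pM].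
    transitivity (B * H * (D * K) ^+ 2 * (K * G)); first by rewrite KG mulr1.
    by rewrite -exprVn -/D; ring.
  have t4 : `|h x * (g1 x * g1 x) * (k x * (k x * (k x * k x)))| <= B ^+ 2 * H * (D * K) ^+ 2.
    rewrite !normrM -/K (_ : B ^+ 2 * H * _ = (H * ((B * (G / d)) * (B * (G / d)))) * (K * (K * (K * K)))).
      by apply: ler_wpM2r; [rewrite !mulr_ge0|apply: ler_pM => //; exact: ler_pM].
    transitivity (B ^+ 2 * H * (D * K) ^+ 2 * (K * G) ^+ 2); first by rewrite KG expr1n mulr1.
    by rewrite -/D; ring.
  move: t1 t2 t3 t4.
  set u1 := h2 x * _; set u2 := h1 x * _ * _; set u3 := h x * g2 x * _; set u4 := h x * _ * _ => t1 t2 t3 t4.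
  move: u1 u2 u3 u4 t1 t2 t3 t4 => u1 u2 u3 u4 t1 t2 t3 t4.
  have tr : `|u1 - 3 * u2 - u3 + 3 * u4| <= `|u1| + 3 * `|u2| + `|u3| + 3 * `|u4|.
    rewrite (le_trans (ler_normD _ _))// normrM (gtr0_norm (_ : 0 < 3))// lerD2r.
    rewrite (le_trans (ler_normB _ _))// lerD2r.
    by rewrite (le_trans (ler_normB _ _))// normrM (gtr0_norm (_ : 0 < 3)).
  by apply: (le_trans tr); move: t1 t2 t3 t4; move: (_ ^+ 2) => w; lra.
apply: (le_trans rb).
have q0 : 0 <= 1 + 4 * B + 3 * B ^+ 2 by rewrite !addr_ge0 ?mulr_ge0 ?sqr_ge0.
apply: ler_wpM2l; first by rewrite mulr_ge0.
have D0 := ltW Dp; have gi0 : 0 <= gam^-1 by rewrite invr_ge0 ltW.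
rewrite -exprVn invfM -/D mulrC.
have a0 : 0 <= K * D by exact: mulr_ge0.
have b0 : 0 <= gam^-1 * D by exact: mulr_ge0.
by rewrite ler_sqr ?nnegrE//; apply: ler_wpM2r.
Qed.

End IntegrationByParts.

End OneVariableCalculus.

(** * Jets of functions of two variables *)

Section Jets.
Context {R : realType}.
Implicit Types (s : nat -> nat -> R * R -> R) (z : R * R) (D : set (R * R)).

(* [s p q] stands for the partial derivative of order (p, q) of [s 0 0]; the
   family [jetP s] is then the jet of dx dy (dx - dy) applied to it. *)
Definition jet D s := forall p q z, D z ->
  is_diff z (s p q) (fun w => w.1 * s p.+1 q z + w.2 * s p q.+1 z).

Definition jetP s p q z := s p.+2 q.+1 z - s p.+1 q.+2 z.

Definition box (x0 y0 r : R) : set (R * R) :=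
  [set z | `|z.1 - x0| <= r /\ `|z.2 - y0| <= r].

Lemma jetP_jet D s : jet D s -> jet D (jetP s).
Proof.
move=> js p q z Dz; apply: (is_diff_eq (is_diffB (js p.+2 q.+1 z Dz) (js p.+1 q.+2 z Dz))).
by apply/funext => w; rewrite !fctE /jetP /=; ring.
Qed.

Lemma jet_sub D D' s : D' `<=` D -> jet D s -> jet D' s.
Proof. by move=> DD js p q z /DD; exact: js. Qed.

Lemma is_diff_of_derive (f : R -> R) (t a : R) : is_derive t 1 f a -> is_diff t f (fun h => h * a).
Proof.
move=> fa; have df : differentiable f t by apply/derivable1_diffP; exact: ex_derive.
apply: DiffDef => //; rewrite diff1E//; apply/funext => h.
by rewrite derive1E derive_val.
Qed.

Lemma is_derive_of_diff (f df : R -> R) (t : R) : is_diff t f df -> is_derive t 1 f (df 1).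
Proof.
move=> fd; have dfx : differentiable f t by exact: ex_diff.
apply: DeriveDef; first exact: diff_derivable.
by rewrite deriveE// diff_val.
Qed.

Lemma jet_curve D s p q (a b : R -> R) (a' b' t : R) : jet D s -> D (a t, b t) ->
  is_derive t 1 a a' -> is_derive t 1 b b' ->
  is_derive t 1 (fun u => s p q (a u, b u))
    (a' * s p.+1 q (a t, b t) + b' * s p q.+1 (a t, b t)).
Proof.
move=> js Dt da db.
have dab := is_diff_pair (is_diff_of_derive da) (is_diff_of_derive db).
have := is_derive_of_diff (is_diff_comp dab (js p q _ Dt)).
by rewrite /= !mul1r.
Qed.

Lemma jet_partial_x D s p q x y : jet D s -> D (x, y) ->
  is_derive x 1 (fun u => s p q (u, y)) (s p.+1 q (x, y)).
Proof.
move=> js Dxy; apply: (der_eq (jet_curve p q (a := id) (b := fun=> y) js Dxy (der_id x) (der_cst x y))).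
by rewrite mul1r mul0r addr0.
Qed.

Lemma jet_partial_y D s p q x y : jet D s -> D (x, y) ->
  is_derive y 1 (fun u => s p q (x, u)) (s p q.+1 (x, y)).
Proof.
move=> js Dxy; apply: (der_eq (jet_curve p q (a := fun=> x) (b := id) js Dxy (der_cst y x) (der_id y))).
by rewrite mul1r mul0r add0r.
Qed.

Lemma box_convex x0 y0 r x y x' y' t : box x0 y0 r (x, y) -> box x0 y0 r (x', y') ->
  0 <= t <= 1 -> box x0 y0 r (x + t * (x' - x), y + t * (y' - y)).
Proof.
have H (c u v : R) : `|u - c| <= r -> `|v - c| <= r -> 0 <= t <= 1 -> `|u + t * (v - u) - c| <= r.
  rewrite !ler_norml => /andP[h1 h2] /andP[h3 h4] /andP[h5 h6].
  by apply/andP; split; nra.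
by move=> [h1 h2] [h3 h4] ht; split; apply: H.
Qed.

Lemma box_center x0 y0 r : 0 <= r -> box x0 y0 r (x0, y0).
Proof. by move=> r0; split; rewrite /= subrr normr0. Qed.

Lemma box_sub (x0 y0 r x1 y1 r' : R) : `|x1 - x0| + r' <= r -> `|y1 - y0| + r' <= r ->
  box x1 y1 r' `<=` box x0 y0 r.
Proof.
move=> hx hy z [h1 h2]; split.
  by have := ler_normD (z.1 - x1) (x1 - x0); rewrite addrA subrK; lra.
by have := ler_normD (z.2 - y1) (y1 - y0); rewrite addrA subrK; lra.
Qed.

Lemma mvt2 x0 y0 r s p q z z' : jet (box x0 y0 r) s -> box x0 y0 r z -> box x0 y0 r z' ->
  exists2 w, box x0 y0 r w &
    s p q z' - s p q z = (z'.1 - z.1) * s p.+1 q w + (z'.2 - z.2) * s p q.+1 w.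
Proof.
case: z z' => [x y] [x' y'] js bz bz'.
pose a t := x + t * (x' - x); pose b t := y + t * (y' - y).
have da (t k c : R) : is_derive t 1 (fun u => c + u * k) k.
  by apply: (der_eq (der_add (der_cst t c) (der_mul (der_id t) (der_cst t k)))); ring.
have dF (t : R) : 0 <= t <= 1 -> is_derive t 1 (fun u => s p q (a u, b u))
    ((x' - x) * s p.+1 q (a t, b t) + (y' - y) * s p q.+1 (a t, b t)).
  by move=> ht; apply: jet_curve js _ _ _ => //; exact: box_convex.
have [c hc E] := MVT_ex dF ler01.
exists (a c, b c); first exact: box_convex.
by move: E; rewrite /a /b !mul1r !mul0r !addr0 [x + _]addrC [y + _]addrC !subrK subr0 mulr1.
Qed.

Lemma mvt_box x0 y0 r s p q K1 K2 z z' : jet (box x0 y0 r) s ->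
  (forall w, box x0 y0 r w -> `|s p.+1 q w| <= K1) ->
  (forall w, box x0 y0 r w -> `|s p q.+1 w| <= K2) ->
  box x0 y0 r z -> box x0 y0 r z' ->
  `|s p q z' - s p q z| <= `|z'.1 - z.1| * K1 + `|z'.2 - z.2| * K2.
Proof.
move=> js h1 h2 bz bz'; have [w bw ->] := mvt2 p q js bz bz'.
rewrite (le_trans (ler_normD _ _))// !normrM lerD// ler_wpM2l//.
  exact: h1.
exact: h2.
Qed.

(** The mean value theorem twice: in [v], which gives [dy], then along [(-1, 1)], which gives
    [dx - dy]. Applied to an x-derivative with [q = 0], the bracket becomes a value of [jetP]. *)
Lemma second_difference D s p q (x y y' tau : R) : jet D s ->
  (forall v t, (y <= v <= y') || (y' <= v <= y) -> (0 <= t <= tau) || (tau <= t <= 0) ->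
     D (x - t, v + t)) ->
  exists v t, [/\ (y <= v <= y') || (y' <= v <= y), (0 <= t <= tau) || (tau <= t <= 0) &
    (s p q (x, y') - s p q (x - tau, y' + tau)) - (s p q (x, y) - s p q (x - tau, y + tau)) =
    (y' - y) * tau * (s p.+1 q.+1 (x - t, v + t) - s p q.+2 (x - t, v + t))].
Proof.
move=> js Dbox.
pose psi v := s p q (x, v) - s p q (x - tau, v + tau).
pose psi' v := s p q.+1 (x, v) - s p q.+1 (x - tau, v + tau).
have t0 : ((0 : R) <= 0 <= tau) || (tau <= (0 : R) <= 0) by rewrite !lexx andbT /=; exact: le_total.
have tt : (0 <= tau <= tau) || (tau <= tau <= 0) by rewrite !lexx !andbT /=; exact: le_total.
have dpsi (v : R) : (y <= v <= y') || (y' <= v <= y) -> is_derive v 1 psi (psi' v).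
  move=> hv; apply: der_sub.
    by apply: jet_partial_y js _; have := Dbox v 0 hv t0; rewrite subr0 addr0.
  apply: (der_eq (jet_curve p q (a := fun=> x - tau) (b := fun u => u + tau) js (Dbox v tau hv tt) (der_cst v _) (der_add (der_id v) (der_cst v _)))).
  by rewrite mul0r add0r addr0 mul1r.
have [v hv Ev] : exists2 v, (y <= v <= y') || (y' <= v <= y) & psi y' - psi y = psi' v * (y' - y).
  have [yy'|/ltW yy'] := leP y y'.
    have [v hv E] := MVT_ex (f := psi) (df := psi') (fun v hv => dpsi v ltac:(by rewrite hv)) yy'.
    by exists v; rewrite ?hv.
  have dpsi2 (u : R) : y' <= u <= y -> is_derive u 1 psi (psi' u) by move=> hu; apply: dpsi; rewrite hu orbT.
  have [v hv E] := MVT_ex dpsi2 yy'.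
  by exists v; rewrite ?hv ?orbT//; rewrite -opprB E -mulrN opprB.
pose chi t := s p q.+1 (x - t, v + t).
pose chi' t := - (s p.+1 q.+1 (x - t, v + t) - s p q.+2 (x - t, v + t)).
have dchi (t : R) : (0 <= t <= tau) || (tau <= t <= 0) -> is_derive t 1 chi (chi' t).
  move=> ht.
  apply: (der_eq (jet_curve p q.+1 (a := fun t => x - t) (b := fun u => v + u) js (Dbox v t hv ht) (der_sub (der_cst t x) (der_id t)) (der_add (der_cst t v) (der_id t)))).
  by rewrite /chi' sub0r add0r mulN1r mul1r opprB addrC.
have [t ht Et] : exists2 t, (0 <= t <= tau) || (tau <= t <= 0) & chi tau - chi 0 = chi' t * tau.
  have [ta|/ltW ta] := leP 0 tau.
    have dchi1 (u : R) : 0 <= u <= tau -> is_derive u 1 chi (chi' u) by move=> hu; apply: dchi; rewrite hu.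
    have [t ht E] := MVT_ex dchi1 ta.
    by exists t; rewrite ?ht//; move: E; rewrite subr0.
  have dchi2 (u : R) : tau <= u <= 0 -> is_derive u 1 chi (chi' u) by move=> hu; apply: dchi; rewrite hu orbT.
  have [t ht E] := MVT_ex dchi2 ta.
  by exists t; rewrite ?ht ?orbT//; rewrite -opprB E sub0r mulrN opprK.
exists v, t; split => //; rewrite -/(psi y') -/(psi y) Ev.
have -> : psi' v = - (chi tau - chi 0) by rewrite /psi' /chi subr0 addr0 opprB.
by rewrite Et /chi'; ring.
Qed.

Lemma jet_continuous D s p q z : jet D s -> D z -> {for z, continuous (s p q)}.
Proof. by move=> js Dz; apply: differentiable_continuous; have := js p q z Dz => h; exact: ex_diff. Qed.

End Jets.

(** * The oscillatory kernel *)

Section KernelEstimate.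
Context {R : realType}.

(** Bounds are normalised at length [d]: each derivative costs [1 / d], so that [H] is invariant
    under rescaling. *)
Record amplitude (a b d H : R) (h h1 h2 : R -> R) : Prop := Amplitude {
  amp_d : forall x, a <= x <= b -> is_derive x 1 h (h1 x);
  amp_d1 : forall x, a <= x <= b -> is_derive x 1 h1 (h2 x);
  amp_c : forall x, a <= x <= b -> {for x, continuous h2};
  amp_u : forall x, a <= x <= b -> `|h x| <= H;
  amp_u1 : forall x, a <= x <= b -> `|h1 x| <= H / d;
  amp_u2 : forall x, a <= x <= b -> `|h2 x| <= H / d ^+ 2 }.

(** The factor 4 is [1 + 2 + 1], from the Leibniz rule for the second derivative. *)
Lemma amplitude_mul a b d H K h h1 h2 k k1 k2 : 0 < d -> 0 <= H -> 0 <= K ->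
  amplitude a b d H h h1 h2 -> amplitude a b d K k k1 k2 ->
  amplitude a b d (4 * H * K) (fun x => h x * k x) (fun x => h1 x * k x + h x * k1 x)
    (fun x => h2 x * k x + 2 * (h1 x * k1 x) + h x * k2 x).
Proof.
move=> d0 H0 K0 [dh dh1 ch hu h1u h2u] [dk dk1 ck ku k1u k2u].
have i0 : 0 < d^-1 by rewrite invr_gt0.
split=> x xab; have := hu x xab; have := h1u x xab; have := h2u x xab;
  have := ku x xab; have := k1u x xab; have := k2u x xab;
  have := dh x xab; have := dk x xab; have := dh1 x xab; have := dk1 x xab
  => Dk1 Dh1 Dk Dh bk2 bk1 bk bh2 bh1 bh.
- exact: der_mul.
- by apply: (der_eq (der_add (der_mul Dh1 Dk) (der_mul Dh Dk1))); ring.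
- have c0 : {for x, continuous h} := der_continuous Dh.
  have c1 : {for x, continuous h1} := der_continuous Dh1.
  have e0 : {for x, continuous k} := der_continuous Dk.
  have e1 : {for x, continuous k1} := der_continuous Dk1.
  have c2 := ch x xab; have e2 := ck x xab.
  apply: continuousD; [apply: continuousD|]; apply: continuousM => //.
    exact: cst_continuous.
  exact: continuousM.
- rewrite normrM (le_trans (ler_pM _ _ bh bk))//.
  by have := mulr_ge0 H0 K0; lra.
- apply: (le_trans (ler_normD _ _)); rewrite !normrM.
  have t1 := ler_pM (normr_ge0 _) (normr_ge0 _) bh1 bk.
  have t2 := ler_pM (normr_ge0 _) (normr_ge0 _) bh bk1.
  apply: (le_trans (lerD t1 t2)).
  have := mulr_ge0 (mulr_ge0 H0 K0) (ltW i0).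
  rewrite (_ : H / d * K = H * K * d^-1); last by ring.
  rewrite (_ : H * (K / d) = H * K * d^-1); last by ring.
  rewrite (_ : 4 * H * K / d = 4 * (H * K * d^-1)); last by ring.
  by lra.
- have t1 := ler_pM (normr_ge0 _) (normr_ge0 _) bh2 bk.
  have t2 := ler_pM (normr_ge0 _) (normr_ge0 _) bh1 bk1.
  have t3 := ler_pM (normr_ge0 _) (normr_ge0 _) bh bk2.
  apply: (le_trans (ler_normD _ _)); apply: (le_trans (lerD (ler_normD _ _) (lexx _))).
  rewrite !normrM (gtr0_norm (_ : 0 < 2))//.
  rewrite (_ : 4 * H * K / d ^+ 2 = H / d ^+ 2 * K + 2 * (H / d * (K / d)) + H * (K / d ^+ 2)).
    by lra.
  by field; rewrite gt_eqF.
Qed.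

(** A parabola vanishing at both ends and at least 1 on [[x0, x0 + d]]. Its square, which serves as
    weight, also has vanishing derivative at the ends, so the two integrations by parts leave no
    boundary terms. *)
Lemma amplitude_bump (x0 d : R) : 0 < d ->
  amplitude (x0 - d) (x0 + 2 * d) d 2
    (fun u => (u - (x0 - d)) * (x0 + 2 * d - u) / (2 * d ^+ 2))
    (fun u => (2 * x0 + d - 2 * u) / (2 * d ^+ 2)) (fun u => - (d ^+ 2)^-1).
Proof.
move=> d0; have dn : d != 0 by rewrite gt_eqF.
have dd0 : 0 < d ^+ 2 by rewrite exprn_gt0.
have der_lin (k b x : R) : is_derive x 1 (fun u => k * u + b) k by exact: der_affine.
split=> x /andP[xa xb].
- have D := der_mul (der_mul (der_lin 1 (- (x0 - d)) x) (der_lin (-1) (x0 + 2 * d) x)) (der_cst x (2 * d ^+ 2)^-1).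
  move: D; under eq_fun do rewrite mul1r mulN1r [- _ + _]addrC; move=> D.
  by apply: (der_eq D); field.
- have D := der_mul (der_lin (-2) (2 * x0 + d) x) (der_cst x (2 * d ^+ 2)^-1).
  move: D; under eq_fun do rewrite mulNr [- _ + _]addrC; move=> D.
  by apply: (der_eq D); field.
- exact: cst_continuous.
- rewrite normrM normfV (gtr0_norm (_ : 0 < 2 * d ^+ 2)) ?mulr_gt0// ler_pdivrMr ?mulr_gt0//.
  rewrite ger0_norm ?mulr_ge0 ?subr_ge0//.
  have := sqr_ge0 ((x - (x0 - d)) - (x0 + 2 * d - x)).
  by rewrite expr2 (expr2 d); nra.
- rewrite normrM normfV (gtr0_norm (_ : 0 < 2 * d ^+ 2)) ?mulr_gt0// ler_pdivrMr ?mulr_gt0//.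
  rewrite (_ : 2 / d * (2 * d ^+ 2) = 4 * d); last by field.
  by rewrite ler_norml; apply/andP; split; lra.
- rewrite normrN normfV (gtr0_norm dd0).
  have : 0 < (d ^+ 2)^-1 by rewrite invr_gt0. by set i := (d ^+ 2)^-1; lra.
Qed.

(** The primitive [atan (M x) / M] varies by at most [pi / M], and [pi < 4]. *)
Lemma Int_cauchy_kernel_le (M d : R) : 0 < M -> 0 <= d ->
  Int (fun x => itvind (- d) d x * (1 + (M * x) ^+ 2)^-1) <= 4 / M.
Proof.
move=> M0 d0.
have dE (x : R) : is_derive x 1 (fun y => M^-1 * atan (M * y + 0)) ((1 + (M * x) ^+ 2)^-1).
  have D := der_comp (der_affine M 0 x) (is_derive1_atan (M * x + 0)).
  apply: (der_eq (der_mul (der_cst x M^-1) D)).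
  by rewrite mul0r add0r addr0 mulrA mulVf ?mul1r// gt_eqF.
rewrite (FTC_segment (E := fun y => M^-1 * atan (M * y + 0))) //; last 2 first.
- by lra.
- move=> x _.
  have nz : 1 + (M * x + 0) * (M * x + 0) != 0 by rewrite gt_eqF// ltr_pwDl// -expr2 sqr_ge0.
  have D := der_inv (f := fun y => 1 + (M * y + 0) * (M * y + 0)) nz
    (der_add (der_cst x 1) (der_mul (der_affine M 0 x) (der_affine M 0 x))).
  rewrite (_ : (fun y => _) = (fun y => (1 + (M * y + 0) * (M * y + 0))^-1)).
    exact: der_continuous D.
  by apply/funext => y; rewrite addr0 expr2.
rewrite -mulrBr mulrC ler_pM2r ?invr_gt0//.
have := atan_ltpi2 (M * d + 0); have := atan_gtNpi2 (M * - d + 0); have := @pihalf_lt2 R.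
by lra.
Qed.

Variables (x0 y0 d : R) (s : nat -> nat -> R * R -> R) (A0 A1 A2 : R * R -> R).
Variables (B c mu BA : R).
Hypotheses (d0 : 0 < d) (c0 : 0 < c) (mu0 : 0 < mu) (B0 : 0 <= B) (BA0 : 0 <= BA).
Hypothesis js : jet (box x0 y0 (3 * d)) s.
Hypothesis low : forall z, box x0 y0 (3 * d) z -> c * mu <= `|jetP s 0 0 z|.
Hypothesis up1 : forall z, box x0 y0 (3 * d) z -> `|jetP s 1 0 z| <= B * mu / d.
Hypothesis up2 : forall z, box x0 y0 (3 * d) z -> `|jetP s 2 0 z| <= B * mu / d ^+ 2.
Hypothesis ampA : forall y, `|y - y0| <= 3 * d ->
  amplitude (x0 - 3 * d) (x0 + 3 * d) d BA (fun u => A0 (u, y)) (fun u => A1 (u, y)) (fun u => A2 (u, y)).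

Section FixedLines.
Variables (tau y y' : R).
Hypotheses (td : `|tau| <= d).
Hypotheses (yI : y0 <= y <= y0 + d) (yI' : y0 <= y' <= y0 + d).
Hypotheses (ytI : y0 <= y + tau <= y0 + d) (ytI' : y0 <= y' + tau <= y0 + d).

(** The phase left after both squares are opened, with [p] derivatives in [u]: corners at heights
    [y], [y'] and their translates by [(-tau, tau)]. *)
Definition fourth_difference p u :=
  (s p 0 (u, y') - s p 0 (u - tau, y' + tau)) - (s p 0 (u, y) - s p 0 (u - tau, y + tau)).
Local Notation delta := fourth_difference.

Let tauI : - d <= tau <= d. Proof. by rewrite -ler_norml. Qed.

Let inbox u t v : x0 - d <= u <= x0 + 2 * d -> - d <= t <= d -> y0 <= v <= y0 + d ->
  box x0 y0 (3 * d) (u - t, v).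
Proof.
by move=> /andP[? ?] /andP[? ?] /andP[? ?]; split; rewrite /= ler_norml; apply/andP; split; lra.
Qed.

Let zeroI : - d <= 0 <= d. Proof. by rewrite oppr_le0 ltW. Qed.

Lemma fourth_difference_derive p u : x0 - d <= u <= x0 + 2 * d ->
  is_derive u 1 (delta p) (delta p.+1 u).
Proof.
move=> hu.
have H v : y0 <= v <= y0 + d -> is_derive u 1 (fun u => s p 0 (u, v)) (s p.+1 0 (u, v)).
  by move=> hv; apply: jet_partial_x js _; have := inbox hu zeroI hv; rewrite subr0.
have H' v : y0 <= v + tau <= y0 + d -> is_derive u 1 (fun u => s p 0 (u - tau, v + tau)) (s p.+1 0 (u - tau, v + tau)).
  move=> hv; have D := jet_curve p 0 (a := fun u => u - tau) (b := fun=> v + tau) js (inbox hu tauI hv)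
     (der_sub (der_id u) (der_cst u tau)) (der_cst u _).
  by apply: (der_eq D); rewrite subr0 mul1r mul0r addr0.
by apply: der_sub; apply: der_sub; [exact: H|exact: H'|exact: H|exact: H'].
Qed.

(** Every derivative carries the same factor [(y' - y) * tau], though with its own intermediate
    point. Hence higher derivatives are comparable to the first one, in the relative form that
    integration by parts asks for. *)
Lemma fourth_difference_mvt p u : x0 - d <= u <= x0 + 2 * d ->
  exists2 z, box x0 y0 (3 * d) z & delta p.+1 u = (y' - y) * tau * jetP s p 0 z.
Proof.
move=> hu.
have hb v t : (y <= v <= y') || (y' <= v <= y) -> (0 <= t <= tau) || (tau <= t <= 0) ->
    box x0 y0 (3 * d) (u - t, v + t).
  move: yI yI' ytI ytI' tauI => /andP[? ?] /andP[? ?] /andP[? ?] /andP[? ?] /andP[? ?].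
  by move: hu => /andP[? ?] /orP[] /andP[? ?] /orP[] /andP[? ?]; split;
     rewrite /= ler_norml; apply/andP; split; lra.
have [v [t [hv ht E]]] := second_difference p.+1 0 (x := u) js hb.
by exists (u - t, v + t); [exact: hb|exact: E].
Qed.

(** The constant that [amplitude_mul] yields for the squared bump ([4 * 2 * 2]) times two pairs of
    amplitudes ([4 * BA * BA] each). *)
Let K := 4 * (4 * (4 * 2 * 2) * (4 * BA * BA)) * (4 * BA * BA).
Definition kernel_const := (1 + 4 * (B / c) + 3 * (B / c) ^+ 2) * K * 3.

Definition bump u := itvind (x0 - d) (x0 + 2 * d) u *
  ((u - (x0 - d)) * (x0 + 2 * d - u) / (2 * d ^+ 2)) ^+ 2.

Let ampl v t : `|v - y0| <= 3 * d -> - d <= t <= d ->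
  amplitude (x0 - d) (x0 + 2 * d) d BA (fun u => A0 (u - t, v)) (fun u => A1 (u - t, v)) (fun u => A2 (u - t, v)).
Proof.
move=> hv /andP[ht1 ht2]; have [a1 a2 a3 a4 a5 a6] := ampA hv.
have hb u : x0 - d <= u <= x0 + 2 * d -> x0 - 3 * d <= u - t <= x0 + 3 * d.
  by move=> /andP[? ?]; apply/andP; split; lra.
have der (f : R * R -> R) (u D : R) : is_derive (u - t) 1 (fun u => f (u, v)) D ->
    is_derive u 1 (fun u => f (u - t, v)) D.
  move=> h; have := der_comp (der_sub (der_id u) (der_cst u t)) h.
  by rewrite subr0 mul1r.
split=> u /hb hu; [exact/der/a1|exact/der/a2| |exact: a4|exact: a5|exact: a6].
apply: (@continuous_comp _ _ _ (fun u => u - t) (fun u => A2 (u, v))); last exact: a3.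
exact: der_continuous (der_sub (der_id u) (der_cst u t)).
Qed.

Let K0 : 0 <= K. Proof. by rewrite /K !mulr_ge0. Qed.

Lemma kernel_const_ge0 : 0 <= kernel_const.
Proof.
by rewrite /kernel_const !mulr_ge0// !addr_ge0// ?mulr_ge0 ?sqr_ge0 ?invr_ge0 ?(ltW c0).
Qed.

(** The trivial bound and two integrations by parts together give the minimum of 1 and [M ^- 2],
    with [M] the quantity squared in the statement; twice [1 / (1 + M ^+ 2)] dominates it and has an
    explicit primitive. *)
Lemma kernel_bound :
  `|Int (fun u => bump u * (A0 (u, y) * A0 (u - tau, y + tau) * (A0 (u, y') * A0 (u - tau, y' + tau))
      * cos (delta 0 u)))| <=
  kernel_const * d * (2 * (1 + (c * mu * `|tau| * d * (y' - y)) ^+ 2)^-1).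
Proof.
have ab : x0 - d <= x0 + 2 * d by rewrite lerD2l (@le_trans _ _ 0) ?oppr_le0 ?mulr_ge0// ltW.
have yn v : y0 <= v <= y0 + d -> `|v - y0| <= 3 * d.
  by move=> /andP[? ?]; rewrite ler_norml; apply/andP; split; lra.
have a1 := ampl (yn y yI) zeroI; have a2 := ampl (yn _ ytI) tauI.
have a3 := ampl (yn _ yI') zeroI; have a4 := ampl (yn _ ytI') tauI.
have b4 : 0 <= 4 * BA * BA by rewrite !mulr_ge0.
have bp := amplitude_bump x0 d0.
have aw := amplitude_mul d0 (ler0n _ _) (ler0n _ _) bp bp.
have a12 := amplitude_mul d0 BA0 BA0 a1 a2.
have a34 := amplitude_mul d0 BA0 BA0 a3 a4.
have w40 : 0 <= 4 * 2 * 2 :> R by rewrite !mulr_ge0.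
have w12 : 0 <= 4 * (4 * 2 * 2) * (4 * BA * BA) by rewrite !mulr_ge0.
have ah := amplitude_mul d0 w12 b4 (amplitude_mul d0 w40 b4 aw a12) a34.
move: ah; set h := (fun x => _ * _ * _) : R -> R; set h1 := (fun x => _ + _); set h2 := (fun x => _ + _); rewrite -/K => ah.
have Eh : (fun u => bump u * (A0 (u, y) * A0 (u - tau, y + tau) * (A0 (u, y') * A0 (u - tau, y' + tau)) * cos (delta 0 u))) =
    (fun u => itvind (x0 - d) (x0 + 2 * d) u * (h u * cos (delta 0 u))).
  by apply/funext => u; rewrite /bump /h !subr0; ring.
rewrite Eh; set X := `|_|.
have cc u : x0 - d <= u <= x0 + 2 * d -> {for u, continuous (fun u => h u * cos (delta 0 u))}.
  move=> hu; apply: continuousM; first exact: der_continuous (amp_d ah hu).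
  exact: der_continuous (der_cos (fourth_difference_derive 0 hu)).
have bI := bmeas_itvind_continuous cc.
have len : x0 + 2 * d - (x0 - d) = 3 * d by ring.
have X1 : X <= K * (3 * d).
  rewrite /X -len; apply: Int_bound => //; last first.
    by move=> x; rewrite /itvind => /negbTE ->; rewrite mul0r.
  move=> u; rewrite /itvind; case: (boolP (_ && _)) => [hu|_]; last by rewrite mul0r normr0.
  have Cc : `|cos (delta 0 u)| <= 1 by rewrite ler_norml cos_geN1 cos_le1.
  by rewrite mul1r normrM -[K]mulr1 ler_pM//; exact: amp_u ah u hu.
pose M := c * mu * `|tau| * d * (y' - y).
rewrite -/M; set cB := 1 + 4 * (B / c) + 3 * (B / c) ^+ 2.
have Bc0 : 0 <= B / c by rewrite divr_ge0// ltW.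
have cB1 : 1 <= cB.
  rewrite /cB; have Bc2 : 0 <= (B / c) ^+ 2 by exact: sqr_ge0.
  by move: Bc0 Bc2; set u := B / c; set v := u ^+ 2; lra.
have kE : kernel_const * d = cB * (K * (3 * d)) by rewrite /kernel_const -/cB; ring.
have M2 : 0 <= M ^+ 2 by exact: sqr_ge0.
have K3 : 0 <= K * (3 * d) by rewrite !mulr_ge0// ltW.
have X1' : X <= cB * (K * (3 * d)).
  by apply: (le_trans X1); rewrite -{1}(mul1r (K * _)) ler_wpM2r.
suff : X * (1 + M ^+ 2) <= 2 * (cB * (K * (3 * d))).
  rewrite kE (_ : cB * (K * (3 * d)) * (2 * (1 + M ^+ 2)^-1) = 2 * (cB * (K * (3 * d))) / (1 + M ^+ 2)); last by ring.
  by rewrite ler_pdivlMr// ltr_pwDl.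
suff X2 : X * M ^+ 2 <= cB * (K * (3 * d)) by rewrite mulrDr mulr1 mulr_natl mulr2n lerD.
have [M0|Mn0] := eqVneq M 0; first by rewrite M0 expr0n /= mulr0 mulr_ge0// ltW// (lt_le_trans _ cB1).
have yy' : y' - y != 0 by apply: contra_neq Mn0 => e; rewrite /M e mulr0.
have tn : `|tau| != 0 by apply: contra_neq Mn0 => e; rewrite /M e mulr0 !mul0r.
pose gam := c * mu * `|(y' - y) * tau|.
have n0 : 0 < `|(y' - y) * tau| by rewrite normr_gt0 mulf_neq0// -normr_eq0.
have gam0 : 0 < gam by rewrite /gam !mulr_gt0.
have Mg : M ^+ 2 = (gam * d) ^+ 2.
  rewrite -(real_normK (num_real M)); congr (_ ^+ 2).
  by rewrite /M /gam !normrM normr_id (gtr0_norm c0) (gtr0_norm mu0) (gtr0_norm d0); ring.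
have gl u : x0 - d <= u <= x0 + 2 * d -> gam <= `|delta 1 u|.
  move=> hu; have [z bz ->] := fourth_difference_mvt 0 hu.
  by rewrite normrM /gam mulrC ler_wpM2l//; exact: low.
(* The absolute bound on a higher derivative is turned into a multiple of [|delta 1 u|] by dividing
   by the lower bound [gam]. *)
have gu p u : x0 - d <= u <= x0 + 2 * d -> (forall z, box x0 y0 (3 * d) z -> `|jetP s p 0 z| <= B * mu / d ^+ p) ->
    `|delta p.+1 u| <= B / c * (`|delta 1 u| / d ^+ p).
  move=> hu hp; have [z bz ->] := fourth_difference_mvt p hu.
  rewrite normrM (le_trans (ler_wpM2l (ltW n0) (hp z bz)))//.
  have dp : 0 <= (d ^+ p)^-1 by rewrite invr_ge0 exprn_ge0// ltW.
  have := ler_wpM2r (mulr_ge0 Bc0 dp) (gl u hu).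
  rewrite /gam (_ : c * mu * _ * (B / c / d ^+ p) = `|(y' - y) * tau| * (B * mu / d ^+ p)); last by field; rewrite expf_neq0 ?gt_eqF.
  by rewrite (_ : `|delta 1 u| * (B / c / d ^+ p) = B / c * (`|delta 1 u| / d ^+ p))//; ring.
have va : (x0 - d) - (x0 - d) = 0 by rewrite subrr.
have vb : x0 + 2 * d - (x0 + 2 * d) = 0 by rewrite subrr.
have cont4 u : x0 - d <= u <= x0 + 2 * d -> {for u, continuous (delta 3)}.
  by move=> hu; exact: der_continuous (fourth_difference_derive 3 hu).
have e1 : x0 - d <= x0 - d <= x0 + 2 * d by rewrite lexx.
have e2 : x0 - d <= x0 + 2 * d <= x0 + 2 * d by rewrite lexx andbT.
have := oscillatory_by_parts ab (fun u hu => fourth_difference_derive 0 hu)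
  (fun u hu => fourth_difference_derive 1 hu) (fun u hu => fourth_difference_derive 2 hu)
  (amp_d ah) (amp_d1 ah) cont4 (amp_c ah) _ _ _ _ gam0 d0 Bc0 K0 gl _ _ (amp_u ah) (amp_u1 ah) (amp_u2 ah).
rewrite len -/cB -/X => /(_ _ _ _ _ _ _)-H.
have {}H : X <= cB * K / (gam * d) ^+ 2 * (3 * d).
  apply: H.
  - by rewrite /h va !mul0r.
  - by rewrite /h vb !mulr0 !mul0r.
  - by rewrite /h1 va; ring.
  - by rewrite /h1 vb; ring.
  - by move=> u hu; have := gu 1%N u hu; rewrite expr1; apply; exact: up1.
  - by move=> u hu; have := gu 2 u hu; apply; exact: up2.
rewrite Mg; have g2 : 0 < (gam * d) ^+ 2 by rewrite exprn_gt0// mulr_gt0.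
rewrite -ler_pdivlMr// (le_trans H)// le_eqVlt; apply/orP; left; apply/eqP; ring.
Qed.

End FixedLines.
End KernelEstimate.

(** * The nondegenerate case *)

Section BaseCase.
Context {R : realType}.
Implicit Types f : R -> R.

Definition energy f := Int (fun x => f x ^+ 2).
Definition autocorr f (tau u : R) := f u * f (u - tau).

Lemma energy_ge0 f : 0 <= energy f.
Proof. by apply: Int_ge0 => x; exact: sqr_ge0. Qed.

Lemma bmeas_translate f (tau : R) : bmeas size1 f -> bmeas size1 (fun u => f (u - tau)).
Proof.
move=> bf.
apply: (@bmeas_comp _ _ _ _ _ _ _ f (fun x : R => x - tau) (1 + `|tau|)) => //; first exact: bf.
  by apply: measurable_funB.
move=> x; rewrite /size1; have := ler_normD (x - tau) tau; rewrite subrK.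
have := mulr_ge0 (normr_ge0 tau) (normr_ge0 (x - tau)).
by move: (`|tau|) (`|x - tau|) (`|x|) => a b c; nra.
Qed.

Lemma bmeas_autocorr f tau : bmeas size1 f -> bmeas size1 (autocorr f tau).
Proof. by move=> bf; apply: bmeasM => //; exact: bmeas_translate. Qed.

Lemma bmeas_autocorr2 f : bmeas size1 f -> bmeas size2 (fun z => autocorr f z.1 z.2).
Proof.
move=> bf.
apply: (@bmeas_comp2 _ _ _ _ _ _ _ _ _ _ f f snd (fun z : R * R => z.2 - z.1) 2) => //; [exact: bf|exact: bf| |].
  by apply: measurable_funB; [exact: measurable_snd|exact: measurable_fst].
move=> z; rewrite /size2 /size_prod /size1 /=.
have := ler_normB z.2 (z.2 - z.1); rewrite opprB addrC subrK.
by have := normr_ge0 z.2; have := normr_ge0 (z.2 - z.1); lra.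
Qed.

Lemma bmeas_energy_autocorr f : bmeas size1 f -> bmeas size1 (fun tau => energy (autocorr f tau)).
Proof. by move=> bf; exact: (bmeas_Int_r (bmeasX 1 (bmeas_autocorr2 bf))). Qed.

(** Once the integrals are exchanged, replacing [u - tau] by a new variable separates the two
    factors. *)
Lemma Int_energy_autocorr f : bmeas size1 f ->
  Int (fun tau => energy (autocorr f tau)) = energy f ^+ 2.
Proof.
move=> bf; have bf2 := bmeasX 1 bf.
rewrite /energy (Int_swap (bmeasX 1 (bmeas_autocorr2 bf))) expr2 -IntZr//.
apply: eq_Int => u; rewrite -(Int_reflect u bf2) -IntZ.
  by apply: eq_Int => tau; rewrite /autocorr exprMn.
apply: (@bmeas_comp _ _ _ _ _ _ _ (fun x => f x ^+ 2) (fun x : R => u - x) (1 + `|u|)) => //; first exact: bf2.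
  by apply: measurable_funB.
move=> x; rewrite /size1; have := ler_normB u (u - x); rewrite opprB addrC subrK.
have := mulr_ge0 (normr_ge0 u) (normr_ge0 (u - x)).
by move: (`|u|) (`|u - x|) (`|x|) => a b c; nra.
Qed.

Lemma Int_norm_autocorr_le f tau : bmeas size1 f ->
  Int (fun u => `|autocorr f tau u|) <= energy f.
Proof.
move=> bf; have bf2 := bmeasX 1 bf.
have bt := bmeasX 1 (bmeas_translate tau bf).
apply: (@le_trans _ _ (Int (fun u => 2^-1 * (f u ^+ 2 + f (u - tau) ^+ 2)))).
  apply: le_Int; [exact/bmeas_norm/bmeas_autocorr|exact/bmeasZ/bmeasD|move=> u].
  rewrite /autocorr normrM -(real_normK (num_real (f u))) -(real_normK (num_real (f (u - tau)))).
  by have := sqr_ge0 (`|f u| - `|f (u - tau)|); move: (`|f u|) (`|f _|) => a b; nra.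
rewrite IntZ; last exact: bmeasD.
by rewrite IntD// (Int_shift (- tau) bf2) /energy; lra.
Qed.

(** The best [al] is [b / a]; if [a] or [b] is zero, a suitable [al] refutes [x > 0]. In this form
    Cauchy-Schwarz stays linear in the squares, and no square root has to be integrated or
    summed. *)
Lemma amgm_inf (x a b : R) : 0 <= a -> 0 <= b ->
  (forall al, 0 < al -> x <= 2^-1 * (al * a ^+ 2 + b ^+ 2 / al)) -> x <= a * b.
Proof.
move=> a0 b0 h; have [a_eq0|an0] := eqVneq a 0.
  rewrite a_eq0 mul0r leNgt; apply/negP => x0.
  have al0 : 0 < b ^+ 2 / x + 1 by rewrite ltr_wpDl// divr_ge0 ?sqr_ge0 ?ltW.
  have := h _ al0; rewrite a_eq0 expr0n /= mulr0 add0r => {}h.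
  have : x * (b ^+ 2 / x + 1) <= 2^-1 * b ^+ 2 by rewrite -ler_pdivlMr// -mulrA.
  rewrite mulrDr mulr1 mulrCA divff ?gt_eqF// mulr1.
  by have := sqr_ge0 b; lra.
have ap : 0 < a by rewrite lt_def an0.
have [b_eq0|bn0] := eqVneq b 0.
  rewrite b_eq0 mulr0 leNgt; apply/negP => x0.
  have := h (x / a ^+ 2) _; rewrite b_eq0 expr0n /= mul0r addr0 divfK ?expf_neq0//.
  by rewrite divr_gt0 ?exprn_gt0// => /(_ isT); lra.
have bp : 0 < b by rewrite lt_def bn0.
have := h (b / a) (divr_gt0 bp ap).
by rewrite (_ : _ * (_ + _) = a * b)//; field; rewrite an0 bn0.
Qed.

(** The pointwise companion of [amgm_inf], with the same free parameter [al]. *)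
Lemma le_sum_of_sqr_le_mul (x D e g al : R) : 0 <= D -> 0 <= e -> 0 <= g -> 0 < al ->
  x ^+ 2 <= D ^+ 2 * (e * g) -> x <= D * (2^-1 * (al * e + g / al)).
Proof.
move=> D0 e0 g0 al0 h; have s0 : 0 <= 2^-1 * (al * e + g / al).
  have al1 := ltW al0; apply: mulr_ge0; rewrite ?invr_ge0//.
  by apply: addr_ge0; [exact: mulr_ge0|exact: divr_ge0].
have [x0|x0] := leP x 0.
  by apply: (le_trans x0); rewrite mulr_ge0.
rewrite -ler_sqr ?nnegrE; [apply: (le_trans h)|exact: ltW|exact: mulr_ge0].
rewrite exprMn ler_wpM2l ?sqr_ge0//.
have := sqr_ge0 (al * e - g / al).
rewrite (_ : e * g = (al * e) * (g / al)); last by field; rewrite gt_eqF.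
by move: (al * e) (g / al) => p q; nra.
Qed.

Variables (x0 y0 d : R) (s : nat -> nat -> R * R -> R) (S A0 A1 A2 : R * R -> R).
Variables (B c mu BA kappa : R).
Hypotheses (d0 : 0 < d) (c0 : 0 < c) (mu0 : 0 < mu) (B0 : 0 <= B) (BA0 : 0 <= BA).
Hypothesis js : jet (box x0 y0 (3 * d)) s.
Hypothesis mS : measurable_fun setT S.
Hypothesis Ss : forall z, box x0 y0 (3 * d) z -> S z = s 0 0 z.
Hypothesis low : forall z, box x0 y0 (3 * d) z -> c * mu <= `|jetP s 0 0 z|.
Hypothesis up1 : forall z, box x0 y0 (3 * d) z -> `|jetP s 1 0 z| <= B * mu / d.
Hypothesis up2 : forall z, box x0 y0 (3 * d) z -> `|jetP s 2 0 z| <= B * mu / d ^+ 2.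
Hypothesis bA : bmeasurable A0.
Hypothesis ampA : forall y, `|y - y0| <= 3 * d ->
  amplitude (x0 - 3 * d) (x0 + 3 * d) d BA (fun u => A0 (u, y)) (fun u => A1 (u, y)) (fun u => A2 (u, y)).
Hypotheses (kap0 : 0 < kappa) (kapmu : 1 <= kappa ^+ 6 * mu * d ^+ 3).
Variables (f1 f2 f3 : R -> R).
Hypotheses (b1 : bmeas size1 f1) (b2 : bmeas size1 f2) (b3 : bmeas size1 f3).
Hypothesis supp1 : forall u, f1 u != 0 -> x0 <= u <= x0 + d.
Hypothesis supp2 : forall y, f2 y != 0 -> y0 <= y <= y0 + d.

Let kc := kernel_const B c BA.
(** [8 = 4 * 2]: the 4 of [Int_cauchy_kernel_le] and the 2 of [kernel_bound]. *)
Let C4 := 8 * kc / c.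
(** The first term pays for the short shifts, an interval of length [2 * (d * kappa ^+ 2)] with the
    trivial bound; the second pays for the long shifts. *)
Definition base_const := 2 * BA ^+ 2 + (1 + C4).

Let kc0 : 0 <= kc. Proof. exact: kernel_const_ge0. Qed.
Let C40 : 0 <= C4. Proof. by apply: divr_ge0; [rewrite mulr_ge0|exact: ltW]. Qed.

Let inQ u y : x0 <= u <= x0 + d -> y0 <= y <= y0 + d -> box x0 y0 (3 * d) (u, y).
Proof. by move=> /andP[? ?] /andP[? ?]; split; rewrite /= ler_norml; apply/andP; split; lra. Qed.

Let Abound z : box x0 y0 (3 * d) z -> `|A0 z| <= BA.
Proof.
case: z => u y [/= hu hy]; apply: (amp_u (ampA hy)).
by move: hu; rewrite ler_norml => /andP[? ?]; apply/andP; split; lra.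
Qed.

Let mSc : bmeasurable (fun z => cos (S z)).
Proof.
split; first by apply: measurableT_comp => //; apply: continuous_measurable_fun; exact: continuous_cos.
by exists 1 => z; rewrite ler_norml cos_geN1 cos_le1.
Qed.

Let mSs : bmeasurable (fun z => sin (S z)).
Proof.
split; first by apply: measurableT_comp => //; apply: continuous_measurable_fun; exact: continuous_sin.
by exists 1 => z; rewrite ler_norml sin_geN1 sin_le1.
Qed.

Let b12 : bmeas size2 (fun z => f1 z.1 * f2 z.2).
Proof.
apply: (@bmeas_comp2 _ _ _ _ _ _ _ _ _ _ f1 f2 fst snd 1) => //; [exact: b1|exact: b2|].
by move=> z; rewrite /size2 /size_prod /size1; lra.
Qed.

Let Kc z := f1 z.1 * f2 z.2 * (cos (S z) * A0 z).
Let Ks z := f1 z.1 * f2 z.2 * (sin (S z) * A0 z).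
Let bKc : bmeas size2 Kc. Proof. by apply: bmeasMl => //; exact: bmeasurableM. Qed.
Let bKs : bmeas size2 Ks. Proof. by apply: bmeasMl => //; exact: bmeasurableM. Qed.

Section FixedTau.
Variable tau : R.
Let F := autocorr f1 tau.
Let G := autocorr f2 (- tau).
Let sh (z : R * R) := (z.1 - tau, z.2 + tau).
Let B1 z := A0 z * A0 (sh z) * cos (S z - S (sh z)).
Let B2 z := A0 z * A0 (sh z) * sin (S z - S (sh z)).

Let msh : measurable_fun setT sh.
Proof.
apply: measurable_fun_pair; first by apply: measurable_funB => //; exact: measurable_fst.
by apply: measurable_funD => //; exact: measurable_snd.
Qed.

Let mdS : measurable_fun setT (fun z => S z - S (sh z)).
Proof. by apply: measurable_funB => //; apply: measurableT_comp. Qed.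

Let bAA : bmeasurable (fun z => A0 z * A0 (sh z)).
Proof. by apply: bmeasurableM => //; apply: bmeasurable_comp. Qed.

Let bB1 : bmeasurable B1.
Proof.
apply: bmeasurableM => //; split.
  by apply: measurableT_comp => //; apply: continuous_measurable_fun; exact: continuous_cos.
by exists 1 => z; rewrite ler_norml cos_geN1 cos_le1.
Qed.

Let bB2 : bmeasurable B2.
Proof.
apply: bmeasurableM => //; split.
  by apply: measurableT_comp => //; apply: continuous_measurable_fun; exact: continuous_sin.
by exists 1 => z; rewrite ler_norml sin_geN1 sin_le1.
Qed.

Let bF : bmeas size1 F. Proof. exact: bmeas_autocorr. Qed.
Let bG : bmeas size1 G. Proof. exact: bmeas_autocorr. Qed.

Let suppF u : F u != 0 -> (x0 <= u <= x0 + d) /\ (x0 <= u - tau <= x0 + d).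
Proof. by rewrite /F /autocorr mulf_eq0 negb_or => /andP[/supp1 ? /supp1 ?]. Qed.

Let suppG y : G y != 0 -> (y0 <= y <= y0 + d) /\ (y0 <= y + tau <= y0 + d).
Proof. by rewrite /G /autocorr opprK mulf_eq0 negb_or => /andP[/supp2 ? /supp2 ?]. Qed.

(** The contribution of one shift. Sine and cosine kernels are added so that the phase is the
    difference [S z - S (sh z)]. *)
Definition tau_form := Int (fun u => Int (fun y =>
  Kc (u, y) * Kc (u - tau, y + tau) + Ks (u, y) * Ks (u - tau, y + tau))).

Let tau_formE : tau_form = Int (fun u => F u * Int (fun y => G y * B1 (u, y))).
Proof.
apply: eq_Int => u; rewrite -IntZ.
  apply: eq_Int => y; rewrite /F /G /B1 /Kc /Ks /sh /autocorr /= cosB opprK; ring.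
by apply: bmeasMl => //; apply: bmeasurable_comp.
Qed.

Lemma tau_form_trivial : `|tau_form| <= BA ^+ 2 * (energy f1 * energy f2).
Proof.
have bFG : bmeas size2 (fun z => F z.1 * (G z.2 * B1 z)).
  have bFG' : bmeas size2 (fun z => F z.1 * G z.2).
    apply: (@bmeas_comp2 _ _ _ _ _ _ _ _ _ _ F G fst snd 1) => //; [exact: bF|exact: bG|].
    by move=> z; rewrite /size2 /size_prod /size1; lra.
  by under eq_fun do rewrite mulrA; exact: bmeasMl.
have bGB u : bmeas size1 (fun y => G y * B1 (u, y)).
  by apply: bmeasMl => //; apply: bmeasurable_comp => //; apply: measurable_fun_pair.
rewrite tau_formE.
have -> : Int (fun u => F u * Int (fun y => G y * B1 (u, y))) = Int (fun u => Int (fun y => F u * (G y * B1 (u, y)))).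
  by apply: eq_Int => u; rewrite IntZ.
have bn := bmeas_Int_r bFG.
apply: (le_trans (norm_Int bn)).
apply: (@le_trans _ _ (Int (fun u => `|F u| * (BA ^+ 2 * energy f2)))).
  apply: le_Int; [exact: bmeas_norm|by apply: bmeasMl; [exact: bmeas_norm|exact: bmeasurable_cst]|].
  move=> u; rewrite /= IntZ// normrM.
  have [->|Fu] := eqVneq (F u) 0; first by rewrite normr0 !mul0r.
  rewrite ler_wpM2l//; apply: (le_trans (norm_Int (bGB u))).
  apply: (@le_trans _ _ (Int (fun y => BA ^+ 2 * `|G y|))).
    apply: le_Int; [exact: bmeas_norm|exact/bmeasZ/bmeas_norm|move=> y].
    have [->|Gy] := eqVneq (G y) 0; first by rewrite mul0r normr0 mulr0.
    rewrite normrM mulrC ler_wpM2r//.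
    have [Fu1 Fu2] := suppF Fu; have [Gy1 Gy2] := suppG Gy.
    rewrite /B1 normrM -[leRHS]mulr1; apply: ler_pM => //.
      by rewrite normrM expr2 ler_pM//; apply: Abound; exact: inQ.
    by rewrite ler_norml cos_geN1 cos_le1.
  rewrite IntZ; last exact: bmeas_norm.
  by rewrite ler_wpM2l ?sqr_ge0//; exact: Int_norm_autocorr_le.
rewrite IntZr; last exact: bmeas_norm.
rewrite [leRHS]mulrCA ler_wpM2r ?mulr_ge0 ?sqr_ge0 ?energy_ge0//.
exact: Int_norm_autocorr_le.
Qed.

(** Put [t = d * kappa ^+ 2]. The kernel has mass at most [C4 / (mu * |tau|)], and [kapmu] says
    [mu * t ^+ 3 >= 1], so for [|tau| >= t] this mass is at most [C4 * t ^+ 2]. *)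
Lemma tau_form_sqr_le : d * kappa ^+ 2 <= `|tau| ->
  tau_form ^+ 2 <= ((1 + C4) * (d * kappa ^+ 2)) ^+ 2 * (energy F * energy G).
Proof.
move=> tl.
have k20 : 0 < d * kappa ^+ 2 by rewrite mulr_gt0// exprn_gt0.
have [td|td] := leP `|tau| d; last first.
  (* A shift longer than [d] moves the support of [f1] off itself. *)
  have -> : tau_form = 0.
    rewrite tau_formE -[RHS]Int0; apply: eq_Int => u.
    have [->|Fu] := eqVneq (F u) 0; first by rewrite mul0r.
    have [/andP[? ?] /andP[? ?]] := suppF Fu.
    have : `|tau| <= d by rewrite ler_norml; apply/andP; split; lra.
    by rewrite leNgt td.
  by rewrite expr0n /= mulr_ge0 ?sqr_ge0// mulr_ge0// energy_ge0.
have tp : 0 < `|tau| by exact: lt_le_trans k20 tl.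
rewrite tau_formE.
pose M := c * mu * `|tau| * d.
have M0 : 0 < M by rewrite /M !mulr_gt0.
pose kap sg := itvind (- d) d sg * (1 + (M * sg) ^+ 2)^-1 * (kc * d * 2).
have cden (x : R) : {for x, continuous (fun sg => (1 + (M * sg) ^+ 2)^-1)}.
  rewrite (_ : (fun y => _) = (fun y => (1 + (M * y + 0) * (M * y + 0))^-1)).
    have nz : 1 + (M * x + 0) * (M * x + 0) != 0 by rewrite gt_eqF// ltr_pwDl// -expr2 sqr_ge0.
    exact: (der_continuous (der_inv (f := fun y => 1 + (M * y + 0) * (M * y + 0)) nz
      (der_add (der_cst x 1) (der_mul (der_affine M 0 x) (der_affine M 0 x))))).
  by apply/funext => y; rewrite addr0 expr2.
have bk0 : bmeas size1 (fun sg => itvind (- d) d sg * (1 + (M * sg) ^+ 2)^-1).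
  by apply: bmeas_itvind_continuous.
have bkap : bmeas size1 kap by apply: bmeasMl => //; exact: bmeasurable_cst.
have kap_ge0 x : 0 <= kap x.
  rewrite /kap; have dd := ltW d0; apply: mulr_ge0; last first.
    by apply: mulr_ge0 => //; apply: mulr_ge0.
  by apply: mulr_ge0; [exact: itvind_ge0|rewrite invr_ge0 addr_ge0 ?sqr_ge0].
have bb : bmeas size1 (bump x0 d).
  apply: bmeas_itvind_continuous => x xab.
  have aw := amplitude_mul d0 (ler0n _ _) (ler0n _ _) (amplitude_bump x0 d0) (amplitude_bump x0 d0).
  have := der_continuous (amp_d aw xab); congr {for x, continuous _}.
have bump0 u : 0 <= bump x0 d u by rewrite /bump mulr_ge0 ?itvind_ge0 ?sqr_ge0.
have bump1 u : F u != 0 -> 1 <= bump x0 d u.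
  move=> /suppF [/andP[u1 u2] _]; rewrite /bump /itvind.
  have -> : (x0 - d <= u) && (u <= x0 + 2 * d) by apply/andP; split; lra.
  rewrite mul1r -[1](expr1n _ 2) ler_sqr ?nnegrE//; last first.
    by rewrite divr_ge0 ?mulr_ge0 ?sqr_ge0//; lra.
  rewrite ler_pdivlMr ?mulr_gt0 ?exprn_gt0// mul1r expr2.
  by have := mulr_ge0 (_ : 0 <= u - x0) (_ : 0 <= x0 + d - u); rewrite !subr_ge0 u1 u2 => /(_ isT isT); nra.
have ker y y' : G y != 0 -> G y' != 0 ->
    `|Int (fun u => bump x0 d u * (B1 (u, y) * B1 (u, y') + B2 (u, y) * B2 (u, y')))| <= kap (y' - y).
  move=> /suppG [yI ytI] /suppG [yI' ytI'].
  have := kernel_bound d0 c0 mu0 B0 BA0 js low up1 up2 ampA td yI yI' ytI ytI'.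
  set J1 := Int _; set J2 := Int _ => h.
  (* On the support of the bump all four points lie in the box, where [S] is [s 0 0]; the sum of
     products is then the cosine of the fourth difference. *)
  have -> : J2 = J1.
    apply: eq_Int => u; rewrite /bump /itvind.
    case: (boolP (_ && _)) => [/andP[u1 u2]|_]; last by rewrite !mul0r.
    move: yI yI' ytI ytI' td; rewrite ler_norml => /andP[? ?] /andP[? ?] /andP[? ?] /andP[? ?] /andP[? ?].
    have inb v t : x0 - 3 * d <= v <= x0 + 3 * d -> y0 <= t <= y0 + d -> box x0 y0 (3 * d) (v, t).
      by move=> /andP[? ?] /andP[? ?]; split; rewrite /= ler_norml; apply/andP; split; lra.
    rewrite /B1 /B2 /sh /= /fourth_difference !Ss; try by apply: inb; apply/andP; split; lra.
    move: (s 0 0 (u, y)) (s 0 0 (u, y')) (s 0 0 (u - tau, y + tau)) (s 0 0 (u - tau, y' + tau)) => p1 p2 p3 p4.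
    rewrite (_ : p2 - p4 - (p1 - p3) = - ((p1 - p3) - (p2 - p4))); last by ring.
    by move: (p1 - p3) (p2 - p4) => al be; rewrite cosN cosB; ring.
  apply: (le_trans h); rewrite /kap /itvind.
  have -> : (- d <= y' - y) && (y' - y <= d).
    by move: yI yI' => /andP[? ?] /andP[? ?]; apply/andP; split; lra.
  by rewrite /M /kc mul1r le_eqVlt; apply/orP; left; apply/eqP; ring.
have := bilinear_sqr_le bF bG bb bB1 bB2 bkap bump0 bump1 kap_ge0 ker.
move=> h; apply: (le_trans h).
have eF := energy_ge0 F; have eG := energy_ge0 G.
rewrite -/(energy F) -/(energy G) mulrCA ler_wpM2r ?mulr_ge0//.
have -> : Int kap = Int (fun sg => itvind (- d) d sg * (1 + (M * sg) ^+ 2)^-1) * (kc * d * 2) by rewrite IntZr.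
have hk : 0 <= kc * d * 2.
  by have dd := ltW d0; apply: mulr_ge0 => //; apply: mulr_ge0.
apply: (le_trans (ler_wpM2r hk (Int_cauchy_kernel_le M0 (ltW d0)))).
have -> : 4 / M * (kc * d * 2) = C4 / (mu * `|tau|).
  by rewrite /M /C4; field; rewrite ?gt_eqF.
have q1 : (mu * `|tau|)^-1 <= (d * kappa ^+ 2) ^+ 2.
  rewrite -[leRHS]mul1r -ler_pdivrMr ?exprn_gt0// -invfM invf_le1 ?mulr_gt0 ?exprn_gt0//.
  apply: (le_trans kapmu).
  rewrite (_ : kappa ^+ 6 * mu * d ^+ 3 = mu * (d * kappa ^+ 2) * (d * kappa ^+ 2) ^+ 2); last by ring.
  by rewrite ler_wpM2r ?sqr_ge0// ler_wpM2l// ltW.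
rewrite exprMn; apply: (le_trans (ler_wpM2l C40 q1)).
by rewrite ler_wpM2r ?sqr_ge0//; have := C40; have := sqr_ge0 C4; nra.
Qed.

End FixedTau.

(** The square is an integral over shifts. Those below [d * kappa ^+ 2] are bounded trivially and
    the others by oscillation; this threshold balances the two bounds when [kapmu] is an
    equality. *)
Lemma base_case :
  Int (fun x => Int (fun y => cos (S (x, y)) * A0 (x, y) * (f1 x * f2 y * f3 (x + y)))) ^+ 2 <=
  base_const * (d * kappa ^+ 2) * (energy f1 * energy f2 * energy f3).
Proof.
have k20 : 0 < d * kappa ^+ 2 by rewrite mulr_gt0// exprn_gt0.
have -> : Int (fun x => Int (fun y => cos (S (x, y)) * A0 (x, y) * (f1 x * f2 y * f3 (x + y)))) =
   Int (fun x => Int (fun y => Kc (x, y) * f3 (x + y))).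
  by apply: eq_Int => x; apply: eq_Int => y; rewrite /Kc /=; ring.
apply: (le_trans (pairing_sqr_le bKc b3)).
rewrite -/(energy f3) [leRHS]mulrA [leRHS]mulrC ler_wpM2l ?energy_ge0//.
have e1 := energy_ge0 f1; have e2 := energy_ge0 f2.
(* The sine part is an integral of squares, so it may be added at no cost. *)
set Tc := Int _; pose Ts := Int (fun t => Int (fun u => Ks (u, t - u)) ^+ 2).
have Ts0 : 0 <= Ts by apply: Int_ge0 => t; exact: sqr_ge0.
have btau : bmeas size2 (fun z => Int (fun y => Kc (z.2, y) * Kc (z.2 - z.1, y + z.1) + Ks (z.2, y) * Ks (z.2 - z.1, y + z.1))).
  by have := bmeas_Int size2_ge0 (bmeasD (bmeas_correlation_sheared bKc) (bmeas_correlation_sheared bKs)).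
have bform : bmeas size1 tau_form := bmeas_Int_r btau.
have ET : Tc + Ts = Int tau_form.
  rewrite /Tc /Ts (correlation bKc) (correlation bKs).
  have i2 (K : R * R -> R) : bmeas size2 K ->
      bmeas size2 (fun z : R * R => Int (fun y => K (z.2, y) * K (z.2 - z.1, y + z.1))).
    by move=> bK; have := bmeas3_Int_c (bmeas_correlation_sheared bK).
  rewrite -IntD; [|exact: (bmeas_Int_r (i2 _ bKc))|exact: (bmeas_Int_r (i2 _ bKs))].
  apply: eq_Int => tau; rewrite /tau_form /= -IntD;
    [|exact: (bmeas_section_r tau (i2 _ bKc))|exact: (bmeas_section_r tau (i2 _ bKs))].
  apply: eq_Int => u; rewrite -IntD//.
    exact: (bmeas_section_r u (bmeas3_section1 (bmeas_correlation_sheared bKc) tau)).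
  exact: (bmeas_section_r u (bmeas3_section1 (bmeas_correlation_sheared bKs) tau)).
apply: (@le_trans _ _ (Int tau_form)); first by rewrite -ET lerDl.
set t0 := d * kappa ^+ 2 in k20 *.
have C41 : 0 <= (1 + C4) * t0 by rewrite mulr_ge0 ?addr_ge0// ltW.
suff main : Int tau_form - BA ^+ 2 * (energy f1 * energy f2) * (2 * t0) <= (1 + C4) * t0 * (energy f1 * energy f2).
  by move: main; rewrite lerBlDr => /le_trans; apply; rewrite /base_const; lra.
have C41p : 0 < (1 + C4) * t0 by rewrite mulr_gt0// ltr_pwDl.
(* For long shifts the bound is a geometric mean of the two energies; with [al] fixed it becomes
   linear in them, and their integrals over [tau] are known. *)
rewrite -ler_pdivrMl//; apply: amgm_inf => // al al0.
rewrite ler_pdivrMl// lerBlDr.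
have be1 := bmeas_energy_autocorr b1.
have be2 : bmeas size1 (fun tau => energy (autocorr f2 (- tau))).
  apply: (@bmeas_comp _ _ _ _ _ _ _ (fun tau => energy (autocorr f2 tau)) (fun x : R => - x) 1) => //; first exact: (bmeas_energy_autocorr b2).
    exact: measurable_funN.
  by move=> x; rewrite /size1 normrN mul1r lerDr.
have I2 : Int (fun tau => energy (autocorr f2 (- tau))) = energy f2 ^+ 2.
  rewrite -(Int_energy_autocorr b2) -(Int_reflect 0 (bmeas_energy_autocorr b2)).
  by apply: eq_Int => x; rewrite sub0r.
have bsum : bmeas size1 (fun tau => al * energy (autocorr f1 tau) + al^-1 * energy (autocorr f2 (- tau))).
  by apply: bmeasD; apply: bmeasZ.
have -> : (1 + C4) * t0 * (2^-1 * (al * energy f1 ^+ 2 + energy f2 ^+ 2 / al)) + BA ^+ 2 * (energy f1 * energy f2) * (2 * t0) =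
   Int (fun tau => (1 + C4) * t0 * 2^-1 * (al * energy (autocorr f1 tau) + al^-1 * energy (autocorr f2 (- tau)))
      + BA ^+ 2 * (energy f1 * energy f2) * itvind (- t0) t0 tau).
  rewrite IntD; [|exact: bmeasZ|exact/bmeasZ/bmeas_itvind].
  rewrite !IntZ//; last exact: bmeas_itvind.
  rewrite IntD; [|exact: bmeasZ|exact: bmeasZ].
  rewrite !IntZ// I2 (Int_energy_autocorr b1) Int_itvind; last by lra.
  by ring.
apply: le_Int => //.
  by apply: bmeasD; [exact: bmeasZ|exact/bmeasZ/bmeas_itvind].
move=> tau; have eF := energy_ge0 (autocorr f1 tau); have eG := energy_ge0 (autocorr f2 (- tau)).
have s0 : 0 <= (1 + C4) * t0 * 2^-1 * (al * energy (autocorr f1 tau) + al^-1 * energy (autocorr f2 (- tau))).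
  have al1 := ltW al0; apply: mulr_ge0; first by apply: mulr_ge0; rewrite ?invr_ge0.
  by apply: addr_ge0; apply: mulr_ge0; rewrite ?invr_ge0.
have [tl|tl] := leP t0 `|tau|.
  apply: (@le_trans _ _ ((1 + C4) * t0 * (2^-1 * (al * energy (autocorr f1 tau) + energy (autocorr f2 (- tau)) / al)))).
    by apply: le_sum_of_sqr_le_mul => //; exact: tau_form_sqr_le.
  rewrite [X in X <= _](_ : _ = (1 + C4) * t0 * 2^-1 * (al * energy (autocorr f1 tau) + al^-1 * energy (autocorr f2 (- tau)))); last by ring.
  rewrite lerDl; apply: mulr_ge0; last exact: itvind_ge0.
  by apply: mulr_ge0; [exact: sqr_ge0|exact: mulr_ge0].
rewrite ler_wpDl// (le_trans (ler_norm _))// (le_trans (tau_form_trivial tau))//.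
rewrite /itvind; have -> : (- t0 <= tau) && (tau <= t0) by rewrite -ler_norml ltW.
by rewrite mulr1.
Qed.

End BaseCase.

(** * The trilinear form *)

Section TrilinearForm.
Context {R : realType}.
Implicit Types (f : R -> R) (S A : R * R -> R).

Definition nrm f := Num.sqrt (energy f).

Lemma nrm_ge0 f : 0 <= nrm f. Proof. exact: sqrtr_ge0. Qed.

Lemma nrm_sqr f : nrm f ^+ 2 = energy f.
Proof. by rewrite sqr_sqrtr// energy_ge0. Qed.

Definition Tri S A f1 f2 f3 := Int (fun x => Int (fun y =>
  cos (S (x, y)) * A (x, y) * (f1 x * f2 y * f3 (x + y)))).

Lemma measurable_comp_continuous d (T : measurableType d) (g : R -> R) (h : T -> R) :
  continuous g -> measurable_fun setT h -> measurable_fun setT (fun t => g (h t)).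
Proof.
by move=> cg mh; apply: measurableT_comp => //; exact: continuous_measurable_fun.
Qed.

Lemma bmeasurable_cos d (T : measurableType d) (h : T -> R) :
  measurable_fun setT h -> bmeasurable (fun t => cos (h t)).
Proof.
move=> mh; split; first by apply: measurable_comp_continuous => //; exact: continuous_cos.
by exists 1 => t; rewrite ler_norml cos_geN1 cos_le1.
Qed.

Section Integrand.
Variables (S A : R * R -> R).
Hypotheses (mS : measurable_fun setT S) (bA : bmeasurable A).

Lemma bmeas_prod f1 f2 : bmeas size1 f1 -> bmeas size1 f2 ->
  bmeas size2 (fun z => f1 z.1 * f2 z.2).
Proof.
move=> b1 b2.
apply: (@bmeas_comp2 _ _ _ _ _ _ _ _ _ _ f1 f2 fst snd 1) => //; [exact: b1|exact: b2|].
by move=> z; rewrite /size2 /size_prod /size1; lra.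
Qed.

Lemma bmeas_Tri f1 f2 f3 : bmeas size1 f1 -> bmeas size1 f2 -> bmeas size1 f3 ->
  bmeas size2 (fun z => cos (S z) * A z * (f1 z.1 * f2 z.2 * f3 (z.1 + z.2))).
Proof.
move=> b1 b2 b3; apply: bmeasMr.
  by apply: bmeasurableM => //; exact: bmeasurable_cos.
apply: bmeasMl; first exact: bmeas_prod.
apply: (bmeasurable_comp (bmeas_bmeasurable b3)).
by apply: measurable_funD; [exact: measurable_fst|exact: measurable_snd].
Qed.

Lemma TriE f1 f2 f3 : bmeas size1 f1 -> bmeas size1 f2 -> bmeas size1 f3 ->
  Tri S A f1 f2 f3 = Int2 (fun z => cos (S z) * A z * (f1 z.1 * f2 z.2 * f3 (z.1 + z.2))).
Proof. by move=> b1 b2 b3; rewrite Int2E//; exact: bmeas_Tri. Qed.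

Lemma Tri_add1 f f' f2 f3 : bmeas size1 f -> bmeas size1 f' -> bmeas size1 f2 ->
  bmeas size1 f3 -> Tri S A (fun x => f x + f' x) f2 f3 = Tri S A f f2 f3 + Tri S A f' f2 f3.
Proof.
move=> b b' b2 b3; have B := bmeas_Tri b b2 b3; have B' := bmeas_Tri b' b2 b3.
rewrite /Tri -IntD; [|exact: (bmeas_Int_r B)|exact: (bmeas_Int_r B')].
apply: eq_Int => x; rewrite -IntD; [|exact: (bmeas_section_r x B)|exact: (bmeas_section_r x B')].
by apply: eq_Int => y /=; ring.
Qed.

Lemma Tri_add2 f1 f f' f3 : bmeas size1 f1 -> bmeas size1 f -> bmeas size1 f' ->
  bmeas size1 f3 -> Tri S A f1 (fun x => f x + f' x) f3 = Tri S A f1 f f3 + Tri S A f1 f' f3.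
Proof.
move=> b1 b b' b3; have B := bmeas_Tri b1 b b3; have B' := bmeas_Tri b1 b' b3.
rewrite /Tri -IntD; [|exact: (bmeas_Int_r B)|exact: (bmeas_Int_r B')].
apply: eq_Int => x; rewrite -IntD; [|exact: (bmeas_section_r x B)|exact: (bmeas_section_r x B')].
by apply: eq_Int => y /=; ring.
Qed.

(** Cauchy-Schwarz in [x + y], then in [u] over the support of [f1], whose length gives [sqrt d]. No
    oscillation is used. *)
Lemma Tri_trivial x0 d BA f1 f2 f3 : 0 <= d -> 0 <= BA ->
  bmeas size1 f1 -> bmeas size1 f2 -> bmeas size1 f3 ->
  (forall x, f1 x != 0 -> x0 <= x <= x0 + d) ->
  (forall x y, f1 x != 0 -> f2 y != 0 -> `|A (x, y)| <= BA) ->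
  `|Tri S A f1 f2 f3| <= BA * Num.sqrt d * (nrm f1 * nrm f2 * nrm f3).
Proof.
move=> d0 BA0 b1 b2 b3 s1 hA.
pose K z := f1 z.1 * f2 z.2 * (cos (S z) * A z).
have bK : bmeas size2 K.
  by apply: bmeasMl; [exact: bmeas_prod|apply: bmeasurableM => //; exact: bmeasurable_cos].
have -> : Tri S A f1 f2 f3 = Int (fun x => Int (fun y => K (x, y) * f3 (x + y))).
  by apply: eq_Int => x; apply: eq_Int => y; rewrite /K /=; ring.
have bsk := bmeas_skew bK.
have sq z : K z ^+ 2 <= BA ^+ 2 * (f1 z.1 ^+ 2 * f2 z.2 ^+ 2).
  have [f10|f1n] := eqVneq (f1 z.1) 0; first by rewrite /K f10 !mul0r expr0n /= mul0r mulr0.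
  have [f20|f2n] := eqVneq (f2 z.2) 0; first by rewrite /K f20 mulr0 mul0r expr0n /= !mulr0.
  have -> : K z ^+ 2 = (cos (S z) * A z) ^+ 2 * (f1 z.1 ^+ 2 * f2 z.2 ^+ 2) by rewrite /K; ring.
  apply: ler_wpM2r; first by apply: mulr_ge0; exact: sqr_ge0.
  rewrite -[X in X <= _](real_normK (num_real (cos (S z) * A z))) ler_sqr ?nnegrE// normrM -(mul1r BA) ler_pM//.
    by rewrite ler_norml cos_geN1 cos_le1.
  by rewrite [z in A z]surjective_pairing; exact: hA.
have b12 := bmeas_prod (bmeasX 1 b1) (bmeasX 1 b2).
have bs12 := bmeas_skew b12.
have step : Int (fun t => Int (fun u => K (u, t - u)) ^+ 2) <=
    d * BA ^+ 2 * (energy f1 * energy f2).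
  apply: (@le_trans _ _ (Int (fun t => d * BA ^+ 2 * Int (fun u => f1 u ^+ 2 * f2 (t - u) ^+ 2)))).
    apply: le_Int; [exact: (bmeasX 1 (bmeas_Int_r bsk))|exact/bmeasZ/(bmeas_Int_r bs12)|move=> t].
    have bKt := bmeas_section_r t bsk.
    have -> : Int (fun u => K (u, t - u)) = Int (fun u => itvind x0 (x0 + d) u * K (u, t - u)).
      apply: eq_Int => u; rewrite /itvind; case: (boolP (_ && _)) => [_|hu]; first by rewrite mul1r.
      rewrite mul0r /K /=; suff -> : f1 u = 0 by rewrite !mul0r.
      by apply/eqP; apply: contraNT hu; exact: s1.
    apply: (le_trans (Int_CS (bmeas_itvind _ _) bKt)).
    have -> : Int (fun x => itvind x0 (x0 + d) x ^+ 2) = d.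
      rewrite -[RHS](addrK x0) [d + x0]addrC -(Int_itvind (_ : x0 <= x0 + d)) ?lerDl//.
      by apply: eq_Int => x; rewrite /itvind; case: (_ && _); rewrite ?expr1n ?expr0n.
    rewrite -mulrA ler_wpM2l// -IntZ; last exact: (bmeas_section_r t bs12).
    apply: le_Int; [exact: (bmeasX 1 bKt)|exact/bmeasZ/(bmeas_section_r t bs12)|move=> u].
    exact: (sq (u, t - u)).
  rewrite IntZ; last exact: (bmeas_Int_r bs12).
  apply: ler_wpM2l; first by rewrite mulr_ge0 ?sqr_ge0.
  rewrite (Int_swap bs12) /= /energy -IntZr; last exact: (bmeasX 1 b1).
  apply: le_Int.
  - exact: (bmeas_Int_l bs12).
  - by apply: bmeasMl; [exact: (bmeasX 1 b1)|exact: bmeasurable_cst].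
  move=> u; rewrite IntZ; last exact: (bmeas_translate u (bmeasX 1 b2)).
  by rewrite (Int_shift (- u) (bmeasX 1 b2)).
have main := pairing_sqr_le bK b3.
have {}main : Int (fun x => Int (fun y => K (x, y) * f3 (x + y))) ^+ 2 <=
   (BA * Num.sqrt d * (nrm f1 * nrm f2 * nrm f3)) ^+ 2.
  apply: (le_trans main); rewrite -/(energy f3).
  apply: (le_trans (ler_wpM2l (energy_ge0 f3) step)).
  by rewrite !exprMn sqr_sqrtr// !nrm_sqr le_eqVlt; apply/orP; left; apply/eqP; ring.
have r0 : 0 <= BA * Num.sqrt d * (nrm f1 * nrm f2 * nrm f3).
  by rewrite !mulr_ge0// ?nrm_ge0 ?sqrtr_ge0.
by rewrite -ler_sqr ?nnegrE// real_normK ?num_real.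
Qed.

End Integrand.

(** Half-open, so that neighbouring intervals are disjoint and energies of the pieces add up
    exactly. *)
Definition hind (a b x : R) : R := ((a <= x) && (x < b))%:R.

Lemma bmeasurable_hind a b : bmeasurable (hind a b).
Proof.
split.
  apply: measurable_bool_natr; apply: measurable_and.
    by apply: measurable_fun_ler.
  by apply: measurable_fun_ltr.
by exists 1 => x; rewrite /hind; case: (_ && _); rewrite ?normr0 ?normr1.
Qed.

Definition cut f a b x := hind a b x * f x.

Lemma bmeas_cut f a b : bmeas size1 f -> bmeas size1 (cut f a b).
Proof. by move=> bf; apply: bmeasMr => //; exact: bmeasurable_hind. Qed.

Lemma cut_neq0 f a b x : cut f a b x != 0 -> (a <= x < b) /\ f x != 0.
Proof.
rewrite /cut /hind mulf_eq0 negb_or => /andP[+ ->].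
by case: (boolP (_ && _)) => [//|_]; rewrite eqxx.
Qed.

Lemma cut_split f a m b : a <= m <= b -> cut f a b = (fun x => cut f a m x + cut f m b x).
Proof.
move=> /andP[am mb]; apply/funext => x; rewrite /cut /hind -mulrDl; congr (_ * _).
have [xm|mx] := ltP x m.
  by rewrite (lt_le_trans xm mb) !andbT /= addr0.
by rewrite (le_trans am mx) andbF add0r.
Qed.

Lemma energy_le f g : bmeas size1 f -> bmeas size1 g ->
  (forall x, `|f x| <= `|g x|) -> energy f <= energy g.
Proof.
move=> bf bg fg; apply: le_Int; [exact: (bmeasX 1 bf)|exact: (bmeasX 1 bg)|move=> x].
by rewrite -(real_normK (num_real (f x))) -(real_normK (num_real (g x))) ler_sqr ?nnegrE.
Qed.

Lemma nrm_le f g : bmeas size1 f -> bmeas size1 g ->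
  (forall x, `|f x| <= `|g x|) -> nrm f <= nrm g.
Proof. by move=> bf bg fg; apply: ler_wsqrtr; exact: energy_le. Qed.

Lemma nrm_cut_le f a b : bmeas size1 f -> nrm (cut f a b) <= nrm f.
Proof.
move=> bf; apply: nrm_le => //; first exact: bmeas_cut.
move=> x; rewrite /cut /hind; case: (_ && _); first by rewrite mul1r.
by rewrite mul0r normr0.
Qed.

Lemma nrm_cut_sub f a b a' b' : bmeas size1 f -> a' <= a -> b <= b' ->
  nrm (cut f a b) <= nrm (cut f a' b').
Proof.
move=> bf aa bb; apply: nrm_le; [exact: bmeas_cut..|move=> x].
rewrite /cut /hind; case: (boolP ((a <= x) && _)) => [/andP[ax xb]|_].
  by rewrite (le_trans aa ax) (lt_le_trans xb bb).
by rewrite mul0r normr0.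
Qed.

Lemma energy_cutD f a m b : bmeas size1 f -> a <= m <= b ->
  energy (cut f a b) = energy (cut f a m) + energy (cut f m b).
Proof.
move=> bf amb; rewrite /energy -IntD; [|exact: (bmeasX 1 (bmeas_cut _ _ bf))..].
apply: eq_Int => x; rewrite (cut_split f amb) /cut /hind.
by have [xm|mx] := ltP x m; rewrite ?andbF ?andbT ?(leNgt m x) ?xm ?mx /=; rewrite ?mul0r ?addr0 ?add0r ?expr0n ?addr0 ?add0r.
Qed.

Lemma energy_grid f a h n : bmeas size1 f -> 0 <= h ->
  \sum_(i < n) energy (cut f (a + i%:R * h) (a + i.+1%:R * h)) = energy (cut f a (a + n%:R * h)).
Proof.
move=> bf h0; elim: n => [|n ih].
  rewrite big_ord0 mul0r addr0 /energy -[LHS]Int0; apply: eq_Int => x.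
  by rewrite /cut /hind leNgt andNb mul0r expr0n.
rewrite big_ord_recr /= ih -energy_cutD//.
by rewrite lerDl mulr_ge0// lerD2l ler_wpM2r// ler_nat leqnSn.
Qed.

Lemma energy_grid_le f a h n : bmeas size1 f -> 0 <= h ->
  \sum_(i < n) energy (cut f (a + i%:R * h) (a + i.+1%:R * h)) <= energy f.
Proof.
move=> bf h0; rewrite energy_grid// -!nrm_sqr ler_sqr ?nnegrE ?nrm_ge0//.
exact: nrm_cut_le.
Qed.

(** On a grid square the sum [x + y] runs through two consecutive cells, whence windows of length
    two; each point lies in at most two of them. *)
Lemma energy_grid2_le f a h n : bmeas size1 f -> 0 <= h ->
  \sum_(i < n) energy (cut f (a + i%:R * h) (a + i.+2%:R * h)) <= 2 * energy f.
Proof.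
move=> bf h0.
have -> : \sum_(i < n) energy (cut f (a + i%:R * h) (a + i.+2%:R * h)) =
  \sum_(i < n) energy (cut f (a + i%:R * h) (a + i.+1%:R * h)) +
  \sum_(i < n) energy (cut f (a + h + i%:R * h) (a + h + i.+1%:R * h)).
  rewrite -big_split /=; apply: eq_bigr => i _.
  rewrite (@energy_cutD _ _ (a + i.+1%:R * h))//; last first.
    by rewrite !lerD2l !ler_wpM2r// ler_nat.
  have E1 : a + h + i%:R * h = a + i.+1%:R * h by rewrite -natr1; ring.
  have E2 : a + h + i.+1%:R * h = a + i.+2%:R * h by rewrite -(natr1 i.+1); ring.
  by rewrite E1 E2.
have := energy_grid_le a n bf h0; have := energy_grid_le (a + h) n bf h0; lra.
Qed.

End TrilinearForm.

(** * Summation over sparse index sets *)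

Section SpreadSums.
Context {R : realType}.

Lemma sum_fiber_le (I K : finType) (P : pred I) (k : I -> K) (u : K -> R) (M : nat) :
  (forall x, 0 <= u x) -> (forall x, #|[pred i | P i & k i == x]| <= M)%N ->
  \sum_(i | P i) u (k i) <= M%:R * \sum_x u x.
Proof.
move=> u0 hM; rewrite (partition_big k xpredT) //= mulr_sumr; apply: ler_sum => x _.
rewrite (eq_bigr (fun=> u x)); last by move=> i /andP[_ /eqP ->].
rewrite big_const iter_addr_0 -[leLHS]mulr_natl.
by apply: ler_wpM2r => //; rewrite ler_nat; exact: hM.
Qed.

(** Cauchy-Schwarz over the indices in [P]: in the sum of squares of either factor each value is
    repeated at most [M] times. *)
Lemma spread_sum_le (I K L : finType) (P : pred I) (k : I -> K) (l : I -> L)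
    (u : K -> R) (v : L -> R) (M : nat) (U V : R) :
  (forall x, 0 <= u x) -> (forall x, 0 <= v x) -> 0 <= U -> 0 <= V ->
  \sum_x u x ^+ 2 <= U ^+ 2 -> \sum_x v x ^+ 2 <= V ^+ 2 ->
  (forall x, #|[pred i | P i & k i == x]| <= M)%N ->
  (forall x, #|[pred i | P i & l i == x]| <= M)%N ->
  \sum_(i | P i) u (k i) * v (l i) <= M%:R * (U * V).
Proof.
move=> u0 v0 U0 V0 hu hv hk hl.
have [M0|M0] := posnP M.
  rewrite M0 mul0r big1// => i Pi; exfalso; have := hk (k i); rewrite M0 leqn0 => /eqP/card0_eq/(_ i).
  by rewrite !inE Pi eqxx.
have Mp : 0 < M%:R :> R by rewrite ltr0n.
rewrite -ler_pdivrMl//; apply: amgm_inf => // al al0; rewrite ler_pdivrMl//.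
apply: (@le_trans _ _ (2^-1 * (al * \sum_(i | P i) u (k i) ^+ 2 + (\sum_(i | P i) v (l i) ^+ 2) / al))).
  rewrite mulr_sumr mulr_suml -big_split /= mulr_sumr; apply: ler_sum => i _.
  have := @le_sum_of_sqr_le_mul R (u (k i) * v (l i)) 1 (u (k i) ^+ 2) (v (l i) ^+ 2) al.
  by rewrite mul1r expr1n mul1r exprMn; apply; rewrite ?sqr_ge0.
rewrite mulrCA ler_wpM2l ?invr_ge0// mulrDr; apply: lerD.
  rewrite mulrCA ler_wpM2l ?(ltW al0)//.
  apply: (le_trans (sum_fiber_le (u := fun x => u x ^+ 2) _ hk)) => [x|]; first exact: sqr_ge0.
  by rewrite ler_wpM2l.
rewrite mulrA ler_wpM2r ?invr_ge0 ?(ltW al0)//.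
apply: (le_trans (sum_fiber_le (u := fun x => v x ^+ 2) _ hl)) => [x|]; first exact: sqr_ge0.
by rewrite ler_wpM2l.
Qed.

(** Subtracting the least value of [w] injects the set into the integers from 0 to [M]. *)
Lemma card_spread (I : finType) (P : pred I) (w : I -> nat) (M : nat) :
  {in P &, injective w} -> (forall i i', P i -> P i' -> (w i <= w i' + M)%N) ->
  (#|P| <= M.+1)%N.
Proof.
move=> wi wM; case: (pickP P) => [i0 Pi0|P0]; last by rewrite (eq_card0 P0).
have [m Pm mmin] := @arg_minnP I i0 P w Pi0.
pose g i : 'I_M.+1 := inord (w i - w m).
have gE i : P i -> g i = (w i - w m)%N :> nat.
  by move=> Pi; rewrite /g inordK// ltnS leq_subLR; exact: wM.
rewrite -[M.+1]card_ord -(card_in_image (f := g) (A := P)); first exact: max_card.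
move=> i i' Pi Pi' e.
apply: wi => //; have := congr1 val e; rewrite /= !gE// => h.
by rewrite -(subnK (mmin i Pi)) h subnK// mmin.
Qed.

End SpreadSums.

(** * Induction on the order of vanishing *)

Section Decay.
Context {R : realType}.
Implicit Types (s : nat -> nat -> R * R -> R) (S A : R * R -> R).

(** The half-side [3 * d] leaves room for the bump, which extends by [d] beyond the square, and for
    a further shift by at most [d]. Outside this box [S] is merely measurable. *)
Record datum (x0 y0 d : R) s S A0 A1 A2 (BA : R) : Prop := Datum {
  datum_jet : jet (box x0 y0 (3 * d)) s;
  datum_meas : measurable_fun setT S;
  datum_eq : forall z, box x0 y0 (3 * d) z -> S z = s 0 0 z;
  datum_bA : bmeasurable A0;
  datum_amp : forall y, `|y - y0| <= 3 * d ->
    amplitude (x0 - 3 * d) (x0 + 3 * d) d BA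
      (fun u => A0 (u, y)) (fun u => A1 (u, y)) (fun u => A2 (u, y)) }.

Definition upper (x0 y0 d mu B : R) s k := forall p q z, (p + q <= k)%N ->
  box x0 y0 (3 * d) z -> `|jetP s p q z| * d ^+ (p + q) <= B * mu.

Definition lower (x0 y0 d mu c : R) s a := forall z, box x0 y0 (3 * d) z ->
  exists p q, (p + q <= a)%N /\ c * mu <= `|jetP s p q z| * d ^+ (p + q).

(* A scale-invariant form of the decay estimate: d is the side of the square
   that carries the integral and mu / d^(p+q) the size of the (p,q)-derivative
   of D S, so that kappa plays the part of (mu d^3)^(-1/(2(a+3))). *)
Definition decay a := forall B c BA : R, 0 <= B -> 0 < c -> 0 <= BA ->
  exists2 C, 0 <= C & forall x0 y0 d s S A0 A1 A2 mu kappa f1 f2 f3,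
    0 < d -> 0 < mu -> datum x0 y0 d s S A0 A1 A2 BA ->
    upper x0 y0 d mu B s a.+2 -> lower x0 y0 d mu c s a ->
    0 < kappa -> 1 <= kappa ^+ (2 * (a + 3)) * mu * d ^+ 3 ->
    bmeas size1 f1 -> bmeas size1 f2 -> bmeas size1 f3 ->
    (forall x, f1 x != 0 -> x0 <= x < x0 + d) ->
    (forall y, f2 y != 0 -> y0 <= y < y0 + d) ->
    `|Tri S A0 f1 f2 f3| <= C * (Num.sqrt d * kappa) * (nrm f1 * nrm f2 * nrm f3).

(** The amplitude keeps its constant because the allowance [1 / d] per derivative only grows when
    the square shrinks. *)
Lemma datum_sub x0 y0 d x1 y1 d1 s S A0 A1 A2 BA : 0 < d1 -> d1 <= d -> 0 <= BA ->
  `|x1 - x0| + 3 * d1 <= 3 * d -> `|y1 - y0| + 3 * d1 <= 3 * d ->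
  datum x0 y0 d s S A0 A1 A2 BA -> datum x1 y1 d1 s S A0 A1 A2 BA.
Proof.
move=> d10 d1d BA0 hx hy [j m e bA am]; have bs := box_sub hx hy.
split => //; first exact: jet_sub j; first by move=> z /bs; exact: e.
have id : d^-1 <= d1^-1 by rewrite lef_pV2 ?posrE// (lt_le_trans d10).
have d0 : 0 < d by exact: lt_le_trans d1d.
move=> y hy1; have hyd : `|y - y0| <= 3 * d.
  by have := ler_normD (y - y1) (y1 - y0); rewrite addrA subrK; lra.
have [a1 a2 a3 a4 a5 a6] := am y hyd.
have hb x : x1 - 3 * d1 <= x <= x1 + 3 * d1 -> x0 - 3 * d <= x <= x0 + 3 * d.
  have := ler_norm (x1 - x0); have := ler_norm (- (x1 - x0)); rewrite normrN => ? ? /andP[? ?].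
  by apply/andP; split; lra.
split=> x /hb hx'; [exact: a1|exact: a2|exact: a3|exact: a4| |].
  by apply: (le_trans (a5 x hx')); rewrite ler_wpM2l.
apply: (le_trans (a6 x hx')); rewrite ler_wpM2l// -!exprVn.
have i0 : 0 <= d^-1 by rewrite invr_ge0 ltW.
have i1 : 0 <= d1^-1 by rewrite invr_ge0 ltW.
by rewrite ler_sqr ?nnegrE.
Qed.

Lemma ler_norm_sub (u v : R) : `|u| <= `|v| + `|u - v|.
Proof. by have := ler_normD v (u - v); rewrite addrC subrK. Qed.

Lemma decay0 : decay 0.
Proof.
move=> B c BA B0 c0 BA0.
have kc0 := kernel_const_ge0 c0 B0 BA0.
have bc0 : 0 <= base_const B c BA.
  apply: addr_ge0; first by rewrite mulr_ge0 ?sqr_ge0.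
  by apply: addr_ge0 => //; apply: divr_ge0; [rewrite mulr_ge0|exact: ltW].
exists (Num.sqrt (base_const B c BA)); first exact: sqrtr_ge0.
move=> x0 y0 d s S A0 A1 A2 mu kappa f1 f2 f3 d0 mu0 [j m e bA am] up lo k0 kmu b1 b2 b3 s1 s2.
have dn0 : d != 0 by rewrite gt_eqF.
have lo' z : box x0 y0 (3 * d) z -> c * mu <= `|jetP s 0 0 z|.
  by move=> /lo[p [q []]]; rewrite leqn0 addn_eq0 => /andP[/eqP -> /eqP ->]; rewrite mulr1.
have up1 z : box x0 y0 (3 * d) z -> `|jetP s 1 0 z| <= B * mu / d.
  by move=> bz; rewrite ler_pdivlMr//; have := up 1%N 0%N z isT bz; rewrite expr1.
have up2 z : box x0 y0 (3 * d) z -> `|jetP s 2 0 z| <= B * mu / d ^+ 2.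
  by move=> bz; rewrite ler_pdivlMr ?exprn_gt0//; exact: up.
have s1' x : f1 x != 0 -> x0 <= x <= x0 + d by move=> /s1/andP[-> /ltW ->].
have s2' x : f2 x != 0 -> y0 <= x <= y0 + d by move=> /s2/andP[-> /ltW ->].
have H := base_case d0 c0 mu0 B0 BA0 j m e lo' up1 up2 bA am k0 kmu b1 b2 b3 s1' s2'.
rewrite -/(Tri S A0 f1 f2 f3) in H.
rewrite -ler_sqr ?nnegrE ?mulr_ge0 ?sqrtr_ge0 ?nrm_ge0 ?(ltW k0)// real_normK ?num_real//.
apply: (le_trans H); rewrite !exprMn !sqr_sqrtr ?(ltW d0) ?energy_ge0//.
Qed.

Section Tree.
Variables (a : nat) (x0 y0 d mu B c BA : R) (s : nat -> nat -> R * R -> R).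
Variables (S A0 A1 A2 : R * R -> R).
Let b := a.+1.
Hypotheses (d0 : 0 < d) (mu0 : 0 < mu) (B0 : 0 <= B) (c0 : 0 < c) (BA0 : 0 <= BA).
Hypothesis dt : datum x0 y0 d s S A0 A1 A2 BA.
Hypothesis up : upper x0 y0 d mu B s b.+2.

Definition side n := d / 2 ^+ n.
(** Chosen so that [scale n / side n ^+ b] does not depend on [n]: the derivatives of order [b] have
    the same normalised size at every level. *)
Definition scale n := mu / 2 ^+ (n * b).
Definition xgrid n (i : nat) := x0 + i%:R * side n.
Definition ygrid n (i : nat) := y0 + i%:R * side n.

(** The negation is the hypothesis [lower] on this square at its own scale, so off the bad squares
    the induction hypothesis is available. The enlarged box is used because [lower] refers to it. *)
Definition bad n i j := `[< exists2 z, box (xgrid n i) (ygrid n j) (3 * side n) z &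
  forall p q, (p + q <= a)%N -> `|jetP s p q z| * side n ^+ (p + q) < c * scale n >].

Lemma side_gt0 n : 0 < side n.
Proof. by rewrite divr_gt0// exprn_gt0. Qed.

Lemma scale_gt0 n : 0 < scale n.
Proof. by rewrite divr_gt0// exprn_gt0. Qed.

Lemma sideS n : side n.+1 = side n / 2.
Proof. by rewrite /side exprS invfM; ring. Qed.

Lemma side_pow n : 2 ^+ n * side n = d.
Proof. by rewrite /side mulrCA divff ?mulr1// expf_neq0// pnatr_eq0. Qed.

Lemma scale_side n : scale n / side n ^+ b = mu / d ^+ b.
Proof.
rewrite /scale /side expr_div_n -exprM invf_div mulrA divfK//.
Qed.

Lemma grid_box n i j : (i < 2 ^ n)%N -> (j < 2 ^ n)%N ->
  (`|xgrid n i - x0| + 3 * side n <= 3 * d) /\ (`|ygrid n j - y0| + 3 * side n <= 3 * d).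
Proof.
have H k : (k < 2 ^ n)%N -> k%:R * side n + 3 * side n <= 3 * d.
  move=> hk; have sp := side_gt0 n; have sd := side_pow n.
  have h1 : (k%:R + 1) * side n <= d.
    rewrite -sd; apply: ler_wpM2r; first exact: ltW.
    by rewrite natr1 -natrX ler_nat.
  have h2 : side n <= d.
    rewrite -sd -{1}(mul1r (side n)) ler_wpM2r ?(ltW sp)//.
    by rewrite -natrX ler1n expn_gt0.
  by rewrite mulrDl mul1r in h1; lra.
move=> hi hj; rewrite /xgrid /ygrid ![_ + _ * side n - _]addrAC !subrr !add0r.
have sn0 := ltW (side_gt0 n).
by rewrite (ger0_norm (mulr_ge0 (ler0n _ i) sn0)) (ger0_norm (mulr_ge0 (ler0n _ j) sn0)); split; exact: H.
Qed.

Let JP : jet (box x0 y0 (3 * d)) (jetP s). Proof. exact/jetP_jet/(datum_jet dt). Qed.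

(** A derivative of order [a] is small at some point of each square, so its increment between the
    points is small, and the mean value theorem reads this as a bound on the lattice displacement.
    The two small values give [2 * c]; the positions inside the boxes, up to [6 * side n] in each
    coordinate, give [12 * B]. *)
Lemma bad_difference n i j i' j' p q : (i < 2 ^ n)%N -> (j < 2 ^ n)%N ->
  (i' < 2 ^ n)%N -> (j' < 2 ^ n)%N -> (p + q = a)%N -> bad n i j -> bad n i' j' ->
  exists2 w, box x0 y0 (3 * d) w &
    `|(i'%:R - i%:R) * jetP s p.+1 q w + (j'%:R - j%:R) * jetP s p q.+1 w| * d ^+ b
      <= (2 * c + 12 * B) * mu.
Proof.
move=> hi hj hi' hj' pq /asboolP[z bz Hz] /asboolP[z' bz' Hz'].
have [gx gy] := grid_box hi hj; have [gx' gy'] := grid_box hi' hj'.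
have Bz := box_sub gx gy bz; have Bz' := box_sub gx' gy' bz'.
have [w bw E] := mvt2 p q JP Bz Bz'.
exists w => //; have sp := side_gt0 n.
have db : 0 < d ^+ b by rewrite exprn_gt0.
pose T := mu / d ^+ b.
have T0 : 0 < T by rewrite divr_gt0.
have TE : scale n = T * side n ^+ b.
  by rewrite /T -(scale_side n) divfK// expf_neq0// gt_eqF.
have sa : 0 < side n ^+ a by rewrite exprn_gt0.
have hz u : (forall p q, (p + q <= a)%N -> `|jetP s p q u| * side n ^+ (p + q) < c * scale n) ->
    `|jetP s p q u| <= c * T * side n.
  move=> h; have := h p q; rewrite pq leqnn => /(_ isT); rewrite TE /b exprS => /ltW.
  by rewrite (_ : c * (T * (side n * side n ^+ a)) = c * T * side n * side n ^+ a) ?ler_pM2r//; ring.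
have up' p' q' : (p' + q' = b)%N -> `|jetP s p' q' w| <= B * T.
  move=> h; rewrite /T mulrA ler_pdivlMr// -h; apply: up => //.
  by rewrite h /b; rewrite -addn2 leq_addr.
have ux := up' p.+1 q; have uy := up' p q.+1.
rewrite /b addSn pq in ux; rewrite /b addnS pq in uy.
have {}ux := ux erefl; have {}uy := uy erefl.
have h1 := hz _ Hz; have h2 := hz _ Hz'.
set X := jetP s p.+1 q w in E ux *; set Y := jetP s p q.+1 w in E uy *.
pose r1 := (z'.1 - xgrid n i') - (z.1 - xgrid n i).
pose r2 := (z'.2 - ygrid n j') - (z.2 - ygrid n j).
have [bz1 bz2] := bz; have [bz1' bz2'] := bz'.
have r1b : `|r1| <= 6 * side n by rewrite /r1 (le_trans (ler_normB _ _))//; lra.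
have r2b : `|r2| <= 6 * side n by rewrite /r2 (le_trans (ler_normB _ _))//; lra.
have main : ((i'%:R - i%:R) * X + (j'%:R - j%:R) * Y) * side n =
    jetP s p q z' - jetP s p q z - r1 * X - r2 * Y.
  by rewrite E /r1 /r2 /xgrid /ygrid; ring.
have t1 : `|r1 * X| <= 6 * side n * (B * T) by rewrite normrM ler_pM.
have t2 : `|r2 * Y| <= 6 * side n * (B * T) by rewrite normrM ler_pM.
have nb : `|((i'%:R - i%:R) * X + (j'%:R - j%:R) * Y) * side n| <= (2 * c + 12 * B) * T * side n.
  rewrite main; apply: (le_trans (ler_normB _ _)); apply: (le_trans (lerD (ler_normB _ _) (lexx _))).
  apply: (le_trans (lerD (lerD (ler_normB _ _) (lexx _)) (lexx _))).
  rewrite (_ : (2 * c + 12 * B) * T * side n = (c * T * side n + c * T * side n + 6 * side n * (B * T)) + 6 * side n * (B * T)); last by ring.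
  by rewrite !lerD.
move: nb; rewrite normrM (gtr0_norm sp) ler_pM2r// => nb.
by rewrite -ler_pdivlMr// -mulrA -/T.
Qed.

(** Some derivative of order [a] varies at a definite rate in the given direction, so it cannot be
    small at two distant places of the same line. [steepx], [steepy] and [steepd] treat rows,
    columns and antidiagonals. *)
Definition steepx (c1 : R) := exists p q, (p + q = a)%N /\
  forall z, box x0 y0 (3 * d) z -> c1 * mu <= `|jetP s p.+1 q z| * d ^+ b.
Definition steepy (c1 : R) := exists p q, (p + q = a)%N /\
  forall z, box x0 y0 (3 * d) z -> c1 * mu <= `|jetP s p q.+1 z| * d ^+ b.
Definition steepd (c1 : R) := exists p q, (p + q = a)%N /\
  forall z, box x0 y0 (3 * d) z -> c1 * mu <= `|jetP s p.+1 q z - jetP s p q.+1 z| * d ^+ b.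

Variables (c1 : R) (M : nat).
Hypotheses (c10 : 0 < c1) (hM : 2 * c + 12 * B <= c1 * M%:R).

Let spread_nat (i i' : nat) (X : R) : c1 * mu <= `|X| * d ^+ b ->
  `|(i'%:R - i%:R) * X| * d ^+ b <= (2 * c + 12 * B) * mu -> (i <= i' + M)%N.
Proof.
move=> hX h; rewrite leqNgt; apply/negP => hi.
have hi' : M%:R + 1 <= i%:R - i'%:R :> R.
  by rewrite lerBrDr natr1 -natrD ler_nat addSn addnC.
have Mn : 0 <= M%:R :> R by [].
(* A displacement of at least [M + 1] contradicts the bound, since [c1 * M] already absorbs
   [2 * c + 12 * B]. *)
have : (M%:R + 1) * (c1 * mu) <= c1 * M%:R * mu.
  apply: (le_trans _ (ler_wpM2r (ltW mu0) hM)); apply: (le_trans _ h).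
  rewrite normrM distrC -mulrA (ger0_norm (_ : 0 <= i%:R - i'%:R)); last by lra.
  by apply: ler_pM => //; rewrite mulr_ge0// ltW.
have := mulr_gt0 c10 mu0; nra.
Qed.

Lemma bad_spread_rows n i i' j : steepx c1 -> (i < 2 ^ n)%N -> (i' < 2 ^ n)%N -> (j < 2 ^ n)%N ->
  bad n i j -> bad n i' j -> (i <= i' + M)%N.
Proof.
move=> [p [q [pq hs]]] hi hi' hj h h'.
have [w bw] := bad_difference hi hj hi' hj pq h h'; rewrite subrr mul0r addr0.
exact: spread_nat (hs w bw).
Qed.

Lemma bad_spread_cols n i j j' : steepy c1 -> (i < 2 ^ n)%N -> (j < 2 ^ n)%N -> (j' < 2 ^ n)%N ->
  bad n i j -> bad n i j' -> (j <= j' + M)%N.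
Proof.
move=> [p [q [pq hs]]] hi hj hj' h h'.
have [w bw] := bad_difference hi hj hi hj' pq h h'; rewrite subrr mul0r add0r.
exact: spread_nat (hs w bw).
Qed.

(** On an antidiagonal the two displacements are opposite, so only the difference of the two partial
    derivatives is seen. *)
Lemma bad_spread_diags n i i' j j' : steepd c1 -> (i < 2 ^ n)%N -> (i' < 2 ^ n)%N ->
  (j < 2 ^ n)%N -> (j' < 2 ^ n)%N -> (i + j = i' + j')%N ->
  bad n i j -> bad n i' j' -> (i <= i' + M)%N.
Proof.
move=> [p [q [pq hs]]] hi hi' hj hj' ij h h'.
have [w bw] := bad_difference hi hj hi' hj' pq h h'.
have -> : j'%:R - j%:R = - (i'%:R - i%:R) :> R.
  by have := congr1 (fun k : nat => k%:R : R) ij; rewrite !natrD; lra.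
rewrite mulNr -mulrBr; exact: spread_nat (hs w bw).
Qed.

Definition two_steep := [\/ steepx c1 /\ steepy c1, steepx c1 /\ steepd c1 | steepy c1 /\ steepd c1].

End Tree.

(** A mixed derivative of order [a.+1] is both an x- and a y-derivative of derivatives of order [a].
    A pure one gives one direction; the neighbouring mixed derivative is either large itself, or far
    from the pure one, and this gives the second direction. The choice costs [c2 / 2] and the
    oscillation at most twice [c2 / 8], which leaves [c2 / 4]. *)
Lemma two_steep_of_center a (x0 y0 d mu c2 : R) s : 0 < d -> 0 < mu -> 0 < c2 ->
  (exists p q, (p + q = a.+1)%N /\ c2 * mu <= `|jetP s p q (x0, y0)| * d ^+ a.+1) ->
  (forall p q z, (p + q = a.+1)%N -> box x0 y0 (3 * d) z ->
     `|jetP s p q z - jetP s p q (x0, y0)| * d ^+ a.+1 <= c2 / 8 * mu) ->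
  two_steep a x0 y0 d mu s (c2 / 4).
Proof.
move=> d0 mu0 c20 [p [q [pq hc]]] osc.
have db : 0 < d ^+ a.+1 by rewrite exprn_gt0.
set D := d ^+ a.+1 in hc osc db *.
have big p' q' z : (p' + q' = a.+1)%N -> c2 / 2 * mu <= `|jetP s p' q' (x0, y0)| * D ->
    box x0 y0 (3 * d) z -> c2 / 4 * mu <= `|jetP s p' q' z| * D.
  move=> h1 h2 bz; have := osc p' q' z h1 bz.
  rewrite (distrC (jetP s p' q' z)) => o.
  have := ler_wpM2r (ltW db) (ler_norm_sub (jetP s p' q' (x0, y0)) (jetP s p' q' z)).
  rewrite mulrDl => h3; have := mulr_gt0 c20 mu0.
  by move: h2 o h3; lra.
have hc2 : c2 / 2 * mu <= `|jetP s p q (x0, y0)| * D.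
  by apply: le_trans hc; rewrite ler_wpM2r ?(ltW mu0)//; lra.
have sx p' q' : (p' + q' = a)%N -> c2 / 2 * mu <= `|jetP s p'.+1 q' (x0, y0)| * D ->
    steepx a x0 y0 d mu s (c2 / 4).
  by move=> h1 h2; exists p', q'; split=> // z; apply: big; rewrite ?addSn ?h1.
have sy p' q' : (p' + q' = a)%N -> c2 / 2 * mu <= `|jetP s p' q'.+1 (x0, y0)| * D ->
    steepy a x0 y0 d mu s (c2 / 4).
  by move=> h1 h2; exists p', q'; split=> // z; apply: big; rewrite ?addnS ?h1.
have sd p' q' : (p' + q' = a)%N ->
    c2 / 2 * mu <= `|jetP s p'.+1 q' (x0, y0) - jetP s p' q'.+1 (x0, y0)| * D ->
    steepd a x0 y0 d mu s (c2 / 4).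
  move=> h1 h2; exists p', q'; split=> // z bz.
  have o1 : `|jetP s p'.+1 q' z - jetP s p'.+1 q' (x0, y0)| * D <= c2 / 8 * mu by apply: osc; rewrite ?addSn ?h1.
  have o2 : `|jetP s p' q'.+1 z - jetP s p' q'.+1 (x0, y0)| * D <= c2 / 8 * mu by apply: osc; rewrite ?addnS ?h1.
  rewrite -/D; move: h2 o1 o2; move: (jetP s p'.+1 q' z) (jetP s p' q'.+1 z) => X Y.
  move: (jetP s p'.+1 q' (x0, y0)) (jetP s p' q'.+1 (x0, y0)) => X0 Y0 h2 o1 o2.
  have t : `|X0 - Y0| <= `|X - Y| + `|X - X0| + `|Y - Y0|.
    rewrite (_ : X0 - Y0 = (X - Y) - (X - X0) + (Y - Y0)); last by ring.
    by rewrite (le_trans (ler_normD _ _))// lerD2r ler_normB.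
  have := ler_wpM2r (ltW db) t; rewrite !mulrDl => t'.
  by move: h2 o1 o2 t'; lra.
have D0 := ltW db.
have dich (X Y : R) : c2 * mu <= `|X| * D -> c2 / 2 * mu <= `|Y| * D \/ c2 / 2 * mu <= `|X - Y| * D.
  move=> hX; have [h|/ltW h] := leP (c2 / 2 * mu) (`|Y| * D); [by left|right].
  have := ler_wpM2r D0 (ler_norm_sub X Y); rewrite mulrDl => t.
  by move: hX h t; lra.
case: p q pq hc hc2 => [|p] [|q] // pq hc hc2.
- have sY : steepy a x0 y0 d mu s (c2 / 4) by apply: (sy 0%N q) => //; case: pq.
  have qa : q = a by case: pq.
  have [h|h] := dich _ (jetP s 1 q (x0, y0)) hc.
    by apply: Or31; split=> //; apply: (sx 0%N q).
  by apply: Or33; split=> //; apply: (sd 0%N q) => //; rewrite (distrC (jetP s 1 q (x0, y0))).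
- have pa : p = a by move: pq; rewrite addn0 => -[].
  have sX : steepx a x0 y0 d mu s (c2 / 4) by apply: (sx p 0%N); rewrite ?addn0.
  have [h|h] := dich _ (jetP s p 1 (x0, y0)) hc.
    by apply: Or31; split=> //; apply: (sy p 0%N); rewrite ?addn0.
  by apply: Or32; split=> //; apply: (sd p 0%N); rewrite ?addn0.
- apply: Or31; split.
    by apply: (sx p q.+1) => //; move: pq; rewrite addSn => -[].
  by apply: (sy p.+1 q) => //; move: pq; rewrite addnS => -[].
Qed.

End Decay.

(** * The tree of dyadic squares and the sums over bad squares *)

Section TreeSums.
Context {R : realType}.
Implicit Types (s : nat -> nat -> R * R -> R) (S A : R * R -> R) (f : R -> R).

Lemma sum_double (F : nat -> R) n :
  \sum_(i < n.*2) F i = \sum_(i < n) (F i.*2 + F i.*2.+1).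
Proof.
elim: n => [|n ih]; first by rewrite !big_ord0.
by rewrite doubleS !big_ord_recr /= ih addrA.
Qed.

Lemma sum_quad (F : nat -> nat -> R) n :
  \sum_(i < n.*2) \sum_(j < n.*2) F i j = \sum_(i < n) \sum_(j < n)
    (F i.*2 j.*2 + F i.*2 j.*2.+1 + (F i.*2.+1 j.*2 + F i.*2.+1 j.*2.+1)).
Proof.
rewrite (sum_double (fun i => \sum_(j < n.*2) F i j)); apply: eq_bigr => i _.
by rewrite (sum_double (F i.*2)) (sum_double (F i.*2.+1)) -big_split.
Qed.

Lemma norm_sum4_le (p1 p2 p3 p4 x1 x2 x3 x4 w : R) :
  `|p1| <= x1 + w -> `|p2| <= x2 + w -> `|p3| <= x3 + w -> `|p4| <= x4 + w ->
  `|p1 + p2 + (p3 + p4)| <= x1 + x2 + (x3 + x4) + 4 * w.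
Proof.
move=> h1 h2 h3 h4.
have := ler_normD (p1 + p2) (p3 + p4).
by have := ler_normD p1 p2; have := ler_normD p3 p4; lra.
Qed.

Lemma nth_root_ex (x : R) (e : nat) : (0 < e)%N -> 0 < x -> exists2 y, 0 < y & y ^+ e = x.
Proof.
move=> e0 x0; exists (x `^ (e%:R^-1)); first exact: powR_gt0.
rewrite -powR_mulrn ?powR_ge0// -powRrM mulVf ?pnatr_eq0 -?lt0n// powRr1//.
exact: ltW.
Qed.

(** The least [J] that makes the product reach 1 cannot overshoot by a factor of 2. *)
Lemma dyadic_level (k : R) : 0 < k -> k < 1 -> exists J, 1 <= k * 2 ^+ J /\ k * 2 ^+ J < 2.
Proof.
move=> k0 k1.
have [n hn] : exists n, 1 <= k * 2 ^+ n.
  pose n := (Num.truncn k^-1).+1.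
  exists n; rewrite mulrC -ler_pdivrMr// mul1r.
  have /ltW h : k^-1 < n%:R by apply: truncnS_gt.
  apply: (le_trans h); rewrite -natrX ler_nat; exact: ltnW (ltn_expl _ _).
case: (ex_minnP (ex_intro (fun n => 1 <= k * 2 ^+ n) n hn)) => J hJ Jmin.
exists J; split=> //; case: J hJ Jmin => [|J] hJ Jmin.
  by rewrite expr0 mulr1 (lt_trans k1)// ltr1n.
rewrite exprS mulrCA gtr_pMr// ltNge; apply/negP => h.
by have := Jmin J h; rewrite ltnn.
Qed.

Lemma scaleS a (mu : R) n : scale a mu n.+1 = scale a mu n / 2 ^+ a.+1.
Proof. by rewrite /scale mulSn addnC exprD invfM mulrA. Qed.

Section Roots.
Variables (a : nat) (x0 y0 d mu B c BA : R) (s : nat -> nat -> R * R -> R).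
Variables (S A0 A1 A2 : R * R -> R).
Let b := a.+1.
Hypotheses (d0 : 0 < d) (mu0 : 0 < mu) (B0 : 0 <= B) (c0 : 0 < c) (BA0 : 0 <= BA).
Hypothesis dt : datum x0 y0 d s S A0 A1 A2 BA.
Hypothesis up : upper x0 y0 d mu B s b.+2.

Local Notation side := (side d).
Local Notation scale := (scale a mu).
Local Notation xg := (xgrid x0 d).
Local Notation yg := (xgrid y0 d).
Local Notation badsq := (bad a x0 y0 d mu c s).

Let sg n : 0 < side n. Proof. exact: side_gt0. Qed.
Let mg n : 0 < scale n. Proof. exact: scale_gt0. Qed.

(** For the orders [b] and [b.+1] the bound of the large square survives rescaling. Lower orders
    follow by descending induction: start from the point where all of them are small and move by at
    most [6 * side n] in each coordinate, which multiplies the constant by [13 = 1 + 12]. *)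
Lemma upper_of_bad n i j p q z : (i < 2 ^ n)%N -> (j < 2 ^ n)%N -> badsq n i j ->
  (p + q <= b.+1)%N -> box (xg n i) (yg n j) (3 * side n) z ->
  `|jetP s p q z| * side n ^+ (p + q) <= (B + c) * 13 ^+ b * scale n.
Proof.
move=> hi hj /asboolP[z0 bz0 Hz0]; have [gx gy] := grid_box x0 y0 d0 hi hj.
have bsub := box_sub gx gy.
have Bc : B <= B + c by rewrite lerDl ltW.
have Bc0 : 0 <= B + c by apply: le_trans Bc.
have e13 k : 1 <= 13 ^+ k :> R by rewrite exprn_ege1// ler1n.
have high p' q' z' : (b <= p' + q' <= b.+1)%N -> box (xg n i) (yg n j) (3 * side n) z' ->
    `|jetP s p' q' z'| * side n ^+ (p' + q') <= (B + c) * scale n.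
  move=> /andP[h1 h2] /bsub bz; have := up (leqW h2) bz.
  rewrite -{1}(side_pow d n) exprMn mulrCA mulrC -exprM => h.
  have e0 : 0 < 2 ^+ (n * (p' + q')) :> R by rewrite exprn_gt0.
  rewrite -ler_pdivlMr// in h; apply: (le_trans h).
  rewrite /scale mulrA; apply: ler_pM; rewrite ?mulr_ge0 ?invr_ge0 ?exprn_ge0// ?(ltW mu0)//.
    by rewrite ler_wpM2r// ltW.
  rewrite lef_pV2 ?posrE ?exprn_gt0// ler_weXn2l ?ler1n//.
  by rewrite leq_mul2l h1 orbT.
have low k : forall p' q' z', (p' + q' + k = b)%N -> box (xg n i) (yg n j) (3 * side n) z' ->
    `|jetP s p' q' z'| * side n ^+ (p' + q') <= (B + c) * 13 ^+ k * scale n.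
  elim: k => [|k ih] p' q' z' h bz.
    by rewrite mulr1; apply: high => //; rewrite -h addn0 leqnn leqnSn.
  have se : 0 < side n ^+ (p' + q') by rewrite exprn_gt0.
  have js : jet (box (xg n i) (yg n j) (3 * side n)) (jetP s).
    exact: jet_sub bsub (jetP_jet (datum_jet dt)).
  pose K := (B + c) * 13 ^+ k * scale n / side n ^+ (p' + q').+1.
  have K1 w : box (xg n i) (yg n j) (3 * side n) w -> `|jetP s p'.+1 q' w| <= K.
    move=> bw; rewrite /K ler_pdivlMr ?exprn_gt0// -addSn; apply: ih => //.
    by rewrite -h addSn addSn addnS.
  have K2 w : box (xg n i) (yg n j) (3 * side n) w -> `|jetP s p' q'.+1 w| <= K.
    move=> bw; rewrite /K ler_pdivlMr ?exprn_gt0// -addnS; apply: ih => //.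
    by rewrite -h !addnS addSn.
  have m := mvt_box js K1 K2 bz0 bz.
  have pa : (p' + q' <= a)%N by rewrite -ltnS -/b -h addnS ltnS leq_addr.
  have /ltW h0 := Hz0 p' q' pa.
  have [b1 b2] := bz; have [b3 b4] := bz0.
  have d1 : `|z'.1 - z0.1| <= 6 * side n.
    have := ler_normB (z'.1 - xg n i) (z0.1 - xg n i); rewrite opprB addrA subrK.
    by move: b1 b3; lra.
  have d2 : `|z'.2 - z0.2| <= 6 * side n.
    have := ler_normB (z'.2 - yg n j) (z0.2 - yg n j); rewrite opprB addrA subrK.
    by move: b2 b4; lra.
  have K0 : 0 <= K by apply: le_trans (K1 z0 bz0).
  have m' : `|jetP s p' q' z' - jetP s p' q' z0| <= 12 * side n * K.
    apply: (le_trans m); apply: (le_trans (lerD (ler_wpM2r K0 d1) (ler_wpM2r K0 d2))).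
    by rewrite le_eqVlt; apply/orP; left; apply/eqP; ring.
  have t := ler_wpM2r (ltW se) (ler_norm_sub (jetP s p' q' z') (jetP s p' q' z0)).
  have t' := ler_wpM2r (ltW se) m'.
  have KE : 12 * side n * K * side n ^+ (p' + q') = 12 * ((B + c) * 13 ^+ k * scale n).
    by rewrite /K exprS; field; rewrite expf_neq0 ?gt_eqF.
  rewrite KE in t'; rewrite mulrDl in t.
  apply: (le_trans t); apply: (le_trans (lerD h0 t')).
  have c1 : c * scale n <= (B + c) * 13 ^+ k * scale n.
    rewrite ler_wpM2r ?(ltW (mg n))// (@le_trans _ _ (B + c)) ?lerDr// -{1}(mulr1 (B + c)).
    by rewrite ler_wpM2l.
  by rewrite exprS; lra.
move=> hpq bz; have [h|h] := leqP b (p + q).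
  apply: (le_trans (high p q z _ bz)); first by rewrite h.
  by rewrite ler_wpM2r ?(ltW (mg n))// -{1}(mulr1 (B + c)) ler_wpM2l.
have E : (p + q + (b - (p + q)) = b)%N by rewrite subnKC// ltnW.
apply: (le_trans (low _ p q z E bz)); rewrite ler_wpM2r ?(ltW (mg n))// ler_wpM2l//.
by rewrite ler_weXn2l ?ler1n// leq_subr.
Qed.

(** The last factor pays for the passage from [scale n] to [scale n.+1]. *)
Definition child_bound := (B + c) * 13 ^+ b * 2 ^+ b.

Lemma child_upper n i j i' j' : (i < 2 ^ n)%N -> (j < 2 ^ n)%N -> badsq n i j ->
  i'./2 = i -> j'./2 = j ->
  upper (xg n.+1 i') (yg n.+1 j') (side n.+1) (scale n.+1) child_bound s a.+2.
Proof.
move=> hi hj bd hi' hj' p q z pq bz.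
have sS := sideS d n; have sp := sg n.
have H (o : R) k k' : k'./2 = k -> `|xgrid o d n.+1 k' - xgrid o d n k| + 3 * side n.+1 <= 3 * side n.
  move=> <-; rewrite /xgrid sS -{1}(odd_double_half k') natrD -mul2n natrM.
  rewrite (_ : _ - _ = (odd k')%:R * (side n / 2)); last by field.
  rewrite ger0_norm; last by rewrite mulr_ge0// divr_ge0// ltW.
  have : (odd k')%:R <= 1 :> R by rewrite (ler_nat R _ 1) leq_b1.
  by move=> h; have := ler_wpM2r (ltW sp) h; lra.
have bz' := box_sub (H x0 i i' hi') (H y0 j j' hj') bz.
have U := upper_of_bad hi hj bd pq bz'.
apply: (@le_trans _ _ (`|jetP s p q z| * side n ^+ (p + q))).
  rewrite ler_wpM2l// lerXn2r ?nnegrE ?(ltW (sg _))// sS.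
  by rewrite ler_pdivrMr// ler_peMr ?(ltW sp)// ler1n.
apply: (le_trans U); rewrite le_eqVlt; apply/orP; left; apply/eqP.
by rewrite /child_bound scaleS -/b; field; rewrite expf_neq0.
Qed.

Lemma child_lower n i j : ~~ badsq n i j ->
  lower (xg n i) (yg n j) (side n) (scale n) c s a.
Proof.
move=> /asboolPn nb z bz; apply: contrapT => h; apply: nb; exists z => // p q pq.
by rewrite ltNge; apply/negP => h'; apply: h; exists p, q.
Qed.

Section Sums.
Variables (f1 f2 f3 : R -> R).
Hypotheses (b1 : bmeas size1 f1) (b2 : bmeas size1 f2) (b3 : bmeas size1 f3).

Definition cell o n f i := cut f (xgrid o d n i) (xgrid o d n i.+1).
Definition cell2 o n f i := cut f (xgrid o d n i) (xgrid o d n i.+2).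
Definition piece n i j := Tri S A0 (cell x0 n f1 i) (cell y0 n f2 j) f3.
Definition weight n i j :=
  nrm (cell x0 n f1 i) * nrm (cell y0 n f2 j) * nrm (cell2 (x0 + y0) n f3 (i + j)).

Lemma bmeas_cell o n f i : bmeas size1 f -> bmeas size1 (cell o n f i).
Proof. exact: bmeas_cut. Qed.

Lemma weight_ge0 n i j : 0 <= weight n i j.
Proof. by rewrite /weight !mulr_ge0// nrm_ge0. Qed.

Lemma xgrid_double o n i : xgrid o d n.+1 i.*2 = xgrid o d n i.
Proof. by rewrite /xgrid sideS -mul2n natrM; field. Qed.

Lemma xgrid_le o n i j : (i <= j)%N -> xgrid o d n i <= xgrid o d n j.
Proof. by move=> ij; rewrite /xgrid lerD2l ler_wpM2r ?ler_nat// ltW. Qed.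

Lemma cell_split o n f i : cell o n f i =
  (fun x => cell o n.+1 f i.*2 x + cell o n.+1 f i.*2.+1 x).
Proof.
rewrite /cell -(xgrid_double o n i) -(xgrid_double o n i.+1) doubleS; apply: cut_split.
by rewrite !xgrid_le// ?leqnSn// ltnW.
Qed.

Lemma piece_split n i j : piece n i j =
  piece n.+1 i.*2 j.*2 + piece n.+1 i.*2 j.*2.+1 +
  (piece n.+1 i.*2.+1 j.*2 + piece n.+1 i.*2.+1 j.*2.+1).
Proof.
have bA := datum_bA dt; have mS := datum_meas dt.
have c1 := fun o n i => bmeas_cell o n i b1; have c2 := fun o n i => bmeas_cell o n i b2.
rewrite /piece (cell_split x0 n f1 i) (cell_split y0 n f2 j).
rewrite (Tri_add1 mS bA) //; last by apply: bmeasD.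
by rewrite !(Tri_add2 mS bA).
Qed.

Lemma cell_child o n f i' x : cell o n.+1 f i' x != 0 ->
  xgrid o d n i'./2 <= x < xgrid o d n (i'./2).+1.
Proof.
move=> /cut_neq0[/andP[h1 h2] _].
have e : ((i'./2).*2 <= i' < (i'./2).+1.*2)%N.
  rewrite -{2 3}(odd_double_half i') doubleS leq_addl /=.
  by case: (odd i'); rewrite ?add0n ?add1n ltnS// leqnSn.
move: e => /andP[e1 e2].
rewrite -(xgrid_double o n i'./2) -(xgrid_double o n (i'./2).+1); apply/andP; split.
  by apply: le_trans h1; exact: xgrid_le.
by apply: lt_le_trans h2 _; exact: xgrid_le.
Qed.

(** The window for [f3] is that of the parent, so that the estimate for a child is measured by
    [weight n] of the parent. *)
Lemma piece_child_cut3 n i' j' : piece n.+1 i' j' =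
  Tri S A0 (cell x0 n.+1 f1 i') (cell y0 n.+1 f2 j') (cell2 (x0 + y0) n f3 (i'./2 + j'./2)).
Proof.
apply: eq_Int => x; apply: eq_Int => y; congr (_ * _).
have [->|n1] := eqVneq (cell x0 n.+1 f1 i' x) 0; first by rewrite !mul0r.
have [->|n2] := eqVneq (cell y0 n.+1 f2 j' y) 0; first by rewrite !mulr0 !mul0r.
congr (_ * _); rewrite /cell2 /cut /hind.
have /andP[h1 h2] := cell_child n1; have /andP[h3 h4] := cell_child n2.
suff -> : (xgrid (x0 + y0) d n (i'./2 + j'./2) <= x + y) && (x + y < xgrid (x0 + y0) d n (i'./2 + j'./2).+2) by rewrite mul1r.
move: h1 h2 h3 h4; rewrite /xgrid -!natr1 natrD; set X := (_./2)%:R; set Y := (_./2)%:R.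
by move=> *; apply/andP; split; lra.
Qed.

Lemma nrm_cell_child o n f i' : bmeas size1 f -> nrm (cell o n.+1 f i') <= nrm (cell o n f i'./2).
Proof.
move=> bf; apply: nrm_cut_sub => //.
  rewrite -xgrid_double xgrid_le//.
  by rewrite -{2}(odd_double_half i') leq_addl.
rewrite -[leRHS]xgrid_double xgrid_le//.
rewrite doubleS -{1}(odd_double_half i'); case: (odd i'); first by [].
by rewrite add0n leqnSn.
Qed.

Section Step.
Variables (C : R).
Hypothesis C0 : 0 <= C.
Hypothesis IH : forall x0 y0 d s S A0 A1 A2 mu kappa f1 f2 f3,
    0 < d -> 0 < mu -> datum x0 y0 d s S A0 A1 A2 BA ->
    upper x0 y0 d mu child_bound s a.+2 -> lower x0 y0 d mu c s a ->
    0 < kappa -> 1 <= kappa ^+ (2 * (a + 3)) * mu * d ^+ 3 ->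
    bmeas size1 f1 -> bmeas size1 f2 -> bmeas size1 f3 ->
    (forall x, f1 x != 0 -> x0 <= x < x0 + d) ->
    (forall y, f2 y != 0 -> y0 <= y < y0 + d) ->
    `|Tri S A0 f1 f2 f3| <= C * (Num.sqrt d * kappa) * (nrm f1 * nrm f2 * nrm f3).

Let suppc o n f i : forall x, cell o n f i x != 0 -> xgrid o d n i <= x < xgrid o d n i + side n.
Proof.
have -> : xgrid o d n i + side n = xgrid o d n i.+1 by rewrite /xgrid -natr1; ring.
by move=> x /cut_neq0[].
Qed.

Lemma child_estimate n i j i' j' kappa : (i < 2 ^ n)%N -> (j < 2 ^ n)%N ->
  i'./2 = i -> j'./2 = j -> badsq n i j -> ~~ badsq n.+1 i' j' ->
  0 < kappa -> 1 <= kappa ^+ (2 * (a + 3)) * scale n.+1 * side n.+1 ^+ 3 ->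
  `|piece n.+1 i' j'| <= C * (Num.sqrt (side n.+1) * kappa) * weight n i j.
Proof.
move=> hi hj ei ej bd nb k0 hk.
have half_lt k k' : (k < 2 ^ n)%N -> k'./2 = k -> (k' < 2 ^ n.+1)%N.
  move=> hk' e; rewrite expnS mul2n -(odd_double_half k') e.
  apply: (@leq_trans k.+1.*2); last by rewrite leq_double.
  by rewrite doubleS; case: (odd k'); rewrite ?add0n ?add1n ltnS// leqnSn.
have [gx gy] := grid_box x0 y0 d0 (half_lt i i' hi ei) (half_lt j j' hj ej).
have sd : side n.+1 <= d.
  rewrite -[leRHS](side_pow d n.+1) -[leLHS]mul1r ler_wpM2r ?(ltW (sg _))//.
  by rewrite -natrX ler1n expn_gt0.
have dt' := datum_sub (sg n.+1) sd BA0 gx gy dt.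
rewrite piece_child_cut3 ei ej.
have := IH (sg n.+1) (mg n.+1) dt' (child_upper hi hj bd ei ej) (child_lower nb) k0 hk
  (bmeas_cell x0 n.+1 i' b1) (bmeas_cell y0 n.+1 j' b2) (bmeas_cut _ _ b3)
  (@suppc x0 n.+1 f1 i') (@suppc y0 n.+1 f2 j') .
move=> h; apply: (le_trans (h (x0 + y0 + (i + j)%:R * side n) (x0 + y0 + (i + j).+2%:R * side n))).
apply: ler_wpM2l; first by rewrite !mulr_ge0 ?sqrtr_ge0// ltW.
rewrite /weight ler_pM ?mulr_ge0 ?nrm_ge0// ler_pM ?nrm_ge0//.
  by rewrite -ei; exact: nrm_cell_child.
by rewrite -ej; exact: nrm_cell_child.
Qed.

Definition badsum n := \sum_(i < 2 ^ n) \sum_(j < 2 ^ n) (if badsq n i j then `|piece n i j| else 0).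
Definition badweight n := \sum_(i < 2 ^ n) \sum_(j < 2 ^ n) (if badsq n i j then weight n i j else 0).

(** A bad square is cut into four. A bad child is handed on to the next level; a good child
    satisfies the induction hypothesis, the upper bounds coming from its bad parent and the lower
    bound from itself. *)
Lemma badsum_step n kappa : 0 < kappa ->
  1 <= kappa ^+ (2 * (a + 3)) * scale n.+1 * side n.+1 ^+ 3 ->
  badsum n <= badsum n.+1 + 4 * (C * (Num.sqrt (side n.+1) * kappa)) * badweight n.
Proof.
move=> k0 hk; set g := C * _.
have g0 : 0 <= g by rewrite /g !mulr_ge0 ?sqrtr_ge0// ltW.
pose X i j := if badsq n.+1 i j then `|piece n.+1 i j| else 0.
have X0 i j : 0 <= X i j by rewrite /X; case: ifP.
have -> : badsum n.+1 = \sum_(i < 2 ^ n) \sum_(j < 2 ^ n)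
    (X i.*2 j.*2 + X i.*2 j.*2.+1 + (X i.*2.+1 j.*2 + X i.*2.+1 j.*2.+1)).
  have -> : badsum n.+1 = \sum_(i < 2 ^ n.+1) \sum_(j < 2 ^ n.+1) X i j by [].
  by rewrite expnS mul2n sum_quad.
rewrite /badsum /badweight mulr_sumr -big_split /=; apply: ler_sum => i _.
rewrite mulr_sumr -big_split /=; apply: ler_sum => j _.
case: ifPn => [bd|_]; last by rewrite mulr0 addr0 !addr_ge0.
have H i' j' : i'./2 = i -> j'./2 = j -> `|piece n.+1 i' j'| <= X i' j' + g * weight n i j.
  move=> ei ej; rewrite /X; case: ifPn => [_|nb].
    by rewrite lerDl mulr_ge0 ?weight_ge0.
  by rewrite add0r; apply: child_estimate.
rewrite piece_split.
have e1 k : k.*2./2 = k by rewrite doubleK.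
have e2 k : k.*2.+1./2 = k by rewrite -[k.*2.+1]/(true + k.*2)%N half_bit_double.
rewrite -[4 * g * _]mulrA; apply: norm_sum4_le.
- exact: (H _ _ (e1 i) (e1 j)).
- exact: (H _ _ (e1 i) (e2 j)).
- exact: (H _ _ (e2 i) (e1 j)).
- exact: (H _ _ (e2 i) (e2 j)).
Qed.

Lemma badsum_iter (kap : nat -> R) (Wt T : R) J : (forall n, 0 < kap n) -> 0 <= Wt ->
  (forall n, badweight n <= T) ->
  (forall n, 1 <= kap n ^+ (2 * (a + 3)) * scale n * side n ^+ 3) ->
  badsum 0 <= badsum J + 4 * C * (\sum_(n < J) Num.sqrt (side n.+1) * kap n.+1) * T.
Proof.
move=> k0 W0 hT hk; elim: J => [|J ih]; first by rewrite big_ord0 mulr0 mul0r addr0.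
apply: (le_trans ih); rewrite big_ord_recr /=.
have h := badsum_step (k0 J.+1) (hk J.+1).
have q0 : 0 <= 4 * (C * (Num.sqrt (side J.+1) * kap J.+1)).
  by rewrite !mulr_ge0 ?sqrtr_ge0// ltW.
have h' := ler_wpM2l q0 (hT J).
by move: h h'; lra.
Qed.

End Step.

(** What is still bad at the last level is estimated without oscillation. *)
Lemma badsum_trivial n : badsum n <= BA * Num.sqrt (side n) * badweight n.
Proof.
rewrite /badsum /badweight mulr_sumr; apply: ler_sum => i _; rewrite mulr_sumr; apply: ler_sum => j _.
case: ifP => _; last by rewrite mulr0.
have [gx gy] := grid_box x0 y0 d0 (ltn_ord i) (ltn_ord j).
have cE : piece n i j = Tri S A0 (cell x0 n f1 i) (cell y0 n f2 j) (cell2 (x0 + y0) n f3 (i + j)).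
  apply: eq_Int => x; apply: eq_Int => y; congr (_ * _).
  have [->|n1] := eqVneq (cell x0 n f1 i x) 0; first by rewrite !mul0r.
  have [->|n2] := eqVneq (cell y0 n f2 j y) 0; first by rewrite !mulr0 !mul0r.
  congr (_ * _); rewrite /cell2 /cut /hind.
  have [/andP[h1 h2] _] := cut_neq0 n1; have [/andP[h3 h4] _] := cut_neq0 n2.
  suff -> : (xgrid (x0 + y0) d n (i + j) <= x + y) && (x + y < xgrid (x0 + y0) d n (i + j).+2) by rewrite mul1r.
  move: h1 h2 h3 h4; rewrite /xgrid -!natr1 natrD.
  by move=> *; apply/andP; split; lra.
rewrite cE; apply: (Tri_trivial (x0 := xg n i) (datum_meas dt) (datum_bA dt) (ltW (sg n)) BA0 (bmeas_cell _ _ _ b1) (bmeas_cell _ _ _ b2) (bmeas_cut _ _ b3)).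
  move=> x /cut_neq0[/andP[h1 /ltW h2] _]; rewrite h1 /=; apply: (le_trans h2).
  by rewrite /xgrid -natr1; lra.
move=> x y /cut_neq0[/andP[h1 h2] _] /cut_neq0[/andP[h3 h4] _].
have sp := sg n.
have [bx by_] : box x0 y0 (3 * d) (x, y).
  apply: (box_sub gx gy); split; rewrite /= ler_norml;
    [move: h1 h2|move: h3 h4]; rewrite /ygrid /xgrid -natr1 => *; apply/andP; split; lra.
apply: (amp_u (datum_amp dt by_)).
by move: bx; rewrite /= ler_norml => /andP[? ?]; apply/andP; split; lra.
Qed.

Variables (c1 : R) (M : nat).
Hypotheses (c10 : 0 < c1) (hM : 2 * c + 12 * B <= c1 * M%:R).

(** Two steep directions leave at most [M.+1] bad squares on each line of two families. The norms
    attached to these families are summed by Cauchy-Schwarz, the third is bounded by its total; the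
    2 accounts for the overlapping windows of [f3]. *)
Lemma badweight_le n : two_steep a x0 y0 d mu s c1 ->
  badweight n <= 2 * M.+1%:R * (nrm f1 * nrm f2 * nrm f3).
Proof.
move=> steep; rewrite /badweight pair_big /= -big_mkcond /=.
set P : pred ('I_(2 ^ n) * 'I_(2 ^ n)) := fun z => badsq n z.1 z.2.
pose al (i : 'I_(2 ^ n)) : R := nrm (cell x0 n f1 i).
pose be (i : 'I_(2 ^ n)) : R := nrm (cell y0 n f2 i).
pose ga (k : 'I_(2 ^ n + 2 ^ n).+1) : R := nrm (cell2 (x0 + y0) n f3 k).
pose ky (z : 'I_(2 ^ n) * 'I_(2 ^ n)) : 'I_(2 ^ n + 2 ^ n).+1 := inord (z.1 + z.2).
have kyE z : ky z = (z.1 + z.2)%N :> nat.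
  by rewrite /ky inordK// ltnS leq_add// ltnW.
have al0 i : 0 <= al i by exact: nrm_ge0.
have be0 i : 0 <= be i by exact: nrm_ge0.
have ga0 i : 0 <= ga i by exact: nrm_ge0.
have n1 := nrm_ge0 f1; have n2 := nrm_ge0 f2; have n3 := nrm_ge0 f3.
have sal : \sum_i al i ^+ 2 <= nrm f1 ^+ 2.
  rewrite nrm_sqr; apply: le_trans (energy_grid_le x0 (2 ^ n) b1 (ltW (sg n))).
  by apply: ler_sum => i _; rewrite nrm_sqr.
have sbe : \sum_i be i ^+ 2 <= nrm f2 ^+ 2.
  rewrite nrm_sqr; apply: le_trans (energy_grid_le y0 (2 ^ n) b2 (ltW (sg n))).
  by apply: ler_sum => i _; rewrite nrm_sqr.
have sga : \sum_i ga i ^+ 2 <= (2 * nrm f3) ^+ 2.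
  rewrite exprMn nrm_sqr.
  apply: (@le_trans _ _ (2 * energy f3)); last by have := energy_ge0 f3; lra.
  apply: le_trans (energy_grid2_le (x0 + y0) (2 ^ n + 2 ^ n).+1 b3 (ltW (sg n))).
  by apply: ler_sum => i _; rewrite nrm_sqr.
have wE (z : 'I_(2 ^ n) * 'I_(2 ^ n)) : weight n z.1 z.2 = al z.1 * be z.2 * ga (ky z) by rewrite /weight /ga kyE.
have alu i : al i <= nrm f1 by exact: nrm_cut_le.
have beu i : be i <= nrm f2 by exact: nrm_cut_le.
have gau i : ga i <= nrm f3 by exact: nrm_cut_le.
have M0 : 0 <= M.+1%:R :> R by [].
have rows : steepx a x0 y0 d mu s c1 -> forall x, (#|[pred z | P z & z.2 == x]| <= M.+1)%N.
  move=> sx x; apply: (card_spread (w := fun z : 'I_(2 ^ n) * 'I_(2 ^ n) => z.1 : nat)).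
    move=> [i j] [i' j'] /andP[_ /eqP /= ->] /andP[_ /eqP /= ->] /val_inj /= -> //.
  move=> [i j] [i' j'] /andP[h1 /eqP /= e1] /andP[h2 /eqP /= e2].
  rewrite /P /= in h1 h2; rewrite e1 in h1; rewrite e2 in h2.
  exact: (bad_spread_rows d0 mu0 dt up c10 hM sx (ltn_ord i) (ltn_ord i') (ltn_ord x) h1 h2).
have cols : steepy a x0 y0 d mu s c1 -> forall x, (#|[pred z | P z & z.1 == x]| <= M.+1)%N.
  move=> sx x; apply: (card_spread (w := fun z : 'I_(2 ^ n) * 'I_(2 ^ n) => z.2 : nat)).
    move=> [i j] [i' j'] /andP[_ /eqP /= ->] /andP[_ /eqP /= ->] /val_inj /= -> //.
  move=> [i j] [i' j'] /andP[h1 /eqP /= e1] /andP[h2 /eqP /= e2].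
  rewrite /P /= in h1 h2; rewrite e1 in h1; rewrite e2 in h2.
  exact: (bad_spread_cols d0 mu0 dt up c10 hM sx (ltn_ord x) (ltn_ord j) (ltn_ord j') h1 h2).
have diags : steepd a x0 y0 d mu s c1 -> forall x, (#|[pred z | P z & ky z == x]| <= M.+1)%N.
  move=> sx x; apply: (card_spread (w := fun z : 'I_(2 ^ n) * 'I_(2 ^ n) => z.1 : nat)).
    move=> z z' /andP[_ /eqP h1] /andP[_ /eqP h2] e.
    have := kyE z; have := kyE z'; rewrite h1 h2 => -> /eqP; rewrite e eqn_add2l => /eqP e2.
    by case: z z' e e2 {h1 h2} => [i j] [i' j'] /= /val_inj -> /val_inj ->.
  move=> z z' /andP[h1 /eqP e1] /andP[h2 /eqP e2].
  have e : (z.1 + z.2 = z'.1 + z'.2)%N by rewrite -!kyE e1 e2.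
  exact: (bad_spread_diags d0 mu0 dt up c10 hM sx (ltn_ord z.1) (ltn_ord z'.1) (ltn_ord z.2) (ltn_ord z'.2) e h1 h2).
case: steep => -[h1 h2].
- apply: (@le_trans _ _ (nrm f3 * \sum_(z | P z) al z.1 * be z.2)).
    rewrite mulr_sumr; apply: ler_sum => z _; rewrite wE mulrC ler_wpM2r ?mulr_ge0//.
  have h := spread_sum_le al0 be0 n1 n2 sal sbe (cols h2) (rows h1).
  apply: (le_trans (ler_wpM2l n3 h)).
  have := mulr_ge0 M0 (mulr_ge0 (mulr_ge0 n1 n2) n3); lra.
- apply: (@le_trans _ _ (nrm f1 * \sum_(z | P z) be z.2 * ga (ky z))).
    rewrite mulr_sumr; apply: ler_sum => z _; rewrite wE -mulrA ler_wpM2r ?mulr_ge0//.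
  have n3' : 0 <= 2 * nrm f3 by rewrite mulr_ge0.
  have h := spread_sum_le be0 ga0 n2 n3' sbe sga (rows h1) (diags h2).
  apply: (le_trans (ler_wpM2l n1 h)).
  by rewrite le_eqVlt; apply/orP; left; apply/eqP; ring.
- apply: (@le_trans _ _ (nrm f2 * \sum_(z | P z) al z.1 * ga (ky z))).
    rewrite mulr_sumr; apply: ler_sum => z _; rewrite wE [al _ * _]mulrC -mulrA ler_wpM2r ?mulr_ge0//.
  have n3' : 0 <= 2 * nrm f3 by rewrite mulr_ge0.
  have h := spread_sum_le al0 ga0 n1 n3' sal sga (cols h1) (diags h2).
  apply: (le_trans (ler_wpM2l n2 h)).
  by rewrite le_eqVlt; apply/orP; left; apply/eqP; ring.
Qed.

End Sums.
End Roots.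
End TreeSums.

(** * The induction step and its conclusion *)

Section DecayInduction.
Context {R : realType}.
Implicit Types (s : nat -> nat -> R * R -> R) (S A : R * R -> R) (f : R -> R).

Lemma le_truncnS (x : R) : x <= (Num.truncn x).+1%:R.
Proof. by apply: ltW; apply: truncnS_gt. Qed.

Lemma near_corner (o x l : R) : 0 < l -> o <= x -> x < o + l ->
  `|x - o| <= 3 * l /\ o - 3 * l <= x <= o + 3 * l.
Proof. by move=> *; rewrite ler_norml; split; apply/andP; split; lra. Qed.

(** Take [kap n = w n ^+ (a + 4)] with [w n ^+ e = kappa ^+ 2 * 2 ^+ n]. The condition of the lower
    case then holds by the condition on [kappa], and [sqrt (side d n) * kap n = sqrt d * kappa * w
    n] grows with ratio [rho]. The depth [J] is where [kappa ^+ 2 * 2 ^+ J] lies between 1 and 2: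
    there [w J <= 2], which bounds the geometric sum, and [sqrt (side d J) <= sqrt d * kappa]. *)
Lemma tree_weights a (rho d mu kappa : R) : 1 < rho -> rho ^+ (2 * (a + 3)) = 2 ->
  0 < d -> 0 < mu -> 0 < kappa -> kappa < 1 -> 1 <= kappa ^+ (2 * (a.+1 + 3)) * mu * d ^+ 3 ->
  exists (kap : nat -> R) J, [/\ forall n, 0 < kap n,
    forall n, 1 <= kap n ^+ (2 * (a + 3)) * scale a mu n * side d n ^+ 3,
    \sum_(n < J) Num.sqrt (side d n.+1) * kap n.+1 <= 2 * rho / (rho - 1) * (Num.sqrt d * kappa),
    Num.sqrt (side d J) <= Num.sqrt d * kappa &
    Num.sqrt d * kap 0%N <= 2 * (Num.sqrt d * kappa)].
Proof.
move=> rho1 rhoe d0 mu0 k0 k1 hk; set e := (2 * (a + 3))%N in rhoe *.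
have e0 : (0 < e)%N by rewrite /e muln_gt0 addn_gt0 orbT.
have k20 : 0 < kappa ^+ 2 by rewrite exprn_gt0.
have k21 : kappa ^+ 2 < 1 by rewrite exprn_ilt1// ltW.
have [w0 w0p w0e] := nth_root_ex e0 k20.
have [J [J1 J2]] := dyadic_level k20 k21.
have rho0 : 0 < rho by exact: lt_trans rho1.
pose w n := w0 * rho ^+ n.
have wp n : 0 < w n by rewrite mulr_gt0// exprn_gt0.
have we n : w n ^+ e = kappa ^+ 2 * 2 ^+ n.
  by rewrite /w exprMn w0e -exprM mulnC exprM rhoe.
have s0 := sqrtr_ge0 d; have sd0 : 0 <= Num.sqrt d * kappa by rewrite mulr_ge0// ltW.
have kw n : Num.sqrt (side d n) * w n ^+ (a + 4) = Num.sqrt d * kappa * w n.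
  have n2 : 2 ^+ n != 0 :> R by rewrite expf_neq0.
  have p1 : 0 <= Num.sqrt (side d n) * w n ^+ (a + 4) by rewrite mulr_ge0 ?sqrtr_ge0 ?exprn_ge0 ?ltW.
  have p2 : 0 <= Num.sqrt d * kappa * w n by rewrite mulr_ge0// ltW.
  apply/eqP; rewrite -(@eqrXn2 _ 2)//; apply/eqP.
  have -> : (Num.sqrt (side d n) * w n ^+ (a + 4)) ^+ 2 = side d n * (w n ^+ e * w n ^+ 2).
    rewrite exprMn sqr_sqrtr; last exact: ltW (side_gt0 d0 n).
    by rewrite -exprM -exprD; congr (_ * _ ^+ _); rewrite mulnC /e !mulnDr -addnA.
  have -> : (Num.sqrt d * kappa * w n) ^+ 2 = d * kappa ^+ 2 * w n ^+ 2.
    by rewrite 2!exprMn sqr_sqrtr// ltW.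
  by rewrite we /side; field.
have wJ : w J <= 2.
  rewrite leNgt; apply/negP => h; move: J2; rewrite -we ltNge => /negP; apply.
  apply: (@le_trans _ _ (2 ^+ e)); last by rewrite lerXn2r ?nnegrE// ltW.
  by rewrite -{1}(expr1 2) ler_weXn2l ?ler1n.
exists (fun n => w n ^+ (a + 4)), J; split.
- by move=> n; rewrite exprn_gt0.
- move=> n; rewrite -exprM mulnC exprM we exprMn /scale /side.
  rewrite -exprM -mulrA expr_div_n mulrA.
  rewrite (_ : _ * _ = kappa ^+ (2 * (a.+1 + 3)) * mu * d ^+ 3)//.
  rewrite -!exprM !addSn !addnS addn0.
  have -> : (n * a.+4 = n * a.+1 + n * 3)%N by rewrite -mulnDr addn3.
  by rewrite exprD; field; rewrite !expf_neq0.
- rewrite (eq_bigr (fun n : 'I_J => Num.sqrt d * kappa * w n.+1)); last by move=> n _; exact: kw.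
  rewrite -mulr_sumr mulrC ler_wpM2r//.
  have r1 : 0 < rho - 1 by rewrite subr_gt0.
  rewrite ler_pdivlMr//.
  have -> : (\sum_(n < J) w n.+1) * (rho - 1) = rho * (w J - w 0%N).
    rewrite mulr_suml; elim: (J) => [|j ih]; first by rewrite big_ord0 subrr mulr0.
    by rewrite big_ord_recr /= ih /w !exprS; ring.
  by rewrite mulrC; apply: ler_wpM2r; rewrite ?(ltW rho0)//; have := wp 0%N; lra.
- rewrite -ler_sqr ?nnegrE ?sqrtr_ge0// exprMn !sqr_sqrtr ?(ltW d0) ?(ltW (side_gt0 _ _))//.
  by rewrite /side ler_pdivrMr ?exprn_gt0// -mulrA ler_peMr// ltW.
- have := kw 0%N; rewrite /side expr0 divr1 => ->; rewrite mulrC ler_wpM2r//.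
  apply: le_trans wJ; rewrite /w expr0 mulr1 ler_peMr ?(ltW w0p)//.
  by rewrite exprn_ege1// ltW.
Qed.

(** Badness is taken with threshold 1. If the whole square is good, the lower case applies to it
    directly; otherwise the bad sums are followed down to level [J] and closed with the trivial
    bound. *)
Lemma tree_bound a : @decay R a -> forall B c2 BA : R, 0 <= B -> 0 < c2 -> 0 <= BA ->
  exists2 C, 0 <= C & forall x0 y0 d s S A0 A1 A2 mu kappa f1 f2 f3,
    0 < d -> 0 < mu -> datum x0 y0 d s S A0 A1 A2 BA ->
    upper x0 y0 d mu B s a.+3 -> two_steep a x0 y0 d mu s (c2 / 4) ->
    0 < kappa -> kappa < 1 -> 1 <= kappa ^+ (2 * (a.+1 + 3)) * mu * d ^+ 3 ->
    bmeas size1 f1 -> bmeas size1 f2 -> bmeas size1 f3 ->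
    (forall x, f1 x != 0 -> x0 <= x < x0 + d) ->
    (forall y, f2 y != 0 -> y0 <= y < y0 + d) ->
    `|Tri S A0 f1 f2 f3| <= C * (Num.sqrt d * kappa) * (nrm f1 * nrm f2 * nrm f3).
Proof.
move=> IHa B c2 BA B0 c20 BA0.
have c10 : 0 < c2 / 4 by rewrite divr_gt0.
have cb0 : 0 <= child_bound a B 1 by rewrite /child_bound !mulr_ge0 ?addr_ge0 ?exprn_ge0.
have [C C0 HC] := IHa _ _ _ cb0 (ltr01 : 0 < 1 :> R) BA0.
have [M hM] : exists M : nat, 2 * 1 + 12 * B <= c2 / 4 * M%:R.
  exists (Num.truncn ((2 * 1 + 12 * B) / (c2 / 4))).+1.
  by rewrite [leRHS]mulrC -ler_pdivrMr//; exact: le_truncnS.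
have e0 : (0 < 2 * (a + 3))%N by rewrite muln_gt0 addn_gt0 orbT.
have [rho rho0 rhoe] := nth_root_ex e0 (ltr0n R 2).
have rho1 : 1 < rho.
  rewrite ltNge; apply/negP => h; have : rho ^+ (2 * (a + 3)) <= 1 by rewrite exprn_ile1// ltW.
  by rewrite rhoe lern1.
pose W := 2 * rho / (rho - 1).
have W0 : 0 <= W by rewrite divr_ge0 ?subr_ge0 ?mulr_ge0 ?(ltW rho0) ?(ltW rho1).
pose T0 : R := 2 * M.+1%:R.
have T00 : 0 <= T0 by rewrite mulr_ge0.
exists (2 * C + BA * T0 + 4 * C * W * T0).
  by apply: addr_ge0; [apply: addr_ge0; apply: mulr_ge0|do 2 (apply: mulr_ge0 => //); apply: mulr_ge0].
move=> x0 y0 d s S A0 A1 A2 mu kappa f1 f2 f3 d0 mu0 dt up steep k0 k1 hk b1 b2 b3 s1 s2.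
have [kap [J [kap0 kape ksum kJ kap00]]] := tree_weights rho1 rhoe d0 mu0 k0 k1 hk.
set Pi := nrm f1 * nrm f2 * nrm f3.
have Pi0 : 0 <= Pi by rewrite !mulr_ge0 ?nrm_ge0.
set sk := Num.sqrt d * kappa in ksum kJ kap00 *.
have sk0 : 0 <= sk by rewrite mulr_ge0 ?sqrtr_ge0 ?ltW.
have whole o f : (forall x, f x != 0 -> o <= x < o + d) -> cell d o 0 f 0 = f.
  move=> sf; apply/funext => x; rewrite /cell /cut /hind /xgrid /side expr0 divr1 mul0r addr0 mul1r.
  have [->|fx] := eqVneq (f x) 0; first by rewrite mulr0.
  by rewrite (sf x fx) mul1r.
have pE : piece x0 y0 d S A0 f1 f2 f3 0 0 0 = Tri S A0 f1 f2 f3.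
  by rewrite /piece !whole.
have BS0 := badweight_le d0 mu0 dt up b1 b2 b3 c10 hM ^~ steep.
rewrite -/Pi in BS0.
have rest : 0 <= (BA * T0 + 4 * C * W * T0) * sk * Pi.
  apply: (mulr_ge0 _ Pi0); apply: (mulr_ge0 _ sk0); apply: (addr_ge0 (mulr_ge0 BA0 T00)).
  exact: (mulr_ge0 (mulr_ge0 (mulr_ge0 (ler0n _ 4) C0) W0) T00).
have [bd|nbd] := boolP (bad a x0 y0 d mu 1 s 0 0 0); last first.
  have side0 : side d 0 = d by rewrite /side expr0 divr1.
  have scale0 : scale a mu 0 = mu by rewrite /scale mul0n expr0 divr1.
  have lo := child_lower nbd.
  rewrite /ygrid /xgrid !mul0r !addr0 side0 scale0 in lo.
  have up' : upper x0 y0 d mu (child_bound a B 1) s a.+2.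
    move=> p q z pq bz; apply: (le_trans (up p q z (leqW pq) bz)).
    apply: (ler_wpM2r (ltW mu0)); rewrite /child_bound -mulrA.
    have e1 : 1 <= 13 ^+ a.+1 * 2 ^+ a.+1 :> R by apply: mulr_ege1; apply: exprn_ege1; rewrite ler1n.
    apply: (@le_trans _ _ (B + 1)); first by rewrite lerDl.
    exact: (ler_peMr (addr_ge0 B0 ler01) e1).
  have kape0 := kape 0%N; rewrite scale0 side0 in kape0.
  have := HC _ _ _ _ _ _ _ _ _ _ f1 f2 f3 d0 mu0 dt up' lo (kap0 0%N) kape0 b1 b2 b3 s1 s2.
  move=> h; apply: (le_trans h); rewrite -/Pi.
  have h1 := ler_wpM2r Pi0 (ler_wpM2l C0 kap00).
  by move: h1 rest; lra.
have start : `|Tri S A0 f1 f2 f3| <= badsum a x0 y0 d mu 1 s S A0 f1 f2 f3 0.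
  by rewrite /badsum expn0 !big_ord1 /= bd pE.
have hT n : badweight a x0 y0 d mu 1 s f1 f2 f3 n <= T0 * Pi by exact: BS0.
have it := badsum_iter d0 mu0 B0 ltr01 BA0 dt up b1 b2 b3 C0 HC J kap0 W0 hT kape.
apply: (le_trans start); apply: (le_trans it).
have triv := badsum_trivial a mu 1 d0 BA0 dt b1 b2 b3 J.
have sJ0 : 0 <= Num.sqrt (side d J) by exact: sqrtr_ge0.
have t1 : badsum a x0 y0 d mu 1 s S A0 f1 f2 f3 J <= BA * sk * (T0 * Pi).
  apply: (le_trans triv); apply: (le_trans (ler_wpM2l _ (hT J))); first by rewrite mulr_ge0.
  by apply: ler_wpM2r; [rewrite mulr_ge0|rewrite ler_wpM2l].
have C4 : 0 <= 4 * C by rewrite mulr_ge0.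
have TP : 0 <= T0 * Pi by rewrite mulr_ge0.
have t2 := ler_wpM2r TP (ler_wpM2l C4 ksum).
apply: (le_trans (lerD t1 t2)); rewrite -/W.
have : 0 <= 2 * C * sk * Pi := mulr_ge0 (mulr_ge0 (mulr_ge0 (ler0n _ 2) C0) sk0) Pi0.
by lra.
Qed.

Lemma sum_pieces n : forall (x0 y0 d BA : R) s S A0 A1 A2 f1 f2 f3,
  0 < d -> datum x0 y0 d s S A0 A1 A2 BA ->
  bmeas size1 f1 -> bmeas size1 f2 -> bmeas size1 f3 ->
  piece x0 y0 d S A0 f1 f2 f3 0 0 0 =
  \sum_(i < 2 ^ n) \sum_(j < 2 ^ n) piece x0 y0 d S A0 f1 f2 f3 n i j.
Proof.
move=> x0 y0 d BA s S A0 A1 A2 f1 f2 f3 d0 dt b1 b2 b3.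
elim: n => [|n ->]; first by rewrite expn0 !big_ord1.
rewrite expnS mul2n (sum_quad (piece x0 y0 d S A0 f1 f2 f3 n.+1)).
by apply: eq_bigr => i _; apply: eq_bigr => j _; exact: (piece_split d0 dt b1 b2 b3).
Qed.

(** The 6 is twice the half-side 3 of the small box, once for each coordinate. *)
Lemma jetP_variation (x0 y0 d dl x1 y1 mu B : R) s k p q z z' : 0 < d -> 0 < dl ->
  jet (box x0 y0 (3 * d)) s -> upper x0 y0 d mu B s k -> (p + q < k)%N ->
  box x1 y1 (3 * dl) `<=` box x0 y0 (3 * d) ->
  box x1 y1 (3 * dl) z -> `|z'.1 - z.1| <= 3 * dl -> `|z'.2 - z.2| <= 3 * dl ->
  box x1 y1 (3 * dl) z' ->
  `|jetP s p q z' - jetP s p q z| * d ^+ (p + q) <= 6 * B * mu * (dl / d).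
Proof.
move=> d0 dl0 js up pk sub bz h1 h2 bz'.
pose K := B * mu / d ^+ (p + q).+1.
have K1 w : box x1 y1 (3 * dl) w -> `|jetP s p.+1 q w| <= K.
  by move=> /sub bw; rewrite /K ler_pdivlMr ?exprn_gt0// -addSn; apply: up.
have K2 w : box x1 y1 (3 * dl) w -> `|jetP s p q.+1 w| <= K.
  by move=> /sub bw; rewrite /K ler_pdivlMr ?exprn_gt0// -addnS; apply: up => //; rewrite addnS.
have K0 : 0 <= K by apply: le_trans (K1 z bz).
have m := mvt_box (jet_sub sub (jetP_jet js)) K1 K2 bz bz'.
have m' : `|jetP s p q z' - jetP s p q z| <= 6 * dl * K.
  apply: (le_trans m); apply: (le_trans (lerD (ler_wpM2r K0 h1) (ler_wpM2r K0 h2))).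
  by rewrite le_eqVlt; apply/orP; left; apply/eqP; ring.
have dp : 0 < d ^+ (p + q) by rewrite exprn_gt0.
apply: (le_trans (ler_wpM2r (ltW dp) m')).
rewrite le_eqVlt; apply/orP; left; apply/eqP.
by rewrite /K exprS; field; rewrite expf_neq0 ?gt_eqF.
Qed.

(** A fixed subdivision makes the derivatives of order at most [b] nearly constant on each small
    square. A derivative large at the centre of the box then decides: order [b] leads to the tree, a
    smaller order to the induction hypothesis. *)
Lemma decayS a : @decay R a -> @decay R a.+1.
Proof.
move=> IHa B c BA B0 c0 BA0; set b := a.+1.
(* [96 = 6 * 16]: on the small squares the normalised derivatives vary by at most
   [6 * B * mu / 2 ^+ n], which should not exceed [c / 16 * mu]. *)
pose n := Num.truncn (96 * B / c).
have hn : 96 * B <= c * 2 ^+ n.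
  rewrite [leRHS]mulrC -ler_pdivrMr//; apply: (@le_trans _ _ n.+1%:R); first exact: le_truncnS.
  by rewrite -natrX ler_nat ltn_expl.
have n20 : 0 < 2 ^+ n :> R by rewrite exprn_gt0.
have n21 : 1 <= 2 ^+ n :> R by rewrite exprn_ege1// ler1n.
pose c' := c / 2 ^+ (n * b).
have c'0 : 0 < c' by rewrite divr_gt0// exprn_gt0.
have c'2 : 0 < c' / 2 by rewrite divr_gt0.
have [C1 C10 H1] := tree_bound IHa B0 c'0 BA0.
have [C2 C20 H2] := IHa B (c' / 2) BA B0 c'2 BA0.
pose C := BA + C1 + C2.
have C0 : 0 <= C by rewrite !addr_ge0.
have [BAC C1C C2C] : [/\ BA <= C, C1 <= C & C2 <= C] by rewrite /C; split; lra.
exists ((2 ^ n)%:R * ((2 ^ n)%:R * (C * 2 ^+ n))); first by rewrite !mulr_ge0// ltW.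
move=> x0 y0 d s S A0 A1 A2 mu kappa f1 f2 f3 d0 mu0 dt up lo k0 hk b1 b2 b3 s1 s2.
have js := datum_jet dt.
pose dl := side d n; have dl0 : 0 < dl by exact: side_gt0.
have dln : 2 ^+ n * dl = d by exact: side_pow.
have dld : dl <= d by rewrite -dln ler_peMl// ltW.
have dlq : dl / d = (2 ^+ n)^-1 by rewrite /dl /side; field; rewrite ?(gt_eqF d0) ?(gt_eqF n20).
(* The factor [2 ^+ n] compensates for the smaller side, since the exponent of [kappa] exceeds 3. *)
pose kap := kappa * 2 ^+ n; have kap0 : 0 < kap by rewrite mulr_gt0.
have hkap : 1 <= kap ^+ (2 * (b + 3)) * mu * dl ^+ 3.
  apply: (le_trans hk).
  have h : (2 ^+ n) ^+ 3 <= (2 ^+ n) ^+ (2 * (b + 3)) :> R.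
    by rewrite ler_weXn2l// mulnDr (leq_trans _ (leq_addl _ _)).
  have -> : d ^+ 3 = (2 ^+ n) ^+ 3 * dl ^+ 3 by rewrite -dln; exact: exprMn.
  have -> : kap ^+ (2 * (b + 3)) = kappa ^+ (2 * (b + 3)) * (2 ^+ n) ^+ (2 * (b + 3)) by exact: exprMn.
  rewrite -/b; move: h; set X := (2 ^+ n) ^+ 3; set Y := (2 ^+ n) ^+ (2 * (b + 3)) => h.
  have p0 : 0 <= kappa ^+ (2 * (b + 3)) * mu * dl ^+ 3.
    by rewrite !mulr_ge0 ?exprn_ge0 ?ltW.
  have E := ler_wpM2l p0 h; move: E; set Z := kappa ^+ _; set L := dl ^+ 3 => E.
  by apply: (le_trans _ (le_trans E _)); rewrite le_eqVlt; apply/orP; left; apply/eqP; ring.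
have sq (i j : 'I_(2 ^ n)) : `|piece x0 y0 d S A0 f1 f2 f3 n i j| <=
    C * (Num.sqrt dl * kap) * (nrm f1 * nrm f2 * nrm f3).
  have [gx gy] := grid_box x0 y0 d0 (ltn_ord i) (ltn_ord j).
  have sub := box_sub gx gy; rewrite -/dl in gx gy sub.
  set x1 := xgrid x0 d n i in gx sub; set y1 := ygrid y0 d n j in gy sub.
  have dt' := datum_sub dl0 dld BA0 gx gy dt.
  have bc1 := bmeas_cell d x0 n i b1; have bc2 := bmeas_cell d y0 n j b2.
  have supp o f k x : cell d o n f k x != 0 -> xgrid o d n k <= x < xgrid o d n k + dl.
    have -> : xgrid o d n k + dl = xgrid o d n k.+1 by rewrite /xgrid /dl -natr1; ring.
    by move=> /cut_neq0[].
  have sc1 : forall x, cell d x0 n f1 i x != 0 -> x1 <= x < x1 + dl := @supp x0 f1 i.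
  have sc2 : forall y, cell d y0 n f2 j y != 0 -> y1 <= y < y1 + dl := @supp y0 f2 j.
  have nn : nrm (cell d x0 n f1 i) * nrm (cell d y0 n f2 j) * nrm f3 <= nrm f1 * nrm f2 * nrm f3.
    rewrite ler_wpM2r ?nrm_ge0// ler_pM ?nrm_ge0//; exact: nrm_cut_le.
  have sdk : 0 <= Num.sqrt dl * kap by rewrite mulr_ge0 ?sqrtr_ge0 ?ltW.
  have nn0 : 0 <= nrm (cell d x0 n f1 i) * nrm (cell d y0 n f2 j) * nrm f3 by rewrite !mulr_ge0 ?nrm_ge0.
  suff key : `|piece x0 y0 d S A0 f1 f2 f3 n i j| <= C * (Num.sqrt dl * kap) *
      (nrm (cell d x0 n f1 i) * nrm (cell d y0 n f2 j) * nrm f3).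
    by apply: (le_trans key); rewrite ler_wpM2l// mulr_ge0.
  have fin C' : 0 <= C' -> C' <= C -> `|piece x0 y0 d S A0 f1 f2 f3 n i j| <= C' * (Num.sqrt dl * kap) *
      (nrm (cell d x0 n f1 i) * nrm (cell d y0 n f2 j) * nrm f3) ->
      `|piece x0 y0 d S A0 f1 f2 f3 n i j| <= C * (Num.sqrt dl * kap) *
      (nrm (cell d x0 n f1 i) * nrm (cell d y0 n f2 j) * nrm f3).
    by move=> c1 c2 h; apply: (le_trans h); rewrite ler_wpM2r// ler_wpM2r.
  (* For [kap >= 1] the trivial bound is enough; [kap < 1] is needed by [tree_bound] and for
     comparing powers below. *)
  have [kap1|kap1] := leP 1 kap.
    apply: (fin BA BA0 BAC).
    apply: (@le_trans _ _ (BA * Num.sqrt dl * (nrm (cell d x0 n f1 i) * nrm (cell d y0 n f2 j) * nrm f3))).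
      apply: (Tri_trivial (x0 := x1) (datum_meas dt') (datum_bA dt') (ltW dl0) BA0 bc1 bc2 b3).
        by move=> x /sc1/andP[-> /ltW].
      move=> x y /sc1/andP[h1 h2] /sc2/andP[h3 h4].
      apply: (amp_u (datum_amp dt' _)).
        exact: (near_corner dl0 h3 h4).1.
      exact: (near_corner dl0 h1 h2).2.
    apply: ler_wpM2r => //; apply: ler_wpM2l => //.
    by rewrite ler_peMr ?sqrtr_ge0.
  have up' k : (k <= b.+2)%N -> upper x1 y1 dl mu B s k.
    move=> kb p q z pq bz; apply: (le_trans _ (up p q z (leq_trans pq kb) (sub z bz))).
    by rewrite ler_wpM2l// lerXn2r ?nnegrE ?(ltW dl0) ?(ltW d0).
  have ctr : box x1 y1 (3 * dl) (x1, y1) by apply: box_center; rewrite mulr_ge0// ltW.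
  have [p [q [pq hc]]] := lo _ (sub _ ctr).
  have var p' q' z : (p' + q' <= b)%N -> box x1 y1 (3 * dl) z ->
      `|jetP s p' q' z - jetP s p' q' (x1, y1)| * dl ^+ (p' + q') <= c / 16 * mu / 2 ^+ (n * (p' + q')).
    move=> h bz; have [z1 z2] := bz.
    have v := jetP_variation d0 dl0 js up (leq_trans h (leqnSn _)) sub ctr z1 z2 bz.
    have e : 0 < (2 ^+ (n * (p' + q')))^-1 :> R by rewrite invr_gt0 exprn_gt0.
    rewrite /dl /side expr_div_n -exprM mulrA ler_pM2r//; apply: (le_trans v).
    rewrite dlq ler_pdivrMr//.
    by have := ler_wpM2r (ltW mu0) hn; lra.
  have lowc : c * mu / 2 ^+ (n * (p + q)) <= `|jetP s p q (x1, y1)| * dl ^+ (p + q).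
    by rewrite /dl /side expr_div_n -exprM mulrA ler_pM2r// invr_gt0 exprn_gt0.
  move: pq; rewrite leq_eqVlt => /predU1P[pq|pq].
    apply: (fin C1 C10 C1C).
    apply: (H1 x1 y1 dl s S A0 A1 A2 mu kap) => //; first exact: up'.
    apply: two_steep_of_center => //.
      exists p, q; split=> //; move: lowc; rewrite pq; apply: le_trans.
      by rewrite /c' mulrAC.
    move=> p' q' z h bz; have := var p' q' z (eq_leq h) bz; rewrite h => v.
    apply: (le_trans v); rewrite /c' -/b.
    have e : 0 <= c * mu / 2 ^+ (n * b) by rewrite !mulr_ge0 ?invr_ge0 ?exprn_ge0// ltW.
    by move: e; set u := (2 ^+ (n * b))^-1; lra.
  apply: (fin C2 C20 C2C).
  have pq' : (p + q <= a)%N by rewrite -ltnS.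
  apply: (H2 x1 y1 dl s S A0 A1 A2 mu kap) => //; first by apply: up'; rewrite /b ltnW.
    move=> z bz; exists p, q; split=> //.
    have v := var p q z (leq_trans pq' (leqnSn _)) bz.
    rewrite distrC in v.
    have t := ler_wpM2r (exprn_ge0 (p + q) (ltW dl0)) (ler_norm_sub (jetP s p q (x1, y1)) (jetP s p q z)).
    rewrite mulrDl in t.
    have mono : c' * mu <= c * mu / 2 ^+ (n * (p + q)).
      rewrite /c' mulrAC ler_wpM2l ?mulr_ge0 ?(ltW c0) ?(ltW mu0)//.
      rewrite lef_pV2 ?posrE ?exprn_gt0// ler_weXn2l ?ler1n// leq_mul2l.
      by rewrite (leq_trans pq' (leqnSn _)) orbT.
    have e : 0 <= c' * mu by rewrite mulr_ge0// ltW.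
    by move: lowc v t mono e; rewrite -!mulrA; set u := (2 ^+ (n * (p + q)))^-1; lra.
  (* As [kap < 1], lowering the exponent from that of [b] to that of [a] only increases the
     power. *)
  apply: (le_trans hkap); rewrite ler_wpM2r ?exprn_ge0 ?(ltW dl0)// ler_wpM2r ?(ltW mu0)//.
  by rewrite ler_wiXn2l ?(ltW kap0) ?(ltW kap1)// leq_mul2l leq_add2r leqnSn.
have whole o f : (forall x, f x != 0 -> o <= x < o + d) -> cell d o 0 f 0 = f.
  move=> sf; apply/funext => x; rewrite /cell /cut /hind /xgrid /side expr0 divr1 mul0r addr0 mul1r.
  have [->|fx] := eqVneq (f x) 0; first by rewrite mulr0.
  by rewrite (sf x fx) mul1r.
have pE : piece x0 y0 d S A0 f1 f2 f3 0 0 0 = Tri S A0 f1 f2 f3.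
  by rewrite /piece !whole.
rewrite -pE (sum_pieces n d0 dt b1 b2 b3).
set Pi := nrm f1 * nrm f2 * nrm f3 in sq *.
have Pi0 : 0 <= Pi by rewrite !mulr_ge0 ?nrm_ge0.
have sum_le (F : 'I_(2 ^ n) -> R) K : (forall i, `|F i| <= K) -> `|\sum_i F i| <= (2 ^ n)%:R * K.
  move=> h; apply: (le_trans (ler_norm_sum _ _ _)); apply: (le_trans (ler_sum _ (fun i _ => h i))).
  by rewrite sumr_const card_ord mulr_natl.
apply: (le_trans (sum_le _ _ (fun i => sum_le _ _ (sq i)))).
have dls : Num.sqrt dl <= Num.sqrt d by exact: ler_wsqrtr.
rewrite -!mulrA; do 2 (apply: ler_wpM2l; first by []).
apply: ler_wpM2l => //; rewrite /kap.
have k2 : 0 <= kappa * 2 ^+ n * Pi by apply: mulr_ge0 => //; apply: mulr_ge0; exact: ltW.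
apply: (le_trans _ (le_trans (ler_wpM2r k2 dls) _)); rewrite le_eqVlt; apply/orP; left; apply/eqP; ring.
Qed.

Lemma decay_all a : @decay R a.
Proof. by elim: a => [|a ih]; [exact: decay0|exact: decayS]. Qed.

End DecayInduction.

(** * The estimate near a point *)

Section LocalModel.
Context {R : realType}.
Implicit Types (s : nat -> nat -> R * R -> R).

Lemma nbhs_box (P : set (R * R)) : nbhs (0 : R, 0 : R) P ->
  exists2 e : R, 0 < e & forall z, `|z.1| <= e -> `|z.2| <= e -> P z.
Proof.
move=> /nbhs_ballP[e /= e0 h]; exists (e / 2); first by rewrite divr_gt0.
move=> z h1 h2; apply: h; split; rewrite /ball /= sub0r normrN.
  by apply: (le_lt_trans h1); rewrite ltr_pdivrMr// ltr_pMr// ltr1n.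
by apply: (le_lt_trans h2); rewrite ltr_pdivrMr// ltr_pMr// ltr1n.
Qed.

Lemma box_nbhs (P : set (R * R)) (e : R) : 0 < e ->
  (forall z, `|z.1| < e -> `|z.2| < e -> P z) -> nbhs (0 : R, 0 : R) P.
Proof.
move=> e0 h; apply/nbhs_ballP; exists e => //= z [].
by rewrite /ball /= !sub0r !normrN => h1 h2; apply: h.
Qed.

(** The plane carries the product sigma-algebra, so an open set is exhibited as a countable union of
    rational boxes contained in it. *)
Lemma open_measurable2 (U : set (R * R)) : open U -> measurable U.
Proof.
move=> oU.
pose eps (k : nat) : R := k.+1%:R^-1.
pose bx (k : nat) (p q : rat) : set (R * R) :=
  `](ratr p - eps k), (ratr p + eps k)[ `*` `](ratr q - eps k), (ratr q + eps k)[.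
have -> : U = \bigcup_(k in [set: nat]) \bigcup_(p in [set: rat]) \bigcup_(q in [set: rat])
    (if `[< bx k p q `<=` U >] then bx k p q else set0).
  apply/seteqP; split=> z.
    move=> Uz; have /nbhs_ballP[e /= e0 he] : nbhs z U by exact: open_nbhs_nbhs.
    pose k := Num.truncn (2 / e); have k0 : 0 < eps k by rewrite /eps invr_gt0.
    have ke : 2 * eps k < e.
      have h : 2 / e < k.+1%:R by exact: truncnS_gt.
      by rewrite /eps ltr_pdivrMr// mulrC -ltr_pdivrMr.
    have rt (x : R) : exists p : rat, x - eps k < ratr p < x + eps k.
      have xx : x - eps k < x + eps k by lra.
      by have [p] := rat_in_itvoo xx; rewrite in_itv /= => h; exists p.
    have [p /andP[p1 p2]] := rt z.1; have [q /andP[q1 q2]] := rt z.2.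
    exists k => //; exists p => //; exists q => //.
    case: asboolP => [_|[]]; first by split; rewrite /= in_itv /=; apply/andP; split; lra.
    move=> w [/=]; rewrite !in_itv /= => /andP[w1 w2] /andP[w3 w4].
    by apply: he; split; rewrite /ball /= ltr_norml; apply/andP; split; lra.
  by move=> [k _ [p _ [q _]]]; case: asboolP => // h; exact: h.
apply: bigcupT_measurable => k; apply: bigcupT_measurable_rat => p; apply: bigcupT_measurable_rat => q.
by case: asboolP => _ //; apply: measurableX => //; exact: measurable_itv.
Qed.

(** Extension by zero turns a function known only near the origin into a globally measurable one. *)
Lemma measurable_open_continuous (D : set (R * R)) (f : R * R -> R) : open D ->
  (forall z, D z -> {for z, continuous f}) ->
  measurable_fun setT (fun z => if `[< D z >] then f z else 0).
Proof.
move=> oD cf; apply: (measurability _ (RGenOInfty.measurableE R)) => //.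
move=> _ [_ [a ->] <-]; rewrite setTI.
have oP : open (D `&` f @^-1` [set x | a < x]).
  rewrite openE => z [Dz az]; apply: filterI; first exact: open_nbhs_nbhs.
  by apply: (cf z Dz); apply: open_nbhs_nbhs; split => //; exact: open_gt.
have [a0|a0] := ltP a 0.
  rewrite (_ : _ @^-1` _ = (D `&` f @^-1` [set x | a < x]) `|` ~` D).
    by apply: measurableU; [exact: open_measurable2|apply: measurableC; exact: open_measurable2].
  apply/seteqP; split=> z /=; rewrite in_itv /= andbT; case: asboolP => Dz; try tauto.
rewrite (_ : _ @^-1` _ = (D `&` f @^-1` [set x | a < x])).
  exact: open_measurable2.
apply/seteqP; split=> z /=; rewrite in_itv /= andbT; case: asboolP => Dz; try tauto.
by rewrite ltNge a0.
Qed.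

Lemma continuous_measurable2 (f : R * R -> R) : continuous f -> measurable_fun setT f.
Proof.
move=> cf; have := @measurable_open_continuous setT f openT (fun z _ => cf z).
by congr measurable_fun; apply/funext => z; case: asboolP => // -[].
Qed.

(** The constant [th] will realise quarter turns of the phase. It enters at order [(0, 0)] only and
    is invisible to [jetP]. *)
Definition phase_family s (lam th : R) p q z :=
  lam * s p q z + (if (p == 0%N) && (q == 0%N) then th else 0).

Lemma phase_family_jet (D : set (R * R)) s lam th : jet D s -> jet D (phase_family s lam th).
Proof.
move=> js p q z Dz; have h := js p q z Dz.
apply: (is_diff_eq (is_diffD (is_diffZ lam h) (is_diff_cst (if (p == 0%N) && (q == 0%N) then th else 0) z))).
by apply/funext => w; rewrite !fctE /phase_family /GRing.scale /= andbF !addr0; ring.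
Qed.

Lemma phase_family_jetP s lam th p q z : jetP (phase_family s lam th) p q z = lam * jetP s p q z.
Proof. by rewrite /jetP /phase_family /= !addr0 mulrBr. Qed.

Lemma half_itv (x d : R) : - (d / 2) < x -> x < d / 2 -> (- (d / 2) <= x) && (x < - (d / 2) + d).
Proof. by move=> h1 h2; apply/andP; split; lra. Qed.

(** [decay] on one fixed square centred at the origin, with [|lam|] as size; all powers of [d] go
    into the constant, which does not depend on [lam] or [th]. *)
Lemma model_upper a s (r0 : R) : 0 < r0 -> jet (box 0 0 r0) s ->
  (exists p q, (p + q = a)%N /\ jetP s p q (0, 0) != 0) ->
  exists2 rho : R, 0 < rho & forall (A0 A1 A2 : R * R -> R) (K : R),
    (forall x y : R, is_derive x 1 (fun u => A0 (u, y)) (A1 (x, y))) ->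
    (forall x y : R, is_derive x 1 (fun u => A1 (u, y)) (A2 (x, y))) ->
    (forall x y : R, {for x, continuous (fun u => A2 (u, y))}) ->
    (forall z, [/\ `|A0 z| <= K, `|A1 z| <= K & `|A2 z| <= K]) ->
    measurable_fun setT A0 ->
    (forall z, A0 z != 0 -> `|z.1| < rho /\ `|z.2| < rho) ->
    exists2 C : R, 0 <= C & forall (St : R * R -> R) (lam th : R) (f1 f2 f3 : R -> R),
      measurable_fun setT St -> (forall z, box 0 0 r0 z -> St z = s 0 0 z) -> 1 <= `|lam| ->
      bmeas size1 f1 -> bmeas size1 f2 -> bmeas size1 f3 ->
      `|Tri (fun z => lam * St z + th) A0 f1 f2 f3| <=
        C * `|lam| `^ (- (2 * (a + 3))%:R^-1) * (nrm f1 * nrm f2 * nrm f3).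
Proof.
move=> r00 js [p0 [q0 [pq0 P0]]].
have ctr : box (0 : R) 0 r0 (0, 0) by apply: box_center; exact: ltW.
have cP p q : {for (0 : R, 0 : R), continuous (jetP s p q)} := jet_continuous (jetP_jet js) ctr.
pose N := a.+3.
(* The added 1 leaves room for continuity, so that [B] bounds these derivatives near the origin as
   well. *)
pose B := \sum_(p < N) \sum_(q < N) (`|jetP s p q (0, 0)| + 1).
have B1 p q : (p < N)%N -> (q < N)%N -> `|jetP s p q (0, 0)| + 1 <= B.
  move=> hp hq; have t (n : nat) (F : 'I_n -> R) k : (forall i, 0 <= F i) -> F k <= \sum_i F i.
    by move=> F0; rewrite (bigD1 k)//= lerDl sumr_ge0.
  have e (i j : nat) : 0 <= `|jetP s i j (0, 0)| + 1 by rewrite addr_ge0.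
  apply: (le_trans (t N (fun q : 'I_N => `|jetP s p q (0, 0)| + 1) (Ordinal hq) _)) => [//|].
  by apply: (t N (fun p : 'I_N => \sum_(q < N) (`|jetP s p q (0, 0)| + 1)) (Ordinal hp)) => i; rewrite sumr_ge0.
have B0 : 0 <= B by rewrite !sumr_ge0// => i _; rewrite sumr_ge0// => j _; rewrite addr_ge0.
have close p q (e : R) : 0 < e -> \forall z \near (0 : R, 0 : R), `|jetP s p q z - jetP s p q (0, 0)| < e.
  move=> e0; have /cvgrPdist_lt /(_ e e0) := cP p q.
  by apply: filterS => z; rewrite distrC.
have nearB : \forall z \near (0 : R, 0 : R), forall p q : 'I_N, `|jetP s p q z| <= B.
  apply: (@filter_forall _ _ (fun (p : 'I_N) (z : R * R) => forall q : 'I_N, `|jetP s p q z| <= B) (nbhs (0 : R, 0 : R)) (@nbhs_filter _ _)) => p.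
  apply: (@filter_forall _ _ (fun (q : 'I_N) (z : R * R) => `|jetP s p q z| <= B) (nbhs (0 : R, 0 : R)) (@nbhs_filter _ _)) => q.
  have := close p q 1 ltr01; apply: filterS => z h.
  apply: le_trans (B1 p q (ltn_ord p) (ltn_ord q)).
  have := ler_norm_sub (jetP s p q z) (jetP s p q (0, 0)); lra.
have Pp : 0 < `|jetP s p0 q0 (0, 0)| / 2 by rewrite divr_gt0 ?normr_gt0.
have [dl dl0 hdl] := nbhs_box (filterI nearB (close p0 q0 _ Pp)).
(* [d <= 1] lets the powers of [d] be dropped in [upper]; the box of half-side [3 * d] about
   [(- d / 2, - d / 2)] fits in the one of half-side [4 * d] about 0. *)
pose d := Num.min 1 (Num.min dl r0) / 4.
have m0 : 0 < Num.min 1 (Num.min dl r0) by rewrite !lt_min ltr01 dl0 r00.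
have d0 : 0 < d by rewrite divr_gt0.
have d1 : d <= 1 by rewrite /d ler_pdivrMr// mul1r (@le_trans _ _ 1)// ?ge_min ?lexx// ler1n.
have d4l : 4 * d <= dl by rewrite /d mulrC divfK// !ge_min lexx orbT.
have d4r : 4 * d <= r0 by rewrite /d mulrC divfK// !ge_min lexx !orbT.
pose x0 := - (d / 2).
have bsub : box x0 x0 (3 * d) `<=` box 0 0 (4 * d).
  by apply: box_sub; rewrite subr0 /x0 normrN ger0_norm; lra.
have bs0 z : box x0 x0 (3 * d) z -> `|z.1| <= dl /\ `|z.2| <= dl.
  by move=> /bsub[]; rewrite !subr0 => h1 h2; split; [apply: (le_trans h1)|apply: (le_trans h2)].
have bsr z : box x0 x0 (3 * d) z -> box 0 0 r0 z.
  by move=> /bsub[h1 h2]; split; [apply: (le_trans h1)|apply: (le_trans h2)].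
pose c := `|jetP s p0 q0 (0, 0)| / 2 * d ^+ a.
have c0 : 0 < c by rewrite mulr_gt0// exprn_gt0.
exists (d / 2); first by rewrite divr_gt0.
move=> A0 A1 A2 K dA0 dA1 cA2 AK mA suppA.
have K0 : 0 <= K by have [h _ _] := AK (0, 0); apply: le_trans h.
have [C C0 HC] := decay_all a B0 c0 K0.
have e0 : (0 < 2 * (a + 3))%N by rewrite muln_gt0 addn_gt0 orbT.
set e := (2 * (a + 3))%N in HC e0 *.
exists (C * (Num.sqrt d * (d ^+ 3) `^ (- e%:R^-1))).
  by rewrite !mulr_ge0 ?sqrtr_ge0 ?powR_ge0.
move=> St lam th f1 f2 f3 mSt Se lam1 b1 b2 b3.
have lam0 : 0 < `|lam| by exact: lt_le_trans lam1.
pose g1 := cut f1 x0 (x0 + d); pose g2 := cut f2 x0 (x0 + d).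
have bg1 : bmeas size1 g1 by exact: bmeas_cut.
have bg2 : bmeas size1 g2 by exact: bmeas_cut.
have -> : Tri (fun z => lam * St z + th) A0 f1 f2 f3 = Tri (fun z => lam * St z + th) A0 g1 g2 f3.
  apply: eq_Int => x; apply: eq_Int => y.
  have [->|An] := eqVneq (A0 (x, y)) 0; first by rewrite !mulr0 !mul0r.
  have [/=] := suppA _ An; rewrite !ltr_norml => /andP[h1 h2] /andP[h3 h4].
  rewrite /g1 /g2 /cut /hind.
  rewrite (half_itv h1 h2) (half_itv h3 h4).
  by rewrite !mul1r.
(* The solution of [kappa ^+ e * |lam| * d ^+ 3 = 1], the smallest value allowed. *)
pose kappa := (`|lam| * d ^+ 3) `^ (- e%:R^-1).
have ld0 : 0 < `|lam| * d ^+ 3 by rewrite mulr_gt0// exprn_gt0.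
have kap0 : 0 < kappa by exact: powR_gt0.
have kape : kappa ^+ e = (`|lam| * d ^+ 3)^-1.
  rewrite -powR_mulrn ?(ltW kap0)// /kappa -powRrM mulNr mulVf ?pnatr_eq0 -?lt0n//.
  by rewrite powRN powRr1// ltW.
have dt : datum x0 x0 d (phase_family s lam th) (fun z => lam * St z + th) A0 A1 A2 K.
  split.
  - by apply: phase_family_jet; exact: jet_sub bsr js.
  - apply: measurable_funD; last exact: measurable_cst.
    by apply: measurable_funM => //; exact: measurable_cst.
  - by move=> z /bsr bz; rewrite /phase_family /= Se.
  - by split=> //; exists K => z; have [] := AK z.
  - have di : 1 <= d^-1 by rewrite invf_ge1.
    move=> y _; split=> x _; [exact: dA0|exact: dA1|exact: cA2|by have [] := AK (x, y)| |].
      by have [_ h _] := AK (x, y); rewrite (le_trans h)// ler_peMr.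
    have [_ _ h] := AK (x, y); rewrite (le_trans h)// ler_peMr// -exprVn exprn_ege1//.
have up : upper x0 x0 d `|lam| B (phase_family s lam th) a.+2.
  move=> p q z pq bz; rewrite phase_family_jetP normrM mulrC [B * _]mulrC mulrCA.
  apply: ler_wpM2l => //; have [b1' b2'] := bs0 z bz.
  have [hB _] := hdl z b1' b2'.
  have hp : (p < N)%N by rewrite ltnS (leq_trans (leq_addr _ _) pq).
  have hq : (q < N)%N by rewrite ltnS (leq_trans (leq_addl _ _) pq).
  have h := hB (Ordinal hp) (Ordinal hq).
  rewrite -[B]mul1r; apply: ler_pM => //; first by rewrite exprn_ge0 ?ltW.
  by rewrite exprn_ile1// ltW.
have lo : lower x0 x0 d `|lam| c (phase_family s lam th) a.
  move=> z bz; exists p0, q0; rewrite pq0 leqnn; split=> //.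
  rewrite phase_family_jetP normrM /c.
  have [b1' b2'] := bs0 z bz; have [_ h] := hdl z b1' b2'.
  have t := ler_norm_sub (jetP s p0 q0 (0, 0)) (jetP s p0 q0 z); rewrite (distrC (jetP s p0 q0 (0, 0))) in t.
  rewrite mulrAC ler_wpM2r ?exprn_ge0 ?(ltW d0)// mulrC ler_wpM2l//.
  by move: h t; lra.
have hk : 1 <= kappa ^+ e * `|lam| * d ^+ 3.
  by rewrite kape -mulrA mulVf// gt_eqF.
have sup (f : R -> R) x : cut f x0 (x0 + d) x != 0 -> x0 <= x < x0 + d by move=> /cut_neq0[].
have := HC _ _ _ _ _ _ _ _ _ _ g1 g2 f3 d0 lam0 dt up lo kap0 hk bg1 bg2 b3 (@sup f1) (@sup f2).
move=> h; apply: (le_trans h).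
have kE : kappa = (d ^+ 3) `^ (- e%:R^-1) * `|lam| `^ (- e%:R^-1).
  by rewrite /kappa powRM ?exprn_ge0 ?(ltW d0)// mulrC.
have l0 : 0 <= `|lam| `^ (- e%:R^-1) by exact: powR_ge0.
have q0' : 0 <= (d ^+ 3) `^ (- e%:R^-1) by exact: powR_ge0.
rewrite kE.
apply: (@le_trans _ _ (C * (Num.sqrt d * (d ^+ 3) `^ (- e%:R^-1)) * `|lam| `^ (- e%:R^-1) * (nrm g1 * nrm g2 * nrm f3))).
  by rewrite le_eqVlt; apply/orP; left; apply/eqP; ring.
apply: ler_wpM2l.
  by apply: mulr_ge0 => //; apply: mulr_ge0 => //; apply: mulr_ge0 => //; exact: sqrtr_ge0.
apply: ler_wpM2r; first exact: nrm_ge0.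
by apply: ler_pM; [exact: nrm_ge0|exact: nrm_ge0|exact: nrm_cut_le|exact: nrm_cut_le].
Qed.

End LocalModel.

(** * Jets of power series *)

Section PowerSeries.
Context {R : realType}.
Implicit Types (c : nat -> nat -> R) (z w : R * R).

Definition lform (a b : R) (w : R * R) : R := w.1 * a + w.2 * b.

Lemma continuous_lform (a b : R) : continuous (lform a b).
Proof.
move=> w; rewrite /continuous_at /lform; apply: cvgD; apply: cvgM; try exact: cvg_cst.
  exact: cvg_fst.
exact: cvg_snd.
Qed.

(** A quadratic remainder is little-o of the norm. The norm on pairs is the maximum, whence
    [(|w.1| + |w.2|)^2 <= 4 |w|^2]. *)
Lemma is_diff_of_remainder (f : R * R -> R) z (a b C e : R) : 0 < e ->
  (forall w, `|w.1| <= e -> `|w.2| <= e ->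
     `|f (z + w) - f z - lform a b w| <= C * (`|w.1| + `|w.2|) ^+ 2) ->
  is_diff z f (lform a b).
Proof.
move=> e0 h.
have lin : linear (lform a b).
  by move=> k u v; rewrite /lform /= /GRing.scale /=; ring.
pose lM := GRing.isLinear.Build _ _ _ _ _ lin.
pose df : {linear (R * R)%type -> R} := HB.pack (lform a b) lM.
have E : f \o shift z = cst (f z) + df +o_ (0 : R * R) id.
  apply/eqaddoP => _ /posnumP[eps].
  have q0 : 0 < Num.min e (eps%:num / (4 * (`|C| + 1))).
    by rewrite lt_min e0 /= divr_gt0 ?mulr_gt0// ltr_wpDl.
  have near0 : \forall w \near (0 : R * R), `|w| < Num.min e (eps%:num / (4 * (`|C| + 1))).
    exact: nbhs0_lt.
  apply: filterS near0 => w; rewrite lt_min => /andP[we wq].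
  have w1 : `|w.1| <= `|w| by rewrite [leRHS]prod_normE le_max lexx.
  have w2 : `|w.2| <= `|w| by rewrite [leRHS]prod_normE le_max lexx orbT.
  have -> : (f \o shift z - (cst (f z) + df)) w = f (z + w) - f z - lform a b w.
    by rewrite !fctE /= [w + z]addrC opprD addrA.
  apply: (le_trans (h w (le_trans w1 (ltW we)) (le_trans w2 (ltW we)))).
  have n0 := normr_ge0 w.
  apply: (@le_trans _ _ ((`|C| + 1) * (4 * `|w| * `|w|))).
    have s2 : (`|w.1| + `|w.2|) ^+ 2 <= 4 * `|w| * `|w|.
      have p1 := normr_ge0 w.1; have p2 := normr_ge0 w.2.
      by move: p1 p2 w1 w2 n0; move: (`|w.1|) (`|w.2|) (`|w|) => p q t; nra.
    have Cl : C <= `|C| + 1 by have := ler_norm C; lra.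
    apply: (@le_trans _ _ ((`|C| + 1) * (`|w.1| + `|w.2|) ^+ 2)).
      by rewrite ler_wpM2r// sqr_ge0.
    by rewrite ler_wpM2l// addr_ge0.
  have C1 : 0 < 4 * (`|C| + 1) by rewrite mulr_gt0// ltr_wpDl.
  rewrite (_ : _ * _ = `|w| * (4 * (`|C| + 1)) * `|w|); last by ring.
  by apply: ler_wpM2r => //; rewrite -ler_pdivlMr// ltW.
have dE := diff_unique (df := df) (@continuous_lform a b) E.
apply: DiffDef; last by rewrite dE.
by apply/diff_locallyP; rewrite dE; split; [exact: continuous_lform|exact: E].
Qed.

Lemma is_diff_exact (f : R * R -> R) z (a b : R) :
  (forall w, f (z + w) - f z = lform a b w) -> is_diff z f (lform a b).
Proof.
move=> h; apply: (@is_diff_of_remainder f z a b 0 1) => // w _ _.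
by rewrite h subrr normr0 mul0r.
Qed.

Lemma is_diff_tensor (f g : R -> R) z (a b : R) : is_derive z.1 1 f a -> is_derive z.2 1 g b ->
  is_diff z (fun z => f z.1 * g z.2) (fun w => w.1 * (a * g z.2) + w.2 * (f z.1 * b)).
Proof.
move=> fa gb.
have p1 : is_diff z (fun z => z.1) (lform 1 0).
  by apply: is_diff_exact => w; rewrite /lform /=; ring.
have p2 : is_diff z (fun z => z.2) (lform 0 1).
  by apply: is_diff_exact => w; rewrite /lform /=; ring.
have d1 := is_diff_comp p1 (is_diff_of_derive fa).
have d2 := is_diff_comp p2 (is_diff_of_derive gb).
apply: (is_diff_eq (is_diffM d1 d2)).
by apply/funext => w; rewrite !fctE /GRing.scale /lform /=; ring.
Qed.

Lemma series_dominated (u k : R^nat) : (forall i, `|u i| <= k i) -> cvgn (series k) ->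
  cvgn (series u) /\ `|limn (series u)| <= limn (series k).
Proof.
move=> uk ck.
have nc : cvgn [normed series u].
  apply: (@series_le_cvg _ (fun i => `|u i|) k) => // n.
  exact: le_trans (normr_ge0 _) (uk n).
split; first exact: normed_cvg nc.
by apply: (le_trans (lim_series_norm nc)); apply: lim_series_le.
Qed.

Section JetSeries.
Variables (T : nat -> nat -> nat -> R * R -> R) (K : nat -> nat -> nat -> R) (rho : R).
Hypothesis rho0 : 0 < rho.
Hypothesis TK : forall i p q z, box 0 0 rho z -> `|T i p q z| <= K p q i.
Hypothesis jT : forall i, jet (box 0 0 rho) (T i).
Hypothesis cK : forall p q, cvgn (series (K p q)).

Definition sum_jet p q z := limn (series (fun i => T i p q z)).

Lemma sum_jet_cvg p q z : box 0 0 rho z -> cvgn (series (fun i => T i p q z)).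
Proof. by move=> bz; have [] := series_dominated (fun i => TK i p q bz) (@cK p q). Qed.

(** Termwise differentiation: the first-order remainder of each term is quadratic in [w] with a
    summable constant built from second derivatives. Halving [rho] keeps [z + w] in the box where
    these are dominated. *)
Lemma sum_jet_jet : jet (box 0 0 (rho / 2)) sum_jet.
Proof.
move=> p q z bz; have rh0 := rho0.
pose k i := K p.+2 q i + K p.+1 q.+1 i + (K p.+1 q.+1 i + K p q.+2 i).
have ck : cvgn (series k).
  by rewrite /k; do 2 (apply: is_cvg_seriesD => //).
apply: (@is_diff_of_remainder _ _ _ _ (limn (series k)) (rho / 2)); first by rewrite divr_gt0.
move=> w w1 w2; have [z1 z2] := bz; rewrite !subr0 in z1 z2.
have Bz : box 0 0 rho z by split; rewrite subr0; [apply: (le_trans z1)|apply: (le_trans z2)]; lra.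
have Bzw : box 0 0 rho (z + w).
  split; rewrite subr0 /=; rewrite (le_trans (ler_normD _ _))//; lra.
pose e := Num.max `|w.1| `|w.2|.
have e0 : 0 <= e by rewrite le_max normr_ge0.
have we1 : `|w.1| <= e by rewrite le_max lexx.
have we2 : `|w.2| <= e by rewrite le_max lexx orbT.
have er : e <= rho / 2 by rewrite ge_max w1 w2.
have esum : e <= `|w.1| + `|w.2| by rewrite ge_max lerDl lerDr !normr_ge0.
have sub : box z.1 z.2 e `<=` box 0 0 rho by apply: box_sub; rewrite subr0; lra.
have bc : box z.1 z.2 e z by split; rewrite subrr normr0.
have bw : box z.1 z.2 e (z + w) by split; rewrite /= addrAC subrr add0r.
pose u i := T i p q (z + w) - T i p q z - (w.1 * T i p.+1 q z + w.2 * T i p q.+1 z).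
have ub i : `|u i| <= (`|w.1| + `|w.2|) ^+ 2 * k i.
  have j := jet_sub sub (jT i).
  have [x bx E] := mvt2 p q j bc bw.
  have kb p' q' y : box z.1 z.2 e y -> `|T i p' q' y| <= K p' q' i by move=> /sub; exact: TK.
  have [x1 x2] := bx.
  have K0 p' q' : 0 <= K p' q' i by apply: le_trans (TK i p' q' Bz).
  have v1 := mvt_box j (kb p.+2 q) (kb p.+1 q.+1) bc bx.
  have v2 := mvt_box j (kb p.+1 q.+1) (kb p q.+2) bc bx.
  have x1' := le_trans x1 esum; have x2' := le_trans x2 esum.
  set s := `|w.1| + `|w.2| in x1' x2' *.
  have s0 : 0 <= s by rewrite addr_ge0.
  have v1' : `|T i p.+1 q x - T i p.+1 q z| <= s * (K p.+2 q i + K p.+1 q.+1 i).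
    by apply: (le_trans v1); rewrite mulrDr lerD// ler_wpM2r.
  have v2' : `|T i p q.+1 x - T i p q.+1 z| <= s * (K p.+1 q.+1 i + K p q.+2 i).
    by apply: (le_trans v2); rewrite mulrDr lerD// ler_wpM2r.
  have -> : u i = w.1 * (T i p.+1 q x - T i p.+1 q z) + w.2 * (T i p q.+1 x - T i p q.+1 z).
    rewrite /u E /=.
    by rewrite [z.1 + w.1]addrC [z.2 + w.2]addrC !addrK; ring.
  apply: (le_trans (ler_normD _ _)); rewrite !normrM.
  have ws1 : `|w.1| <= s by rewrite /s lerDl.
  have ws2 : `|w.2| <= s by rewrite /s lerDr.
  have a1 := ler_pM (normr_ge0 _) (normr_ge0 _) ws1 v1'.
  have a2 := ler_pM (normr_ge0 _) (normr_ge0 _) ws2 v2'.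
  apply: (le_trans (lerD a1 a2)); rewrite le_eqVlt; apply/orP; left; apply/eqP.
  by rewrite /k; ring.
have cw := sum_jet_cvg (p := p) (q := q) Bzw; have cz := sum_jet_cvg (p := p) (q := q) Bz.
have c1 := sum_jet_cvg (p := p.+1) (q := q) Bz; have c2 := sum_jet_cvg (p := p) (q := q.+1) Bz.
have c1' := is_cvg_seriesZ (k := w.1) c1; have c2' := is_cvg_seriesZ (k := w.2) c2.
have Eu : limn (series u) = sum_jet p q (z + w) - sum_jet p q z - lform (sum_jet p.+1 q z) (sum_jet p q.+1 z) w.
  have cd := is_cvg_seriesB cw cz.
  have cs := is_cvg_seriesD c1' c2'.
  have := lim_seriesB cd cs; rewrite (lim_seriesB cw cz) (lim_seriesD c1' c2').
  by rewrite (lim_seriesZ w.1 c1) (lim_seriesZ w.2 c2).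
have ckk := is_cvg_seriesZ (k := (`|w.1| + `|w.2|) ^+ 2) ck.
have [_] := series_dominated (k := (`|w.1| + `|w.2|) ^+ 2 *: k) ub ckk.
by rewrite (lim_seriesZ _ ck) Eu /GRing.scale /= mulrC.
Qed.

End JetSeries.

(** The [p]-th derivative of [x ^+ u]; for [p > u] the falling factorial is zero, so the truncated
    exponent does no harm. *)
Definition mono (u p : nat) (x : R) : R := (u ^_ p)%:R * x ^+ (u - p).

Lemma mono_derive (u p : nat) (x : R) : is_derive x 1 (mono u p) (mono u p.+1 x).
Proof.
have h : is_derive x 1 (fun y : R => y ^+ (u - p)) ((u - p)%:R * x ^+ (u - p).-1).
  elim: (u - p)%N => [|n ih]; first by rewrite mul0r; exact: der_cst.
  under eq_fun do rewrite exprS.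
  apply: (der_eq (der_mul (der_id x) ih)); rewrite -natr1.
  by case: n {ih} => [|n]; rewrite ?exprS /=; ring.
apply: (der_eq (der_mul (der_cst x _) h)).
by rewrite mul0r add0r /mono ffactnSr natrM mulrA subnS.
Qed.

Lemma mono0 u p : mono u p 0 = if u == p then (p`!)%:R else 0.
Proof.
rewrite /mono; case: ltngtP => h.
- by rewrite ffact_small// mul0r.
- by rewrite expr0n subn_eq0 leqNgt h mulr0.
- by rewrite h subnn expr0 mulr1 ffactnn.
Qed.

Lemma bin_le_exp2 n k : ('C(n, k) <= 2 ^ n)%N.
Proof.
elim: n k => [|n ih] [|k] //; first by rewrite bin0 expn_gt0.
by rewrite binS expnS mul2n -addnn leq_add.
Qed.

(** The binomial coefficient is at most [2 ^+ u], which is absorbed by halving the radius; what is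
    left depends on [u] only through [r1 ^+ u]. *)
Lemma mono_le u p x r1 : 0 < r1 -> `|x| <= r1 / 2 ->
  `|mono u p x| <= (p`!)%:R * (2 / r1) ^+ p * r1 ^+ u.
Proof.
move=> r0 hx.
have [up|pu] := ltnP u p.
  by rewrite /mono ffact_small// mul0r normr0 !mulr_ge0 ?exprn_ge0 ?divr_ge0 ?ltW.
rewrite /mono normrM ger0_norm// normrX -bin_ffact natrM.
have h1 : ('C(u, p))%:R <= 2 ^+ u :> R by rewrite -natrX ler_nat bin_le_exp2.
have h2 : `|x| ^+ (u - p) <= (r1 / 2) ^+ (u - p) by apply: lerXn2r => //; rewrite nnegrE// divr_ge0// ltW.
apply: (@le_trans _ _ (2 ^+ u * (p`!)%:R * (r1 / 2) ^+ (u - p))).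
  apply: ler_pM => //; rewrite ?exprn_ge0//.
  by rewrite ler_wpM2r.
have E : 2 ^+ u * (r1 / 2) ^+ (u - p) = (2 / r1) ^+ p * r1 ^+ u.
  rewrite -{1 3}(subnKC pu) !exprD !expr_div_n.
  by field; rewrite !expf_neq0 ?gt_eqF.
by rewrite mulrAC E mulrC mulrA.
Qed.

Definition homjet c i p q z := \sum_(u < i.+1) c u (i - u)%N * (mono u p z.1 * mono (i - u) q z.2).

Lemma homjet_jet c i (D : set (R * R)) : jet D (homjet c i).
Proof.
move=> p q z _.
have H (n : nat) (F : 'I_n -> R * R -> R) (a b : 'I_n -> R) :
    (forall u, is_diff z (F u) (fun w => w.1 * a u + w.2 * b u)) ->
    is_diff z (fun z => \sum_u F u z) (fun w => w.1 * (\sum_u a u) + w.2 * \sum_u b u).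
  elim: n F a b => [|n ih] F a b h.
    rewrite (_ : (fun z => _) = cst 0); last by apply/funext => x; rewrite big_ord0.
    apply: (is_diff_eq (is_diff_cst (0 : R) z)).
    by apply/funext => w; rewrite !big_ord0 !mulr0 addr0.
  rewrite (_ : (fun z => _) = (fun z => \sum_(u < n) F (widen_ord (leqnSn n) u) z) + F ord_max).
    apply: (is_diff_eq (is_diffD (ih _ _ _ (fun u => h (widen_ord (leqnSn n) u))) (h ord_max))).
    by apply/funext => w; rewrite !fctE !big_ord_recr /=; ring.
  by apply/funext => x; rewrite !fctE big_ord_recr.
apply: (H _ (fun (u : 'I_i.+1) z => c u (i - u)%N * (mono u p z.1 * mono (i - u) q z.2))) => u.
apply: (is_diff_eq (is_diffZ (c u (i - u)%N) (is_diff_tensor (mono_derive u p z.1) (mono_derive (i - u) q z.2)))).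
by apply/funext => w; rewrite !fctE /GRing.scale /=; ring.
Qed.

Lemma homjet00 c i z : homjet c i 0 0 z = hom_part c i z.
Proof. by apply: eq_bigr => u _; rewrite /mono !ffactn0 !mul1r !subn0 mulrA. Qed.

Lemma homjet_high c i p q z : (i < p + q)%N -> homjet c i p q z = 0.
Proof.
move=> h; apply: big1 => u _; have [up|pu] := ltnP u p.
  by rewrite {1}/mono ffact_small// !mul0r mulr0.
rewrite {2}/mono (@ffact_small (i - u))// ?mul0r ?mulr0//.
apply: leq_ltn_trans (leq_sub2l i pu) _.
by rewrite ltn_subLR// (leq_trans pu)// -ltnS.
Qed.

Lemma homjet_at0 c i p q : (p + q)%N != i -> homjet c i p q (0, 0) = 0.
Proof.
move=> h; apply: big1 => u _; rewrite !mono0.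
have [up|] := eqVneq (u : nat) p; last by rewrite mul0r mulr0.
have [uq|] := eqVneq (i - u)%N q; last by rewrite !mulr0.
by move: h; rewrite -up -uq subnKC ?eqxx// -ltnS.
Qed.

Lemma homjet_le c i p q z r1 : 0 < r1 -> box 0 0 (r1 / 2) z ->
  `|homjet c i p q z| <= (p`!)%:R * (2 / r1) ^+ p * ((q`!)%:R * (2 / r1) ^+ q) * abs_hom_part c i (r1, r1).
Proof.
move=> r0 [h1 h2]; rewrite !subr0 in h1 h2.
apply: (le_trans (ler_norm_sum _ _ _)); rewrite /abs_hom_part mulr_sumr; apply: ler_sum => u _ /=.
rewrite 2!normrM /= (gtr0_norm r0).
have m1 := mono_le u p r0 h1; have m2 := mono_le (i - u) q r0 h2.
have m := ler_pM (normr_ge0 _) (normr_ge0 _) m1 m2.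
apply: (le_trans (ler_wpM2l (normr_ge0 _) m)).
by rewrite le_eqVlt; apply/orP; left; apply/eqP; ring.
Qed.

(** The radius is halved three times: to stay inside the domain of convergence, to dominate the
    differentiated series, and to differentiate termwise. At the origin only the part of degree
    [p + q] contributes to order [(p, q)]. *)
Lemma power_series_jet (S : R * R -> R) c r : power_series_rep S c r ->
  exists2 rho : R, 0 < rho & exists h : nat -> nat -> R * R -> R,
    [/\ jet (box 0 0 rho) h, forall z, box 0 0 rho z -> S z = h 0 0 z &
      forall p q, h p q (0, 0) = homjet c (p + q) p q (0, 0)].
Proof.
move=> [r0 hr]; pose r1 := r / 2; have r10 : 0 < r1 by rewrite divr_gt0.
have r1r : `|r1| < r by rewrite gtr0_norm// /r1 ltr_pdivrMr// ltr_pMr// ltr1n.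
have [[l hl] _] := hr (r1, r1) r1r r1r.
have ca : cvgn (series (fun i => abs_hom_part c i (r1, r1))) by apply/cvg_ex; exists l.
pose K p q i := (p`!)%:R * (2 / r1) ^+ p * ((q`!)%:R * (2 / r1) ^+ q) * abs_hom_part c i (r1, r1).
have cK p q : cvgn (series (K p q)).
  exact: (is_cvg_seriesZ (k := (p`!)%:R * (2 / r1) ^+ p * ((q`!)%:R * (2 / r1) ^+ q)) ca).
have r20 : 0 < r1 / 2 by rewrite divr_gt0.
have TK i p q z : box 0 0 (r1 / 2) z -> `|homjet c i p q z| <= K p q i by exact: homjet_le.
exists (r1 / 2 / 2); first by rewrite !divr_gt0.
exists (sum_jet (homjet c)); split.
- exact: (sum_jet_jet r20 TK (fun i => @homjet_jet c i _) cK).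
- move=> z [z1 z2]; rewrite !subr0 in z1 z2.
  have rr : r1 / 2 / 2 < r by rewrite /r1; lra.
  have [_ cS] := hr z (le_lt_trans z1 rr) (le_lt_trans z2 rr).
  rewrite /sum_jet; under eq_fun do rewrite homjet00.
  by apply/esym/cvg_lim.
- move=> p q; rewrite /sum_jet; apply/cvg_lim => //.
  apply: (@cvg_near_cst _ _ _ _ _ _).
  exists (p + q).+1 => // n /= hn.
  rewrite /series /= (big_cat_nat (n := (p + q).+1))//= big_nat_recr//=.
  rewrite big_nat_cond big1 ?add0r; last first.
    by move=> i; rewrite andbT => /andP[_ ip]; apply: homjet_at0; rewrite gtn_eqF.
  rewrite big_nat_cond big1 ?addr0// => i; rewrite andbT => /andP[ip _].
  by apply: homjet_at0; rewrite ltn_eqF.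
Qed.

End PowerSeries.

(** * Adapted linear coordinates *)

Section DirectionalJets.
Context {R : realType}.
Implicit Types (h F : nat -> nat -> R * R -> R) (e z Z : R * R) (D : set (R * R)).

Definition Dir e h p q z := e.1 * h p.+1 q z + e.2 * h p q.+1 z.

Definition lin2 e1 e2 Z : R * R := (Z.1 * e1.1 + Z.2 * e2.1, Z.1 * e1.2 + Z.2 * e2.2).

(** By the chain rule, the jet of [h] composed with the linear map [lin2 e1 e2]. *)
Definition pull e1 e2 h p q Z := iter p (Dir e1) (iter q (Dir e2) h) 0 0 (lin2 e1 e2 Z).

Lemma DirC e e' h : Dir e (Dir e' h) = Dir e' (Dir e h).
Proof. by apply/funext => p; apply/funext => q; apply/funext => z; rewrite /Dir; ring. Qed.

Lemma iter_DirC n e e' h : iter n (Dir e) (Dir e' h) = Dir e' (iter n (Dir e) h).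
Proof. by elim: n => //= n ->; rewrite DirC. Qed.

Lemma DirZ k e h p q z : Dir (k *: e) h p q z = k * Dir e h p q z.
Proof. by rewrite /Dir /= /GRing.scale /=; ring. Qed.

Lemma jet_Dir D e h : jet D h -> jet D (Dir e h).
Proof.
move=> jh p q z Dz.
apply: (is_diff_eq (is_diffD (is_diffZ e.1 (jh p.+1 q z Dz)) (is_diffZ e.2 (jh p q.+1 z Dz)))).
by apply/funext => w; rewrite !fctE /GRing.scale /Dir /=; ring.
Qed.

Lemma jet_iter_Dir D n e h : jet D h -> jet D (iter n (Dir e) h).
Proof. by move=> jh; elim: n => //= n ih; exact: jet_Dir. Qed.

Lemma jet_derive D h e p q z : jet D h -> D z -> 'D_e (h p q) z = Dir e h p q z.
Proof.
move=> jh Dz; have d := jh p q z Dz.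
by rewrite deriveE ?diff_val//; exact: ex_diff.
Qed.

Lemma jet_pull D e1 e2 h : jet D h -> jet (lin2 e1 e2 @^-1` D) (pull e1 e2 h).
Proof.
move=> jh p q Z DZ.
have l1 : is_diff Z (fun Z => Z.1 * e1.1 + Z.2 * e2.1) (lform e1.1 e2.1).
  by apply: is_diff_exact => w; rewrite /lform /=; ring.
have l2 : is_diff Z (fun Z => Z.1 * e1.2 + Z.2 * e2.2) (lform e1.2 e2.2).
  by apply: is_diff_exact => w; rewrite /lform /=; ring.
pose g := iter p (Dir e1) (iter q (Dir e2) h).
have jg : jet D g by do 2 apply: jet_iter_Dir.
apply: (is_diff_eq (is_diff_comp (is_diff_pair l1 l2) (jg 0%N 0%N _ DZ))).
apply/funext => w; rewrite /pull /= iter_DirC -/g /lform /Dir /=; ring.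
Qed.

(** In the new coordinates [dX], [dY] and [dX - dY] are the derivatives along [e1], [e2] and
    [e1 - e2], which are multiples of [v2], [v1] and [v3]. *)
Lemma jetP_pull e1 e2 h (k1 k2 k3 : R) (v1 v2 v3 : R * R) p q Z :
  e1 = k1 *: v2 -> e2 = k2 *: v1 -> e1 - e2 = k3 *: v3 ->
  jetP (pull e1 e2 h) p q Z =
  k1 * k2 * k3 * pull e1 e2 (Dir v1 (Dir v2 (Dir v3 h))) p q Z.
Proof.
move=> E1 E2 E3; set z := lin2 e1 e2 Z.
pose g := iter p (Dir e1) (iter q (Dir e2) h).
have gE : iter p (Dir e1) (iter q (Dir e2) (Dir v1 (Dir v2 (Dir v3 h)))) =
    Dir v1 (Dir v2 (Dir v3 g)) by rewrite !iter_DirC.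
rewrite /jetP /pull gE.
have -> : iter p.+2 (Dir e1) (iter q.+1 (Dir e2) h) = Dir e2 (Dir e1 (Dir e1 g)).
  by rewrite iterS iterS iterS !iter_DirC DirC (DirC e1 e2).
have -> : iter p.+1 (Dir e1) (iter q.+2 (Dir e2) h) = Dir e2 (Dir e1 (Dir e2 g)).
  by rewrite !iterS !iter_DirC DirC (DirC e1 e2).
rewrite -/z.
have F u a b y : Dir e1 u a b y - Dir e2 u a b y = k3 * Dir v3 u a b y.
  by rewrite -DirZ -E3 /Dir /=; ring.
have F3 a b y : Dir e1 g a b y - Dir e2 g a b y = k3 * Dir v3 g a b y by exact: F.
have DL e u v w : (forall a b y, u a b y - v a b y = k3 * w a b y) ->
    forall a b y, Dir e u a b y - Dir e v a b y = k3 * Dir e w a b y.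
  move=> H a b y; transitivity (e.1 * (u a.+1 b y - v a.+1 b y) + e.2 * (u a b.+1 y - v a b.+1 y)).
    by rewrite /Dir; ring.
  by rewrite !H /Dir; ring.
rewrite (DL e2 _ _ _ (DL e1 _ _ _ F3) 0%N 0%N z).
rewrite E2 DirZ (_ : Dir v1 (Dir e1 _) 0 0 z = k1 * Dir v1 (Dir v2 (Dir v3 g)) 0 0 z); first by ring.
by rewrite DirC E1 DirZ DirC.
Qed.

Lemma iter_Dir_eq0 e1 e2 F z j : (forall a b, (a + b < j)%N -> F a b z = 0) ->
  forall p q a b, (p + q + (a + b) < j)%N -> iter p (Dir e1) (iter q (Dir e2) F) a b z = 0.
Proof.
move=> F0; elim=> [|p ih].
  elim=> [a b|q /= ih a b]; rewrite ?add0n => h; first exact: F0.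
  by rewrite /Dir !ih ?mulr0 ?addr0//; move: h; rewrite ?(addSn, addnS).
move=> q a b h; rewrite /= /Dir !ih ?mulr0 ?addr0//.
all: by move: h; rewrite ?(addSn, addnS).
Qed.

(** Induction on the order, applied to the two directional derivatives of [F]; Cramer's rule then
    recovers the partial derivatives. *)
Lemma iter_Dir_basis e1 e2 F z j : e1.1 * e2.2 - e1.2 * e2.1 != 0 ->
  (forall p q, (p + q)%N = j -> iter p (Dir e1) (iter q (Dir e2) F) 0 0 z = 0) ->
  forall a b, (a + b)%N = j -> F a b z = 0.
Proof.
move=> de; elim: j F => [|j ih] F F0.
  by move=> a b /eqP; rewrite addn_eq0 => /andP[/eqP-> /eqP->]; exact: (F0 0%N 0%N).
have H1 a b : (a + b)%N = j -> Dir e1 F a b z = 0.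
  apply: ih => p q pq; rewrite iter_DirC iter_DirC -iterS.
  by apply: F0; rewrite addSn pq.
have H2 a b : (a + b)%N = j -> Dir e2 F a b z = 0.
  apply: ih => p q pq; rewrite -iterSr; apply: F0; by rewrite addnS pq.
have S a b : (a + b)%N = j -> F a.+1 b z = 0 /\ F a b.+1 z = 0.
  move=> ab; move: (H1 _ _ ab) (H2 _ _ ab); rewrite /Dir => h1 h2.
  split; apply: (mulfI de); rewrite mulr0.
    transitivity (e2.2 * (e1.1 * F a.+1 b z + e1.2 * F a b.+1 z) - e1.2 * (e2.1 * F a.+1 b z + e2.2 * F a b.+1 z)); first by ring.
    by rewrite h1 h2 !mulr0 subrr.
  transitivity (e1.1 * (e2.1 * F a.+1 b z + e2.2 * F a b.+1 z) - e2.1 * (e1.1 * F a.+1 b z + e1.2 * F a b.+1 z)); first by ring.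
  by rewrite h1 h2 !mulr0 subrr.
case=> [|a] b; first by rewrite add0n => ->; have [] := S 0%N j erefl.
by rewrite addSn => -[ab]; have [] := S a b ab.
Qed.

Lemma jet_eq0 F : jet setT F -> (forall z, F 0 0 z = 0) -> forall p q z, F p q z = 0.
Proof.
move=> jF F0.
have step p q : (forall z, F p q z = 0) -> forall z, F p.+1 q z = 0 /\ F p q.+1 z = 0.
  move=> h z; have d := jF p q z I.
  have E : F p q = cst 0 by apply/funext => y; rewrite h.
  rewrite E in d.
  have : 'd (cst (0 : R)) z = (fun w : R * R => w.1 * F p.+1 q z + w.2 * F p q.+1 z) :> (_ -> _).
    exact: diff_val.
  have -> : 'd (cst (0 : R)) z = (0 : R * R -> R) :> (_ -> _) by exact: diff_cst.
  move=> H; split.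
    by have := congr1 (fun g => g (1, 0)) H; rewrite /= mul1r mul0r addr0 => <-.
  by have := congr1 (fun g => g (0, 1)) H; rewrite /= mul1r mul0r add0r => <-.
elim=> [|p ih] q z; last by have [] := step p q (ih q) z.
by elim: q z => [|q ih] z //; have [] := step 0%N q ih z.
Qed.

(** Descending induction on the order by the mean value theorem from the origin: such a function is
    a polynomial with zero coefficients. *)
Lemma jet_taylor_eq0 F n : jet setT F -> (forall p q, (n < p + q)%N -> forall z, F p q z = 0) ->
  (forall p q, F p q (0, 0) = 0) -> forall z, F 0 0 z = 0.
Proof.
move=> jF hi at0.
have H k p q : (n < p + q + k)%N -> forall z, F p q z = 0.
  elim: k p q => [|k ih] p q; first by rewrite addn0; exact: hi.
  move=> h z; pose r := `|z.1| + `|z.2|.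
  have r0 : 0 <= r by rewrite addr_ge0.
  have bz : box 0 0 r z by split; rewrite subr0 /r ?lerDl ?lerDr.
  have [w _] := mvt2 p q (jet_sub (subsetT (box 0 0 r)) jF) (box_center 0 0 r0) bz.
  rewrite at0 subr0 => ->.
  by rewrite !ih ?mulr0 ?addr0//; move: h; rewrite ?(addSn, addnS).
by move=> z; apply: (H n.+1) => //=; rewrite add0n.
Qed.

Lemma Dperp_hom_part c i v1 v2 v3 z :
  Dperp v1 v2 v3 (hom_part c i) z = Dir v1 (Dir v2 (Dir v3 (homjet c i))) 0 0 z.
Proof.
have -> : hom_part c i = homjet c i 0 0 by apply/funext => y; rewrite homjet00.
have E F v : jet setT F -> 'D_v (F 0%N 0%N) = Dir v F 0%N 0%N.
  by move=> jF; apply/funext => y; apply: (jet_derive _ _ _ jF).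
have j0 := @homjet_jet _ c i setT.
rewrite /Dperp (E _ v3 j0) (E _ v2 (jet_Dir v3 j0)).
by rewrite (jet_derive v1 0 0 (jet_Dir v2 (jet_Dir v3 j0))).
Qed.

(** [T i], the image under the operator of the part of degree [i], is homogeneous of degree [i - 3].
    Its jet at the origin lives in that single order and determines it, so the first nonzero [T m]
    shows in order [m - 3]. *)
Lemma multiplicity_jets v1 v2 v3 c m h : is_mult_pi v1 v2 v3 c m ->
  (forall p q, h p q (0, 0) = homjet c (p + q) p q (0, 0)) ->
  let G := Dir v1 (Dir v2 (Dir v3 h)) in
  [/\ (3 <= m)%N, (forall p q, (p + q < m - 3)%N -> G p q (0, 0) = 0) &
    exists p q, (p + q)%N = (m - 3)%N /\ G p q (0, 0) != 0].
Proof.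
move=> [[z0 hz0] low] h0 G.
pose T i := Dir v1 (Dir v2 (Dir v3 (homjet c i))).
have jT i : jet setT (T i) by do 3 apply: jet_Dir; exact: homjet_jet.
have T3 i p q z : T i p q z = 0 \/ (p + q + 3 <= i)%N.
  have [|hi] := leqP (p + q + 3) i; [by right|left].
  by rewrite /T /Dir !homjet_high ?(mulr0, addr0)//; move: hi; rewrite ?(addSn, addnS, addn0).
have T0 i p q : (p + q + 3)%N != i -> T i p q (0, 0) = 0.
  by move=> hi; rewrite /T /Dir !homjet_at0 ?(mulr0, addr0)//; move: hi; rewrite ?(addSn, addnS, addn0).
have GT p q : G p q (0, 0) = T (p + q + 3)%N p q (0, 0).
  by rewrite /G /T /Dir !h0 ?(addSn, addnS, addn0).
have m3 : (3 <= m)%N.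
  rewrite leqNgt; apply/negP => m3; apply: hz0; rewrite Dperp_hom_part.
  by case: (T3 m 0%N 0%N z0) => //; rewrite !add0n leqNgt m3.
split => //.
- move=> p q pq; rewrite GT.
  have hi : (p + q + 3 < m)%N by rewrite addnC -ltn_subRL.
  by apply: (jet_eq0 (jT _)) => z; rewrite -(low _ hi z) Dperp_hom_part.
- apply: contrapT => hn; apply: hz0; rewrite Dperp_hom_part.
  apply: (@jet_taylor_eq0 (T m) (m - 3)) => //.
    move=> p q hpq z; case: (T3 m p q z) => //.
    by move=> pqm; exfalso; move: hpq; rewrite ltnNge leq_subRL// addnC pqm.
  move=> p q; have [E|/T0//] := eqVneq (p + q + 3)%N m.
  apply: contrapT => /eqP nz; apply: hn; exists p, q.
  by split; [rewrite -E addnK|rewrite GT E].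
Qed.

Lemma pairZ (k : R) z : k *: z = (k * z.1, k * z.2).
Proof. by []. Qed.

Lemma pairD z z' : z + z' = (z.1 + z'.1, z.2 + z'.2).
Proof. by []. Qed.

Lemma linear2E (p : R * R -> R) : linear2 p -> forall z, p z = z.1 * p (1, 0) + z.2 * p (0, 1).
Proof.
move=> lp z.
have p0 : p 0 = 0 by have := lp 1 0 0; rewrite scale1r addr0 mul1r => /(congr1 (fun x => x - p 0)); rewrite addrK subrr.
rewrite {1}(_ : z = z.1 *: (1, 0) + (z.2 *: (0, 1) + 0)); last first.
  by case: z => x y; rewrite addr0 2!pairZ pairD /=; congr pair; ring.
by rewrite !lp p0 /=; ring.
Qed.

(** If both forms vanished at [v], both would be multiples of [z.2 * v.1 - z.1 * v.2]. *)
Lemma lin_indep2_neq0 (p q : R * R -> R) v : linear2 p -> linear2 q -> lin_indep2 p q ->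
  unit_vec2 v -> p v = 0 -> q v != 0.
Proof.
move=> lp lq ind uv pv; apply/eqP => qv.
have pE := linear2E lp; have qE := linear2E lq.
pose A := - p (1, 0) * v.2 + p (0, 1) * v.1; pose B := - q (1, 0) * v.2 + q (0, 1) * v.1.
move: uv pv qv; rewrite /unit_vec2 pE qE => uv pv qv.
have pA z : p z = A * (z.2 * v.1 - z.1 * v.2).
  rewrite pE /A; move: pv uv; move: (p (1, 0)) (p (0, 1)) v.1 v.2 => a b x y h1 h2.
  apply/eqP; rewrite -subr_eq0; apply/eqP.
  have -> : z.1 * a + z.2 * b - (- a * y + b * x) * (z.2 * x - z.1 * y) =
    (z.1 * a + z.2 * b) * (1 - (x ^+ 2 + y ^+ 2)) + (z.1 * x + z.2 * y) * (x * a + y * b) by ring.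
  by rewrite h1 h2 subrr !mulr0 addr0.
have qB z : q z = B * (z.2 * v.1 - z.1 * v.2).
  rewrite qE /B; move: qv uv; move: (q (1, 0)) (q (0, 1)) v.1 v.2 => a b x y h1 h2.
  apply/eqP; rewrite -subr_eq0; apply/eqP.
  have -> : z.1 * a + z.2 * b - (- a * y + b * x) * (z.2 * x - z.1 * y) =
    (z.1 * a + z.2 * b) * (1 - (x ^+ 2 + y ^+ 2)) + (z.1 * x + z.2 * y) * (x * a + y * b) by ring.
  by rewrite h1 h2 subrr !mulr0 addr0.
have [_ A0] : B = 0 /\ - A = 0 by apply: ind => z; rewrite pA qB; ring.
have [/eqP] : 1 = 0 :> R /\ 0 = 0 :> R.
  apply: ind => z; rewrite pA.
  by rewrite -(opprK A) A0 oppr0 !mul0r mulr0 addr0.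
by rewrite oner_eq0.
Qed.

Lemma unit_vec2_parallel (u v : R * R) : unit_vec2 v -> u.1 * v.2 - u.2 * v.1 = 0 ->
  u = (u.1 * v.1 + u.2 * v.2) *: v.
Proof.
case: u v => [x y] [a b]; rewrite /unit_vec2 pairZ /= => ab h; congr pair.
  transitivity (x * (a ^+ 2 + b ^+ 2) - (x * b - y * a) * b); last by ring.
  by rewrite ab h mul0r subr0 mulr1.
transitivity (y * (a ^+ 2 + b ^+ 2) + (x * b - y * a) * a); last by ring.
by rewrite ab h mul0r addr0 mulr1.
Qed.

(** [e1] spans the kernel of [pi2] and [e2] that of [pi1], both scaled to have [pi3] equal to 1;
    then [e1 - e2] lies in the kernel of [pi3]. *)
Lemma adapted_basis (pi1 pi2 pi3 : R * R -> R) v1 v2 v3 :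
  linear2 pi1 -> linear2 pi2 -> linear2 pi3 ->
  lin_indep2 pi1 pi2 -> lin_indep2 pi1 pi3 -> lin_indep2 pi2 pi3 ->
  unit_vec2 v1 -> unit_vec2 v2 -> unit_vec2 v3 ->
  pi1 v1 = 0 -> pi2 v2 = 0 -> pi3 v3 = 0 ->
  exists e1 e2 al1 al2, [/\ al1 != 0, al2 != 0, e1.1 * e2.2 - e1.2 * e2.1 != 0 &
    [/\ forall Z, pi1 (lin2 e1 e2 Z) = al1 * Z.1, forall Z, pi2 (lin2 e1 e2 Z) = al2 * Z.2,
      forall Z, pi3 (lin2 e1 e2 Z) = Z.1 + Z.2 &
    exists k1 k2 k3, [/\ k1 * k2 * k3 != 0, e1 = k1 *: v2, e2 = k2 *: v1 & e1 - e2 = k3 *: v3]]].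
Proof.
move=> l1 l2 l3 i12 i13 i23 u1 u2 u3 p1 p2 p3.
have n31 := lin_indep2_neq0 l1 l3 i13 u1 p1.
have n32 := lin_indep2_neq0 l2 l3 i23 u2 p2.
have n21 := lin_indep2_neq0 l1 l2 i12 u1 p1.
have i21 : lin_indep2 pi2 pi1.
  by move=> s t h; have [] : t = 0 /\ s = 0 by apply: i12 => z; rewrite addrC.
have n12 := lin_indep2_neq0 l2 l1 i21 u2 p2.
have E1 := linear2E l1; have E2 := linear2E l2; have E3 := linear2E l3.
pose e1 := (pi3 v2)^-1 *: v2; pose e2 := (pi3 v1)^-1 *: v1.
have Z1 : pi1 e2 = 0 by rewrite -[e2]addr0 l1 p1 mulr0 add0r; have := l1 1 0 0; rewrite scale1r addr0 mul1r => /(congr1 (fun x => x - pi1 0)); rewrite addrK subrr.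
have Z2 : pi2 e1 = 0 by rewrite -[e1]addr0 l2 p2 mulr0 add0r; have := l2 1 0 0; rewrite scale1r addr0 mul1r => /(congr1 (fun x => x - pi2 0)); rewrite addrK subrr.
have sc (p : R * R -> R) k v : linear2 p -> p (k *: v) = k * p v.
  by move=> lp; rewrite (linear2E lp (k *: v)) (linear2E lp v) /= /GRing.scale /=; ring.
have A1 : pi1 e1 != 0 by rewrite sc// mulf_neq0// invr_eq0.
have A2 : pi2 e2 != 0 by rewrite sc// mulf_neq0// invr_eq0.
have B1 : pi3 e1 = 1 by rewrite sc// mulVf.
have B2 : pi3 e2 = 1 by rewrite sc// mulVf.
exists e1, e2, (pi1 e1), (pi2 e2).
have pl (p : R * R -> R) Z : linear2 p -> p (lin2 e1 e2 Z) = Z.1 * p e1 + Z.2 * p e2.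
  by move=> lp; rewrite (linear2E lp (lin2 e1 e2 Z)) (linear2E lp e1) (linear2E lp e2) /=; ring.
split => //.
  have dd : pi1 e1 * pi2 e2 - pi1 e2 * pi2 e1 =
      (pi1 (1, 0) * pi2 (0, 1) - pi1 (0, 1) * pi2 (1, 0)) * (e1.1 * e2.2 - e1.2 * e2.1).
    by rewrite (E1 e1) (E1 e2) (E2 e1) (E2 e2); ring.
  apply/eqP => d0; move: dd; rewrite d0 mulr0 Z1 mul0r subr0 => /eqP.
  by rewrite mulf_eq0 (negbTE A1) (negbTE A2).
split.
- by move=> Z; rewrite pl// Z1 mulr0 addr0 mulrC.
- by move=> Z; rewrite pl// Z2 mulr0 add0r mulrC.
- by move=> Z; rewrite pl// B1 B2 !mulr1.
have P3 : pi3 (e1 - e2) = 0.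
  rewrite (_ : e1 - e2 = (-1) *: e2 + e1); last by rewrite scaleN1r addrC.
  by rewrite l3 B1 B2; ring.
pose k3 := (e1 - e2).1 * v3.1 + (e1 - e2).2 * v3.2.
have K3 : e1 - e2 = k3 *: v3.
  pose d := (e1 - e2).1 * v3.2 - (e1 - e2).2 * v3.1.
  have d0 : d = 0.
    have z1 : pi3 (1, 0) * d = 0.
      transitivity (v3.2 * pi3 (e1 - e2) - (e1 - e2).2 * pi3 v3); last by rewrite P3 p3 !mulr0 subrr.
      by rewrite (E3 (e1 - e2)) (E3 v3) /d; ring.
    have z2 : pi3 (0, 1) * d = 0.
      transitivity ((e1 - e2).1 * pi3 v3 - v3.1 * pi3 (e1 - e2)); last by rewrite P3 p3 !mulr0 subrr.
      by rewrite (E3 (e1 - e2)) (E3 v3) /d; ring.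
    rewrite -[d]mul1r -B1 (E3 e1).
    by rewrite mulrDl -!mulrA z1 z2 !mulr0 addr0.
  exact: unit_vec2_parallel.
exists (pi3 v2)^-1, (pi3 v1)^-1, k3; split => //.
apply: mulf_neq0; first by rewrite mulf_neq0// invr_eq0.
apply/eqP => k0; move: K3; rewrite k0 scale0r => /eqP; rewrite subr_eq0 => /eqP K3.
by move: A1; rewrite K3 Z1 eqxx.
Qed.

Lemma lin2_box e1 e2 (rho : R) : 0 < rho -> exists2 rho', 0 < rho' &
  box 0 0 rho' `<=` lin2 e1 e2 @^-1` box 0 0 rho.
Proof.
move=> r0; pose M := 1 + (`|e1.1| + `|e2.1|) + (`|e1.2| + `|e2.2|).
have M0 : 0 < M by rewrite /M -addrA ltr_pwDl// !addr_ge0.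
exists (rho / M); first by rewrite divr_gt0.
move=> Z [z1 z2]; rewrite !subr0 in z1 z2.
have H a b : `|a| + `|b| <= M -> `|Z.1 * a + Z.2 * b - 0| <= rho.
  move=> ab; rewrite subr0 (le_trans (ler_normD _ _))// !normrM.
  have h1 : `|Z.1| * `|a| <= rho / M * `|a| by rewrite ler_wpM2r.
  have h2 : `|Z.2| * `|b| <= rho / M * `|b| by rewrite ler_wpM2r.
  apply: (le_trans (lerD h1 h2)); rewrite -mulrDr.
  apply: (@le_trans _ _ (rho / M * M)); last by rewrite divfK// gt_eqF.
  by rewrite ler_wpM2l// divr_ge0 ?ltW.
by split; apply: H; rewrite /M; have := normr_ge0 e1.1; have := normr_ge0 e2.1;
  have := normr_ge0 e1.2; have := normr_ge0 e2.2; lra.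
Qed.

Lemma phase_normal_form (pi1 pi2 pi3 : R * R -> R) v1 v2 v3 S c r m :
  linear2 pi1 -> linear2 pi2 -> linear2 pi3 ->
  lin_indep2 pi1 pi2 -> lin_indep2 pi1 pi3 -> lin_indep2 pi2 pi3 ->
  unit_vec2 v1 -> unit_vec2 v2 -> unit_vec2 v3 ->
  pi1 v1 = 0 -> pi2 v2 = 0 -> pi3 v3 = 0 ->
  power_series_rep S c r -> is_mult_pi v1 v2 v3 c m ->
  exists e1 e2 al1 al2, [/\ al1 != 0, al2 != 0, e1.1 * e2.2 - e1.2 * e2.1 != 0 &
    [/\ forall Z, pi1 (lin2 e1 e2 Z) = al1 * Z.1, forall Z, pi2 (lin2 e1 e2 Z) = al2 * Z.2,
      forall Z, pi3 (lin2 e1 e2 Z) = Z.1 + Z.2 &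
    exists rho s, [/\ 0 < rho, jet (box 0 0 rho) s,
        forall Z, box 0 0 rho Z -> S (lin2 e1 e2 Z) = s 0 0 Z &
      [/\ (3 <= m)%N, forall p q, (p + q < m - 3)%N -> jetP s p q (0, 0) = 0 &
        exists p q, (p + q)%N = (m - 3)%N /\ jetP s p q (0, 0) != 0]]]].
Proof.
move=> l1 l2 l3 i12 i13 i23 u1 u2 u3 p1 p2 p3 psr mult.
have [e1 [e2 [al1 [al2 [a1 a2 de [q1 q2 q3 [k1 [k2 [k3 [k0 E1 E2 E3]]]]]]]]]] :=
  adapted_basis l1 l2 l3 i12 i13 i23 u1 u2 u3 p1 p2 p3.
exists e1, e2, al1, al2; split => //; split => //.
have [rho r0 [h [jh Sh h0]]] := power_series_jet psr.
have [m3 low [p [q [pq nz]]]] := multiplicity_jets mult h0.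
have [rho' r0' sub] := lin2_box e1 e2 r0.
set G := Dir v1 (Dir v2 (Dir v3 h)) in low nz *.
have L0 : lin2 e1 e2 (0, 0) = (0, 0) by rewrite /lin2 /= !mul0r addr0.
exists rho', (pull e1 e2 h); split => //.
- exact: jet_sub sub (jet_pull jh).
- by move=> Z /sub; exact: Sh.
split => //.
- move=> p' q' hpq; rewrite (jetP_pull h p' q' (0, 0) E1 E2 E3) -/G /pull L0.
  by rewrite (iter_Dir_eq0 _ _ low) ?mulr0// addn0.
- apply: contrapT => hn; move/eqP: nz; apply.
  apply: (iter_Dir_basis de) pq => p' q' pq'.
  apply: contrapT => nz'; apply: hn; exists p', q'; split => //.
  rewrite (jetP_pull h p' q' (0, 0) E1 E2 E3) -/G /pull L0.
  by apply: mulf_neq0 => //; apply/eqP.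
Qed.

End DirectionalJets.

(** * Square integrable inputs *)

Section SquareIntegrableInputs.
Context {R : realType}.
Implicit Types (e Z : R * R) (f g : R -> R).

(** The bound [M] on the absolute integrals may be crude: monotone convergence only needs it to make
    [H] integrable. Then [H] dominates the sequence and the sharp bound [B] passes to the limit. *)
Lemma limit_bound d (T : measurableType d) (mu : {measure set T -> \bar R})
    (h : nat -> T -> R) (H : T -> R) (M B : R) :
  (forall n, measurable_fun setT (h n)) -> measurable_fun setT H ->
  (forall n, mu.-integrable setT (EFin \o h n)) ->
  (forall n m (z : T), (n <= m)%N -> `|h n z| <= `|h m z|) ->
  (forall n (z : T), `|h n z| <= `|H z|) ->
  (forall z : T, \forall n \near \oo, h n z = H z) ->
  (forall n, Rintegral mu setT (fun z => `|h n z|) <= M) ->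
  (forall n, `|Rintegral mu setT (h n)| <= B) ->
  mu.-integrable setT (EFin \o H) /\ `|Rintegral mu setT H| <= B.
Proof.
move=> mh mH ih mono hH cvh hM hB.
pose g n (z : T) := (`|h n z|)%:E.
have mg n : measurable_fun setT (g n).
  by apply/measurable_EFinP; exact: measurableT_comp.
have lg z : limn (g ^~ z) = (`|H z|)%:E.
  apply/cvg_lim => //; apply: cvg_near_cst.
  by apply: filterS (cvh z) => n; rewrite /g => ->.
have gfin n : (\int[mu]_z g n z = (Rintegral mu setT (fun z => `|h n z|))%:E)%E.
  rewrite /Rintegral fineK//; apply: (integrable_fin_num measurableT).
  by have := integrable_norm (ih n).
have intH : (\int[mu]_z (`|H z|)%:E <= M%:E)%E.
  have g0 n z : setT z -> (0 <= g n z)%E by rewrite lee_fin.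
  have gm z : setT z -> {homo g ^~ z : n m / (n <= m)%N >-> (n <= m)%E}.
    by move=> _ n m nm; rewrite lee_fin; exact: mono.
  have C := @cvg_monotone_convergence _ _ _ mu _ measurableT g mg g0 gm.
  have -> : (\int[mu]_z (`|H z|)%:E = \int[mu]_z limn (g ^~ z))%E.
    by apply: eq_integral => z _; rewrite lg.
  rewrite -(cvg_lim _ C)//; apply: lime_le; first by apply/cvg_ex; eexists; exact: C.
  by apply: nearW => n; rewrite gfin lee_fin.
have iH : mu.-integrable setT (EFin \o H).
  apply/integrableP; split; first exact/measurable_EFinP.
  by apply: le_lt_trans intH _; rewrite ltry.
split=> //.
have iN : mu.-integrable setT (fun z => (`|H z|)%:E) by have := integrable_norm iH.
have D : ((\int[mu]_z (h n z)%:E)%E @[n --> \oo] --> (\int[mu]_z (H z)%:E)%E).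
  apply: (@dominated_cvg _ _ _ mu _ measurableT (fun n z => (h n z)%:E) (fun z => (H z)%:E) (fun z => (`|H z|)%:E)) => //.
  - by move=> n; exact/measurable_EFinP.
  - by move=> z _; apply: cvg_near_cst; apply: filterS (cvh z) => n ->.
  - by move=> n z _; rewrite lee_fin.
have HE : (\int[mu]_z (H z)%:E = (Rintegral mu setT H)%:E)%E.
  by rewrite /Rintegral fineK//; exact: (integrable_fin_num measurableT iH).
rewrite HE in D.
have [_ D'] := (fine_cvgP _ _).1 D.
have N := cvg_norm D'.
have := @cvgr_to_le nat \oo _ R (fun n => `|Rintegral mu setT (h n)|) _ B (N _).
by apply; apply: nearW => n; exact: hB.
Qed.

Lemma measurable_lin2 e1 e2 : measurable_fun setT (lin2 e1 e2).
Proof.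
have h (a b : R) : measurable_fun setT (fun Z : R * R => Z.1 * a + Z.2 * b).
  by apply: measurable_funD; apply: measurable_funM; first [exact: measurable_cst|exact: measurable_fst|exact: measurable_snd].
by apply: measurable_fun_pair; exact: h.
Qed.

Lemma bmeas_lin2 (F : R * R -> R) e1 e2 : e1.1 * e2.2 - e1.2 * e2.1 != 0 -> bmeas size2 F ->
  bmeas size2 (fun Z => F (lin2 e1 e2 Z)).
Proof.
move=> de bF; set D := _ - _ in de.
pose C := (`|e1.1| + `|e1.2| + `|e2.1| + `|e2.2|) / `|D|.
have C0 : 0 <= C by rewrite divr_ge0// !addr_ge0.
apply: (@bmeas_comp _ _ _ _ _ _ _ F (lin2 e1 e2) C) => //; first exact: bF.
  exact: measurable_lin2.
move=> Z; rewrite /size2 /size_prod /size1 /=.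
set x := Z.1 * e1.1 + _; set y := Z.1 * e1.2 + _.
have Dn : `|D| != 0 by rewrite normr_eq0.
have h1 : `|Z.1| = `|e2.2 * x - e2.1 * y| / `|D|.
  by rewrite (_ : e2.2 * x - e2.1 * y = Z.1 * D) ?normrM ?mulfK// /x /y /D; ring.
have h2 : `|Z.2| = `|e1.1 * y - e1.2 * x| / `|D|.
  by rewrite (_ : e1.1 * y - e1.2 * x = Z.2 * D) ?normrM ?mulfK// /x /y /D; ring.
rewrite h1 h2 -mulrDl /C mulrAC; apply: ler_wpM2r; first by rewrite invr_ge0.
have n1 := ler_normB (e2.2 * x) (e2.1 * y); have n2 := ler_normB (e1.1 * y) (e1.2 * x).
rewrite !normrM in n1 n2; apply: (le_trans (lerD n1 n2)).
move: (normr_ge0 x) (normr_ge0 y) (normr_ge0 e1.1) (normr_ge0 e1.2) (normr_ge0 e2.1) (normr_ge0 e2.2).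
move: (`|x|) (`|y|) (`|e1.1|) (`|e1.2|) (`|e2.1|) (`|e2.2|) => X Y a b c d X0 Y0 a0 b0 c0 d0.
have := mulr_ge0 a0 X0; have := mulr_ge0 b0 Y0; have := mulr_ge0 c0 X0; have := mulr_ge0 d0 Y0.
by nra.
Qed.

(** The matrix is factored into two triangular ones, each a one-dimensional affine substitution with
    the other variable fixed; the pivot is [a]. *)
Lemma Int2_shear (F : R * R -> R) (a b c d : R) : a != 0 -> a * d - b * c != 0 ->
  bmeas size2 F ->
  Int2 (fun Z => F (lin2 (a, b) (c, d) Z)) = `|a * d - b * c|^-1 * Int2 F.
Proof.
move=> a0 D0 bF.
have bL : bmeas size2 (fun Z => F (lin2 (a, b) (c, d) Z)) by apply: bmeas_lin2.
rewrite Int2E_swap//.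
pose k := (a * d - b * c) / a.
have k0 : k != 0 by rewrite mulf_neq0// invr_eq0.
pose G (z : R * R) := F (z.1, b / a * z.1 + k * z.2).
have bG : bmeas size2 G.
  have n0 : (1, b / a).1 * (0, k).2 - (1, b / a).2 * (0, k).1 != 0 :> R by rewrite /= mul1r mulr0 subr0.
  have -> : G = fun z => F (lin2 (1, b / a) (0, k) z).
    by apply/funext => z; rewrite /G /lin2 /=; congr (F (_, _)); ring.
  by apply: bmeas_lin2 bF; exact: n0.
have E y : Int (fun x => F (lin2 (a, b) (c, d) (x, y))) = `|a|^-1 * Int (fun x => G (x, y)).
  rewrite -(Int_affine (c * y) a0 (bmeas_section_l y bG)); apply: eq_Int => x.
  by rewrite /G /lin2 /k /=; congr (F (_, _)); [ring|field].
rewrite (eq_Int E) IntZ; last exact: (bmeas_Int_l bG).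
rewrite -(Int_swap bG).
have E' x : Int (fun y => G (x, y)) = `|k|^-1 * Int (fun y => F (x, y)).
  rewrite -(Int_affine (b / a * x) k0 (bmeas_section_r x bF)); apply: eq_Int => y.
  by rewrite /G /= [k * y + _]addrC.
rewrite (eq_Int E') IntZ; last exact: (bmeas_Int_r bF).
have ak : a * k = a * d - b * c by rewrite /k mulrC divfK.
by rewrite -Int2E// mulrA -invfM -normrM ak.
Qed.

Lemma Int2_lin2 (F : R * R -> R) e1 e2 : e1.1 * e2.2 - e1.2 * e2.1 != 0 -> bmeas size2 F ->
  Int2 (fun Z => F (lin2 e1 e2 Z)) = `|e1.1 * e2.2 - e1.2 * e2.1|^-1 * Int2 F.
Proof.
case: e1 e2 => [a b] [c d] /= de bF.
have [a0|a0] := eqVneq a 0; last exact: Int2_shear.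
have c0 : c != 0 by apply: contraNneq de => ->; rewrite a0 mul0r mulr0 subrr.
have E : c * b - d * a = - (a * d - b * c) by ring.
have de' : c * b - d * a != 0 by rewrite E oppr_eq0.
have bL1 : bmeas size2 (fun Z => F (lin2 (a, b) (c, d) Z)) by apply: bmeas_lin2.
have bL2 : bmeas size2 (fun Z => F (lin2 (c, d) (a, b) Z)) by apply: bmeas_lin2.
rewrite -normrN -E -(Int2_shear c0 de' bF) (Int2E bL1) (Int2E_swap bL2).
by apply: eq_Int => x; apply: eq_Int => y; rewrite /lin2 /=; congr (F (_, _)); ring.
Qed.

Definition trunc (n : nat) g x : R := if (`|x| <= n%:R) && (`|g x| <= n%:R) then g x else 0.

Lemma bmeas_trunc n g : measurable_fun setT g -> bmeas size1 (trunc n g).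
Proof.
move=> mg; split.
  apply: measurable_fun_ifT => //.
  apply: measurable_and; apply: measurable_fun_ler => //; exact: measurableT_comp.
exists n%:R => x; rewrite /trunc /size1; split.
  by case: ifPn => [/andP[]//|_]; rewrite normr0.
by move=> nx; rewrite leNgt nx.
Qed.

Lemma trunc_le n m g x : (n <= m)%N -> `|trunc n g x| <= `|trunc m g x|.
Proof.
move=> nm; rewrite /trunc; case: (boolP (_ && _)) => [/andP[h1 h2]|_]; last by rewrite normr0.
have nm' : n%:R <= m%:R :> R by rewrite ler_nat.
by rewrite (le_trans h1 nm') (le_trans h2 nm').
Qed.

Lemma norm_trunc_le n g x : `|trunc n g x| <= `|g x|.
Proof. by rewrite /trunc; case: ifPn => // _; rewrite normr0. Qed.

Lemma trunc_near g x : \forall n \near \oo, trunc n g x = g x.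
Proof.
exists (Num.truncn (`|x| + `|g x|)).+1 => // n /= hn.
have h : `|x| + `|g x| < n%:R by apply: lt_le_trans (truncnS_gt _) _; rewrite ler_nat.
rewrite /trunc; have -> // : (`|x| <= n%:R) && (`|g x| <= n%:R).
by have := normr_ge0 x; have := normr_ge0 (g x); move=> *; apply/andP; split; lra.
Qed.

Lemma bmeas_scale (k : R) g : k != 0 -> bmeas size1 g -> bmeas size1 (fun x => g (k * x)).
Proof.
move=> k0 bg; apply: (@bmeas_comp _ _ _ _ _ _ _ g (fun x => k * x) `|k|^-1) => //.
- exact: bg.
- by apply: measurable_funM.
- move=> x; rewrite /size1 normrM mulrDr mulr1 mulrA mulVf ?normr_eq0// mul1r lerDr invr_ge0//.
Qed.

Lemma nrm_scale (k : R) g : k != 0 -> bmeas size1 g ->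
  nrm (fun x => g (k * x)) = Num.sqrt `|k|^-1 * nrm g.
Proof.
move=> k0 bg; rewrite /nrm -sqrtrM ?invr_ge0//; congr Num.sqrt.
rewrite /energy -(Int_affine 0 k0 (bmeasX 1 bg)).
by apply: eq_Int => x; rewrite addr0.
Qed.

Lemma nrm_abs g : nrm (fun x => `|g x|) = nrm g.
Proof. by rewrite /nrm /energy; congr Num.sqrt; apply: eq_Int => x; rewrite real_normK ?num_real. Qed.

Section Form.
Variables (Sg A : R * R -> R) (rho BA D al1 al2 : R) (e1 e2 : R * R).
Hypotheses (mS : measurable_fun setT Sg) (bA : bmeasurable A).
Hypothesis rho0 : 0 <= rho.
Hypothesis AB : forall Z, `|A Z| <= BA.
Hypothesis As : forall Z, A Z != 0 -> `|Z.1| < rho.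
Hypothesis TriD : forall f1 f2 f3, bmeas size1 f1 -> bmeas size1 f2 -> bmeas size1 f3 ->
  `|Tri Sg A f1 f2 f3| <= D * (nrm f1 * nrm f2 * nrm f3).
Hypotheses (D0 : 0 <= D) (al10 : al1 != 0) (al20 : al2 != 0).
Hypothesis de : e1.1 * e2.2 - e1.2 * e2.1 != 0.

Definition form g1 g2 g3 Z :=
  cos (Sg Z) * A Z * (g1 (al1 * Z.1) * g2 (al2 * Z.2) * g3 (Z.1 + Z.2)).

(** The Jacobian of the coordinate change times the factors by which rescaling the first two inputs
    changes their norms. *)
Definition jac := `|e1.1 * e2.2 - e1.2 * e2.1|^-1 * (Num.sqrt `|al1|^-1 * Num.sqrt `|al2|^-1).

Lemma jac_ge0 : 0 <= jac.
Proof. by apply: mulr_ge0; [rewrite invr_ge0|apply: mulr_ge0; exact: sqrtr_ge0]. Qed.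

Lemma bmeas_form g1 g2 g3 : bmeas size1 g1 -> bmeas size1 g2 -> bmeas size1 g3 ->
  bmeas size2 (form g1 g2 g3).
Proof.
move=> b1 b2 b3.
by have := bmeas_Tri mS bA (bmeas_scale al10 b1) (bmeas_scale al20 b2) b3.
Qed.

Lemma nrm_prod_le (g1 g2 g3 : R -> R) (N1 N2 N3 : R) :
  nrm g1 <= N1 -> nrm g2 <= N2 -> nrm g3 <= N3 -> nrm g1 * nrm g2 * nrm g3 <= N1 * N2 * N3.
Proof.
move=> n1 n2 n3; apply: ler_pM => //; rewrite ?nrm_ge0//; first by apply: mulr_ge0; exact: nrm_ge0.
by apply: ler_pM => //; exact: nrm_ge0.
Qed.

Lemma form_bounded g1 g2 g3 (N1 N2 N3 : R) :
  bmeas size1 g1 -> bmeas size1 g2 -> bmeas size1 g3 ->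
  nrm g1 <= N1 -> nrm g2 <= N2 -> nrm g3 <= N3 ->
  `|Int2 (fun z => form g1 g2 g3 (lin2 e1 e2 z))| <= jac * D * (N1 * N2 * N3).
Proof.
move=> b1 b2 b3 n1 n2 n3.
have b1' := bmeas_scale al10 b1; have b2' := bmeas_scale al20 b2.
rewrite (Int2_lin2 de (bmeas_form b1 b2 b3)) -(TriE mS bA b1' b2' b3) normrM ger0_norm ?invr_ge0//.
apply: (le_trans (ler_wpM2l _ (TriD b1' b2' b3))); first by rewrite invr_ge0.
rewrite !nrm_scale//.
apply: (@le_trans _ _ (jac * D * (nrm g1 * nrm g2 * nrm g3))).
  by rewrite le_eqVlt; apply/orP; left; apply/eqP; rewrite /jac; ring.
by apply: ler_wpM2l; [exact: (mulr_ge0 jac_ge0)|exact: nrm_prod_le].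
Qed.

(** The absolute value of the integrand is again of trilinear type, with zero phase and amplitude
    [|cos (Sg Z) * A Z|], so the trivial estimate applies. *)
Lemma form_abs_bounded g1 g2 g3 (N1 N2 N3 : R) :
  bmeas size1 g1 -> bmeas size1 g2 -> bmeas size1 g3 ->
  nrm g1 <= N1 -> nrm g2 <= N2 -> nrm g3 <= N3 ->
  Int2 (fun z => `|form g1 g2 g3 (lin2 e1 e2 z)|) <=
      jac * (BA * Num.sqrt (2 * rho)) * (N1 * N2 * N3).
Proof.
move=> b1 b2 b3 n1 n2 n3; have r0 := rho0.
have b1' := bmeas_scale al10 b1; have b2' := bmeas_scale al20 b2.
have bF := bmeas_form b1 b2 b3.
have BA0 : 0 <= BA by apply: le_trans (AB (0, 0)).
rewrite (Int2_lin2 de (bmeas_norm bF)).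
pose A' Z := `|cos (Sg Z) * A Z|.
have bA' : bmeasurable A'.
  by apply: bmeasurable_norm; apply: bmeasurableM => //; exact: bmeasurable_cos.
have m0 : measurable_fun setT (fun _ : R * R => 0 : R) by exact: measurable_cst.
pose c1 := cut (fun x => `|g1 (al1 * x)|) (- rho) (- rho + 2 * rho).
have bc1 : bmeas size1 c1 by apply: bmeas_cut; exact: bmeas_norm.
have bn2 := bmeas_norm b2'; have bn3 := bmeas_norm b3.
have -> : Int2 (fun t => `|form g1 g2 g3 t|) =
    Tri (fun=> 0) A' c1 (fun x => `|g2 (al2 * x)|) (fun x => `|g3 x|).
  rewrite (TriE m0 bA' bc1 bn2 bn3); congr Int2; apply/funext => Z.
  rewrite cos0 mul1r /form /A' /c1 /cut.
  have [->|/As] := eqVneq (A Z) 0; first by rewrite !mulr0 !mul0r normr0 mul0r.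
  rewrite ltr_norml => /andP[h1 h2]; rewrite /hind.
  have -> : (- rho <= Z.1) && (Z.1 < - rho + 2 * rho) by apply/andP; split; lra.
  by rewrite mul1r !normrM.
have A'B Z : `|A' Z| <= BA.
  rewrite normr_id normrM -[BA]mul1r; apply: ler_pM => //.
  by rewrite ler_norml cos_geN1 cos_le1.
have sup x : c1 x != 0 -> - rho <= x <= - rho + 2 * rho.
  by move=> /cut_neq0[/andP[h1 /ltW h2] _]; rewrite h1 h2.
have t := Tri_trivial m0 bA' (mulr_ge0 (ler0n _ 2) r0) BA0 bc1 bn2 bn3 sup (fun x y _ _ => A'B (x, y)).
rewrite (nrm_abs (fun x => g2 (al2 * x))) (nrm_abs g3) (nrm_scale al20 b2) in t.
have cl : nrm c1 <= Num.sqrt `|al1|^-1 * nrm g1.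
  rewrite -(nrm_scale al10 b1) -(nrm_abs (fun x => g1 (al1 * x))).
  by apply: nrm_cut_le; exact: bmeas_norm.
apply: (le_trans (ler_wpM2l _ (le_trans (ler_norm _) t))); first by rewrite invr_ge0.
have s10 := sqrtr_ge0 `|al1|^-1; have s20 := sqrtr_ge0 `|al2|^-1; have s30 := sqrtr_ge0 (2 * rho).
rewrite /jac -2!(mulrA (`|_|^-1)); apply: ler_wpM2l; first by rewrite invr_ge0.
move: s10 s20 s30 cl; move: (Num.sqrt `|al1|^-1) (Num.sqrt `|al2|^-1) (Num.sqrt (2 * rho)) => s1 s2 s3 s10 s20 s30 cl.
apply: (@le_trans _ _ (BA * s3 * (s1 * nrm g1 * (s2 * nrm g2) * nrm g3))).
  apply: ler_wpM2l; first exact: mulr_ge0.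
  by do 2 (apply: ler_wpM2r; rewrite ?mulr_ge0 ?nrm_ge0//).
have -> : BA * s3 * (s1 * nrm g1 * (s2 * nrm g2) * nrm g3) =
  s1 * s2 * (BA * s3) * (nrm g1 * nrm g2 * nrm g3) by ring.
apply: (@le_trans _ _ (s1 * s2 * (BA * s3) * (N1 * N2 * N3))).
  by apply: ler_wpM2l; [rewrite !mulr_ge0|exact: nrm_prod_le].
by rewrite le_eqVlt; apply/orP; left; apply/eqP; ring.
Qed.

Lemma measurable_form g1 g2 g3 : measurable_fun setT g1 -> measurable_fun setT g2 ->
  measurable_fun setT g3 -> measurable_fun setT (form g1 g2 g3).
Proof.
move=> m1 m2 m3.
have s1 (k : R) : measurable_fun setT (fun Z : R * R => k * Z.1).
  by apply: measurable_funM; [exact: measurable_cst|exact: measurable_fst].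
have s2 (k : R) : measurable_fun setT (fun Z : R * R => k * Z.2).
  by apply: measurable_funM; [exact: measurable_cst|exact: measurable_snd].
have s3 : measurable_fun setT (fun Z : R * R => Z.1 + Z.2).
  by apply: measurable_funD; [exact: measurable_fst|exact: measurable_snd].
apply: measurable_funM.
  by apply: measurable_funM; [have [] := bmeasurable_cos mS|have [] := bA].
apply: measurable_funM; last exact: (measurableT_comp m3 s3).
by apply: measurable_funM; [exact: (measurableT_comp m1 (s1 _))|exact: (measurableT_comp m2 (s2 _))].
Qed.

Lemma form_le (g1 g2 g3 h1 h2 h3 : R -> R) Z :
  (forall x, `|g1 x| <= `|h1 x|) -> (forall x, `|g2 x| <= `|h2 x|) ->
  (forall x, `|g3 x| <= `|h3 x|) -> `|form g1 g2 g3 Z| <= `|form h1 h2 h3 Z|.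
Proof.
move=> l1 l2 l3; rewrite /form normrM [leRHS]normrM; apply: ler_wpM2l => //.
by rewrite !normrM; apply: ler_pM => //; exact: ler_pM.
Qed.

Lemma form_bound g1 g2 g3 (N1 N2 N3 : R) :
  measurable_fun setT g1 -> measurable_fun setT g2 -> measurable_fun setT g3 ->
  (forall n, nrm (trunc n g1) <= N1) -> (forall n, nrm (trunc n g2) <= N2) ->
  (forall n, nrm (trunc n g3) <= N3) ->
  (@leb2 R).-integrable setT (EFin \o (fun z => form g1 g2 g3 (lin2 e1 e2 z))) /\
  `|Rintegral (@leb2 R) setT (fun z => form g1 g2 g3 (lin2 e1 e2 z))| <= jac * D * (N1 * N2 * N3).
Proof.
move=> m1 m2 m3 n1 n2 n3.
have b1 n := bmeas_trunc n m1; have b2 n := bmeas_trunc n m2; have b3 n := bmeas_trunc n m3.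
have bT n : bmeas size2 (fun z => form (trunc n g1) (trunc n g2) (trunc n g3) (lin2 e1 e2 z)).
  exact: (bmeas_lin2 de (bmeas_form (b1 n) (b2 n) (b3 n))).
apply: (@limit_bound _ _ (@leb2 R) (fun n z => form (trunc n g1) (trunc n g2) (trunc n g3) (lin2 e1 e2 z))
   _ (jac * (BA * Num.sqrt (2 * rho)) * (N1 * N2 * N3))).
- by move=> n; have [] := bT n.
- exact: (measurableT_comp (measurable_form m1 m2 m3) (measurable_lin2 e1 e2)).
- by move=> n; exact: bmeas2_integrable.
- by move=> n m z nm; apply: form_le => x; exact: trunc_le.
- by move=> n z; apply: form_le => x; exact: norm_trunc_le.
- move=> z; rewrite /form; set Z := lin2 _ _ _.
  apply: filterS3 (trunc_near g1 (al1 * Z.1)) (trunc_near g2 (al2 * Z.2)) (trunc_near g3 (Z.1 + Z.2)) => n.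
  by move=> -> -> ->.
- by move=> n; exact: form_abs_bounded.
- by move=> n; exact: form_bounded.
Qed.

End Form.

End SquareIntegrableInputs.

(** * The upper bound *)

Section UpperBound.
Context {R : realType}.
Implicit Types (Z z : R * R) (b : R * R -> R).

Definition part (c : bool) (w : R[i]) : R := if c then complex.Im w else complex.Re w.

Lemma part_sqr_le c (w : R[i]) : part c w ^+ 2 <= cmod w ^+ 2.
Proof.
rewrite /cmod sqr_sqrtr; last by rewrite addr_ge0 ?sqr_ge0.
by case: c; rewrite /part ?lerDl ?lerDr sqr_ge0.
Qed.

Lemma cmod_le (w : R[i]) (B : R) : (forall c, `|part c w| <= B) -> cmod w <= 2 * B.
Proof.
move=> h; have h1 := h false; have h2 := h true; rewrite /part in h1 h2.
have B0 : 0 <= B by apply: le_trans h1.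
have s0 : 0 <= cmod w by exact: sqrtr_ge0.
rewrite -ler_sqr ?nnegrE ?mulr_ge0// /cmod sqr_sqrtr; last by rewrite addr_ge0 ?sqr_ge0.
rewrite -[complex.Re w ^+ 2]real_normK ?num_real// -[complex.Im w ^+ 2]real_normK ?num_real//.
have p1 := normr_ge0 (complex.Re w); have p2 := normr_ge0 (complex.Im w).
have q1 : `|complex.Re w| ^+ 2 <= B ^+ 2 by rewrite ler_sqr ?nnegrE.
have q2 : `|complex.Im w| ^+ 2 <= B ^+ 2 by rewrite ler_sqr ?nnegrE.
by rewrite exprMn; have := sqr_ge0 B; move: q1 q2; move: (_ ^+ 2) (_ ^+ 2) (_ ^+ 2) => u v t; lra.
Qed.

Definition quarter (n : nat) : R := n%:R * (pi / 2).

Lemma cos_quarter (t : R) n : cos (t + quarter n.+2) = - cos (t + quarter n).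
Proof.
rewrite (_ : t + quarter n.+2 = (t + quarter n) + pi); last first.
  by rewrite /quarter -addn2 natrD; field.
by rewrite cosD cospi sinpi mulr0 subr0 mulrN1.
Qed.

Lemma cos_quarter0 (t : R) : cos (t + quarter 0) = cos t.
Proof. by rewrite /quarter mul0r addr0. Qed.

Lemma cos_quarter1 (t : R) : cos (t + quarter 1) = - sin t.
Proof. by rewrite /quarter mul1r cosD cos_pihalf sin_pihalf mulr0 mulr1 sub0r. Qed.

Lemma complex_mulE (a b c d : R) :
  Complex a b * Complex c d = Complex (a * c - b * d) (a * d + b * c).
Proof. by []. Qed.

(* A factor [i] in the product is a quarter turn of the phase; taking the
   imaginary part amounts to three more. *)
Lemma part_expand (e : bool) (t : R) (w0 w1 w2 w3 : R[i]) :
  part e (expi t * w0 * (w1 * w2 * w3)) =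
  \sum_(c0 : bool) \sum_(c1 : bool) \sum_(c2 : bool) \sum_(c3 : bool)
    cos (t + quarter (e * 3 + (c0 + c1 + c2 + c3))) * part c0 w0 *
      (part c1 w1 * part c2 w2 * part c3 w3).
Proof.
rewrite !big_bool /=; case: w0 w1 w2 w3 => [a0 b0] [a1 b1] [a2 b2] [a3 b3].
rewrite /expi !complex_mulE.
case: e; rewrite /part /= ?(addn0, add0n, mul1n, mul0n) ?(addnS, addSn, addn0, add0n);
  by rewrite !(cos_quarter, cos_quarter0, cos_quarter1); ring.
Qed.

Lemma L2_part c (f : R -> R[i]) : L2 f -> measurable_fun setT (fun x => part c (f x)) /\
  forall n, nrm (trunc n (fun x => part c (f x))) <= L2norm f.
Proof.
move=> [mr [mi fin]].
have mp : measurable_fun setT (fun x => part c (f x)) by case: c.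
split=> // n; apply: ler_wsqrtr.
have msq : measurable_fun setT (fun x => cmod (f x) ^+ 2).
  rewrite (_ : (fun x => _) = (fun x => complex.Re (f x) ^+ 2 + complex.Im (f x) ^+ 2)).
    by apply: measurable_funD; apply: measurable_funX.
  by apply/funext => x; rewrite /cmod sqr_sqrtr// addr_ge0 ?sqr_ge0.
have ic : (@lebesgue_measure R).-integrable setT (EFin \o (fun x => cmod (f x) ^+ 2)).
  apply/integrableP; split; first exact/measurable_EFinP.
  apply: le_lt_trans fin; rewrite le_eqVlt; apply/orP; left; apply/eqP.
  by apply: eq_integral => x _ /=; rewrite ger0_norm ?sqr_ge0.
apply: le_Rintegral => //.
  by have := bmeas_integrable (bmeasX 1 (bmeas_trunc n mp)).
move=> x _; apply: le_trans (part_sqr_le c (f x)).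
rewrite -[X in X <= _]real_normK ?num_real// -[leRHS]real_normK ?num_real//.
by rewrite ler_sqr ?nnegrE ?normr_ge0//; exact: norm_trunc_le.
Qed.

Lemma lin2_derive (b : R * R -> R) e1 e2 (x y : R) : differentiable b (lin2 e1 e2 (x, y)) ->
  is_derive x 1 (fun u => b (lin2 e1 e2 (u, y))) ('D_e1 b (lin2 e1 e2 (x, y))).
Proof.
move=> db.
have h (p q : R) : is_diff x (fun u : R => u * p + y * q) (fun h => h * p).
  apply: is_diff_of_derive.
  by apply: (der_eq (der_add (der_mul (der_id x) (der_cst x p)) (der_cst x (y * q)))); ring.
have dc := is_diff_pair (h e1.1 e2.1) (h e1.2 e2.2).
have db' : is_diff (lin2 e1 e2 (x, y)) b ('d b (lin2 e1 e2 (x, y))) by exact: DiffDef.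
have := is_derive_of_diff (is_diff_comp dc db').
by rewrite /= deriveE// !mul1r -surjective_pairing.
Qed.

Lemma derive_supported b (v : R * R) (K : set (R * R)) : closed K ->
  (forall z, b z != 0 -> K z) -> forall z, 'D_v b z != 0 -> K z.
Proof.
move=> cK bK z; apply: contraNP => nK.
have oK : open (~` K) by exact: closed_openC.
rewrite (near_eq_derive (g := cst 0) v); first by rewrite derive_cst.
have := open_nbhs_nbhs (conj oK nK); apply: filterS => w nw.
by apply/eqP; apply: contraPT nw => /bK h; exact.
Qed.

Lemma compact_supported_bounded b (K : set (R * R)) : continuous b -> compact K ->
  (forall z, b z != 0 -> K z) -> exists M : R, forall z, `|b z| <= M.
Proof.
move=> cb cK bK.
have ci : compact (b @` K) by apply: continuous_compact => //; exact: continuous_subspaceT.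
have [M [_ hM]] := compact_bounded ci.
exists (Num.max 0 (M + 1)) => z; rewrite le_max.
have [->|/bK Kz] := eqVneq (b z) 0; first by rewrite normr0 lexx.
by rewrite (hM (M + 1)) ?orbT ?ltrDl//; exists z.
Qed.

(** Only derivatives along [e1] are recorded, since the integrations by parts take place in the
    first coordinate. *)
Lemma smooth_amplitude b (K : set (R * R)) e1 e2 : smooth2 b -> compact K ->
  (forall z, b z != 0 -> K z) -> exists A1 A2 : R * R -> R, exists M : R,
  let A0 := fun Z => b (lin2 e1 e2 Z) in
  [/\ forall x y : R, is_derive x 1 (fun u => A0 (u, y)) (A1 (x, y)),
      forall x y : R, is_derive x 1 (fun u => A1 (u, y)) (A2 (x, y)),
      forall x y : R, {for x, continuous (fun u => A2 (u, y))},
      forall z, [/\ `|A0 z| <= M, `|A1 z| <= M & `|A2 z| <= M] &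
      measurable_fun setT A0].
Proof.
move=> sb cK bK.
have clK : closed K by apply: compact_closed => //; exact: norm_hausdorff.
have df vs z : differentiable (Defs.iterD vs b) z := sb vs z.
have cont vs : continuous (Defs.iterD vs b) by move=> z; exact: differentiable_continuous.
have sup vs : forall z, Defs.iterD vs b z != 0 -> K z.
  by elim: vs => [//|v vs ih] /=; exact: derive_supported.
have bd vs := compact_supported_bounded (cont vs) cK (sup vs).
have [M0 h0] := bd [::]; have [M1 h1] := bd [:: e1]; have [M2 h2] := bd [:: e1; e1].
exists (fun Z => Defs.iterD [:: e1] b (lin2 e1 e2 Z)), (fun Z => Defs.iterD [:: e1; e1] b (lin2 e1 e2 Z)).
exists (Num.max M0 (Num.max M1 M2)); split.
- by move=> x y; exact: (lin2_derive (df [::] _)).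
- by move=> x y; exact: (lin2_derive (df [:: e1] _)).
- by move=> x y; apply: der_continuous (lin2_derive (df [:: e1; e1] _)).
- by move=> Z; rewrite !le_max; split; apply/orP; [left; exact: h0|right; apply/orP; left; exact: h1|right; apply/orP; right; exact: h2].
- by apply: measurableT_comp (measurable_lin2 e1 e2); apply: continuous_measurable2; exact: (cont [::]).
Qed.

Lemma part_neq0 c (w : R[i]) : part c w != 0 -> w != 0.
Proof. by apply: contra_neq => ->; case: c. Qed.

Lemma smooth2C_continuous (a : R * R -> R[i]) c : smooth2C a -> continuous (fun z => part c (a z)).
Proof. by move=> [sr si] z; apply: differentiable_continuous; case: c; [exact: (si [::])|exact: (sr [::])]. Qed.

Lemma smooth2C_bounded (a : R * R -> R[i]) (K : set (R * R)) : smooth2C a -> compact K ->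
  (forall z, a z != 0 -> K z) -> exists M : R, forall c z, `|part c (a z)| <= M.
Proof.
move=> sa cK aK.
have h c := compact_supported_bounded (@smooth2C_continuous a c sa) cK (fun z hz => aK z (part_neq0 hz)).
have [M0 hM0] := h false; have [M1 hM1] := h true.
exists (Num.max M0 M1) => -[] z; rewrite le_max; first by rewrite hM1 orbT.
by rewrite hM0.
Qed.

Definition bounded_integral (H : R * R -> R) (B : R) :=
  (@leb2 R).-integrable setT (EFin \o H) /\ `|Rintegral (@leb2 R) setT H| <= B.

Lemma bounded_integral_sum (H : bool -> R * R -> R) B : (forall c, bounded_integral (H c) B) ->
  bounded_integral (fun z => \sum_(c : bool) H c z) (2 * B).
Proof.
move=> h; have [i1 b1] := h true; have [i2 b2] := h false.
rewrite (_ : (fun z => _) = (fun z => H true z + H false z)); last first.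
  by apply/funext => z; rewrite big_bool.
split; first by have := integrableD measurableT i1 i2.
rewrite RintegralD//; apply: (le_trans (ler_normD _ _)); lra.
Qed.

Definition invl (e1 e2 : R * R) : (R * R) * (R * R) :=
  let d := e1.1 * e2.2 - e1.2 * e2.1 in ((e2.2 / d, - e1.2 / d), (- e2.1 / d, e1.1 / d)).

Lemma lin2K (e1 e2 : R * R) : e1.1 * e2.2 - e1.2 * e2.1 != 0 ->
  (forall z, lin2 e1 e2 (lin2 (invl e1 e2).1 (invl e1 e2).2 z) = z) /\
  (forall Z, lin2 (invl e1 e2).1 (invl e1 e2).2 (lin2 e1 e2 Z) = Z).
Proof.
case: e1 e2 => [a b] [c d] /= h; split=> -[x y]; rewrite /lin2 /invl /=;
  by congr pair; field.
Qed.

Lemma invl_det (e1 e2 : R * R) : e1.1 * e2.2 - e1.2 * e2.1 != 0 ->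
  (invl e1 e2).1.1 * (invl e1 e2).2.2 - (invl e1 e2).1.2 * (invl e1 e2).2.1 != 0.
Proof.
move=> h; rewrite (_ : _ - _ = (e1.1 * e2.2 - e1.2 * e2.1)^-1) ?invr_eq0//.
by rewrite /invl /=; field.
Qed.

(** [S] is controlled only near the origin; cutting it off gives a measurable phase and changes
    nothing on the support of the amplitude. *)
Definition patch (rho : R) (s : nat -> nat -> R * R -> R) Z : R :=
  if `[< `|Z.1| < rho /\ `|Z.2| < rho >] then s 0 0 Z else 0.

Lemma measurable_patch rho s : jet (box 0 0 rho) s -> measurable_fun setT (patch rho s).
Proof.
move=> js; apply: (@measurable_open_continuous _ [set Z | `|Z.1| < rho /\ `|Z.2| < rho]).
  have c1 : continuous (fun Z : R * R => `|Z.1|).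
    by move=> Z; apply: (@cvg_norm _ _ _ (nbhs Z) _ fst); exact: cvg_fst.
  have c2 : continuous (fun Z : R * R => `|Z.2|).
    by move=> Z; apply: (@cvg_norm _ _ _ (nbhs Z) _ snd); exact: cvg_snd.
  have o1 : open [set Z : R * R | `|Z.1| < rho] := (continuousP _).1 c1 _ (@open_lt R rho).
  have o2 : open [set Z : R * R | `|Z.2| < rho] := (continuousP _).1 c2 _ (@open_lt R rho).
  exact: (openI o1 o2).
by move=> Z [h1 h2]; apply: jet_continuous js _; split; rewrite subr0 ltW.
Qed.

Lemma patchE rho s Z : `|Z.1| < rho -> `|Z.2| < rho -> patch rho s Z = s 0 0 Z.
Proof. by move=> h1 h2; rewrite /patch; case: asboolP => // -[]. Qed.

Section Assembly.
Variables (pi1 pi2 pi3 S : R * R -> R) (e1 e2 : R * R) (al1 al2 rho : R).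
Variables (s : nat -> nat -> R * R -> R) (k : nat).
Hypotheses (al10 : al1 != 0) (al20 : al2 != 0) (de : e1.1 * e2.2 - e1.2 * e2.1 != 0).
Hypothesis q1 : forall Z, pi1 (lin2 e1 e2 Z) = al1 * Z.1.
Hypothesis q2 : forall Z, pi2 (lin2 e1 e2 Z) = al2 * Z.2.
Hypothesis q3 : forall Z, pi3 (lin2 e1 e2 Z) = Z.1 + Z.2.
Hypotheses (rho0 : 0 < rho) (js : jet (box 0 0 rho) s).
Hypothesis Ss : forall Z, box 0 0 rho Z -> S (lin2 e1 e2 Z) = s 0 0 Z.
Hypothesis nz : exists p q, (p + q)%N = k /\ jetP s p q (0, 0) != 0.

Lemma upper_estimate : exists2 eps : R, 0 < eps & forall (a : R * R -> R[i]) (K : set (R * R)),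
  smooth2C a -> compact K -> (forall z, a z != 0 -> K z) ->
  (forall Z, K (lin2 e1 e2 Z) -> `|Z.1| < eps /\ `|Z.2| < eps) ->
  exists C : R, forall lam : R, 1 <= `|lam| ->
    forall f1 f2 f3 : R -> R[i], L2 f1 -> L2 f2 -> L2 f3 ->
    cmod (Lambda lam S a pi1 pi2 pi3 f1 f2 f3) <=
      C * `|lam| `^ (- (2 * (k + 3))%:R^-1) * (L2norm f1 * L2norm f2 * L2norm f3).
Proof.
have r2 : 0 < rho / 2 by rewrite divr_gt0.
have r2r : rho / 2 < rho by rewrite ltr_pdivrMr// ltr_pMr// ltr1n.
have sub : box 0 0 (rho / 2) `<=` box 0 0 rho.
  by apply: box_sub; rewrite subrr normr0 add0r ltW.
have [eps0 eps00 model] := model_upper r2 (jet_sub sub js) nz.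
exists (Num.min eps0 rho); first by rewrite lt_min eps00.
move=> a K [sr si] cK aK Keps.
have aK' c z (h : part c (a z) != 0) : K z := aK z (part_neq0 h).
have sm c : smooth2 (fun z => part c (a z)) by case: c.
have mP := measurable_patch js.
have modelc c : exists2 C : R, 0 <= C & forall (lam th : R) (f1 f2 f3 : R -> R), 1 <= `|lam| ->
    bmeas size1 f1 -> bmeas size1 f2 -> bmeas size1 f3 ->
    `|Tri (fun Z => lam * patch rho s Z + th) (fun Z => part c (a (lin2 e1 e2 Z))) f1 f2 f3| <=
      C * `|lam| `^ (- (2 * (k + 3))%:R^-1) * (nrm f1 * nrm f2 * nrm f3).
  have [A1 [A2 [M [h1 h2 h3 h4 h5]]]] := smooth_amplitude e1 e2 (sm c) cK (aK' c).
  have supp Z : part c (a (lin2 e1 e2 Z)) != 0 -> `|Z.1| < eps0 /\ `|Z.2| < eps0.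
    by move=> /aK' /Keps; rewrite !lt_min => -[/andP[-> _] /andP[-> _]].
  have [C C0 HC] := model _ A1 A2 M h1 h2 h3 h4 h5 supp.
  exists C => // lam th f1 f2 f3 lam1 b1 b2 b3; apply: HC => // Z [z1 z2].
  by apply: patchE; [move: z1|move: z2]; rewrite subr0 => h; apply: le_lt_trans h r2r.
have [C0 C00 H0] := modelc false; have [C1 C10 H1] := modelc true.
pose C := C0 + C1.
have CC c (lam th : R) (f1 f2 f3 : R -> R) : 1 <= `|lam| ->
    bmeas size1 f1 -> bmeas size1 f2 -> bmeas size1 f3 ->
    `|Tri (fun Z => lam * patch rho s Z + th) (fun Z => part c (a (lin2 e1 e2 Z))) f1 f2 f3| <=
      C * `|lam| `^ (- (2 * (k + 3))%:R^-1) * (nrm f1 * nrm f2 * nrm f3).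
  move=> lam1 b1 b2 b3.
  have mon x : 0 <= x -> x <= C -> x * `|lam| `^ (- (2 * (k + 3))%:R^-1) * (nrm f1 * nrm f2 * nrm f3) <=
     C * `|lam| `^ (- (2 * (k + 3))%:R^-1) * (nrm f1 * nrm f2 * nrm f3).
    move=> x0 xC; apply: ler_wpM2r; first by apply: mulr_ge0; [apply: mulr_ge0|]; exact: nrm_ge0.
    by apply: ler_wpM2r => //; exact: powR_ge0.
  case: c; [apply: le_trans (H1 _ _ _ _ _ lam1 b1 b2 b3) (mon _ _ _)|apply: le_trans (H0 _ _ _ _ _ lam1 b1 b2 b3) (mon _ _ _)] => //.
    by rewrite /C lerDr.
  by rewrite /C lerDl.
have [M HM] := smooth2C_bounded (conj sr si) cK aK.
have mA c : measurable_fun setT (fun Z => part c (a (lin2 e1 e2 Z))).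
  by have [? [? [? [_ _ _ _]]]] := smooth_amplitude e1 e2 (sm c) cK (aK' c).
pose d1 := (invl e1 e2).1; pose d2 := (invl e1 e2).2.
have dd : d1.1 * d2.2 - d1.2 * d2.1 != 0 by exact: invl_det.
have [LK LK'] := lin2K de.
(* [32 = 2 * 2 ^ 4]: sixteen real terms for the parts of the four complex factors, doubled by
   passing to the modulus. *)
exists (32 * (jac al1 al2 d1 d2 * C)) => lam lam1 f1 f2 f3 L1 L2f L3.
pose P := L2norm f1 * L2norm f2 * L2norm f3.
pose D := C * `|lam| `^ (- (2 * (k + 3))%:R^-1).
have D0 : 0 <= D by apply: mulr_ge0; [exact: addr_ge0|exact: powR_ge0].
pose Sg th Z := lam * patch rho s Z + th.
have mSg th : measurable_fun setT (Sg th).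
  by apply: measurable_funD => //; apply: measurable_funM.
pose G c0 c1 c2 c3 th z := form (Sg th) (fun Z => part c0 (a (lin2 e1 e2 Z))) al1 al2
  (fun x => part c1 (f1 x)) (fun x => part c2 (f2 x)) (fun x => part c3 (f3 x)) (lin2 d1 d2 z).
have BG c0 c1 c2 c3 th : bounded_integral (G c0 c1 c2 c3 th) (jac al1 al2 d1 d2 * D * P).
  have [m1 n1] := L2_part c1 L1; have [m2 n2] := L2_part c2 L2f; have [m3 n3] := L2_part c3 L3.
  have bA : bmeasurable (fun Z => part c0 (a (lin2 e1 e2 Z))).
    by split => //; exists M => Z; exact: HM.
  have supp Z : part c0 (a (lin2 e1 e2 Z)) != 0 -> `|Z.1| < rho.
    by move=> /aK' /Keps []; rewrite !lt_min => /andP[_].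
  have TD g1 g2 g3 (b1 : bmeas size1 g1) (b2 : bmeas size1 g2) (b3 : bmeas size1 g3) :=
    CC c0 lam th g1 g2 g3 lam1 b1 b2 b3.
  have := form_bound (mSg th) bA (ltW rho0) (fun Z => HM c0 _) supp TD.
  by move/(_ _ _ _ _ D0 al10 al20 dd _ _ _ _ _ _ m1 m2 m3 n1 n2 n3).
pose F z := expi (lam * S z) * a z * (f1 (pi1 z) * f2 (pi2 z) * f3 (pi3 z)).
have FE e z : part e (F z) = \sum_(c0 : bool) \sum_(c1 : bool) \sum_(c2 : bool) \sum_(c3 : bool)
    G c0 c1 c2 c3 (quarter (e * 3 + (c0 + c1 + c2 + c3))) z.
  have p1 : pi1 z = al1 * (lin2 d1 d2 z).1 by rewrite -q1 LK.
  have p2 : pi2 z = al2 * (lin2 d1 d2 z).2 by rewrite -q2 LK.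
  have p3 : pi3 z = (lin2 d1 d2 z).1 + (lin2 d1 d2 z).2 by rewrite -q3 LK.
  rewrite /F part_expand p1 p2 p3.
  apply: eq_bigr => c0 _; apply: eq_bigr => c1 _; apply: eq_bigr => c2 _; apply: eq_bigr => c3 _.
  rewrite /G /form /Sg; set Z := lin2 d1 d2 z; rewrite -[lin2 e1 e2 Z]/(lin2 e1 e2 (lin2 d1 d2 z)) LK.
  have [->|/aK'] := eqVneq (part c0 (a z)) 0; first by rewrite !mulr0 !mul0r.
  rewrite -(LK z) => /Keps[]; rewrite -/d1 -/d2 -/Z !lt_min => /andP[_ h1] /andP[_ h2].
  rewrite (patchE _ h1 h2) -Ss; last by split; rewrite subr0 ltW.
  by rewrite /Z LK.
have FB e : bounded_integral (fun z => part e (F z)) (2 * (2 * (2 * (2 * (jac al1 al2 d1 d2 * D * P))))).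
  rewrite (_ : (fun z => part e (F z)) = fun z => \sum_(c0 : bool) \sum_(c1 : bool) \sum_(c2 : bool) \sum_(c3 : bool)
    G c0 c1 c2 c3 (quarter (e * 3 + (c0 + c1 + c2 + c3))) z); last by apply/funext => z; exact: FE.
  by do 4 (apply: bounded_integral_sum => ?); exact: BG.
have main : cmod (Lambda lam S a pi1 pi2 pi3 f1 f2 f3) <=
    2 * (2 * (2 * (2 * (2 * (jac al1 al2 d1 d2 * D * P))))).
  by apply: cmod_le => -[]; [have [_] := FB true|have [_] := FB false].
apply: (le_trans main); rewrite -/P /D le_eqVlt; apply/orP; left; apply/eqP; ring.
Qed.

End Assembly.

End UpperBound.

(** * Sharpness *)

Section Sharpness.
Context {R : realType}.
Implicit Types (Z z : R * R) (g al : nat -> R).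

(** The [j]-th derivative of the polynomial of degree below [n] whose derivatives at 0 are the
    [al i]. *)
Definition tay al n j (t : R) : R := \sum_(i < n) al i / (i`!)%:R * mono i j t.

Lemma der_sum n (F : 'I_n -> R -> R) (F' : 'I_n -> R) (t : R) :
  (forall i, is_derive t 1 (F i) (F' i)) -> is_derive t 1 (fun u => \sum_i F i u) (\sum_i F' i).
Proof.
elim: n F F' => [|n ih] F F' h.
  rewrite (_ : (fun u => _) = fun=> 0); last by apply/funext => u; rewrite big_ord0.
  by rewrite big_ord0; exact: der_cst.
rewrite (_ : (fun u => _) = fun u => \sum_(i < n) F (widen_ord (leqnSn n) i) u + F ord_max u).
  by rewrite big_ord_recr /=; apply: der_add => //; apply: ih => i.
by apply/funext => u; rewrite big_ord_recr.
Qed.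

Lemma tay_derive al n j (t : R) : is_derive t 1 (tay al n j) (tay al n j.+1 t).
Proof.
apply: der_sum => i.
apply: (der_eq (der_mul (der_cst t (al i / (i`!)%:R)) (mono_derive i j t))).
by rewrite mul0r add0r.
Qed.

Lemma tay0 al n j : (j < n)%N -> tay al n j 0 = al j.
Proof.
move=> jn; rewrite /tay (bigD1 (Ordinal jn))//= mono0 eqxx divfK ?pnatr_eq0 -?lt0n ?fact_gt0//.
rewrite big1 ?addr0// => i ij; rewrite mono0.
by case: eqVneq => [E|_]; [move: ij; rewrite -val_eqE /= E eqxx|rewrite mulr0].
Qed.

Lemma measurable_tay al n j : measurable_fun setT (tay al n j).
Proof. by apply: continuous_measurable_fun => t; apply: der_continuous (tay_derive al n j t). Qed.

(** The jet of [s] minus [q1(X) + q2(Y) + q3(X + Y)]; the tests on [p] and [q] express that mixed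
    derivatives do not see the first two. *)
Definition residual (s : nat -> nat -> R * R -> R) (al be ga : nat -> R) n p q Z : R :=
  s p q Z - (if q == 0%N then tay al n p Z.1 else 0) - (if p == 0%N then tay be n q Z.2 else 0)
  - tay ga n (p + q) (Z.1 + Z.2).

Lemma jet_of_fst (D : set (R * R)) (f : nat -> R -> R) : (forall j (t : R), is_derive t 1 (f j) (f j.+1 t)) ->
  jet D (fun p q Z => if q == 0%N then f p Z.1 else 0).
Proof.
move=> fd p q Z _; case: q => [|q] /=; last first.
  by apply: (is_diff_eq (is_diff_cst (0 : R) Z)); apply/funext => w; rewrite !mulr0 addr0.
have p1 : is_diff Z (fun z : R * R => z.1) (lform 1 0).
  by apply: is_diff_exact => w; rewrite /lform /=; ring.
apply: (is_diff_eq (is_diff_comp p1 (is_diff_of_derive (fd p Z.1)))).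
by apply/funext => w; rewrite /lform /=; ring.
Qed.

Lemma jet_of_snd (D : set (R * R)) (f : nat -> R -> R) : (forall j (t : R), is_derive t 1 (f j) (f j.+1 t)) ->
  jet D (fun p q Z => if p == 0%N then f q Z.2 else 0).
Proof.
move=> fd p q Z _; case: p => [|p] /=; last first.
  by apply: (is_diff_eq (is_diff_cst (0 : R) Z)); apply/funext => w; rewrite !mulr0 addr0.
have p1 : is_diff Z (fun z : R * R => z.2) (lform 0 1).
  by apply: is_diff_exact => w; rewrite /lform /=; ring.
apply: (is_diff_eq (is_diff_comp p1 (is_diff_of_derive (fd q Z.2)))).
by apply/funext => w; rewrite /lform /=; ring.
Qed.

Lemma jet_of_sum (D : set (R * R)) (f : nat -> R -> R) : (forall j (t : R), is_derive t 1 (f j) (f j.+1 t)) ->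
  jet D (fun p q Z => f (p + q)%N (Z.1 + Z.2)).
Proof.
move=> fd p q Z _; rewrite addSn addnS.
have p1 : is_diff Z (fun z : R * R => z.1 + z.2) (lform 1 1).
  by apply: is_diff_exact => w; rewrite /lform /=; ring.
apply: (is_diff_eq (is_diff_comp p1 (is_diff_of_derive (fd (p + q)%N (Z.1 + Z.2))))).
by apply/funext => w; rewrite /lform /=; ring.
Qed.

Lemma jetB (D : set (R * R)) s s' : jet D s -> jet D s' -> jet D (fun p q Z => s p q Z - s' p q Z).
Proof.
move=> js js' p q Z Dz; apply: (is_diff_eq (is_diffB (js p q Z Dz) (js' p q Z Dz))).
by apply/funext => w; rewrite !fctE /=; ring.
Qed.

Lemma jet_residual D s al be ga n : jet D s -> jet D (residual s al be ga n).
Proof.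
move=> js; apply: jetB; last by apply: jet_of_sum; exact: tay_derive.
apply: jetB; last by apply: jet_of_snd; exact: tay_derive.
by apply: jetB => //; apply: jet_of_fst; exact: tay_derive.
Qed.

(* As [jetP s] vanishes to order [k], all mixed derivatives of [s] at 0 of a given
   order below [k + 3] agree: q3 takes their common value, q1 and q2 the rest. *)
Lemma residual_vanishing s k : (forall p q, (p + q < k)%N -> jetP s p q (0, 0) = 0) ->
  exists al be ga : nat -> R, forall p q, (p + q < k + 3)%N ->
    residual s al be ga (k + 3) p q (0, 0) = 0.
Proof.
move=> low.
pose ga i := if (i < 2)%N then 0 else s i.-1 1%N (0, 0).
pose al i := s i 0%N (0, 0) - ga i.
pose be i := if i == 0%N then 0 else s 0%N i (0, 0) - ga i.
exists al, be, ga => p q pq.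
have hp := leq_ltn_trans (leq_addr q p) pq; have hq := leq_ltn_trans (leq_addl p q) pq.
rewrite /residual /= addr0 (tay0 ga pq) (tay0 al hp) (tay0 be hq).
have mid p' q' : (p' + q' < k + 1)%N -> s p'.+1 q'.+1 (0, 0) = s (p' + q').+1 1%N (0, 0).
  elim: q' p' => [|q' ih] p' h; first by rewrite addn0.
  have h' : (p' + q' < k)%N by move: h; rewrite addnS addn1.
  have /eqP := low _ _ h'; rewrite /jetP subr_eq0 => /eqP <-.
  by rewrite ih ?addSnnS//; rewrite addSnnS.
case: p q pq {hp hq} => [|p] [|q] pq; rewrite /al /be /=.
- by rewrite /ga /=; ring.
- by rewrite add0n; ring.
- by rewrite addn0; ring.
- rewrite !subr0 /ga /= addSn addnS /= mid ?subrr//.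
  by move: pq; rewrite addSn addnS addn3 addn1.
Qed.

(** Starting from bounded derivatives of order [m], each step down uses the mean value theorem from
    the origin and gains a factor [2 * r]. *)
Lemma jet_vanishing_order (s : nat -> nat -> R * R -> R) (r0 : R) m : 0 < r0 -> jet (box 0 0 r0) s ->
  (forall p q, (p + q < m)%N -> s p q (0, 0) = 0) ->
  exists r1 C : R, [/\ 0 < r1, r1 <= r0, 0 <= C &
    forall r z, 0 <= r -> r <= r1 -> box 0 0 r z -> `|s 0 0 z| <= C * r ^+ m].
Proof.
move=> r00 js s0.
have ctr : box (0 : R) 0 r0 (0, 0) by apply: box_center; exact: ltW.
pose B := \sum_(p < m.+1) (`|s p (m - p)%N (0, 0)| + 1).
have B0 : 0 <= B by rewrite sumr_ge0// => i _; rewrite addr_ge0.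
have near0 : \forall z \near (0 : R, 0 : R), forall p : 'I_m.+1, `|s p (m - p)%N z| <= B.
  apply: (@filter_forall _ _ (fun (p : 'I_m.+1) (z : R * R) => `|s p (m - p)%N z| <= B) (nbhs (0 : R, 0 : R)) (@nbhs_filter _ _)) => p.
  have /cvgrPdist_lt /(_ 1 ltr01) := jet_continuous (p := p) (q := (m - p)%N) js ctr.
  apply: filterS => z h.
  have t := ler_norm_sub (s p (m - p)%N z) (s p (m - p)%N (0, 0)).
  rewrite (distrC (s p (m - p)%N z)) in t.
  apply: (@le_trans _ _ (`|s p (m - p)%N (0, 0)| + 1)); first by move: h t; lra.
  by rewrite /B (bigD1 p)//= lerDl sumr_ge0// => i _; rewrite addr_ge0.
have [r2 r20 hr2] := nbhs_box near0.
exists (Num.min r2 r0), (2 ^+ m * B); split.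
- by rewrite lt_min r20.
- by rewrite ge_min lexx orbT.
- by rewrite mulr_ge0// exprn_ge0.
move=> r z rp; rewrite le_min => /andP[rr2 rr0] bz.
have jr : jet (box 0 0 r) s by apply: jet_sub js; apply: box_sub; rewrite subrr normr0 add0r.
have H n p q : (p + q + n)%N = m -> forall w, box 0 0 r w -> `|s p q w| <= 2 ^+ n * B * r ^+ n.
  elim: n p q => [|n ih] p q E w bw.
    rewrite expr0 mul1r mulr1; have [w1 w2] := bw; rewrite !subr0 in w1 w2.
    have pm : (p < m.+1)%N by rewrite ltnS -E addn0 leq_addr.
    have := hr2 w (le_trans w1 rr2) (le_trans w2 rr2) (Ordinal pm) => /=.
    by rewrite -E addn0 addKn.
  have E1 : (p.+1 + q + n)%N = m by rewrite -E addnS !addSn.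
  have E2 : (p + q.+1 + n)%N = m by rewrite -E addnS addnS !addSn.
  have := mvt_box jr (ih _ _ E1) (ih _ _ E2) (box_center 0 0 rp) bw.
  rewrite s0; last by rewrite -E addnS ltnS leq_addr.
  have [] := bw; rewrite !subr0 => w1 w2 /le_trans; apply.
  have K0 : 0 <= 2 ^+ n * B * r ^+ n by rewrite !mulr_ge0// ?exprn_ge0.
  rewrite -mulrDl (_ : 2 ^+ n.+1 * B * r ^+ n.+1 = (r + r) * (2 ^+ n * B * r ^+ n)).
    by apply: ler_wpM2r => //; exact: lerD.
  by rewrite !exprS; ring.
by apply: (H m 0%N 0%N) => //; rewrite !add0n.
Qed.

Definition test (l dl : R) (q : R -> R) (t : R) : R[i] :=
  Complex (itvind (- dl) dl t * cos (l * q t)) (itvind (- dl) dl t * - sin (l * q t)).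

Lemma itvind_sqr (a b x : R) : itvind a b x ^+ 2 = itvind a b x.
Proof. by rewrite /itvind; case: (_ && _); rewrite ?expr1n ?expr0n. Qed.

Lemma cmod_test l dl q t : cmod (test l dl q t) ^+ 2 = itvind (- dl) dl t.
Proof.
rewrite /cmod sqr_sqrtr ?addr_ge0 ?sqr_ge0//= !exprMn sqrrN -mulrDr cos2Dsin2 mulr1.
exact: itvind_sqr.
Qed.

Lemma test_L2 (l dl k : R) q : measurable_fun setT q -> k != 0 -> 0 <= dl ->
  L2 (fun t => test l dl q (k * t)) /\
  L2norm (fun t => test l dl q (k * t)) = Num.sqrt (`|k|^-1 * (2 * dl)).
Proof.
move=> mq k0 dl0.
have mk : measurable_fun setT (fun t : R => k * t) by apply: measurable_funM.
have mi : measurable_fun setT (itvind (- dl) dl) by exact: measurable_itvind.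
have mlq : measurable_fun setT (fun t => l * q t) by apply: measurable_funM.
have bi : bmeas size1 (fun t => itvind (- dl) dl (k * t)).
  by apply: bmeas_scale => //; exact: bmeas_itvind.
have E t : cmod (test l dl q (k * t)) ^+ 2 = itvind (- dl) dl (k * t) by exact: cmod_test.
split; last first.
  rewrite /L2norm; congr Num.sqrt.
  transitivity (Int (fun t => itvind (- dl) dl (k * t))); first by apply: eq_Int => t; rewrite E.
  have := Int_affine 0 k0 (bmeas_itvind (- dl) dl).
  rewrite Int_itvind; last by lra.
  rewrite opprK -mulr2n mulr_natl => <-.
  by apply: eq_Int => t; rewrite addr0.
split; last split.
- apply: (measurableT_comp (f := fun t => itvind (- dl) dl t * cos (l * q t))) mk.
  by apply: measurable_funM => //; apply: measurable_comp_continuous => //; exact: continuous_cos.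
- apply: (measurableT_comp (f := fun t => itvind (- dl) dl t * - sin (l * q t))) mk.
  apply: measurable_funM => //; apply: measurable_funN.
  by apply: measurable_comp_continuous => //; exact: continuous_sin.
- under eq_integral do rewrite E.
  by rewrite -(EFin_Int bi) ltry.
Qed.

Lemma part_test (e : bool) (t l1 l2 l3 d1 d2 d3 u1 u2 u3 : R) (q1 q2 q3 : R -> R) (w : R[i]) :
  part e (expi t * w * (test l1 d1 q1 u1 * test l2 d2 q2 u2 * test l3 d3 q3 u3)) =
  itvind (- d1) d1 u1 * itvind (- d2) d2 u2 * itvind (- d3) d3 u3 *
  part e (expi (t - l1 * q1 u1 - l2 * q2 u2 - l3 * q3 u3) * w).
Proof.
case: w => [x y]; rewrite /test /expi.
move: (itvind _ _ u1) (itvind _ _ u2) (itvind _ _ u3) (l1 * q1 u1) (l2 * q2 u2) (l3 * q3 u3) => i1 i2 i3 a b c.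
rewrite !complex_mulE !(cosB, sinB).
by case: e; rewrite /part /=; ring.
Qed.

Lemma sin_le_norm (x : R) : `|sin x| <= `|x|.
Proof.
wlog x0 : x / 0 <= x.
  move=> H; have [|/ltW xn] := leP 0 x; first exact: H.
  by rewrite -normrN -sinN -[leRHS]normrN; apply: H; rewrite oppr_ge0.
have d (t : R) : 0 <= t <= x -> is_derive t 1 (sin : R -> R) (cos t) by move=> _; exact: is_derive_sin.
have [c _] := MVT_ex d x0; rewrite sin0 !subr0 => ->.
by rewrite normrM ler_piMl// ler_norml cos_geN1 cos_le1.
Qed.

Lemma cos_sub1_le_norm (x : R) : `|cos x - 1| <= `|x|.
Proof.
wlog x0 : x / 0 <= x.
  move=> H; have [|/ltW xn] := leP 0 x; first exact: H.
  by rewrite -cosN -[leRHS]normrN; apply: H; rewrite oppr_ge0.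
have d (t : R) : 0 <= t <= x -> is_derive t 1 (cos : R -> R) (- sin t) by move=> _; exact: is_derive_cos.
have [c _] := MVT_ex d x0; rewrite cos0 !subr0 => ->.
by rewrite normrM ler_piMl// normrN ler_norml sin_geN1 sin_le1.
Qed.

Lemma part_expi_near (e : bool) (t M : R) (w : R[i]) : (forall c, `|part c w| <= M) ->
  `|part e (expi t * w) - part e w| <= 2 * M * `|t|.
Proof.
case: w => [x y] h; have hx := h false; have hy := h true; rewrite /part /= in hx hy.
have s := sin_le_norm t; have c := cos_sub1_le_norm t.
have b (u v : R) : `|u| <= M -> `|v| <= `|t| -> `|v * u| <= M * `|t|.
  by move=> h1 h2; rewrite normrM mulrC; apply: ler_pM.
have M0 : 0 <= M := le_trans (normr_ge0 _) hx.
case: e; rewrite /expi complex_mulE /part /=.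
  rewrite (_ : _ - y = (cos t - 1) * y + sin t * x); last by ring.
  by apply: (le_trans (ler_normD _ _)); have := b _ _ hy c; have := b _ _ hx s; lra.
rewrite (_ : _ - x = (cos t - 1) * x - sin t * y); last by ring.
by apply: (le_trans (ler_normB _ _)); have := b _ _ hx c; have := b _ _ hy s; lra.
Qed.

End Sharpness.

(** * The test functions and the lower bound *)

Section LowerBound.
Context {R : realType}.
Variables (pi1 pi2 pi3 S : R * R -> R) (e1 e2 : R * R) (al1 al2 rho : R).
Variables (s : nat -> nat -> R * R -> R) (k : nat).
Hypotheses (al10 : al1 != 0) (al20 : al2 != 0) (de : e1.1 * e2.2 - e1.2 * e2.1 != 0).
Hypothesis q1 : forall Z, pi1 (lin2 e1 e2 Z) = al1 * Z.1.
Hypothesis q2 : forall Z, pi2 (lin2 e1 e2 Z) = al2 * Z.2.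
Hypothesis q3 : forall Z, pi3 (lin2 e1 e2 Z) = Z.1 + Z.2.
Hypotheses (rho0 : 0 < rho) (js : jet (box 0 0 rho) s).
Hypothesis Ss : forall Z, box 0 0 rho Z -> S (lin2 e1 e2 Z) = s 0 0 Z.
Hypothesis low : forall p q, (p + q < k)%N -> jetP s p q (0, 0) = 0.

Lemma Int2_square (dl : R) : 0 <= dl ->
  Int2 (fun Z : R * R => itvind (- dl) dl Z.1 * itvind (- dl) dl Z.2) = (2 * dl) ^+ 2.
Proof.
move=> dl0; have bi := bmeas_itvind (- dl) dl.
rewrite (Int2E (bmeas_prod bi bi)) /=.
have I : Int (itvind (- dl) dl) = 2 * dl.
  by rewrite Int_itvind; [rewrite opprK; ring|lra].
rewrite (eq_Int (g := fun x => itvind (- dl) dl x * (2 * dl))).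
  by rewrite IntZr// I expr2.
by move=> x; rewrite IntZ// I.
Qed.

(** Multiplication by the sign of [al] makes the real part of the comparison one-sided: the signed
    [G] is at least half of [|al| * H] everywhere. *)
Lemma Int2_lower (G H : R * R -> R) (al : R) : bmeas size2 G -> bmeas size2 H ->
  (forall Z, 0 <= H Z) -> (forall Z, `|G Z - al * H Z| <= `|al| / 2 * H Z) ->
  `|al| / 2 * Int2 H <= `|Int2 G|.
Proof.
move=> bG bH H0 h.
have iG := bmeas2_integrable bG; have iH := bmeas2_integrable bH.
have step (u : R) : `|u| = 1 -> u * al = `|al| -> `|al| / 2 * Int2 H <= `|Int2 G|.
  move=> u1 ua.
  have -> : `|al| / 2 * Int2 H = Int2 (fun Z => `|al| / 2 * H Z) by rewrite /Int2 RintegralZl.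
  have E : Int2 (fun Z => u * G Z) = u * Int2 G by rewrite /Int2 RintegralZl.
  apply: (@le_trans _ _ (Int2 (fun Z => u * G Z))); last first.
    by rewrite E (le_trans (ler_norm _))// normrM u1 mul1r.
  apply: le_Rintegral => //; [exact: (bmeas2_integrable (bmeasZ _ bH))|exact: (bmeas2_integrable (bmeasZ _ bG))|].
  move=> Z _; have hZ := h Z.
  have : `|u * (G Z - al * H Z)| <= `|al| / 2 * H Z by rewrite normrM u1 mul1r.
  rewrite mulrBr mulrA ua ler_norml => /andP[+ _].
  by move: (u * G Z) (H Z) => x y; lra.
have [a0|a0] := leP 0 al; first by apply: (step 1); rewrite ?normr1// mul1r ger0_norm.
by apply: (step (-1)); rewrite ?normrN1// mulN1r ltr0_norm.
Qed.

(** Each test function has norm comparable to [sqrt dl] and the form is comparable to [dl ^+ 2], so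
    the quotient is comparable to [sqrt dl], that is to [|lam|] to the power [-1 / (2 m)]. *)
Lemma lower_estimate (a : R * R -> R[i]) (K : set (R * R)) :
  smooth2C a -> compact K -> (forall z, a z != 0 -> K z) -> a (0, 0) != 0 ->
  exists C' : R, 0 < C' /\ exists L0 : R, forall lam : R, L0 <= `|lam| ->
    exists f1 f2 f3 : R -> R[i], [/\ L2 f1, L2 f2 & L2 f3] /\
      [/\ 0 < L2norm f1, 0 < L2norm f2 & 0 < L2norm f3] /\
      C' * `|lam| `^ (- (2 * (k + 3))%:R^-1) * (L2norm f1 * L2norm f2 * L2norm f3)
        <= cmod (Lambda lam S a pi1 pi2 pi3 f1 f2 f3).
Proof.
move=> sa cK aK a0.
have [c ac] : exists c, part c (a (0, 0)) != 0.
  have [r0|] := eqVneq (part false (a (0, 0))) 0; last by exists false.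
  have [i0|] := eqVneq (part true (a (0, 0))) 0; last by exists true.
  exfalso; move/eqP: a0; apply; move: r0 i0; rewrite /part; case: (a (0, 0)) => x y /= -> ->.
  by [].
set al := part c (a (0, 0)) in ac.
have al0 : 0 < `|al| by rewrite normr_gt0.
have [M HM] := smooth2C_bounded sa cK aK.
have M0 : 0 < M by apply: lt_le_trans (HM c (0, 0)).
have [qa [qb [qc vanish]]] := residual_vanishing low.
set m := (k + 3)%N in vanish *.
have m0 : (0 < m)%N by rewrite /m addn3.
have jr := jet_residual qa qb qc m js.
have [r1 [C [r10 r1r C0 HC]]] := jet_vanishing_order rho0 jr vanish.
have near_a : \forall z \near (0 : R, 0 : R), `|part c (a z) - al| <= `|al| / 4.
  have /cvgrPdist_lt /(_ (`|al| / 4)) := @smooth2C_continuous _ a c sa (0, 0).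
  rewrite divr_gt0// => /(_ isT); apply: filterS => z /ltW; by rewrite -normrN opprB.
have [r2 r20 hr2] := nbhs_box near_a.
have [r3 r30 hr3] := lin2_box e1 e2 r20.
pose dl0 := Num.min (Num.min r1 (rho / 2)) r3.
have dl00 : 0 < dl0 by rewrite !lt_min r10 r30 divr_gt0.
(* The phase left after modulation is at most [C * ep ^+ m]; this [ep] makes its effect on the
   amplitude at most a quarter of [|al|]. *)
pose ep := Num.min 1 (`|al| / (8 * M * (C + 1))).
have C1 : 0 < C + 1 by rewrite ltr_wpDl.
have MC : 0 < 8 * M * (C + 1) by rewrite !mulr_gt0.
have ep0 : 0 < ep by rewrite lt_min ltr01 divr_gt0.
have ep1 : ep <= 1 by rewrite ge_min lexx.
have small : 2 * M * (C * ep ^+ m) <= `|al| / 4.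
  have h1 : ep ^+ m <= ep.
    by rewrite -(prednK m0) exprS ler_piMr ?exprn_ile1// ltW.
  have h2 : ep * (8 * M * (C + 1)) <= `|al| by rewrite -ler_pdivlMr// ge_min lexx orbT.
  have h3 : C * ep ^+ m <= (C + 1) * ep.
    by apply: ler_pM => //; [exact: exprn_ge0 (ltW ep0)|rewrite lerDl].
  have h4 : 2 * M * (C * ep ^+ m) <= 2 * M * ((C + 1) * ep) by rewrite ler_wpM2l// mulr_ge0 ?ltW.
  by move: h2 h4; rewrite (_ : ep * _ = 8 * (M * ((C + 1) * ep))); [rewrite -(mulrA 2 M ((C + 1) * ep)); lra|ring].
pose d1 := (invl e1 e2).1; pose d2 := (invl e1 e2).2.
have dd : d1.1 * d2.2 - d1.2 * d2.1 != 0 by exact: invl_det.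
have [LK LK'] := lin2K de.
have A1p : 0 < Num.sqrt (`|al1^-1|^-1 * 2) by rewrite sqrtr_gt0 mulr_gt0// invr_gt0 normr_gt0 invr_eq0.
have A2p : 0 < Num.sqrt (`|al2^-1|^-1 * 2) by rewrite sqrtr_gt0 mulr_gt0// invr_gt0 normr_gt0 invr_eq0.
have A3p : 0 < Num.sqrt (`|1|^-1 * 4 : R) by rewrite sqrtr_gt0 normr1 invr1 mul1r.
set A1 := Num.sqrt (`|al1^-1|^-1 * 2) in A1p; set A2 := Num.sqrt (`|al2^-1|^-1 * 2) in A2p.
set A3 := Num.sqrt (`|1|^-1 * 4) in A3p.
have Ap : 0 < A1 * A2 * A3 by rewrite !mulr_gt0.
pose J := `|d1.1 * d2.2 - d1.2 * d2.1|^-1.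
have J0 : 0 < J by rewrite invr_gt0 normr_gt0.
have se0 : 0 < Num.sqrt ep by rewrite sqrtr_gt0.
exists (J * (2 * `|al|) * Num.sqrt ep / (A1 * A2 * A3)).
split; first by rewrite divr_gt0// !mulr_gt0.
(* Beyond this value [kap ^+ 2 <= dl0], so the square of half-side [dl] lies where all local
   estimates hold. *)
exists (Num.max 1 (dl0 ^- m)) => lam; rewrite ge_max => /andP[lam1 lamL].
have lam0 : 0 < `|lam| by exact: lt_le_trans lam1.
set kap := `|lam| `^ _.
have kap0 : 0 < kap by exact: powR_gt0.
have kape : kap ^+ (2 * m) = `|lam|^-1.
  rewrite -powR_mulrn ?(ltW kap0)// /kap -powRrM mulNr mulVf ?pnatr_eq0 -?lt0n ?muln_gt0//.
  by rewrite powRN powRr1// ltW.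
(* Since [kap ^+ (2 * m)] is [1 / |lam|], this gives [|lam| * dl ^+ m = ep ^+ m]. *)
pose dl := ep * kap ^+ 2.
have dlp : 0 < dl by rewrite mulr_gt0// exprn_gt0.
have dlm : dl ^+ m = ep ^+ m / `|lam| by rewrite exprMn -exprM kape.
have dlle : dl <= dl0.
  apply: (@le_trans _ _ (kap ^+ 2)); first by rewrite ler_piMl// exprn_ge0 ?ltW.
  have k2 : kap ^+ 2 \is Num.nneg by rewrite nnegrE exprn_ge0 ?ltW.
  have n0 : dl0 \is Num.nneg by rewrite nnegrE ltW.
  have kd : (kap ^+ 2) ^+ m <= dl0 ^+ m.
    rewrite -exprM kape -[dl0 ^+ m]invrK lef_pV2// posrE//.
    by rewrite invr_gt0 exprn_gt0.
  by rewrite (ler_pXn2r m0 k2 n0) in kd.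
have [dlr1 dlrho dlr3] : [/\ dl <= r1, dl < rho & dl <= r3].
  move: dlle; rewrite /dl0 !le_min => /andP[/andP[-> h] ->]; split => //.
  by apply: le_lt_trans h _; rewrite ltr_pdivrMr// ltr_pMr// ltr1n.
pose Q1 := tay qa m 0; pose Q2 := tay qb m 0; pose Q3 := tay qc m 0.
have mQ1 : measurable_fun setT Q1 by exact: measurable_tay.
have mQ2 : measurable_fun setT Q2 by exact: measurable_tay.
have mQ3 : measurable_fun setT Q3 by exact: measurable_tay.
have al1V : al1^-1 != 0 by rewrite invr_eq0.
have al2V : al2^-1 != 0 by rewrite invr_eq0.
have dlp2 : 0 <= 2 * dl by rewrite mulr_ge0 ?ltW.
have [L1 N1] := test_L2 lam mQ1 al1V (ltW dlp).
have [L2' N2] := test_L2 lam mQ2 al2V (ltW dlp).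
have [L3 N3] := test_L2 lam mQ3 (oner_neq0 R) dlp2.
set f1 := (fun t => test lam dl Q1 (al1^-1 * t)) in L1 N1.
set f2 := (fun t => test lam dl Q2 (al2^-1 * t)) in L2' N2.
(* The doubled width makes the indicator equal to 1 at every sum [X + Y] coming from the square. *)
set f3 := (fun t => test lam (2 * dl) Q3 (1 * t)) in L3 N3.
exists f1, f2, f3; split => //.
have sd0 : 0 < Num.sqrt dl by rewrite sqrtr_gt0.
have inv0 (x : R) : x != 0 -> 0 <= `|x|^-1 by rewrite invr_ge0.
have N1' : L2norm f1 = A1 * Num.sqrt dl by rewrite N1 mulrA sqrtrM// mulr_ge0 ?inv0.
have N2' : L2norm f2 = A2 * Num.sqrt dl by rewrite N2 mulrA sqrtrM// mulr_ge0 ?inv0.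
have N3' : L2norm f3 = A3 * Num.sqrt dl.
  rewrite N3 (_ : `|1|^-1 * (2 * (2 * dl)) = `|1|^-1 * 4 * dl); last by ring.
  by rewrite sqrtrM// mulr_ge0 ?invr_ge0.
rewrite N1' N2' N3'; split; first by split; apply: mulr_gt0.
pose F z := expi (lam * S z) * a z * (f1 (pi1 z) * f2 (pi2 z) * f3 (pi3 z)).
pose I Z := itvind (- dl) dl Z.1 * itvind (- dl) dl Z.2.
pose ph Z := lam * patch rho s Z - lam * Q1 Z.1 - lam * Q2 Z.2 - lam * Q3 (Z.1 + Z.2).
pose G Z := I Z * part c (expi (ph Z) * a (lin2 e1 e2 Z)).
have I01 Z : I Z = 0 \/ [/\ I Z = 1, `|Z.1| <= dl & `|Z.2| <= dl].
  rewrite /I /itvind -!ler_norml.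
  have [h1|h1] := boolP (`|Z.1| <= dl); last by left; rewrite mul0r.
  have [h2|h2] := boolP (`|Z.2| <= dl); last by left; rewrite mulr0.
  by right; rewrite mulr1.
have FG z : part c (F z) = G (lin2 d1 d2 z).
  have p1 : pi1 z = al1 * (lin2 d1 d2 z).1 by rewrite -q1 LK.
  have p2 : pi2 z = al2 * (lin2 d1 d2 z).2 by rewrite -q2 LK.
  have p3 : pi3 z = (lin2 d1 d2 z).1 + (lin2 d1 d2 z).2 by rewrite -q3 LK.
  rewrite /F p1 p2 p3 part_test !mulKf// mul1r /G LK /ph -/Q1 -/Q2 -/Q3.
  set Z := lin2 d1 d2 z; rewrite -/(I Z).
  have [->|[-> h1 h2]] := I01 Z; first by rewrite !mul0r.
  have -> : itvind (- (2 * dl)) (2 * dl) (Z.1 + Z.2) = 1.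
    rewrite /itvind -ler_norml (_ : _ <= _ = true)//.
    by apply: (le_trans (ler_normD _ _)); rewrite mulr_natl mulr2n; exact: lerD.
  have z1 := le_lt_trans h1 dlrho; have z2 := le_lt_trans h2 dlrho.
  have -> : S z = s 0 0 Z by rewrite -Ss /Z ?LK//; split; rewrite subr0 ltW.
  by rewrite mulr1 (patchE _ z1 z2).
have bi := bmeas_itvind (- dl) dl.
have bI : bmeas size2 I by exact: bmeas_prod.
have mph : measurable_fun setT ph.
  have mp := measurable_patch js.
  have s3 : measurable_fun setT (fun Z : R * R => Z.1 + Z.2).
    by apply: measurable_funD; [exact: measurable_fst|exact: measurable_snd].
  have mc (f : R * R -> R) : measurable_fun setT f -> measurable_fun setT (fun Z => lam * f Z).
    by move=> mf; apply: measurable_funM.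
  apply: measurable_funB; last by apply: mc; exact: (measurableT_comp mQ3 s3).
  apply: measurable_funB; last by apply: mc; exact: (measurableT_comp mQ2 measurable_snd).
  apply: measurable_funB; last by apply: mc; exact: (measurableT_comp mQ1 measurable_fst).
  exact: mc.
have bG : bmeas size2 G.
  apply: bmeasMl => //.
  have ba c' : bmeasurable (fun Z => part c' (a (lin2 e1 e2 Z))).
    split; last by exists M => Z; exact: HM.
    have mc' := continuous_measurable2 (@smooth2C_continuous _ a c' sa).
    exact: (measurableT_comp mc' (measurable_lin2 e1 e2)).
  have bc := bmeasurable_cos mph.
  have bs : bmeasurable (fun Z => - sin (ph Z)).
    rewrite (_ : (fun Z => _) = fun Z => cos (ph Z + pi / 2)).
      by apply: bmeasurable_cos; apply: measurable_funD.
    by apply/funext => Z; rewrite cosD cos_pihalf sin_pihalf mulr0 mulr1 sub0r.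
  have mE c' : (fun Z => part c' (expi (ph Z) * a (lin2 e1 e2 Z))) = if c' then
      (fun Z => cos (ph Z) * part true (a (lin2 e1 e2 Z)) + -1 * (- sin (ph Z) * part false (a (lin2 e1 e2 Z))))
    else (fun Z => cos (ph Z) * part false (a (lin2 e1 e2 Z)) + - sin (ph Z) * part true (a (lin2 e1 e2 Z))).
    by case: c'; apply/funext => Z; rewrite /expi; case: (a _) => x y; rewrite complex_mulE /part /=; ring.
  have H c' : bmeasurable (fun Z => part c' (expi (ph Z) * a (lin2 e1 e2 Z))).
    rewrite mE; case: c'.
      by apply: bmeasurableD; [exact: bmeasurableM|apply: bmeasurableM; [exact: bmeasurable_cst|exact: bmeasurableM]].
    by apply: bmeasurableD; exact: bmeasurableM.
  exact: H.
have I0 Z : 0 <= I Z by apply: mulr_ge0; exact: itvind_ge0.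
have close Z : `|G Z - al * I Z| <= `|al| / 2 * I Z.
  rewrite /G; have [->|[-> h1 h2]] := I01 Z; first by rewrite mul0r !mulr0 subrr normr0.
  rewrite mul1r !mulr1.
  have z1 := le_lt_trans h1 dlrho; have z2 := le_lt_trans h2 dlrho.
  have bZ : box 0 0 dl Z by split; rewrite subr0.
  have phE : ph Z = lam * residual s qa qb qc m 0 0 Z.
    by rewrite /ph (patchE _ z1 z2) /residual /= addn0 -/Q1 -/Q2 -/Q3; ring.
  have phb : `|ph Z| <= C * ep ^+ m.
    rewrite phE normrM; have h := HC dl Z (ltW dlp) dlr1 bZ.
    apply: (le_trans (ler_wpM2l (normr_ge0 _) h)); rewrite dlm.
    by rewrite le_eqVlt; apply/orP; left; apply/eqP; field; rewrite normr_eq0 -normr_gt0.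
  have t := part_expi_near c (ph Z) (fun c' => HM c' (lin2 e1 e2 Z)).
  have nr : `|part c (a (lin2 e1 e2 Z)) - al| <= `|al| / 4.
    have [b1 b2] : box 0 0 r2 (lin2 e1 e2 Z).
      by apply: hr3; split; rewrite subr0; [exact: le_trans dlr3|exact: le_trans dlr3].
    by apply: hr2; [move: b1|move: b2]; rewrite subr0.
  have t2 : 2 * M * `|ph Z| <= `|al| / 4.
    by apply: le_trans small; rewrite ler_wpM2l// mulr_ge0 ?ltW.
  rewrite (_ : _ - al = (part c (expi (ph Z) * a (lin2 e1 e2 Z)) - part c (a (lin2 e1 e2 Z))) + (part c (a (lin2 e1 e2 Z)) - al)); last by ring.
  apply: (le_trans (ler_normD _ _)); rewrite (_ : `|al| / 2 = `|al| / 4 + `|al| / 4); last by field.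
  exact: (lerD (le_trans t t2) nr).
have main := Int2_lower bG bI I0 close.
rewrite Int2_square in main; last exact: ltW.
have Fint : Rintegral (@leb2 R) setT (fun z => part c (F z)) = J * Int2 G.
  rewrite -(Int2_lin2 dd bG) /Int2; congr Rintegral.
  by apply/funext => z; exact: FG.
have cm : `|J * Int2 G| <= cmod (Lambda lam S a pi1 pi2 pi3 f1 f2 f3).
  have E : part c (Lambda lam S a pi1 pi2 pi3 f1 f2 f3) = J * Int2 G.
    by rewrite -Fint; case: (c).
  rewrite -E -ler_sqr ?nnegrE ?sqrtr_ge0// real_normK ?num_real//; exact: part_sqr_le.
apply: le_trans cm; rewrite normrM (gtr0_norm J0).
apply: (@le_trans _ _ (J * (`|al| / 2 * (2 * dl) ^+ 2))); last by rewrite ler_wpM2l// ltW.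
have sE : Num.sqrt dl = Num.sqrt ep * kap.
  by rewrite /dl sqrtrM ?ltW// sqrtr_sqr gtr0_norm.
have dE : dl = (Num.sqrt ep * kap) ^+ 2 by rewrite -sE sqr_sqrtr ?ltW.
rewrite sE dE; move: se0 Ap; move: (Num.sqrt ep) => w w0 Ap.
rewrite le_eqVlt; apply/orP; left; apply/eqP; field.
by move: A1p A2p A3p => *; rewrite !gt_eqF.
Qed.

End LowerBound.

Theorem theorem1p4 (R : realType) (pi1 pi2 pi3 : R * R -> R) (v1 v2 v3 : R * R)
    (S : R * R -> R) (c : nat -> nat -> R) (r : R) (m : nat) :
  linear2 pi1 -> linear2 pi2 -> linear2 pi3 ->
  lin_indep2 pi1 pi2 -> lin_indep2 pi1 pi3 -> lin_indep2 pi2 pi3 ->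
  unit_vec2 v1 -> unit_vec2 v2 -> unit_vec2 v3 ->
  pi1 v1 = 0 -> pi2 v2 = 0 -> pi3 v3 = 0 ->
  power_series_rep S c r ->
  ~ (\forall z \near (0 : R, 0 : R), Dperp v1 v2 v3 S z = 0) ->
  is_mult_pi v1 v2 v3 c m ->
  exists W : set (R * R), nbhs (0 : R, 0 : R) W /\
  (forall a : R * R -> R[i], smooth2C a -> supported_in a W ->
     exists C : R, forall lam : R, 1 <= `|lam| ->
       forall f1 f2 f3 : R -> R[i], L2 f1 -> L2 f2 -> L2 f3 ->
         cmod (Lambda lam S a pi1 pi2 pi3 f1 f2 f3)
           <= C * `|lam| `^ (- ((2 * m)%:R)^-1)
                * (L2norm f1 * L2norm f2 * L2norm f3)) /\
  (forall a : R * R -> R[i], smooth2C a -> supported_in a W ->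
     a (0, 0) != 0 ->
     exists C' : R, 0 < C' /\
     exists L0 : R, forall lam : R, L0 <= `|lam| ->
       exists f1 f2 f3 : R -> R[i],
         [/\ L2 f1, L2 f2 & L2 f3] /\
         [/\ 0 < L2norm f1, 0 < L2norm f2 & 0 < L2norm f3] /\
         C' * `|lam| `^ (- ((2 * m)%:R)^-1)
            * (L2norm f1 * L2norm f2 * L2norm f3)
           <= cmod (Lambda lam S a pi1 pi2 pi3 f1 f2 f3)).
Proof.
move=> l1 l2 l3 i12 i13 i23 u1 u2 u3 p1 p2 p3 psr _ mult.
have [e1 [e2 [al1 [al2 [a1 a2 de [q1 q2 q3 [rho [s [rho0 js Ss [m3 low nz]]]]]]]]]] :=
  phase_normal_form l1 l2 l3 i12 i13 i23 u1 u2 u3 p1 p2 p3 psr mult.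
have mE : m = ((m - 3) + 3)%N by rewrite subnK.
have [eps eps0 up] := upper_estimate a1 a2 de q1 q2 q3 rho0 js Ss nz.
have [LK LK'] := lin2K de.
(* The square of half-side [eps] in adapted coordinates, described through the inverse map. *)
exists (fun z => let Z := lin2 (invl e1 e2).1 (invl e1 e2).2 z in `|Z.1| < eps /\ `|Z.2| < eps).
split; last split.
- have [r0 r00 sub] := lin2_box (invl e1 e2).1 (invl e1 e2).2 (divr_gt0 eps0 (ltr0n R 2)).
  have e2l : eps / 2 < eps by rewrite ltr_pdivrMr// ltr_pMr// ltr1n.
  apply: (box_nbhs r00) => z h1 h2.
  have [] : box 0 0 (eps / 2) (lin2 (invl e1 e2).1 (invl e1 e2).2 z).
    by apply: sub; split; rewrite subr0 ltW.
  by rewrite !subr0 => b1 b2; split; [apply: le_lt_trans b1 e2l|apply: le_lt_trans b2 e2l].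
- move=> a sa [K [cK [KW aK]]].
  have KZ Z : K (lin2 e1 e2 Z) -> `|Z.1| < eps /\ `|Z.2| < eps.
    move=> /KW h; have {}h : let Y := lin2 (invl e1 e2).1 (invl e1 e2).2 (lin2 e1 e2 Z) in
      `|Y.1| < eps /\ `|Y.2| < eps := h.
    by rewrite LK' in h.
  by have [C hC] := up a K sa cK aK KZ; exists C; rewrite {1}mE.
- move=> a sa [K [cK [_ aK]]] a0.
  have := lower_estimate a1 a2 de q1 q2 q3 rho0 js Ss low sa cK aK a0.
  by rewrite -mE.
Qed.
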